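(* Let $k$ be an algebraically closed field, let $X$ be a nonsingular integral projective surface over $k$ with function field $K=k(X)$ and constant sheaf of rational functions $\mathcal{K}$, and let $\sigma:X\dashrightarrow X$ be a stable, non-geometric birational map. Suppose that $\mathcal{L}\subseteq\mathcal{K}$ is a $\sigma$-positive invertible sheaf. Then the twisted section ring $\widetilde{B}(X,\mathcal{L},\sigma)$ is not a finitely generated $k$-algebra.
   Context: Surface means nonsingular integral projective surface over $k$. A birational map $f:X\dashrightarrow Y$ of surfaces is defined except at a finite set of fundamental points. For a divisor $D$ on $Y$, with $U\subseteq X$ the complement of the fundamental points of $f$, $f^*(D)$ is the unique divisor on $X$ extending $(f|_U)^*(D)$. Stable: there is no irreducible curve $C\subseteq X$ and $n\ge1$ such that $\sigma^n(C)$ is a fundamental point of $\sigma$. Then $(\sigma^n)^*=(\sigma^* )^n$ for all $n\ge1$. Geometric: $\sigma:X\dashrightarrow X$ is geometric if there are a surface $Z$ and a birational map $f:Z\dashrightarrow X$ such that $f^{-1}\sigma f:Z\dashrightarrow Z$ is an automorphism of $Z$. An invertible sheaf is taken with a fixed embedding $\mathcal{L}\subseteq\mathcal{K}$, so $\mathcal{L}=\mathcal{O}_X(D)$ for a Weil divisor $D$. Put $\mathcal{L}^{\sigma}=\sigma^*\mathcal{L}=\mathcal{O}_X(\sigma^*(D))\subseteq\mathcal{K}$, similarly $\mathcal{L}^{\sigma^i}=(\sigma^i)^*\mathcal{L}$, and $\mathcal{L}_0=\mathcal{O}_X$, $\mathcal{L}_n=\mathcal{L}\otimes\mathcal{L}^{\sigma}\otimes\cdots\otimes\mathcal{L}^{\sigma^{n-1}}\subseteq\mathcal{K}$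 for $n\ge1$. $\sigma$-positive: $\mathcal{L}$ is $\sigma$-positive if (1) $\mathcal{L}$ is ample, (2) $\mathcal{L}_n$ is generated by its global sections for all $n\ge1$, and (3) $H^i(X,\mathcal{L}_n)=0$ for all $i>0$ and $n\ge1$. Twisted section ring: let $\sigma$ also denote the automorphism of $K$ induced by pullback of rational functions. Then $\widetilde{B}(X,\mathcal{L},\sigma)=\bigoplus_{n\ge0}H^0(X,\mathcal{L}_n)t^n\subseteq K[t,t^{-1};\sigma]$, a subring of the skew Laurent polynomial ring with multiplication $(at^m)(bt^n)=a\,\sigma^m(b)\,t^{m+n}$. *)

(* Defs.v *)
(* Varieties are treated classically: an integral projective variety over an
   algebraically closed field k is given by its function field together with the
   homogeneous coordinates, in that field, of its generic point.  Points are
   closed points, local rings and stalks of subsheaves of the constant sheaf of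
   rational functions are subsets of the function field, and a subsheaf of that
   constant sheaf is recorded by its stalks at the closed points. *)

From HB Require Import structures.
From mathcomp Require Import all_boot all_order all_algebra finmap mpoly.
From mathcomp Require monalg.

Set Implicit Arguments.
Unset Strict Implicit.
Unset Printing Implicit Defensive.

Import GRing.Theory.
Local Open Scope ring_scope.

Section ProjectiveSpace.
Variables (k : closedFieldType) (n : nat).

(* Each point of P^n(k) has a unique coordinate vector whose first nonzero entry
   is 1; so points have Leibniz equality. *)
Definition normalized (v : {ffun 'I_n.+1 -> k}) : bool :=
  [exists i, (v i == 1) && [forall j : 'I_n.+1, (j < i)%N ==> (v j == 0)]].

Definition ppoint : Type := {v : {ffun 'I_n.+1 -> k} | normalized v}.

Definition pcoord (P : ppoint) (i : 'I_n.+1) : k := sval P i.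

Definition pset : Type := ppoint -> Prop.

Definition psub (A B : pset) : Prop := forall P, A P -> B P.

Definition zclosed (Z : pset) : Prop :=
  exists S : {mpoly k[n.+1]} -> Prop, forall P,
    Z P <-> forall d F, F \is d.-homog -> S F -> F.@[pcoord P] = 0.

Definition zopen (V : pset) : Prop := zclosed (fun P => ~ V P).

Definition zclosure (A : pset) : pset :=
  fun P => forall Z, zclosed Z -> psub A Z -> Z P.

Definition irreducible_closed (Z : pset) : Prop :=
  [/\ zclosed Z, exists P, Z P &
      forall A B, zclosed A -> zclosed B ->
        psub Z (fun P => A P \/ B P) -> psub Z A \/ psub Z B].

Definition has_chain (Y : pset) (d : nat) : Prop :=
  exists Z : nat -> pset,
    (forall i, (i <= d)%N -> irreducible_closed (Z i) /\ psub (Z i) Y) /\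
    (forall i, (i < d)%N -> psub (Z i) (Z i.+1) /\ ~ psub (Z i.+1) (Z i)).

Definition krull_dim (Y : pset) (d : nat) : Prop :=
  has_chain Y d /\ ~ has_chain Y d.+1.

End ProjectiveSpace.

Record projVar (k : closedFieldType) : Type := ProjVar {
  ffield : fieldType;
  fconst : {rmorphism k -> ffield};
  pdim : nat;
  gpoint : {ffun 'I_pdim.+1 -> ffield};
  gpoint_neq0 : exists i, gpoint i != 0;
  gpoint_gen : forall f : ffield,
    exists d (F G : {mpoly k[pdim.+1]}),
      [/\ F \is d.-homog, G \is d.-homog, mmap fconst gpoint G != 0 &
          f = mmap fconst gpoint F / mmap fconst gpoint G]
}.

Section Variety.
Variables (k : closedFieldType) (X : projVar k).
Local Notation K := (ffield X).
Local Notation point := (ppoint k (pdim X)).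

Definition gval (F : {mpoly k[(pdim X).+1]}) : K :=
  mmap (fconst X) (gpoint X) F.

(* The homogeneous ideal of X consists of the forms vanishing at the generic
   point. *)
Definition on_var (P : point) : Prop :=
  forall d F, F \is d.-homog -> gval F = 0 -> F.@[pcoord P] = 0.

(* The local ring O_{X,P} as a subring of K. *)
Definition regular_at (P : point) (f : K) : Prop :=
  exists d F G, [/\ F \is d.-homog, G \is d.-homog,
    G.@[pcoord P] != 0 & f = gval F / gval G].

(* Membership in the maximal ideal of O_{X,P}. *)
Definition vanishes_at (P : point) (f : K) : Prop :=
  exists d F G, [/\ F \is d.-homog, G \is d.-homog,
    G.@[pcoord P] != 0, F.@[pcoord P] = 0 & f = gval F / gval G].

(* Meant for dim O_{X,P} = d: then it says that O_{X,P} is a regular local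
   ring. *)
Definition regular_point (d : nat) (P : point) : Prop :=
  exists u : 'I_d -> K, (forall i, vanishes_at P (u i)) /\
    forall w, vanishes_at P w -> exists a : 'I_d -> K,
      (forall i, regular_at P (a i)) /\ w = \sum_(i < d) a i * u i.

Definition surface : Prop :=
  krull_dim on_var 2 /\ forall P, on_var P -> regular_point 2 P.

Definition curve (C : pset k (pdim X)) : Prop :=
  [/\ irreducible_closed C, psub C on_var & krull_dim C 1].

End Variety.

(* f : X --> Y is given by the pullback of rational functions; bpull_inv is the
   pullback along the inverse of f. *)
Record birat (k : closedFieldType) (X Y : projVar k) : Type := Birat {
  bpull : {rmorphism ffield Y -> ffield X};
  bpull_inv : {rmorphism ffield X -> ffield Y};
  bpullK : cancel bpull bpull_inv;
  bpull_invK : cancel bpull_inv bpull;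
  bpull_const : forall c, bpull (fconst Y c) = fconst X c
}.

Section BiratOps.
Variable k : closedFieldType.

Lemma bpull_inv_const (X Y : projVar k) (f : birat X Y) c :
  bpull_inv f (fconst X c) = fconst Y c.
Proof. by rewrite -(bpull_const f) bpullK. Qed.

Definition birat_inv (X Y : projVar k) (f : birat X Y) : birat Y X :=
  Birat (bpull_invK f) (bpullK f) (bpull_inv_const f).

Definition birat_id (X : projVar k) : birat X X :=
  @Birat k X X idfun idfun (fun=> erefl) (fun=> erefl) (fun=> erefl).

Lemma birat_comp_const (X Y Z : projVar k) (g : birat Y Z) (f : birat X Y) c :
  (bpull f \o bpull g) (fconst Z c) = fconst X c.
Proof. by rewrite /= !bpull_const. Qed.

(* The map g after f; pullback is contravariant. *)
Definition birat_comp (X Y Z : projVar k) (g : birat Y Z) (f : birat X Y) :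
    birat X Z :=
  @Birat k X Z (bpull f \o bpull g) (bpull_inv g \o bpull_inv f)
    (can_comp (bpullK f) (bpullK g))
    (can_comp (bpull_invK g) (bpull_invK f))
    (birat_comp_const g f).

Definition birat_iter (X : projVar k) (s : birat X X) (n : nat) : birat X X :=
  iter n (birat_comp s) (birat_id X).

End BiratOps.

Section BiratGeometry.
Variables (k : closedFieldType).

(* f is defined at P with value Q: after multiplication by a common rational
   function l, the coordinates f^*(y_j) of f are regular at P and take there the
   values Q_j, which are not all zero. *)
Definition maps_to (X Y : projVar k) (f : birat X Y)
    (P : ppoint k (pdim X)) (Q : ppoint k (pdim Y)) : Prop :=
  [/\ on_var P, on_var Q &
    exists l : ffield X, forall j,
      vanishes_at P (l * bpull f (gpoint Y j) - fconst X (pcoord Q j))].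

Definition fundamental (X Y : projVar k) (f : birat X Y)
    (P : ppoint k (pdim X)) : Prop :=
  on_var P /\ ~ exists Q, maps_to f P Q.

Definition everywhere_defined (X Y : projVar k) (f : birat X Y) : Prop :=
  forall P, on_var P -> exists Q, maps_to f P Q.

Definition isomorphism (X Y : projVar k) (f : birat X Y) : Prop :=
  everywhere_defined f /\ everywhere_defined (birat_inv f).

Definition proper_image (X Y : projVar k) (f : birat X Y)
    (C : pset k (pdim X)) : pset k (pdim Y) :=
  zclosure (fun Q => exists2 P, C P & maps_to f P Q).

Definition stable (X : projVar k) (s : birat X X) : Prop :=
  ~ exists C n Q, [/\ @curve k X C, (1 <= n)%N, fundamental s Q &
      forall R, proper_image (birat_iter s n) C R <-> R = Q].

Definition geometric (X : projVar k) (s : birat X X) : Prop :=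
  exists (Z : projVar k) (f : birat Z X), surface Z /\
    isomorphism (birat_comp (birat_inv f) (birat_comp s f)).

End BiratGeometry.

(* Only the stalks at points of X are meaningful. *)
Definition subsheaf (k : closedFieldType) (X : projVar k) : Type :=
  ppoint k (pdim X) -> ffield X -> Prop.

Section Sheaves.
Variable k : closedFieldType.

(* A Cartier divisor, equivalently a Weil divisor when X is nonsingular: near
   each point the stalks are generated by a single g. *)
Definition invertible (X : projVar k) (L : subsheaf X) : Prop :=
  forall P, on_var P -> exists2 g : ffield X, g != 0 &
    exists V, [/\ zopen V, V P & forall P', on_var P' -> V P' ->
      forall s, L P' s <-> regular_at P' (s / g)].

Definition structure_sheaf (X : projVar k) : subsheaf X :=
  fun P s => regular_at P s.

(* For invertible L and M the products form the stalk of L (x) M; no sums are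
   needed. *)
Definition tensor (X : projVar k) (L M : subsheaf X) : subsheaf X :=
  fun P s => exists a b, [/\ L P a, M P b & s = a * b].

Definition tensor_pow (X : projVar k) (L : subsheaf X) (n : nat) : subsheaf X :=
  iter n (fun M => tensor M L) (@structure_sheaf X).

(* The stalk f^*(L_Q) O_{X,P} at P of the pullback of an invertible L, where f
   is defined at P with value Q. *)
Definition pull_stalk (X Y : projVar k) (f : birat X Y) (L : subsheaf Y)
    (P : ppoint k (pdim X)) (Q : ppoint k (pdim Y)) (s : ffield X) : Prop :=
  exists a b, [/\ regular_at P a, L Q b & s = a * bpull f b].

(* M is invertible on X and extends the pullback of L along the restriction of
   f to the complement of the fundamental points. *)
Definition is_pullback (X Y : projVar k) (f : birat X Y) (L : subsheaf Y)
    (M : subsheaf X) : Prop :=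
  invertible M /\
  forall P Q, maps_to f P Q -> forall s, M P s <-> pull_stalk f L P Q s.

(* On nonsingular surfaces such an M exists and its stalks at the points of X
   are unique, so this defines the stalks of that M. *)
Definition pullback (X Y : projVar k) (f : birat X Y) (L : subsheaf Y) :
    subsheaf X :=
  fun P s => exists M, is_pullback f L M /\ M P s.

Fixpoint twist (X : projVar k) (L : subsheaf X) (s : birat X X) (n : nat) :
    subsheaf X :=
  if n is m.+1 then tensor (twist L s m) (pullback (birat_iter s m) L)
  else @structure_sheaf X.

(* Sections over the trace on X of a nonempty open set V; the definition is used
   only when V meets X. *)
Definition sections (X : projVar k) (F : subsheaf X) (V : pset k (pdim X))
    (s : ffield X) : Prop :=
  forall P, on_var P -> V P -> F P s.

Definition global_section (X : projVar k) (F : subsheaf X) (s : ffield X) :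
    Prop := sections F (fun=> True) s.

Definition globally_generated (X : projVar k) (F : subsheaf X) : Prop :=
  forall P, on_var P -> forall s, F P s ->
    exists m (a h : 'I_m -> ffield X),
      [/\ forall i, regular_at P (a i), forall i, global_section F (h i) &
          s = \sum_(i < m) a i * h i].

(* O_Y(1) of the given embedding, generated at Q by any y_j with Q_j <> 0. *)
Definition serre_twist (Y : projVar k) : subsheaf Y :=
  fun Q s => exists j a,
    [/\ pcoord Q j != 0, regular_at Q a & s = a * gpoint Y j].

(* L is isomorphic to the pullback of O(1) along a closed immersion of X in a
   projective space, with image Y.  An isomorphism of invertible subsheaves of
   the constant sheaf is multiplication by a nonzero rational function. *)
Definition very_ample (X : projVar k) (L : subsheaf X) : Prop :=
  exists (Y : projVar k) (f : birat X Y) (h : ffield X),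
    [/\ isomorphism f, h != 0 & forall P Q, maps_to f P Q ->
        forall s, L P s <-> pull_stalk f (@serre_twist Y) P Q (s / h)].

Definition ample (X : projVar k) (L : subsheaf X) : Prop :=
  exists2 m, (1 <= m)%N & very_ample (tensor_pow L m).

End Sheaves.

Section Cech.
Variables (k : closedFieldType) (X : projVar k) (F : subsheaf X).
Local Notation K := (ffield X).

(* Nonempty open sets: X is irreducible, so all their intersections are nonempty
   and restriction of sections is the identity of K. *)
Definition open_cover (m : nat) (U : 'I_m -> pset k (pdim X)) : Prop :=
  [/\ forall i, zopen (U i), forall i, exists2 P, on_var P & U i P &
      forall P, on_var P -> exists i, U i P].

Definition cochain (m q : nat) (U : 'I_m -> pset k (pdim X))
    (c : {ffun 'I_q.+1 -> 'I_m} -> K) : Prop :=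
  forall a : {ffun _}, sections F (fun P => forall i, U (a i) P) (c a).

Definition coboundary (m q : nat) (c : {ffun 'I_q.+1 -> 'I_m} -> K)
    (a : {ffun 'I_q.+2 -> 'I_m}) : K :=
  \sum_(j < q.+2) (-1) ^+ j * c [ffun i => a (lift j i)].

(* H^{q+1}(X, F) = 0, where cohomology is the Cech cohomology of X, the direct
   limit over finite open covers: each cocycle of a cover U becomes a
   coboundary on some cover V refining U through r. *)
Definition cech_vanishes_succ (q : nat) : Prop :=
  forall m (U : 'I_m -> pset k (pdim X)) (c : {ffun 'I_q.+2 -> 'I_m} -> K),
    open_cover U -> cochain U c -> (forall a, coboundary c a = 0) ->
    exists m' (V : 'I_m' -> pset k (pdim X)) (r : 'I_m' -> 'I_m)
           (b : {ffun 'I_q.+1 -> 'I_m'} -> K),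
      [/\ open_cover V,
          forall j P, on_var P -> V j P -> U (r j) P,
          cochain V b &
          forall a : {ffun 'I_q.+2 -> 'I_m'}, c [ffun i => r (a i)] = coboundary b a].

End Cech.

Definition sigma_positive (k : closedFieldType) (X : projVar k)
    (s : birat X X) (L : subsheaf X) : Prop :=
  [/\ ample L,
      forall n, (1 <= n)%N -> globally_generated (twist L s n) &
      forall q n, (1 <= n)%N -> cech_vanishes_succ (twist L s n) q].

Import monalg.

Section SkewLaurent.
Variables (k : closedFieldType) (X : projVar k) (s : birat X X).
Local Notation K := (ffield X).

(* Additively K[t, t^-1; s]: finitely supported families of coefficients indexed
   by int, << a *g n >> being a t^n.  The library's own ring product on such
   families is not used. *)
Definition skewLaurent : zmodType := monalg.malg int K.

Definition autpow (n : int) : K -> K :=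
  match n with
  | Posz m => bpull (birat_iter s m)
  | Negz m => bpull (birat_iter (birat_inv s) m.+1)
  end.

Definition skew_mul (p q : skewLaurent) : skewLaurent :=
  \sum_(i <- monalg.msupp p) \sum_(j <- monalg.msupp q)
    << monalg.mcoeff i p * autpow i (monalg.mcoeff j q) *g i + j >>.

Definition twisted_section_ring (L : subsheaf X) (p : skewLaurent) : Prop :=
  forall n : int,
    match n with
    | Posz m => global_section (twist L s m) (monalg.mcoeff n p)
    | Negz _ => monalg.mcoeff n p = 0
    end.

Definition subalgebra (S : skewLaurent -> Prop) : Prop :=
  [/\ forall c : k, S << fconst X c *g 0 >>,
      forall p q, S p -> S q -> S (p + q) &
      forall p q, S p -> S q -> S (skew_mul p q)].

Definition finitely_generated (B : skewLaurent -> Prop) : Prop :=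
  exists gens : seq skewLaurent,
    (forall g, g \in gens -> B g) /\
    forall S, subalgebra S -> (forall g, g \in gens -> S g) ->
      forall p, B p -> S p.

End SkewLaurent.

(* Main.v *)
(* Finite generation of the twisted section ring is shown to force sigma to be
   geometric.  A global section of L_j, pulled back by sigma^i, vanishes at every
   point where sigma^i is undefined.  If the ring is generated in degrees at most
   N, then sigma^j is therefore defined, for all j >= N, at every fundamental
   point of sigma.  For a k-place v of K let A_n be the local ring, inside K, of
   the center of v transported by sigma^n.  The orbit condition makes the A_n
   change only inside a window of length N: outside the fibres of the powers of
   sigma over its fundamental points sigma^N is an open immersion, because an
   injective endomorphism of such a quasi-projective set that is undefined at
   finitely many points only cannot miss more points than that (reduce modulo a
   prime and count).  Hence the intersection B of all A_n equals A_0 or A_N.  The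
   B of all places are the local rings of a nonsingular projective surface Z,
   embedded by the sections of a power of (sigma^N)^* L; H^1(X, L) = 0 gives the
   sections that separate the points contracted by sigma^-N.  As B is
   intersected over all n, sigma permutes these local rings, so it is an
   automorphism of Z.

   No intersection theory is used: sections, centers and indeterminacy are all
   handled through places, that is, maximal homomorphisms from subrings of K to
   k. *)
Require Import Defs.
From HB Require Import structures.
From mathcomp Require Import all_boot all_order all_algebra all_field mpoly.
From mathcomp Require Import boolp ring zify.
From mathcomp Require classical_sets finmap.

Set Implicit Arguments.
Unset Strict Implicit.
Unset Printing Implicit Defensive.

Import GRing.Theory.
Local Open Scope ring_scope.

(** * Places *)

(** Sections vanish for this reason: where [sigma^i] is undefined, normality makes the fibre of its
    graph infinite, while a nonvanishing section would be a common denominator for pulled-back very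
    ample sections, and the coordinates of all points of the fibre could be read off as values at
    one point. Global generation turns this around: in each degree some product of generators
    survives at a given point, so some [sigma^e] with [1 <= e <= N] is defined there.

    Stability enters twice. Pulled-back generators of L acquire no common factor, so pullbacks
    compose; and the image of a contracted curve has a forward orbit free of indeterminacy, so along
    the orbit of a place no contraction precedes an indeterminacy. Hence the rings A_n are constant
    up to the first indeterminacy, if there is one, then grow, then shrink back to the same ring
    within [N] steps. This is why their intersection is one of them and why the two times 0 and [N]
    serve all places at once.

    Divisors are replaced by gcds of tuples of functions in a local ring; together with extension
    across points they describe the stalks of pullbacks. *)

Section PartialHoms.
Variables (K k : fieldType).

(* A ring homomorphism from a subring of K to k, encoded by its graph. *)
Record hrel (H : K -> k -> Prop) : Prop := Hrel {
  hrel1 : H 1 1;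
  hrelB : forall a a' b b', H a b -> H a' b' -> H (a - a') (b - b');
  hrelM : forall a a' b b', H a b -> H a' b' -> H (a * a') (b * b');
  hrel0P : forall c, H 0 c -> c = 0 }.

Definition hle (H H' : K -> k -> Prop) := forall a b, H a b -> H' a b.

Section Theory.
Variables (H : K -> k -> Prop) (hH : hrel H).

Lemma hrel0 : H 0 0.
Proof. by have := hrelB hH (hrel1 hH) (hrel1 hH); rewrite !subrr. Qed.

Lemma hrelN a b : H a b -> H (- a) (- b).
Proof. by move=> h; have := hrelB hH hrel0 h; rewrite !sub0r. Qed.

Lemma hrelD a a' b b' : H a b -> H a' b' -> H (a + a') (b + b').
Proof.
by move=> h h'; have := hrelB hH h (hrelN h'); rewrite !opprK.
Qed.

Lemma hrel_fun a b b' : H a b -> H a b' -> b = b'.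
Proof.
move=> h h'; apply/eqP; rewrite -subr_eq0; apply/eqP.
by apply: (hrel0P hH); rewrite -(subrr a); apply: hrelB.
Qed.

Lemma hrelX a b n : H a b -> H (a ^+ n) (b ^+ n).
Proof.
move=> h; elim: n => [|n IH]; first by rewrite !expr0; apply: hrel1.
by rewrite !exprS; apply: hrelM.
Qed.

Lemma hrel_sum (I : Type) (r : seq I) (P : pred I) (F : I -> K) (G : I -> k) :
  (forall i, P i -> H (F i) (G i)) ->
  H (\sum_(i <- r | P i) F i) (\sum_(i <- r | P i) G i).
Proof.
move=> h; elim/big_rec2: _ => [|i y1 y2 Pi h']; first exact: hrel0.
exact: hrelD (h i Pi) h'.
Qed.

Definition hpoly (p : {poly K}) (q : {poly k}) := forall i, H p`_i q`_i.

Lemma hpolyB p q p' q' : hpoly p q -> hpoly p' q' -> hpoly (p - p') (q - q').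
Proof. by move=> h h' i; rewrite !coefB; apply: hrelB. Qed.

Lemma hpolyM p q p' q' : hpoly p q -> hpoly p' q' -> hpoly (p * p') (q * q').
Proof.
move=> h h' i; rewrite !coefM; apply: hrel_sum => j _; exact: hrelM.
Qed.

Lemma hpolyC a b : H a b -> hpoly a%:P b%:P.
Proof. by move=> h i; rewrite !coefC; case: eqP => _ //; apply: hrel0. Qed.

Lemma hpolyX : hpoly 'X 'X.
Proof.
by move=> i; rewrite !coefX; case: eqP => _ /=; [apply: hrel1|apply: hrel0].
Qed.

Definition hadjoin (f : K) (xi : k) a b :=
  exists p q, [/\ hpoly p q, a = p.[f] & b = q.[xi]].

Lemma hadjoin_hrel f xi :
  (forall p q, hpoly p q -> p.[f] = 0 -> q.[xi] = 0) -> hrel (hadjoin f xi).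
Proof.
move=> h; split.
- exists 1%:P, 1%:P; rewrite !hornerC; split=> //.
  exact: hpolyC (hrel1 hH).
- move=> a a' b b' [p [q [h1 -> ->]]] [p' [q' [h1' -> ->]]].
  exists (p - p'), (q - q'); rewrite !hornerD !hornerN; split=> //.
  exact: hpolyB.
- move=> a a' b b' [p [q [h1 -> ->]]] [p' [q' [h1' -> ->]]].
  exists (p * p'), (q * q'); rewrite !hornerM; split=> //.
  exact: hpolyM.
- move=> c [p [q [h1 e ->]]]; exact: (h p q h1 (esym e)).
Qed.

Lemma hadjoin_le f xi : hle H (hadjoin f xi).
Proof.
move=> a b h; exists a%:P, b%:P; rewrite !hornerC; split=> //; exact: hpolyC.
Qed.

Lemma hadjoin_gen f xi : hadjoin f xi f xi.
Proof. by exists 'X, 'X; rewrite !hornerX; split=> //; apply: hpolyX. Qed.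

End Theory.
End PartialHoms.

Section Places.
Variables (k : closedFieldType) (K : fieldType) (io : {rmorphism k -> K}).

Definition hconst (H : K -> k -> Prop) := forall c, H (io c) c.

(* A k-place of K; H a b reads "a is finite with value b". *)
Record place (H : K -> k -> Prop) : Prop := Place {
  place_hrel : hrel H;
  place_const : hconst H;
  place_total : forall f, (exists c, H f c) \/ H f^-1 0 }.

(** Chevalley's extension theorem. In a maximal extension [v] elements of nonzero value are
    invertible, and the reductions of the relations on [f] form an ideal of [k[X]], any root of
    which is an admissible value of [f]; roots exist because [k] is algebraically closed. The ideals
    of [f] and [f^-1] cannot both be the unit ideal. *)
Lemma place_ext H : hrel H -> hconst H -> exists2 v, place v & hle H v.
Proof.
move=> hH cH.
(* The first disjunct admits the empty set, which is the union of the empty chain. *)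
pose PP (S : classical_sets.set (K * k)) :=
  (forall x, ~ S x) \/ (hrel (fun a b => S (a, b)) /\ hle H (fun a b => S (a, b))).
have [F FP Ftot|S [PS maxS]] := classical_sets.Zorn_bigcup (P := PP).
  rewrite /PP.
  have [[S0 FS0 [x0 S0x0]]|none] := EM (exists2 S, F S & exists x, S x); last first.
    left=> x [S FS Sx]; apply: none; exists S => //; by exists x.
  have good S : F S -> (exists x, S x) ->
      hrel (fun a b => S (a, b)) /\ hle H (fun a b => S (a, b)).
    move=> FS [x Sx]; case: (FP S FS) => [e|//]; by case: (e x).
  have both x y : (classical_sets.bigcup F id) x ->
      (classical_sets.bigcup F id) y -> exists S, [/\ F S, S x & S y].
    move=> [S FS Sx] [S' FS' Sy]; case: (Ftot S S' FS FS') => h.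
      by exists S'; split=> //; apply: h.
    by exists S; split=> //; apply: h.
  have [hS0 lS0] := good _ FS0 (ex_intro _ _ S0x0).
  right; split; last by move=> a b h; exists S0 => //; apply: lS0.
  split.
  - by exists S0 => //; apply: (hrel1 hS0).
  - move=> a a' b b' h h'; have [S [FS h1 h2]] := both _ _ h h'.
    have [hS _] := good S FS (ex_intro _ _ h1).
    by exists S => //; apply: (hrelB hS).
  - move=> a a' b b' h h'; have [S [FS h1 h2]] := both _ _ h h'.
    have [hS _] := good S FS (ex_intro _ _ h1).
    by exists S => //; apply: (hrelM hS).
  - move=> c [S FS h1]; have [hS _] := good S FS (ex_intro _ _ h1).
    exact: (hrel0P hS).
have ne : exists x, S x.
  apply: contrapT => e; apply: (maxS (fun x => H x.1 x.2)); last first.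
    by right; split.
  split=> [x Sx|]; first by case: e; exists x.
  by move=> /(_ (1, 1)); move=> h; apply: e; exists (1, 1); apply: h; apply: (hrel1 hH).
case: PS => [e|[hS lS]]; first by case: ne => x /e.
pose v a b := S (a, b).
exists v => //.
have {}hS : hrel v by [].
have {}lS : hle H v by [].
have cv : hconst v by move=> c; apply: lS.
have adj f xi : (forall p q, hpoly v p q -> p.[f] = 0 -> q.[xi] = 0) -> v f xi.
  move=> h; apply: contrapT => nv.
  apply: (maxS (fun x => hadjoin v f xi x.1 x.2)).
    split=> [[a b] Sab|]; first exact: (hadjoin_le hS).
    by move=> /(_ (f, xi)) h'; apply: nv; apply: h'; apply: hadjoin_gen.
  right; split; first exact: (hadjoin_hrel hS h).
  by move=> a b h'; apply: (hadjoin_le hS); apply: lS.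
(* A relation on [a^-1], multiplied by a high power of [a], becomes a relation inside the ring and
   can be evaluated. *)
have vinv a c : v a c -> c != 0 -> v a^-1 c^-1.
  move=> va c0; have a0 : a != 0.
    by apply: contraNneq c0 => a0; move: va; rewrite a0 => /(hrel0P hS) ->.
  apply: adj => p q hpq e.
  pose n := maxn (size p) (size q).
  have: v (\sum_(i < n) p`_i * a ^+ (n - i)) (\sum_(i < n) q`_i * c ^+ (n - i)).
    by apply: (hrel_sum hS) => i _; apply: (hrelM hS) => //; apply: (hrelX hS).
  have E (L : fieldType) (r : {poly L}) (x : L) : x != 0 -> (size r <= n)%N ->
     \sum_(i < n) r`_i * x ^+ (n - i) = r.[x^-1] * x ^+ n.
    move=> x0 sr; rewrite (horner_coef_wide _ sr) mulr_suml; apply: eq_bigr => i _.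
    rewrite -mulrA; congr (_ * _); rewrite exprVn mulrC.
    have -> : x ^+ n = x ^+ (n - i) * x ^+ i by rewrite -exprD subnK // ltnW.
    by rewrite mulfK // expf_neq0.
  rewrite (E _ p) ?leq_maxl // (E _ q) ?leq_maxr // e mul0r => /(hrel0P hS)/eqP.
  by rewrite mulf_eq0 expf_eq0 (negPf c0) andbF orbF => /eqP.
pose J f (q : {poly k}) := exists2 p, hpoly v p q & p.[f] = 0.
have Jroot f : (exists xi, v f xi) \/ J f 1.
  have [[q0 [Jq0 q00 minq]]|nz] := EM (exists q, [/\ J f q, q != 0 &
      forall r, J f r -> r != 0 -> (size q <= size r)%N]); last first.
    left; exists 0; apply: adj => p q hpq e.
    apply: contrapT => q0; apply: nz.
    have exn : exists n, `[< exists r, [/\ J f r, r != 0 & size r = n] >].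
      exists (size q); apply/asboolP; exists q; split=> //; first by exists p.
      by apply/eqP => h; apply: q0; rewrite h horner0.
    case: (ex_minnP exn) => n /asboolP [r [Jr r0 sr]] minn.
    exists r; split=> // r' Jr' r'0.
    by rewrite sr; apply: minn; apply/asboolP; exists r'.
  have Jdvd q : J f q -> q0 %| q.
    move=> [p hpq e]; apply: contrapT => /negP nd.
    case: Jq0 => p0 hp0 e0.
    have Jr : J f (q %% q0).
      have hd (d : {poly k}) : hpoly v (map_poly io d) d.
        by move=> i; rewrite coef_map; apply: cv.
      exists (p - map_poly io (q %/ q0) * p0).
        rewrite (_ : q %% q0 = q - (q %/ q0) * q0); last by rewrite {2}(divp_eq q q0) addrAC subrr add0r.
        by apply: (hpolyB hS) => //; apply: (hpolyM hS).
      by rewrite hornerD hornerN hornerM e e0 mulr0 subrr.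
    by have := minq _ Jr nd; rewrite leqNgt ltn_modp q00.
  have [s1|s1] := eqVneq (size q0) 1%N.
    right; case: Jq0 => p0 hp0 e0.
    have /size_poly1P [c c0 qc] : size q0 == 1%N by rewrite s1.
    exists (p0 * (io c^-1)%:P); last by rewrite hornerM e0 mul0r.
    rewrite (_ : 1 = q0 * (c^-1)%:P); last by rewrite qc -polyCM mulfV.
    by apply: (hpolyM hS) => //; apply: (hpolyC hS).
  left; have [xi rxi] := closed_rootP q0 s1.
  exists xi; apply: adj => p q hpq e.
  have dq : q0 %| q by apply: Jdvd; exists p.
  by apply/eqP; exact: (root_dvdp dq rxi).
split=> // f.
have [f0|f0] := eqVneq f 0; first by left; exists 0; rewrite f0; apply: (hrel0 hS).
have [|J1] := Jroot f; first by left.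
have [[xi vxi]|J2] := Jroot f^-1.
  have [xi0|xi0] := eqVneq xi 0; first by right; rewrite -xi0.
  by left; exists xi^-1; rewrite -(invrK f); apply: vinv.
exfalso.
(* In a relation on [g^-1] that reduces to 1 the constant coefficient is a unit. Its reversal [r] is
   monic in [g] with all other coefficients of value 0, so subtracting a multiple of [r] shortens a
   relation on [g] and keeps its reduction. The sum of the two sizes decreases. *)
pose Q f n := exists p, [/\ hpoly v p 1, p.[f] = 0 & size p = n].
have step g m n : g != 0 -> Q g n -> Q g^-1 m -> (m <= n)%N -> exists2 n', (n' < n)%N & Q g n'.
  move=> g0 [p [hp ep sp]] [q [hq eq sq]] mn.
  have q0n : q`_0 != 0.
    by apply/eqP => h; have := hq 0%N; rewrite h coef1 eqxx /= => /(hrel0P hS)/eqP; rewrite oner_eq0.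
  have p0 : p != 0.
    apply/eqP => h; have := hp 0%N; rewrite h coef0 coef1 eqxx /= => /(hrel0P hS)/eqP.
    by rewrite oner_eq0.
  have q_n0 : q != 0 by apply: contraNneq q0n => ->; rewrite coef0.
  have n0 : (0 < n)%N by rewrite -sp size_poly_gt0.
  have m0 : (0 < m)%N by rewrite -sq size_poly_gt0.
  have vq0 : v (q`_0)^-1 1 by rewrite -invr1; apply: vinv; rewrite ?oner_neq0 //; have := hq 0%N; rewrite coef1.
  pose r := \poly_(i < n) (q`_(n.-1 - i) / q`_0).
  have er : r.[g] = 0.
    transitivity (q.[g^-1] * g ^+ n.-1 / q`_0); last by rewrite eq !mul0r.
    rewrite horner_poly (@horner_coef_wide _ n q) ?sq // !mulr_suml.
    rewrite (reindex_inj rev_ord_inj) /=; apply: eq_bigr => i _.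
    have hi : (i <= n.-1)%N by have := ltn_ord i; lia.
    have -> : (n.-1 - (n - i.+1) = i)%N by lia.
    have -> : (n - i.+1 = n.-1 - i)%N by lia.
    have -> : g ^+ n.-1 = g ^+ (n.-1 - i) * g ^+ i by rewrite -exprD subnK.
    by rewrite exprVn; field; rewrite q0n expf_neq0.
  have rtop : r`_n.-1 = 1 by rewrite coef_poly prednK // leqnn subnn mulfV.
  have hr i : (i < n.-1)%N -> v r`_i 0.
    move=> hi; rewrite coef_poly (_ : (i < n)%N); last by lia.
    have h0 : v q`_(n.-1 - i) 0.
      by have := hq (n.-1 - i)%N; rewrite coef1; case: eqP => // e; lia.
    by have := hrelM hS h0 vq0; rewrite mul0r.
  have hge i : (n.-1 <= i)%N -> (p - (p`_n.-1)%:P * r)`_i = 0.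
    rewrite leq_eqVlt => /orP [/eqP <-|hi].
      by rewrite coefB coefCM rtop mulr1 subrr.
    rewrite coefB coefCM coef_poly (_ : (i < n)%N = false); last by lia.
    by rewrite mulr0 subr0 nth_default // sp; lia.
  exists (size (p - (p`_n.-1)%:P * r)).
    apply: (@leq_ltn_trans n.-1); last by rewrite prednK.
    apply/leq_sizeP; exact: hge.
  exists (p - (p`_n.-1)%:P * r); split=> //; last by rewrite hornerD hornerN hornerM ep er mulr0 subrr.
  move=> i; case: (ltnP i n.-1) => hi; last first.
    rewrite hge // coef1; case: eqP => [i0|_]; last exact: (hrel0 hS).
    move: hi; rewrite i0 leqn0 => /eqP n1.
    have s1 : size p = 1%N by rewrite sp; lia.
    have /size_poly1P [c c0 pc] : size p == 1%N by rewrite s1.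
    by move: ep; rewrite pc hornerC => /eqP; rewrite (negPf c0).
  rewrite coefB coefCM.
  by have := hrelB hS (hp i) (hrelM hS (hp n.-1) (hr i hi)); rewrite mulr0 subr0.
have [p hp ep] := J1; have [q hq eq] := J2.
have main N : forall g n m, g != 0 -> (n + m < N)%N -> Q g n -> Q g^-1 m -> False.
  elim: N => // N IH g n m g0 hN Qn Qm.
  case: (leqP m n) => hmn.
    have [n' ln Qn'] := step g m n g0 Qn Qm hmn.
    by apply: (IH g n' m) => //; lia.
  have gi0 : g^-1 != 0 by rewrite invr_eq0.
  have [m' lm Qm'] := step g^-1 n m gi0 Qm (eq_ind_r (fun z => Q z n) Qn (invrK g)) (ltnW hmn).
  by apply: (IH g n m') => //; lia.
apply: (main (size p + size q).+1 f (size p) (size q)) => //; first by exists p.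
by exists q.
Qed.

(** If there were no such relation, [f^-1] could be adjoined with value 0, and a place extending
    this would make [f] infinite. The constant coefficient has nonzero value, so once it is inverted
    the relation is an equation of integral dependence for [f]. *)
Lemma place_integral H f : hrel H -> hconst H ->
  (forall v, place v -> hle H v -> exists c, v f c) ->
  f = 0 \/ exists (p : {poly K}) (q : {poly k}),
    [/\ forall i, H p`_i q`_i, p.[f^-1] = 0 & q`_0 != 0].
Proof.
move=> hH cH hv; have [f0|f0] := eqVneq f 0; first by left.
right; apply: contrapT => nex.
have hA : hrel (hadjoin H f^-1 0).
  apply: hadjoin_hrel => // p q hpq e; apply: contrapT => q0; apply: nex.
  by exists p, q; split=> //; rewrite -horner_coef0; apply/eqP.
have lA := hadjoin_le hH f^-1 0.
have [v pv lv] := place_ext hA (fun c => lA _ _ (cH c)).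
have [c vc] := hv v pv (fun a b h => lv _ _ (lA _ _ h)).
have v0 : v f^-1 0 by apply: lv; apply: hadjoin_gen.
have hvr := place_hrel pv.
have := hrelM hvr vc v0; rewrite mulfV // mulr0 => h1.
by have /eqP := hrel_fun hvr h1 (hrel1 hvr); rewrite eq_sym oner_eq0.
Qed.

End Places.

(** * Specialization of polynomial relations *)

Section PrimeIdeal.
Variables (R : comNzRingType).

Record prime_pred (pr : R -> Prop) : Prop := PrimePred {
  prB : forall a b, pr a -> pr b -> pr (a - b);
  prM : forall a b, pr b -> pr (a * b);
  prP : forall a b, pr (a * b) -> pr a \/ pr b;
  pr1 : ~ pr 1 }.

Variables (pr : R -> Prop) (hp : prime_pred pr).

Lemma prD a b : pr a -> pr b -> pr (a + b).
Proof.
move=> ha hb; rewrite -(opprK b); apply: (prB hp) => //.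
by rewrite -mulN1r; apply: (prM hp).
Qed.

Lemma prMr a b : pr b -> pr (b * a).
Proof. by rewrite mulrC; apply: (prM hp). Qed.

Lemma prN a : pr a -> pr (- a).
Proof. by move=> h; rewrite -mulN1r; apply: (prM hp). Qed.

Lemma pr_sum (I : Type) (r : seq I) (F : I -> R) :
  pr 0 -> (forall i, pr (F i)) -> pr (\sum_(i <- r) F i).
Proof. by move=> h0 h; elim/big_ind: _ => //; apply: prD. Qed.

Lemma prXn a n : pr (a ^+ n) -> pr a.
Proof.
elim: n => [|n IH]; first by rewrite expr0 => /(pr1 hp).
by rewrite exprS => /(prP hp) [].
Qed.

Lemma prBK a b : pr (a - b) -> pr b -> pr a.
Proof. by move=> h hb; rewrite -(subrK b a); apply: prD. Qed.

End PrimeIdeal.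

Section Extension.
Variables (Om : comNzRingType) (pr : Om -> Prop) (hp : prime_pred pr) (h0 : pr 0).
Variables (R0 : comNzRingType) (Tgt : Type) (fld : Tgt -> fieldType).
Variable bas : forall t, {rmorphism R0 -> fld t}.
Hypothesis Hroot : forall t (p : {poly fld t}), size p != 1%N ->
  exists t' (j : {rmorphism fld t -> fld t'}) x,
    root (map_poly j p) x /\ forall r, j (bas t r) = bas t' r.

(** The prime of [R] meant here is the preimage of [pr]. The family [fld] of target fields serves
    two uses: one algebraically closed field, which gives the Nullstellensatz, and all finite fields
    over [R0 = int], which gives reduction to finite fields. *)
Definition extendable (R : comNzRingType) (c : R0 -> R) (rho : R -> Om) :=
  forall u, ~ pr (rho u) -> exists t (th : {rmorphism R -> fld t}),
    [/\ forall r, pr (rho r) -> th r = 0, th u != 0 &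
        forall r, th (c r) = bas t r].

Definition evp (R S : comNzRingType) (rho : {rmorphism R -> S}) (a : S) :
  {rmorphism {poly R} -> S} := horner_morph (fun x => mulrC a (rho x)).

Lemma evpE (R S : comNzRingType) (rho : {rmorphism R -> S}) (a : S) p :
  evp rho a p = (map_poly rho p).[a].
Proof. by []. Qed.

Lemma evpC (R S : comNzRingType) (rho : {rmorphism R -> S}) (a : S) c :
  evp rho a c%:P = rho c.
Proof. exact: horner_morphC. Qed.

Lemma evpX (R S : comNzRingType) (rho : {rmorphism R -> S}) (a : S) :
  evp rho a 'X = a.
Proof. exact: horner_morphX. Qed.

Lemma evpZ (R S : comNzRingType) (rho : {rmorphism R -> S}) (a : S) c p :
  evp rho a (c *: p) = rho c * evp rho a p.
Proof. by rewrite -mul_polyC rmorphM evpC. Qed.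

Lemma pr_evp (R : comNzRingType) (rho : {rmorphism R -> Om}) a (p : {poly R}) :
  (forall i, pr (rho p`_i)) -> pr (evp rho a p).
Proof.
move=> h; rewrite evpE horner_coef; apply: pr_sum => // i.
by apply: (prMr hp); rewrite coef_map /=; apply: h.
Qed.

(** If the new element is algebraic modulo the prime, take a relation [f] of least degree. Then [u]
    divides a constant [a1] outside the prime, and a root of [f] in a target field where [a1] and
    the leading coefficient of [f] survive cannot be a root of [u]. *)
Lemma good_poly (R : idomainType) (c : R0 -> R) (rho : {rmorphism R -> Om}) a :
  extendable c rho -> extendable (fun r => (c r)%:P) (evp rho a).
Proof.
move=> G u nu.
pose nz (p : {poly R}) := exists i, ~ pr (rho p`_i).
have build t (th : {rmorphism R -> fld t}) (f : {poly R}) :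
    (forall r, pr (rho r) -> th r = 0) -> (forall r, th (c r) = bas t r) ->
    size (map_poly th f) != 1%N ->
    (forall t' (j : {rmorphism fld t -> fld t'}) x,
       root (map_poly j (map_poly th f)) x ->
       (forall p, pr (evp rho a p) -> (map_poly (j \o th) p).[x] = 0) /\
       (map_poly (j \o th) u).[x] != 0) ->
    exists t' (th' : {rmorphism {poly R} -> fld t'}),
    [/\ forall r, pr (evp rho a r) -> th' r = 0, th' u != 0 &
        forall r, th' (c r)%:P = bas t' r].
  move=> hk hb sf hj; have [t' [j [x [rx cj]]]] := Hroot sf.
  have [h1 h2] := hj t' j x rx.
  exists t', (evp (j \o th) x); split=> // r.
  by rewrite evpC /= hb.
have [alg|tra] := EM (exists p, pr (evp rho a p) /\ nz p); last first.
  have tra' p : pr (evp rho a p) -> forall i, pr (rho p`_i).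
    by move=> h i; apply: contrapT => n; apply: tra; exists p; split=> //; exists i.
  have [i ni] : nz u.
    by apply: contrapT => h; apply: nu; apply: pr_evp => i; apply: contrapT => n; apply: h; exists i.
  have [t [th [hk tu hb]]] := G _ ni.
  (* a root of u X + 1 is not a root of u *)
  apply: (build t th (u * 'X + 1)) => //.
    apply/eqP => s1; have : (map_poly th (u * 'X + 1))`_i.+1 = 0.
      by rewrite nth_default // s1.
    rewrite coef_map /= coefD coefMX coef1 addr0 /=.
    by apply/eqP.
  move=> t' j x rx; split.
    move=> p hp'; rewrite (_ : map_poly _ p = 0) ?horner0 //.
    by apply/polyP => l; rewrite coef_map /= coef0 hk ?rmorph0 //; apply: tra'.
  apply/eqP => e; move: rx; rewrite /root -map_poly_comp /= rmorphD rmorphM /= map_polyX rmorph1.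
  by rewrite hornerD hornerM e mul0r hornerC add0r oner_eq0.
have exn : exists n, `[< exists p, [/\ pr (evp rho a p), nz p & size p = n] >].
  by case: alg => p [h1 h2]; exists (size p); apply/asboolP; exists p.
case: (ex_minnP exn) => n /asboolP [f [prf nzf sf]] minf.
have {}minf p : pr (evp rho a p) -> (size p < size f)%N -> forall i, pr (rho p`_i).
  move=> h s i; apply: contrapT => ni.
  have : (n <= size p)%N by apply: minf; apply/asboolP; exists p; split=> //; exists i.
  by rewrite -sf leqNgt s.
have trim (p : {poly R}) : p != 0 -> pr (rho (lead_coef p)) ->
    exists q : {poly R}, [/\ (size q < size p)%N, forall i, pr (rho (p - q)`_i) &
                 pr (evp rho a (p - q))].
  move=> p0 hl; pose q : {poly R} := p - lead_coef p *: 'X^((size p).-1).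
  have hc i : pr (rho (p - q)`_i).
    rewrite opprB addrCA subrr addr0 coefZ rmorphM; exact: prMr.
  exists q.
  split=> //; last exact: pr_evp.
  have sp : (0 < size p)%N by rewrite size_poly_gt0.
  rewrite -ltnS; apply: (@leq_ltn_trans (size p).-1.+1); last by rewrite prednK.
  rewrite ltnS; apply/leq_sizeP => i hi; rewrite coefB coefZ coefXn.
  move: hi; rewrite leq_eqVlt => /orP [/eqP <-|hi].
    by rewrite eqxx mulr1 subrr.
  rewrite gtn_eqF // mulr0 subr0 nth_default //.
  by apply: leq_trans hi; rewrite prednK.
have f0 : f != 0.
  by apply/eqP => f0; case: nzf => i; rewrite f0 coef0 rmorph0.
have lf : ~ pr (rho (lead_coef f)).
  move=> hl; have [q [sq cq eq]] := trim f f0 hl.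
  have [i ni] := nzf; apply: ni.
  have qi : pr (rho q`_i).
    apply: minf => //; rewrite -(subKr f q) rmorphB; exact: (prB hp).
  by apply: (prBK hp _ qi); rewrite -rmorphB -coefB.
(* [h] has least degree among the multiples of [u] outside the prime. Pseudo-division of [h] by [f],
   and then of [f] by [h], shows that it is constant. *)
pose Q h := ~ pr (evp rho a h) /\ exists w, pr (evp rho a (h - u * w)).
have exm : exists m, `[< exists h, Q h /\ size h = m >].
  exists (size u); apply/asboolP; exists u; split=> //; split=> //.
  by exists 1; rewrite mulr1 subrr rmorph0.
case: (ex_minnP exm) => m /asboolP [h [[nh [w hw]] sh]] minh.
have {}minh q v : pr (evp rho a (q - h * v)) -> (size q < size h)%N -> pr (evp rho a q).
  move=> e s; apply: contrapT => nq.
  have : (m <= size q)%N.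
    apply: minh; apply/asboolP; exists q; split=> //; split=> //; exists (w * v).
    rewrite mulrA (_ : q - _ = (q - h * v) + (h - u * w) * v); last by ring.
    by rewrite rmorphD; apply: prD => //; rewrite rmorphM; apply: prMr.
  by rewrite -sh leqNgt s.
have hn0 : h != 0 by apply/eqP => h00; apply: nh; rewrite h00 rmorph0.
have lh : ~ pr (rho (lead_coef h)).
  move=> hl; have [q [sq _ eq]] := trim h hn0 hl.
  apply: nh; rewrite (_ : h = (h - q) + q); last by ring.
  rewrite rmorphD; apply: prD => //; apply: (minh q 1) => //.
  by rewrite mulr1 -opprB rmorphN; apply: prN.
have sfh : (size h <= size f)%N.
  rewrite leqNgt; apply/negP => lt.
  pose l := lead_coef f ^+ Pdiv.Idomain.scalp h f.
  have e := Pdiv.Idomain.divp_eq h f.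
  have sr : (size (h %% f)%R < size f)%N by rewrite Pdiv.Idomain.ltn_modp.
  have : pr (evp rho a (h %% f)).
    apply: (minh _ l%:P); last exact: ltn_trans lt.
    rewrite mulrC mul_polyC /l e opprD addrCA subrr addr0 rmorphN rmorphM.
    by apply: prN => //; apply: (prM hp).
  move=> hr; apply: nh.
  have : pr (evp rho a (l *: h)).
    rewrite /l e rmorphD; apply: prD => //; rewrite rmorphM; exact: (prM hp).
  rewrite evpZ => /(prP hp) [|//].
  by rewrite rmorphXn => /(prXn hp).
have sh1 : size h = 1%N.
  apply/eqP; rewrite eqn_leq size_poly_gt0 hn0 andbT leqNgt; apply/negP => s2.
  have e := Pdiv.Idomain.divp_eq f h.
  set l := _ ^+ _ in e.
  have sr : (size (f %% h)%R < size h)%N by rewrite Pdiv.Idomain.ltn_modp.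
  have hr : pr (evp rho a (f %% h)).
    apply: (minh _ (- (f %/ h))) => //.
    rewrite mulrN opprK mulrC addrC -e evpZ; exact: (prM hp).
  have rc := minf _ hr (leq_trans sr sfh).
  have l0 : l != 0 by rewrite expf_neq0 // lead_coef_eq0.
  have prg : pr (evp rho a (f %/ h)).
    have : pr (evp rho a ((f %/ h) * h)).
      by rewrite -(addrK (f %% h) (_ * _)) -e rmorphB evpZ; apply: (prB hp) => //; apply: (prM hp).
    by rewrite rmorphM => /(prP hp) [].
  have sg : (size (f %/ h)%R < size f)%N.
    have [->|g0] := eqVneq (f %/ h) 0; first by rewrite size_poly0 size_poly_gt0.
    have : (size ((f %/ h) * h)%R <= size f)%N.
      have -> : ((f %/ h) * h)%R = l *: f - (f %% h) by rewrite e addrK.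
      apply: leq_trans (size_polyD _ _) _; rewrite size_polyN geq_max.
      by rewrite size_scale // leqnn /= ltnW // (leq_trans sr).
    rewrite size_mul //.
    have : (0 < size (f %/ h)%R)%N by rewrite size_poly_gt0.
    move=> p1 p2; apply: leq_trans p2.
    by rewrite -(prednK (ltnW s2)) addnS /= -(addn1 (size _)) leq_add2l -ltnS prednK // ltnW.
  have gc := minf _ prg sg.
  have [i ni] := nzf.
  have : pr (rho (l *: f)`_i).
    rewrite e coefD rmorphD; apply: prD => //.
    rewrite coefM rmorph_sum; apply: pr_sum => // j.
    by rewrite rmorphM; apply: prMr.
  rewrite coefZ rmorphM => /(prP hp) [|//].
  by rewrite rmorphXn => /(prXn hp).
have [a1 _ ha1] : exists2 a1, a1 != 0 & h = a1%:P by apply/size_poly1P; rewrite sh1.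
rewrite ha1 evpC in nh; rewrite ha1 in hw.
have nla : ~ pr (rho (lead_coef f * a1)) by rewrite rmorphM => /(prP hp) [].
have [t [th [hk tla hb]]] := G _ nla.
have /andP [tl ta] : (th (lead_coef f) != 0) && (th a1 != 0).
  by rewrite -negb_or -mulf_eq0 -rmorphM.
have kerP t' (j : {rmorphism fld t -> fld t'}) x p :
    root (map_poly j (map_poly th f)) x -> pr (evp rho a p) -> (map_poly (j \o th) p).[x] = 0.
  move=> rx hp'.
  have e := Pdiv.Idomain.divp_eq p f; set l := _ ^+ _ in e.
  have sr : (size (p %% f)%R < size f)%N by rewrite Pdiv.Idomain.ltn_modp.
  have hr : pr (evp rho a (p %% f)).
    have -> : p %% f = l *: p - (p %/ f) * f by rewrite e addrC addKr.
    by rewrite rmorphB evpZ rmorphM; apply: (prB hp); apply: (prM hp).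
  have rc := minf _ hr sr.
  have tr0 : map_poly (j \o th) (p %% f) = 0.
    by apply/polyP => i; rewrite coef_map /= hk ?rmorph0 // coef0.
  have : (map_poly (j \o th) (l *: p)).[x] = 0.
    rewrite e rmorphD rmorphM /= tr0 addr0 hornerM.
    move: rx; rewrite -map_poly_comp => /eqP ->; by rewrite mulr0.
  rewrite -mul_polyC rmorphM /= map_polyC hornerM hornerC => /eqP; rewrite mulf_eq0.
  case/orP => [|/eqP //].
  by rewrite /= rmorphXn rmorphXn expf_eq0 fmorph_eq0 (negPf tl) andbF.
apply: (build t th f) => //.
  rewrite size_map_poly_id0 //; apply/eqP => sf1.
  have [b b0 fb] : exists2 b, b != 0 & f = b%:P by apply/size_poly1P; rewrite sf1.
  by apply: lf; rewrite fb lead_coefC; move: prf; rewrite fb evpC.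
move=> t' j x rx; split; first by move=> p; apply: kerP.
have := kerP t' j x _ rx hw.
rewrite rmorphB rmorphM /= map_polyC hornerD hornerN hornerM hornerC => /eqP; rewrite subr_eq0 => /eqP e.
apply/eqP => u0; move: e; rewrite u0 mul0r /= => /eqP.
by rewrite fmorph_eq0 (negPf ta).
Qed.

End Extension.

(** * Noetherian rings and the Nullstellensatz *)

Section Ideals.
Variable R : comNzRingType.

Record ideal (I : R -> Prop) : Prop := Ideal {
  idl0 : I 0;
  idlD : forall a b, I a -> I b -> I (a + b);
  idlM : forall a b, I b -> I (a * b) }.

Lemma idlB (I : R -> Prop) a b : ideal I -> I a -> I b -> I (a - b).
Proof. by move=> h ha hb; apply: (idlD h) => //; rewrite -mulN1r; apply: (idlM h). Qed.

(** An ideal maximal among those that contain [J] and miss every power of [g] is prime. *)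
Lemma prime_avoiding (J : R -> Prop) g : ideal J -> (forall n, ~ J (g ^+ n)) ->
  exists pr, [/\ prime_pred pr, forall x, J x -> pr x & ~ pr g].
Proof.
move=> hJ gJ.
pose PP (S : classical_sets.set R) := (forall x, ~ S x) \/
  [/\ ideal S, forall x, J x -> S x & forall n, ~ S (g ^+ n)].
have [F FP Ftot|S [PS maxS]] := classical_sets.Zorn_bigcup (P := PP).
  rewrite /PP.
  have [[S0 FS0 [x0 S0x0]]|none] := EM (exists2 S, F S & exists x, S x); last first.
    left=> x [S FS Sx]; apply: none; exists S => //; by exists x.
  have gd S : F S -> (exists x, S x) ->
      [/\ ideal S, forall x, J x -> S x & forall n, ~ S (g ^+ n)].
    by move=> FS [x Sx]; case: (FP S FS) => // e; case: (e x).
  have both x y : (classical_sets.bigcup F id) x ->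
      (classical_sets.bigcup F id) y -> exists S, [/\ F S, S x & S y].
    move=> [S FS Sx] [S' FS' Sy]; case: (Ftot S S' FS FS') => h.
      by exists S'; split=> //; apply: h.
    by exists S; split=> //; apply: h.
  have [hS0 lS0 aS0] := gd _ FS0 (ex_intro _ _ S0x0).
  right; split.
  - split; first by exists S0 => //; apply: (idl0 hS0).
      move=> a b h h'; have [S [FS h1 h2]] := both _ _ h h'.
      have [hS _ _] := gd S FS (ex_intro _ _ h1).
      by exists S => //; apply: (idlD hS).
    move=> a b [S FS h1]; have [hS _ _] := gd S FS (ex_intro _ _ h1).
    by exists S => //; apply: (idlM hS).
  - by move=> x Jx; exists S0 => //; apply: lS0.
  - by move=> n [S FS h1]; have [_ _ h] := gd S FS (ex_intro _ _ h1); apply: (h n).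
have [hS lS aS] : [/\ ideal S, forall x, J x -> S x & forall n, ~ S (g ^+ n)].
  case: PS => // e; exfalso; apply: (maxS J); last by right.
  by split=> [x /e //|h]; apply: (e 0); apply: h; apply: (idl0 hJ).
have ex a : ~ S a -> exists n c s, S s /\ g ^+ n = c * a + s.
  move=> na; apply: contrapT => ne.
  apply: (maxS (fun x => exists c s, S s /\ x = c * a + s)).
    split=> [x Sx|h]; first by exists 0, x; rewrite mul0r add0r.
    by apply: na; apply: h; exists 1, 0; rewrite mul1r addr0; split=> //; apply: (idl0 hS).
  right; split.
  - split; first by exists 0, 0; rewrite mul0r add0r; split=> //; apply: (idl0 hS).
      move=> x y [c [s [Ss ->]]] [c' [s' [Ss' ->]]]; exists (c + c'), (s + s'); split.
        exact: (idlD hS).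
      by ring.
    move=> x y [c [s [Ss ->]]]; exists (x * c), (x * s); split; first exact: (idlM hS).
    by ring.
  - by move=> x Jx; exists 0, x; rewrite mul0r add0r; split=> //; apply: lS.
  - by move=> n [c [s [Ss e]]]; apply: ne; exists n, c, s.
exists S; split=> //; last by move=> h; apply: (aS 1%N); rewrite expr1.
split.
- by move=> a b; apply: idlB.
- exact: (idlM hS).
- move=> a b Sab; apply: contrapT => /not_orP [na nb].
  have [n [c [s [Ss e]]]] := ex a na; have [n' [c' [s' [Ss' e']]]] := ex b nb.
  apply: (aS (n + n')%N); rewrite exprD e e'.
  rewrite (_ : _ * _ = (c * c') * (a * b) + ((c * a) * s' + (c' * b + s') * s)); last by ring.
  apply: (idlD hS); first exact: (idlM hS).
  by apply: (idlD hS); apply: (idlM hS).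
- by move=> h; apply: (aS 0%N); rewrite expr0.
Qed.

Fixpoint ispan (s : seq R) (x : R) : Prop :=
  if s is a :: s' then exists c, ispan s' (x - c * a) else x = 0.

Lemma ispan0 s : ispan s 0.
Proof. by elim: s => //= a s IH; exists 0; rewrite mul0r subr0. Qed.

Lemma ispanD s x y : ispan s x -> ispan s y -> ispan s (x + y).
Proof.
elim: s x y => [|a s IH] x y /=; first by move=> -> ->; rewrite addr0.
move=> [c h] [c' h']; exists (c + c').
by rewrite (_ : _ - _ = (x - c * a) + (y - c' * a)); [apply: IH|ring].
Qed.

Lemma ispanM s x y : ispan s y -> ispan s (x * y).
Proof.
elim: s x y => [|a s IH] x y /=; first by move=> ->; rewrite mulr0.
move=> [c h]; exists (x * c).
by rewrite -mulrA -mulrBr; apply: IH.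
Qed.

Lemma ispan_ideal s : ideal (ispan s).
Proof. by split; [apply: ispan0|apply: ispanD|apply: ispanM]. Qed.

Lemma ispan_mem s x : x \in s -> ispan s x.
Proof.
elim: s => //= a s IH; rewrite inE => /orP [/eqP ->|/IH h].
  by exists 1; rewrite mul1r subrr; apply: ispan0.
by exists 0; rewrite mul0r subr0.
Qed.

Lemma ispan_min s (I : R -> Prop) x : ideal I -> (forall y, y \in s -> I y) ->
  ispan s x -> I x.
Proof.
move=> hI; elim: s x => [|a s IH] x hs /=; first by move=> ->; apply: (idl0 hI).
move=> [c h]; rewrite -(subrK (c * a) x); apply: (idlD hI).
  by apply: IH => // y ys; apply: hs; rewrite inE ys orbT.
by apply: (idlM hI); apply: hs; rewrite inE eqxx.
Qed.

Lemma ispan_sub s s' x : {subset s <= s'} -> ispan s x -> ispan s' x.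
Proof.
move=> ss; apply: ispan_min; first exact: ispan_ideal.
by move=> y /ss; apply: ispan_mem.
Qed.

Definition noeth := forall I : R -> Prop, ideal I ->
  exists s : seq R, (forall x, x \in s -> I x) /\ forall x, I x -> ispan s x.

End Ideals.

(** Hilbert's basis theorem. [L d] collects the coefficients in degree [d] of members of size at
    most [d.+1]. Generators of the union of these ideals all occur by some degree [D], and the
    finitely many degrees below [D] get generators of their own. *)
Lemma noeth_poly (R : comNzRingType) : noeth R -> noeth {poly R}.
Proof.
move=> nR I hI.
pose L d (a : R) := exists f : {poly R}, [/\ I f, (size f <= d.+1)%N & f`_d = a].
have Lmono d e a : (d <= e)%N -> L d a -> L e a.
  move=> de [f [If sf fa]]; exists ('X^(e - d) * f); split.
  - exact: (idlM hI).
  - have [->|f0] := eqVneq f 0; first by rewrite mulr0 size_poly0.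
    by rewrite mulrC size_mulXn //; move: (size f) sf => z sf; lia.
  - by rewrite coefXnM ltnNge leq_subr /= subKn.
have Lid d : ideal (L d).
  split; first by exists 0; rewrite size_poly0 coef0; split=> //; apply: (idl0 hI).
    move=> a b [f [If sf <-]] [g [Ig sg <-]]; exists (f + g); split.
    - exact: (idlD hI).
    - by apply: leq_trans (size_polyD _ _) _; rewrite geq_max sf.
    - by rewrite coefD.
  move=> a b [f [If sf <-]]; exists (a%:P * f); split.
  - exact: (idlM hI).
  - by apply: leq_trans sf; rewrite mul_polyC size_scale_leq.
  - by rewrite coefCM.
have Linf : ideal (fun a => exists d, L d a).
  split; first by exists 0%N; apply: (idl0 (Lid _)).
    move=> a b [d h] [e h']; exists (maxn d e); apply: (idlD (Lid _)).
      exact: Lmono (leq_maxl _ _) h.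
    exact: Lmono (leq_maxr _ _) h'.
  by move=> a b [d h]; exists d; apply: (idlM (Lid _)).
have lift d (s : seq R) : (forall a, a \in s -> L d a) ->
    exists2 G : seq {poly R}, (forall g, g \in G -> I g) &
    forall e x, (d <= e)%N -> ispan s x ->
      exists g : {poly R}, [/\ ispan G g, (size g <= e.+1)%N & g`_e = x].
  elim: s => [|a s IH] hs.
    exists [::] => // e x _ /= ->; exists 0; by rewrite size_poly0 coef0.
  have [|G GI hG] := IH; first by move=> b bs; apply: hs; rewrite inE bs orbT.
  have [f [If sf fa]] := hs a (mem_head _ _).
  exists (f :: G); first by move=> g; rewrite inE => /orP [/eqP -> //|/GI].
  move=> e x de [c /(hG e _ de) [g [gG sg ge]]].
  have sc : (size (c *: 'X^(e - d) * f)%R <= e.+1)%N.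
    have [->|f0] := eqVneq f 0; first by rewrite mulr0 size_poly0.
    rewrite -scalerAl; apply: leq_trans (size_scale_leq _ _) _.
    by rewrite mulrC size_mulXn //; move: (size f) sf => z sf; lia.
  exists (g + c *: 'X^(e - d) * f); split.
  - by exists (c *: 'X^(e - d)); rewrite addrK.
  - by apply: leq_trans (size_polyD _ _) _; rewrite geq_max sg.
  - by rewrite coefD -scalerAl coefZ coefXnM ltnNge leq_subr /= subKn // fa ge subrK.
have PD d : exists2 G : seq {poly R}, (forall g, g \in G -> I g) &
    forall f, I f -> (size f <= d.+1)%N -> exists g, ispan G g /\ (size (f - g)%R <= d)%N.
  have [s [hs ss]] := nR _ (Lid d); have [G GI hG] := lift d s hs.
  exists G => // f If sf; have [|g [gG sg gd]] := hG d f`_d (leqnn _).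
    by apply: ss; exists f.
  exists g; split=> //; apply/leq_sizeP => i; rewrite leq_eqVlt => /orP [/eqP <-|hi].
    by rewrite coefB gd subrr.
  by rewrite coefB !nth_default ?subrr //; [apply: leq_trans hi|apply: leq_trans hi].
have [D [G GI hG]] : exists D, exists2 G : seq {poly R}, (forall g, g \in G -> I g) &
    forall d f, (D <= d)%N -> I f -> (size f <= d.+1)%N ->
      exists g, ispan G g /\ (size (f - g)%R <= d)%N.
  have [s [hs ss]] := nR _ Linf.
  have [D hD] : exists D, forall a, a \in s -> L D a.
    elim: s hs {ss} => [|a s IH] hs; first by exists 0%N.
    have [|D hD] := IH; first by move=> b bs; apply: hs; rewrite inE bs orbT.
    have [d hd] := hs a (mem_head _ _); exists (maxn d D) => b.
    rewrite inE => /orP [/eqP ->|/hD h]; first exact: Lmono (leq_maxl _ _) hd.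
    exact: Lmono (leq_maxr _ _) h.
  have [G GI hG] := lift D s hD; exists D, G => // d f Dd If sf.
  have [|g [gG sg gd]] := hG d f`_d Dd; first by apply: ss; exists d, f.
  exists g; split=> //; apply/leq_sizeP => i; rewrite leq_eqVlt => /orP [/eqP <-|hi].
    by rewrite coefB gd subrr.
  by rewrite coefB !nth_default ?subrr //; [apply: leq_trans hi|apply: leq_trans hi].
have [G' GI' hG'] : exists2 G : seq {poly R}, (forall g, g \in G -> I g) &
    forall d f, I f -> (size f <= d.+1)%N ->
      exists g, ispan G g /\ (size (f - g)%R <= d)%N.
  have : forall n, (n <= D)%N -> exists2 G : seq {poly R}, (forall g, g \in G -> I g) &
    forall d f, (D - n <= d)%N -> I f -> (size f <= d.+1)%N ->
      exists g, ispan G g /\ (size (f - g)%R <= d)%N.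
    elim=> [|n IH] hn; first by exists G => // d f; rewrite subn0; apply: hG.
    have [G1 GI1 hG1] := IH (ltnW hn); have [G2 GI2 hG2] := PD (D - n.+1)%N.
    exists (G1 ++ G2); first by move=> g; rewrite mem_cat => /orP [/GI1|/GI2].
    move=> d f; rewrite leq_eqVlt => /orP [/eqP <-|hd] If sf.
      have [g [gG sg]] := hG2 f If sf; exists g; split=> //.
      by apply: ispan_sub gG => x; rewrite mem_cat orbC => ->.
    have [|g [gG sg]] := hG1 d f _ If sf; first by move: hd; rewrite subnS prednK // subn_gt0.
    exists g; split=> //; by apply: ispan_sub gG => x; rewrite mem_cat => ->.
  move=> /(_ D (leqnn _)) [G1 GI1 hG1]; exists G1 => // d f; apply: hG1; by rewrite subnn.
exists G'; split=> // f If.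
have : forall n f, I f -> (size f <= n)%N -> ispan G' f; last by apply.
elim=> [|n IH] h Ih; first by rewrite leqn0 size_poly_eq0 => /eqP ->; apply: ispan0.
move=> sh; have [g [gG sg]] := hG' n h Ih sh.
rewrite -(subrK g h); apply: ispanD => //; apply: IH => //.
by apply: (idlB hI) => //; apply: (ispan_min hI GI').
Qed.

Lemma noeth_field (k : fieldType) : noeth k.
Proof.
move=> I hI; have [[a Ia a0]|none] := EM (exists2 a, I a & a != 0).
  exists [:: a]; split; first by move=> x; rewrite inE => /eqP ->.
  by move=> x Ix /=; exists (x / a); rewrite divfK ?subrr.
exists [::]; split=> // x Ix /=; apply: contrapT => x0; apply: none; exists x => //.
exact/eqP.
Qed.

Lemma rmorph_mmap (n : nat) (R S T : comNzRingType) (f : {rmorphism R -> S})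
    (g : {rmorphism S -> T}) (h : 'I_n -> S) (p : {mpoly R[n]}) :
  g (mmap f h p) = mmap (g \o f) (g \o h) p.
Proof.
rewrite /mmap rmorph_sum; apply: eq_bigr => m _; rewrite rmorphM; congr (_ * _).
by rewrite /mmap1 rmorph_prod; apply: eq_bigr => i _; rewrite rmorphXn.
Qed.

Lemma eq_mmap (n : nat) (R S : comNzRingType) (f g : R -> S) (h h' : 'I_n -> S)
    (p : {mpoly R[n]}) : f =1 g -> h =1 h' -> mmap f h p = mmap g h' p.
Proof.
move=> fg hh; rewrite /mmap; apply: eq_bigr => m _; rewrite fg; congr (_ * _).
by rewrite /mmap1; apply: eq_bigr => i _; rewrite hh.
Qed.

Lemma mmap_id (n : nat) (R : comNzRingType) (p : {mpoly R[n]}) :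
  mmap (@mpolyC n R) (fun i => 'X_i) p = p.
Proof.
rewrite [RHS]mpolyE /mmap; apply: eq_bigr => m _.
by rewrite -mul_mpolyC; congr (_ * _); rewrite mpolyXE_id.
Qed.

Section Nullstellensatz.
Variables (R0 : idomainType) (Tgt : Type) (fld : Tgt -> fieldType).
Variable bas : forall t, {rmorphism R0 -> fld t}.
Hypothesis Hroot : forall t (p : {poly fld t}), size p != 1%N ->
  exists t' (j : {rmorphism fld t -> fld t'}) x,
    root (map_poly j p) x /\ forall r, j (bas t r) = bas t' r.

(** [T] is an iterated polynomial ring, to which the step for one variable applies; [tau] is a
    section of its map [rho] onto the multivariate ring. *)
Lemma generic_point (n : nat) (pr : {mpoly R0[n]} -> Prop) u :
  prime_pred pr -> pr 0 ->
  (forall r, ~ pr r%:MP -> exists t, bas t r != 0 /\ forall s, pr s%:MP -> bas t s = 0) ->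
  ~ pr u -> exists t (z : 'I_n -> fld t),
    (forall F, pr F -> mmap (bas t) z F = 0) /\ mmap (bas t) z u != 0.
Proof.
move=> hp h0 hb nu.
have : forall m, (m <= n)%N -> exists (T : idomainType) (c : {rmorphism R0 -> T})
   (rho : {rmorphism T -> {mpoly R0[n]}}),
   [/\ extendable pr bas c rho, forall r, rho (c r) = r%:MP &
     forall i : 'I_n, (i < m)%N -> exists x, rho x = 'X_i].
  elim=> [|m IH] hm.
    exists R0, idfun, (@mpolyC n R0); split=> // r nr.
    by have [t [h1 h2]] := hb r nr; exists t, (bas t); split.
  have [T [c [rho [G hc hx]]]] := IH (ltnW hm).
  exists {poly T}, (polyC \o c), (evp rho 'X_(Ordinal hm)); split.
  - exact: (good_poly hp h0 Hroot).
  - by move=> r; rewrite /= evpC hc.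
  - move=> i; rewrite ltnS leq_eqVlt => /orP [/eqP e|/hx [x hx']].
      by exists 'X; rewrite evpX; congr 'X_ _; apply: val_inj.
    by exists x%:P; rewrite evpC.
move=> /(_ n (leqnn _)) [T [c [rho [G hc hx]]]].
have /choice [x hx'] : forall i : 'I_n, exists x, rho x = 'X_i.
  by move=> i; apply: hx.
pose tau F := mmap c x F.
have rt F : rho (tau F) = F.
  rewrite rmorph_mmap -[RHS]mmap_id; apply: eq_mmap => [r|i] /=; [exact: hc|exact: hx'].
have [|t [th [hk tu hbs]]] := G (tau u); first by rewrite rt.
have tt F : th (tau F) = mmap (bas t) (th \o x) F.
  by rewrite rmorph_mmap; apply: eq_mmap => // r /=; apply: hbs.
exists t, (th \o x); split; last by rewrite -tt.
by move=> F hF; rewrite -tt; apply: hk; rewrite rt.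
Qed.

End Nullstellensatz.

Lemma noeth_mpoly (k : fieldType) n : noeth {mpoly k[n]}.
Proof.
have : forall m, (m <= n)%N -> exists (T : comNzRingType) (c : {rmorphism k -> T})
   (rho : {rmorphism T -> {mpoly k[n]}}),
   [/\ noeth T, forall r, rho (c r) = r%:MP &
     forall i : 'I_n, (i < m)%N -> exists x, rho x = 'X_i].
  elim=> [|m IH] hm.
    by exists k, idfun, (@mpolyC n k); split=> //; apply: noeth_field.
  have [T [c [rho [G hc hx]]]] := IH (ltnW hm).
  exists {poly T}, (polyC \o c), (evp rho 'X_(Ordinal hm)); split.
  - exact: noeth_poly.
  - by move=> r; rewrite /= evpC hc.
  - move=> i; rewrite ltnS leq_eqVlt => /orP [/eqP e|/hx [x hx']].
      by exists 'X; rewrite evpX; congr 'X_ _; apply: val_inj.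
    by exists x%:P; rewrite evpC.
move=> /(_ n (leqnn _)) [T [c [rho [nT hc hx]]]].
have /choice [x hx'] : forall i : 'I_n, exists x, rho x = 'X_i.
  by move=> i; apply: hx.
pose tau F := mmap c x F.
have rt F : rho (tau F) = F.
  rewrite rmorph_mmap -[RHS]mmap_id; apply: eq_mmap => [r|i] /=; [exact: hc|exact: hx'].
move=> I hI; have [|s [hs ss]] := nT (fun t => I (rho t)).
  split; first by rewrite rmorph0; apply: (idl0 hI).
    by move=> a b; rewrite rmorphD; apply: (idlD hI).
  by move=> a b; rewrite rmorphM; apply: (idlM hI).
exists (map rho s); split; first by move=> y /mapP [z zs ->]; apply: hs.
have sp t : ispan s t -> ispan (map rho s) (rho t).
  elim: (s) t => [|a s' IH] t /=; first by move=> ->; rewrite rmorph0.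
  by move=> [d /IH h]; exists (rho d); rewrite -rmorphM -rmorphB.
by move=> F IF; rewrite -(rt F); apply: sp; apply: ss; rewrite rt.
Qed.

Lemma nullstellensatz_prime (k : closedFieldType) n (pr : {mpoly k[n]} -> Prop) u :
  prime_pred pr -> pr 0 -> ~ pr u ->
  exists z : 'I_n -> k, (forall F, pr F -> F.@[z] = 0) /\ u.@[z] != 0.
Proof.
move=> hp h0 nu.
have [|r nr|[] [z [h1 h2]]] :=
  @generic_point k unit (fun=> k) (fun=> idfun) _ n pr u hp h0 _ nu.
- by move=> [] p /closed_rootP [x rx]; exists tt, idfun, x; rewrite map_poly_id.
- exists tt; split; first by apply/eqP => r0; apply: nr; move: r0 => /= ->; rewrite mpolyC0.
  move=> s hs /=; apply: contrapT => /eqP s0; apply: (pr1 hp).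
  have := prM hp (s^-1)%:MP hs; by rewrite -mpolyCM mulVf.
- by exists z.
Qed.

(** * Two-dimensional regular local rings *)

Section LocalRing.
Variables (K k : fieldType) (V : K -> k -> Prop).

(** A local ring inside [K] is encoded by the graph [V] of its residue map: [fin] is the ring, and
    [V f 0] is membership in the maximal ideal. *)
Definition fin (f : K) : Prop := exists c, V f c.

Record lring : Prop := LRing {
  lr_hrel :> hrel V;
  lr_inv : forall a c, V a c -> c != 0 -> V a^-1 c^-1 }.

Fixpoint cspan (C : K -> Prop) (s : seq K) (x : K) : Prop :=
  if s is a :: s' then exists c, C c /\ cspan C s' (x - c * a) else x = 0.

Record oideal (I : K -> Prop) : Prop := OIdeal {
  oi_fin : forall a, I a -> fin a;
  oi0 : I 0;
  oiD : forall a b, I a -> I b -> I (a + b);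
  oiM : forall a b, fin a -> I b -> I (a * b) }.

Definition onoeth := forall I, oideal I ->
  exists s, (forall z, z \in s -> I z) /\ forall z, I z -> cspan fin s z.

Definition fracs := forall f, exists2 d, d != 0 & fin d /\ fin (d * f).

Hypothesis hV : lring.

Lemma fin0 : fin 0. Proof. by exists 0; apply: (hrel0 hV). Qed.
Lemma fin1 : fin 1. Proof. by exists 1; apply: (hrel1 hV). Qed.
Lemma finD a b : fin a -> fin b -> fin (a + b).
Proof. by move=> [c h] [d h']; exists (c + d); apply: (hrelD hV). Qed.
Lemma finB a b : fin a -> fin b -> fin (a - b).
Proof. by move=> [c h] [d h']; exists (c - d); apply: (hrelB hV). Qed.
Lemma finN a : fin a -> fin (- a).
Proof. by move=> [c h]; exists (- c); apply: (hrelN hV). Qed.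
Lemma finM a b : fin a -> fin b -> fin (a * b).
Proof. by move=> [c h] [d h']; exists (c * d); apply: (hrelM hV). Qed.
Lemma finX a n : fin a -> fin (a ^+ n).
Proof. by move=> [c h]; exists (c ^+ n); apply: (hrelX hV). Qed.
Lemma fin_sum (J : Type) (r : seq J) (P : pred J) F :
  (forall i, P i -> fin (F i)) -> fin (\sum_(i <- r | P i) F i).
Proof. by move=> h; elim/big_ind: _ => //; [apply: fin0|apply: finD]. Qed.
Lemma fin_prod (J : Type) (r : seq J) (P : pred J) F :
  (forall i, P i -> fin (F i)) -> fin (\prod_(i <- r | P i) F i).
Proof. by move=> h; elim/big_ind: _ => //; [apply: fin1|apply: finM]. Qed.
Lemma max_fin a : V a 0 -> fin a. Proof. by exists 0. Qed.
Lemma maxM a b : fin a -> V b 0 -> V (a * b) 0.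
Proof. by move=> [c h] h'; have := hrelM hV h h'; rewrite mulr0. Qed.
Lemma maxMr a b : fin a -> V b 0 -> V (b * a) 0.
Proof. by rewrite mulrC; apply: maxM. Qed.
Lemma maxD a b : V a 0 -> V b 0 -> V (a + b) 0.
Proof. by move=> h h'; have := hrelD hV h h'; rewrite addr0. Qed.
Lemma max_sum (J : Type) (r : seq J) (P : pred J) F :
  (forall i, P i -> V (F i) 0) -> V (\sum_(i <- r | P i) F i) 0.
Proof. by move=> h; elim/big_ind: _ => //; [apply: (hrel0 hV)|apply: maxD]. Qed.
Lemma max_one : ~ V 1 0.
Proof.
by move=> /(hrel_fun hV (hrel1 hV))/eqP; rewrite oner_eq0.
Qed.
Lemma unit_neq0 u c : V u c -> c != 0 -> u != 0.
Proof. by move=> h; apply: contraNneq => u0; move: h; rewrite u0 => /(hrel0P hV) ->. Qed.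
Lemma unit_fin u c : V u c -> c != 0 -> fin u^-1.
Proof. by move=> h c0; exists c^-1; apply: (lr_inv hV). Qed.
Lemma max_or_unit a : fin a -> V a 0 \/ exists2 c, c != 0 & V a c.
Proof.
by move=> [c h]; have [c0|c0] := eqVneq c 0; [left; rewrite -c0|right; exists c].
Qed.

Lemma oiB I a b : oideal I -> I a -> I b -> I (a - b).
Proof.
move=> h ha hb; apply: (oiD h) => //; rewrite -mulN1r; apply: (oiM h) => //.
by apply: finN; apply: fin1.
Qed.

Lemma oi_cspan I s z : oideal I -> (forall w, w \in s -> I w) -> cspan fin s z -> I z.
Proof.
move=> hI; elim: s z => [|a s IH] z hs /=; first by move=> ->; apply: (oi0 hI).
move=> [c [fc h]]; rewrite -(subrK (c * a) z); apply: (oiD hI).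
  by apply: IH => // w ws; apply: hs; rewrite inE ws orbT.
by apply: (oiM hI) => //; apply: hs; rewrite inE eqxx.
Qed.

Lemma cspanD C s z w : (forall a b, C a -> C b -> C (a + b)) ->
  cspan C s z -> cspan C s w -> cspan C s (z + w).
Proof.
move=> hC; elim: s z w => [|a s IH] z w /=; first by move=> -> ->; rewrite addr0.
move=> [c [Cc h]] [c' [Cc' h']]; exists (c + c'); split; first exact: hC.
by rewrite (_ : _ - _ = (z - c * a) + (w - c' * a)); [apply: IH|ring].
Qed.

Lemma cspanM (C C' : K -> Prop) s a z : (forall b, C b -> C' (a * b)) ->
  cspan C s z -> cspan C' s (a * z).
Proof.
move=> hC; elim: s z => [|b s IH] z /=; first by move=> ->; rewrite mulr0.
move=> [c [Cc h]]; exists (a * c); split; first exact: hC.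
by rewrite -mulrA -mulrBr; apply: IH.
Qed.

(** The hypothesis is that [I] lies in J + mI, with m the maximal ideal. Generators of [I] are
    eliminated one at a time, since the coefficient [1 - m] of the first one is a unit. *)
Lemma nakayama I J : onoeth -> oideal I -> oideal J ->
  (forall z, I z -> exists j m w, [/\ J j, V m 0, I w & z = j + m * w]) ->
  forall z, I z -> J z.
Proof.
move=> nO hI hJ hz.
have [s [hs ss]] := nO I hI.
suff main (t : seq K) : (forall z, z \in t -> exists2 j, J j & cspan (fun m => V m 0) t (z - j)) ->
    forall z, z \in t -> J z.
  move=> z /ss; apply: oi_cspan => // {}z; apply: main => {}z zs.
  have [j [m [w [Jj Vm Iw ->]]]] := hz z (hs z zs).
  exists j => //; rewrite addrC addKr.
  by apply: (cspanM _ (ss w Iw)) => b fb; rewrite mulrC; apply: maxM.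
elim: t => [|a t IH] ht z; first by rewrite in_nil.
have [j Jj [m [Vm h]]] := ht a (mem_head _ _).
have V1m : V (1 - m) 1 by have := hrelB hV (hrel1 hV) Vm; rewrite subr0.
have n1m : 1 - m != 0 by apply: (unit_neq0 V1m); rewrite oner_neq0.
have f1m : fin (1 - m)^-1 by apply: (unit_fin V1m); rewrite oner_neq0.
have ha : exists2 j', J j' & cspan (fun m => V m 0) t (a - j').
  exists ((1 - m)^-1 * j); first exact: (oiM hJ).
  have -> : a - (1 - m)^-1 * j = (1 - m)^-1 * (a - j - m * a) by field.
  by apply: (cspanM _ h) => b; apply: maxM.
have ht' w : w \in t -> exists2 j, J j & cspan (fun m => V m 0) t (w - j).
  move=> wt; have [|j1 Jj1 [m1 [Vm1 h1]]] := ht w; first by rewrite inE wt orbT.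
  have [j2 Jj2 h2] := ha.
  exists (j1 + m1 * j2).
    by apply: (oiD hJ) => //; apply: (oiM hJ) => //; apply: max_fin.
  have -> : w - (j1 + m1 * j2) = (w - j1 - m1 * a) + m1 * (a - j2) by ring.
  apply: cspanD => //; first exact: maxD.
  by apply: (cspanM _ h2) => b Vb; apply: maxM => //; apply: max_fin.
have Jt := IH ht'.
rewrite inE => /orP [/eqP ->|]; last exact: Jt.
have [j' Jj' h'] := ha; rewrite -(subrK j' a); apply: (oiD hJ) => //.
have : cspan fin t (a - j').
  by rewrite -(mul1r (a - j')); apply: (cspanM _ h') => b; rewrite mul1r; apply: max_fin.
exact: oi_cspan.
Qed.

Definition mulO x z := exists2 a, fin a & z = x * a.

Lemma mulO_ideal x : fin x -> oideal (mulO x).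
Proof.
move=> fx; split.
- by move=> _ [b fb ->]; apply: finM.
- by exists 0; [apply: fin0|rewrite mulr0].
- by move=> _ _ [b fb ->] [b' fb' ->]; exists (b + b'); [apply: finD|rewrite mulrDr].
- by move=> a _ fa [b fb ->]; exists (a * b); [apply: finM|rewrite mulrCA].
Qed.

(** Krull's intersection theorem modulo [x]. The ideals generated by [x] and the first cofactors
    [w i] ascend, so some [w N] is a combination of [x] and earlier ones. Multiplied by [y^N] this
    puts [(1 - q) z] in xO with [q] in the maximal ideal. *)
Lemma krull x y z : onoeth -> V x 0 -> V y 0 ->
  (forall n, exists w u, [/\ fin w, fin u & z = y ^+ n * w + x * u]) -> mulO x z.
Proof.
move=> nO Vx Vy hz.
have /choice [w /choice [u hwu]] := hz.
have fw n : fin (w n) by have [] := hwu n.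
have fu n : fin (u n) by have [] := hwu n.
have ez n : z = y ^+ n * w n + x * u n by have [] := hwu n.
pose J n t := exists (c : nat -> K) d, [/\ forall i, fin (c i), fin d &
   t = \sum_(i < n) c i * w i + x * d].
have Jmono n m t : (n <= m)%N -> J n t -> J m t.
  move=> nm [c [d [fc fd ->]]]; exists (fun i => if (i < n)%N then c i else 0), d; split=> //.
    by move=> i; case: ifP => // _; apply: fin0.
  congr (_ + _); rewrite (big_ord_widen m (fun i => c i * w i) nm) [RHS]big_mkcond /=.
  rewrite big_mkcond /=; apply: eq_bigr => i _; case: ifP => //; by rewrite mul0r.
have JD n a b : J n a -> J n b -> J n (a + b).
  move=> [c [d [fc fd ->]]] [c' [d' [fc' fd' ->]]].
  exists (fun i => c i + c' i), (d + d'); split; [by move=> i; apply: finD|exact: finD|].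
  have -> : \sum_(i < n) (c i + c' i) * w i = \sum_(i < n) c i * w i + \sum_(i < n) c' i * w i.
    by rewrite -big_split; apply: eq_bigr => i _; rewrite mulrDl.
  by ring.
have JM n a b : fin a -> J n b -> J n (a * b).
  move=> fa [c [d [fc fd ->]]].
  exists (fun i => a * c i), (a * d); split; [by move=> i; apply: finM|exact: finM|].
  rewrite mulrDr mulr_sumr mulrCA; congr (_ + _); apply: eq_bigr => i _; by rewrite mulrA.
have hI : oideal (fun t => exists n, J n t).
  split.
  - move=> _ [n [c [d [fc fd ->]]]]; apply: finD; last by apply: finM => //; apply: max_fin.
    by apply: fin_sum => i _; apply: finM.
  - exists 0%N, (fun=> 0), 0; rewrite big_ord0 mulr0 addr0; split=> //; [by move=> _; apply: fin0|exact: fin0].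
  - move=> a b [n ha] [m hb]; exists (maxn n m); apply: JD.
      exact: Jmono (leq_maxl _ _) ha.
    exact: Jmono (leq_maxr _ _) hb.
  - by move=> a b fa [n hb]; exists n; apply: JM.
have [s [hs ss]] := nO _ hI.
have [N hN] : exists N, forall a, a \in s -> J N a.
  elim: (s) hs => [|a t IH] hs'; first by exists 0%N.
  have [|N hN] := IH; first by move=> b bt; apply: hs'; rewrite inE bt orbT.
  have [n hn] := hs' a (mem_head _ _); exists (maxn n N) => b.
  rewrite inE => /orP [/eqP ->|/hN h]; first exact: Jmono (leq_maxl _ _) hn.
  exact: Jmono (leq_maxr _ _) h.
have JNid : oideal (J N).
  split; [by move=> a h; apply: (oi_fin hI); exists N| |by apply: JD|by apply: JM].
  exists (fun=> 0), 0; rewrite big1 ?mulr0 ?addr0; last by move=> i _; rewrite mul0r.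
  by split=> //; [move=> _; apply: fin0|exact: fin0].
have [c [d [fc fd ewN]]] : J N (w N).
  have : cspan fin s (w N).
    apply: ss; exists N.+1, (fun i => (i == N)%:R), 0; split.
    - by move=> i; case: eqP => _; [apply: fin1|apply: fin0].
    - exact: fin0.
    - rewrite mulr0 addr0 big_ord_recr /= eqxx mul1r big1 ?add0r // => i _.
      by rewrite ltn_eqF // mul0r.
  exact: oi_cspan.
pose q := \sum_(i < N) c i * y ^+ (N - i).
have Vq : V q 0.
  apply: max_sum => i _; apply: maxM => //.
  have -> : (N - i = (N - i).-1.+1)%N by rewrite prednK // subn_gt0.
  by rewrite exprS; apply: maxMr => //; apply: finX; apply: max_fin.
have eq1 : exists2 e, fin e & (1 - q) * z = x * e.
  exists (y ^+ N * d + u N - \sum_(i < N) c i * y ^+ (N - i) * u i).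
    apply: finB; last by apply: fin_sum => i _; do 2?apply: finM => //; apply: finX; apply: max_fin.
    by apply: finD => //; apply: finM => //; apply: finX; apply: max_fin.
  have : y ^+ N * (\sum_(i < N) c i * w i) = q * z - x * (\sum_(i < N) c i * y ^+ (N - i) * u i).
    rewrite /q mulr_suml !mulr_sumr -sumrB; apply: eq_bigr => i _.
    rewrite {1}(ez i) mulrDr.
    have -> : y ^+ N = y ^+ (N - i) * y ^+ i by rewrite -exprD subnK // ltnW.
    by ring.
  move=> e1; rewrite mulrBl mul1r {1}(ez N) ewN mulrDr e1; ring.
have V1 : V (1 - q) 1 by have := hrelB hV (hrel1 hV) Vq; rewrite subr0.
have [e fe ee] := eq1; exists ((1 - q)^-1 * e).
  by apply: finM => //; apply: (unit_fin V1); rewrite oner_neq0.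
rewrite mulrCA -ee mulKf //; apply: (unit_neq0 V1); exact: oner_neq0.
Qed.

Section Params.
Hypothesis nO : onoeth.

Definition params x y := [/\ V x 0, V y 0 &
  forall f, V f 0 -> exists a b, [/\ fin a, fin b & f = a * x + b * y]].

Lemma paramsC x y : params x y -> params y x.
Proof.
move=> [hx hy h]; split=> // f /h [a [b [fa fb ->]]]; exists b, a; split=> //.
by rewrite addrC.
Qed.

(** [n] is the largest exponent for which [f] lies in the ideal of [x] and [y^n]; a largest one
    exists by [krull]. The cofactor of [y^n] is then a unit, for otherwise it would lie in the ideal
    of [x] and [y]. *)
Lemma order_mod x y f : params x y -> fin f -> ~ mulO x f ->
  exists n u c a, [/\ V u c, c != 0, fin a & f = u * y ^+ n + x * a].
Proof.
move=> [Vx Vy hM] ff nf.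
pose Q n := exists w u, [/\ fin w, fin u & f = y ^+ n * w + x * u].
have [n [Qn nQ]] : exists n, Q n /\ ~ Q n.+1.
  apply: contrapT => ne; apply: nf; apply: (krull nO Vx Vy) => n.
  elim: n => [|n IH]; last by apply: contrapT => h; apply: ne; exists n.
  by exists f, 0; rewrite expr0 mul1r mulr0 addr0; split=> //; apply: fin0.
have [w [u [fw fu e]]] := Qn.
have [Vw|[c c0 Vw]] := max_or_unit fw; last first.
  by exists n, w, c, u; split=> //; rewrite mulrC.
case: nQ; have [a [b [fa fb ew]]] := hM w Vw.
exists b, (u + y ^+ n * a); split=> //.
  by apply: finD => //; apply: finM => //; apply: finX; apply: max_fin.
by rewrite e ew exprS; ring.
Qed.

(* Modulo x every element is a unit times a power of y, and an ideal I modulo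
   which x is regular meets xO in xI; so Nakayama makes I principal. *)
Lemma saturated_principal x y I : params x y -> oideal I ->
  (forall c, fin c -> I (x * c) -> I c) ->
  exists2 f, I f & forall z, I z -> exists2 a, fin a & z = a * f.
Proof.
move=> pxy hI sat; have [Vx Vy hM] := pxy; have fx := max_fin Vx.
have [sub|nsub] := EM (forall z, I z -> mulO x z).
  exists 0 => [|z Iz]; first exact: (oi0 hI).
  exists 0; first exact: fin0.
  have h0 : oideal (fun z => z = 0).
    split=> //; [by move=> _ ->; apply: fin0|by move=> _ _ -> ->; rewrite addr0|].
    by move=> a _ _ ->; rewrite mulr0.
  rewrite mulr0; apply: (nakayama nO hI h0) => // {Iz}z Iz.
  have [a fa e] := sub z Iz; exists 0, x, a; split=> //; last by rewrite add0r.
  by apply: sat => //; rewrite -e.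
pose ord z n := exists u c a, [/\ V u c, c != 0, fin a & z = u * y ^+ n + x * a].
have exn : exists n, `[< exists2 z, I z & ord z n >].
  have [z0 [Iz0 nz0]] : exists z, I z /\ ~ mulO x z.
    by apply: contrapT => h; apply: nsub => z Iz; apply: contrapT => nz; apply: h; exists z.
  have [n [u [c [a h]]]] := order_mod pxy (oi_fin hI Iz0) nz0.
  by exists n; apply/asboolP; exists z0 => //; exists u, c, a.
case: (ex_minnP exn) => n /asboolP [f If [u [c [a [Vu c0 fa ef]]]]] minn.
exists f => //.
have ff := oi_fin hI If.
have hJ := mulO_ideal ff.
suff h : forall z, I z -> mulO f z.
  by move=> z /h [b fb ->]; exists b => //; rewrite mulrC.
apply: (nakayama nO hI hJ) => z Iz.
have key b : fin b -> mulO x (z - f * b) ->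
    exists j m w, [/\ mulO f j, V m 0, I w & z = j + m * w].
  move=> fb [d fd e]; exists (f * b), x, d; split=> //; first by exists b.
    apply: sat => //; rewrite -e; apply: oiB => //; rewrite mulrC; exact: (oiM hI).
  by rewrite -e; ring.
have [hz|hz] := EM (mulO x z).
  by apply: (key 0); [apply: fin0|rewrite mulr0 subr0].
have [n' [u' [c' [a' [Vu' c'0 fa' ez]]]]] := order_mod pxy (oi_fin hI Iz) hz.
have nn' : (n <= n')%N.
  by apply: minn; apply/asboolP; exists z => //; exists u', c', a'.
have fui := unit_fin Vu c0.
have u0 := unit_neq0 Vu c0.
have fy m := finX m (max_fin Vy).
have fb : fin (u' / u * y ^+ (n' - n)).
  by apply: finM => //; apply: finM => //; exists c'.
apply: (key _ fb); exists (a' - a * (u' / u * y ^+ (n' - n))).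
  by apply: finB => //; apply: finM.
rewrite ez ef.
have -> : y ^+ n' = y ^+ (n' - n) * y ^+ n by rewrite -exprD subnK.
by field.
Qed.

Section Tuples.
Variable (n : nat).
Implicit Types (h c : 'I_n -> K).

Definition inspan c z := exists a, (forall i, fin (a i)) /\ z = \sum_i a i * c i.

Lemma inspan_trans c c' z : (forall i, inspan c' (c i)) -> inspan c z -> inspan c' z.
Proof.
move=> hc [a [fa ->]]; have /choice [b hb] := hc.
exists (fun j => \sum_i a i * b i j); split.
  by move=> j; apply: fin_sum => i _; apply: finM => //; have [] := hb i.
under [RHS]eq_bigr => j _ do rewrite mulr_suml.
rewrite exchange_big; apply: eq_bigr => i _ /=.
have [_ e] := hb i; rewrite {1}e mulr_sumr; apply: eq_bigr => j _; by rewrite mulrA.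
Qed.

Lemma inspanM c z a : fin a -> inspan c z -> inspan c (a * z).
Proof.
move=> fa [b [fb ->]]; exists (fun i => a * b i); split; first by move=> i; apply: finM.
by rewrite mulr_sumr; apply: eq_bigr => i _; rewrite mulrA.
Qed.

Lemma inspanD c z w : inspan c z -> inspan c w -> inspan c (z + w).
Proof.
move=> [a [fa ->]] [b [fb ->]]; exists (fun i => a i + b i); split.
  by move=> i; apply: finD.
by rewrite -big_split; apply: eq_bigr => i _; rewrite mulrDl.
Qed.

Lemma inspan_mem c i : inspan c (c i).
Proof.
exists (fun j => (j == i)%:R); split.
  by move=> j; case: eqP => _; [apply: fin1|apply: fin0].
rewrite (bigD1 i) //= eqxx mul1r big1 ?addr0 // => j /negPf ->; by rewrite mul0r.
Qed.

(** The elements that some power of [x] carries into the ideal of the [h i] form an ideal saturated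
    at [x], hence a principal one. Its generator is a gcd up to powers of [x]. *)
Lemma partial_gcd x y h : params x y -> (forall i, fin (h i)) -> (exists i, h i != 0) ->
  exists g c, [/\ g != 0 /\ fin g, forall i, fin (c i), forall i, h i = g * c i &
    exists N, inspan c (x ^+ N)].
Proof.
move=> pxy fh [i0 hi0]; have [Vx Vy hM] := pxy; have fx := max_fin Vx.
pose I z := fin z /\ exists N, inspan h (x ^+ N * z).
have hI : oideal I.
  split.
  - by move=> a [].
  - split; [exact: fin0|exists 0%N; rewrite mulr0; exists (fun=> 0)].
    split; first by move=> _; apply: fin0.
    by rewrite big1 // => i _; rewrite mul0r.
  - move=> a b [fa [N ha]] [fb [M hb]]; split; first exact: finD.
    exists (M + N)%N; have -> : x ^+ (M + N) * (a + b) = x ^+ M * (x ^+ N * a) + x ^+ N * (x ^+ M * b).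
      by rewrite exprD; ring.
    by apply: inspanD; apply: inspanM => //; apply: finX.
  - move=> a b fa [fb [N hb]]; split; first exact: finM.
    by exists N; rewrite mulrCA; apply: inspanM.
have Ih i : I (h i).
  by split=> //; exists 0%N; rewrite expr0 mul1r; apply: inspan_mem.
have [c fc|f If hf] := saturated_principal pxy hI.
  by move=> [_ [N hN]]; split=> //; exists N.+1; rewrite exprSr -mulrA.
have /choice [c hc] : forall i, exists b : K, fin b /\ h i = f * b.
  by move=> i; have [a fa e] := hf _ (Ih i); exists a; split=> //; rewrite mulrC.
have f0 : f != 0 by apply: contraNneq hi0 => f0; have [_ ->] := hc i0; rewrite f0 mul0r.
have ff := oi_fin hI If.
exists f, c; split=> //; [by move=> i; have [] := hc i|by move=> i; have [] := hc i|].
have [_ [N [a [fa e]]]] := If.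
exists N, a; split=> //; apply: (mulIf f0); rewrite e mulr_suml.
by apply: eq_bigr => i _; have [_ ->] := hc i; ring.
Qed.

(** Coprimality in dimension two: for parameters [x] and [y] the ideal of the [c i] contains a power
    of the maximal ideal, without having to be the unit ideal. *)
Definition primitive x y c := (forall i, fin (c i)) /\
  exists N, inspan c (x ^+ N) /\ inspan c (y ^+ N).

(** This takes the place of unique factorization in a regular local ring. Denominators are cleared,
    and then common factors are removed up to powers of [x] and up to powers of [y] in turn. *)
Lemma gcd_exists x y h : fracs -> params x y -> (exists i, h i != 0) ->
  exists g c, [/\ g != 0, forall i, h i = g * c i & primitive x y c].
Proof.
move=> hF pxy [i0 hi0]; have [Vx Vy hM] := pxy.
have fx := max_fin Vx; have fy := max_fin Vy.
have [d d0 fd] : exists2 d, d != 0 & forall i, fin (d * h i).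
  have /choice [d hd] : forall i, exists d, [/\ d != 0, fin d & fin (d * h i)].
    by move=> i; have [d d0 [h1 h2]] := hF (h i); exists d.
  exists (\prod_i d i); first by apply/prodf_neq0 => i _; have [] := hd i.
  move=> i; rewrite (bigD1 i) //= mulrAC mulrC; apply: finM; last by have [] := hd i.
  by apply: fin_prod => j _; have [] := hd j.
have [|g [c [[g0 fg] fc hc [N hN]]]] := partial_gcd pxy fd.
  by exists i0; rewrite mulf_neq0.
have [|g' [c' [[g'0 fg'] fc' hc' [N' hN']]]] := partial_gcd (paramsC pxy) fc.
  exists i0; apply: contraNneq hi0 => ci; move: (hc i0); rewrite ci mulr0 => /eqP.
  by rewrite mulf_eq0 (negPf d0) orFb.
have fX z m : fin z -> fin (z ^+ m) by apply: finX.
exists (g * g' / d), c'; split.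
- by rewrite !mulf_neq0 // invr_eq0.
- move=> i; apply: (mulfI d0); rewrite hc hc'; by field.
- split=> //; exists (N + N')%N; split.
    rewrite addnC exprD; apply: inspanM; first exact: fX.
    apply: inspan_trans hN => i; rewrite hc'; apply: inspanM => //; exact: inspan_mem.
  by rewrite exprD; apply: inspanM => //; apply: fX.
Qed.

End Tuples.

(** The algebraic form of extension across the closed point. *)
Definition depth2 x y := forall w n, fin (x ^+ n * w) -> fin (y ^+ n * w) -> fin w.

(** [y] is a nonzerodivisor modulo [x]: outside xO every element is, modulo [x], a unit times a
    power of [y], and no power of [y] lies in xO. *)
Lemma depth2_of_dim x y : params x y -> x != 0 ->
  (forall n, ~ mulO x (y ^+ n)) -> depth2 x y.
Proof.
move=> pxy x0 dim; have [Vx Vy hM] := pxy; have fx := max_fin Vx; have fy := max_fin Vy.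
have reg a m : fin a -> mulO x (y ^+ m * a) -> mulO x a.
  move=> fa [b fb e]; apply: contrapT => na.
  have [n [u [c [d [Vu c0 fd ea]]]]] := order_mod pxy fa na.
  have u0 := unit_neq0 Vu c0.
  apply: (dim (m + n)%N); exists (u^-1 * (b - y ^+ m * d)).
    apply: finM; first exact: unit_fin Vu c0.
    by apply: finB => //; apply: finM => //; apply: finX.
  rewrite exprD.
  have -> : y ^+ m * y ^+ n = u^-1 * (y ^+ m * a - y ^+ m * (x * d)).
    by rewrite ea; field.
  by rewrite e; ring.
move=> w n hx hy; have : forall m, fin (x ^+ m * w) -> fin w.
  elim=> [|m IH]; first by rewrite expr0 mul1r.
  rewrite exprS -mulrA => h; apply: IH.
  have [|a fa e] := reg _ n h; last by rewrite (mulfI x0 e).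
  exists (x ^+ m * (y ^+ n * w)); last by ring.
  by apply: finM => //; apply: finX.
by move=> /(_ n hx).
Qed.

Lemma primitive_fin n x y (c : 'I_n -> K) w : params x y -> depth2 x y ->
  primitive x y c -> (forall i, fin (w * c i)) -> fin w.
Proof.
move=> pxy dp [fc [N [[a [fa ea]] [b [fb eb]]]]] hw; apply: (dp w N).
  rewrite ea mulr_suml; apply: fin_sum => i _; rewrite -mulrA; apply: finM => //.
  by rewrite mulrC.
rewrite eb mulr_suml; apply: fin_sum => i _; rewrite -mulrA; apply: finM => //.
by rewrite mulrC.
Qed.

(** Write [f = c1 / c0] with coprime terms. The relation puts [c1^n] in the ideal of [c0], and with
    it the [n]-th power of every element of the ideal of [c0] and [c1], in particular powers of both
    parameters. By [depth2] the inverse of [c0] is then regular. *)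
Lemma normal x y f : fracs -> params x y -> depth2 x y ->
  f = 0 \/ (exists (p : {poly K}) (q : {poly k}),
    [/\ forall i, V p`_i q`_i, p.[f^-1] = 0 & q`_0 != 0]) -> fin f.
Proof.
move=> hF pxy dp [->|[p [q [hp e q0]]]]; first exact: fin0.
have [->|f0] := eqVneq f 0; first exact: fin0.
pose h (i : 'I_2) := if i == ord0 then 1 else f.
have [|g [c [g0 hc pc]]] := @gcd_exists 2 x y h hF pxy.
  by exists ord0; rewrite /h eqxx oner_neq0.
have [fc [N [hx hy]]] := pc.
have e0 : 1 = g * c ord0 by rewrite -hc.
have e1 : f = g * c (lift ord0 ord0) by rewrite -hc.
set c0 := c ord0 in e0; set c1 := c (lift ord0 ord0) in e1.
have c00 : c0 != 0 by apply/eqP => h0; move: e0 => /eqP; rewrite h0 mulr0 oner_eq0.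
have fi : f^-1 = c0 / c1.
  have -> : c0 / c1 = (g * c0) / (g * c1).
    by rewrite invfM mulrACA mulfV // mul1r.
  by rewrite -e0 -e1 div1r.
have c10 : c1 != 0 by apply/eqP => h1; move/eqP: e1; rewrite h1 mulr0 (negPf f0).
have fc0 : fin c0 by apply: fc.
have fc1 : fin c1 by apply: fc.
have [m en] : exists m, size p = m.+1.
  exists (size p).-1; rewrite prednK // size_poly_gt0; apply: contraNneq q0 => p0.
  by have := hp 0%N; rewrite p0 coef0 => /(hrel0P hV) ->.
pose n := m.+1.
have fp i : fin p`_i by exists q`_i.
have c1n : mulO c0 (c1 ^+ n).
  have p0 : p`_0 != 0 by apply: unit_neq0 (hp 0%N) q0.
  have : p.[f^-1] * c1 ^+ n = 0 by rewrite e mul0r.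
  rewrite horner_coef mulr_suml en big_ord_recl /= expr0 mulr1 => /eqP.
  rewrite addr_eq0 => /eqP es.
  exists (- (p`_0)^-1 * \sum_(i < m) p`_(i.+1) * c0 ^+ i * c1 ^+ (m - i)).
    apply: finM; first by apply: finN; apply: unit_fin (hp 0%N) q0.
    by apply: fin_sum => i _; apply: finM; [apply: finM => //; apply: finX|apply: finX].
  apply: (mulfI p0); set S := \sum_(i < m) _.
  have -> : p`_0 * (c0 * (- (p`_0)^-1 * S)) = - (c0 * S) by field.
  rewrite es /S mulr_sumr; congr (- _); apply: eq_bigr => i _.
  rewrite fi /bump /= add1n expr_div_n.
  have -> : c1 ^+ n = c1 ^+ (m - i) * c1 ^+ i.+1.
    by rewrite -exprD /n; congr (_ ^+ _); have := ltn_ord i; lia.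
  rewrite (exprS c0); field; by rewrite expf_neq0.
have hi z : inspan c z -> fin (z ^+ n * c0^-1).
  move=> [a [fa ->]]; rewrite big_ord_recl big_ord_recl big_ord0 addr0.
  rewrite -/c0 -/c1 exprDn mulr_suml; apply: fin_sum => i _.
  rewrite mulrnAl -mulr_natr; apply: finM; last first.
    by elim: ('C(n, i))%N => [|l IH]; rewrite ?mulr0n ?mulrS; [apply: fin0|apply: finD; [apply: fin1|]].
  case: (ltnP i n) => hin.
    have -> : (n - i = (n - i).-1.+1)%N by rewrite prednK // subn_gt0.
    rewrite exprS.
    rewrite (_ : _ / c0 = a ord0 * (a ord0 * c0) ^+ (n - i).-1 * (a (lift ord0 ord0) * c1) ^+ i); last by field.
    by apply: finM; [apply: finM => //; apply: finX; apply: finM|apply: finX; apply: finM].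
  have -> : (nat_of_ord i = n)%N by apply/eqP; rewrite eqn_leq hin -ltnS ltn_ord.
  rewrite subnn expr0 mul1r exprMn; have [b fb ->] := c1n.
  rewrite (_ : _ / c0 = a (lift ord0 ord0) ^+ n * b); last by field.
  by apply: finM => //; apply: finX.
have fic0 : fin c0^-1.
  apply: (dp _ (N * n)%N); rewrite exprM; exact: hi.
by rewrite -(invrK f) fi invf_div; apply: finM.
Qed.

End Params.
End LocalRing.

(** * Fraction fields and algebraic dependence *)

Lemma frac_sub (F : fieldType) (a b c d : F) : b != 0 -> d != 0 ->
  a / b - c / d = (a * d - c * b) / (b * d).
Proof. by move=> b0 d0; field; rewrite ?b0 ?d0. Qed.

Lemma frac_mul (F : fieldType) (a b c d : F) : a / b * (c / d) = (a * c) / (b * d).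
Proof. by rewrite mulrACA -invfM. Qed.

Lemma frac_cancel (F : fieldType) (a b c : F) : a != 0 -> b * c = a * b * (c / a).
Proof. by move=> a0; field. Qed.

Section FractionHom.
Variables (R : idomainType) (K : fieldType) (phi : {rmorphism R -> K}).
Hypothesis phi_inj : forall r, phi r = 0 -> r = 0.

Lemma fractionP (x : {fraction R}) : exists n d, d != 0 /\ x = tofrac n / tofrac d.
Proof.
elim/quotW: x => r; exists (\n_r)%R, (\d_r)%R; split; first exact: denom_ratioP.
have d0 := denom_ratioP r.
apply: (canRL (mulfK _)); first by rewrite tofrac_eq0.
unlock FracField.tofrac; rewrite -[LHS]FracField.pi_mul; apply/eqmodP => /=.
rewrite /FracField.mulf /= !numden_Ratio ?oner_neq0 ?mulr1 ?mulf_neq0 ?oner_neq0 //.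
by rewrite FracField.equivfE !numden_Ratio ?oner_neq0 ?mulf_neq0 ?oner_neq0 ?mulr1 // mulrC.
Qed.

Lemma fraction_hom : exists Phi : {rmorphism {fraction R} -> K},
  forall r, Phi (tofrac r) = phi r.
Proof.
have phi0 d : d != 0 -> phi d != 0.
  by apply: contraNneq => /phi_inj ->.
have /choice [n /choice [d hnd]] := fractionP.
have d0 x : d x != 0 by have [] := hnd x.
have ex x : x = tofrac (n x) / tofrac (d x) by have [] := hnd x.
pose F x := phi (n x) / phi (d x).
have FE x m e : e != 0 -> x = tofrac m / tofrac e -> F x = phi m / phi e.
  move=> e0; rewrite {1}(ex x) => /eqP; rewrite eqr_div ?tofrac_eq0 //.
  rewrite -!tofracM tofrac_eq => /eqP h; rewrite /F; apply/eqP.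
  by rewrite eqr_div ?phi0 // -!rmorphM h.
have addF : zmod_morphism F.
  move=> x y; rewrite (FE (x - y) (n x * d y - n y * d x) (d x * d y)) ?mulf_neq0 //.
    by rewrite /F rmorphB !rmorphM frac_sub ?phi0.
  by rewrite {1}(ex x) {1}(ex y) tofracB !tofracM frac_sub // tofrac_eq0.
have mulF : monoid_morphism F.
  split; first by rewrite (FE 1 1 1) ?oner_neq0 ?rmorph1 ?divr1 // tofrac1 divr1.
  move=> x y; rewrite (FE (x * y) (n x * n y) (d x * d y)) ?mulf_neq0 //.
    by rewrite /F !rmorphM frac_mul.
  by rewrite {1}(ex x) {1}(ex y) !tofracM frac_mul.
pose Phi : {rmorphism {fraction R} -> K} := HB.pack F
  (GRing.isZmodMorphism.Build _ _ F addF) (GRing.isMonoidMorphism.Build _ _ F mulF).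
exists Phi => r /=; rewrite (FE _ r 1) ?oner_neq0 ?rmorph1 ?divr1 // tofrac1 divr1 //.
Qed.

End FractionHom.

Section AlgebraicDependence.
Variables (k K : fieldType) (io : {rmorphism k -> K}).

(** The inner variable is evaluated at [f], the outer one at [g]. *)
Definition ev2 (f g : K) : {rmorphism {poly {poly k}} -> K} := evp (evp io f) g.

Definition algdep f g := exists2 p : {poly {poly k}}, p != 0 & ev2 f g p = 0.

Lemma algdep_const f g : algebraicOver io f -> algdep f g.
Proof.
move=> [p p0 rp]; exists p%:P; first by rewrite polyC_eq0.
rewrite /ev2 evpC evpE; exact/eqP.
Qed.

Lemma swap_poly (p : {poly {poly k}}) : p != 0 ->
  exists2 q : {poly {poly k}}, q != 0 & forall f g, ev2 g f q = ev2 f g p.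
Proof.
move=> p0; exists (swapXY p); first by rewrite swapXY_eq0.
move=> f g; rewrite /ev2 !evpE.
have E (r : {poly {poly k}}) u v : (map_poly (evp io u) r).[v] =
    (map_poly (map_poly io) r).[v%:P].[u].
  have -> : map_poly (evp io u) r = map_poly (horner_eval u) (map_poly (map_poly io) r).
    by rewrite -map_poly_comp; apply: eq_map_poly => s /=; rewrite evpE.
  have e : v = horner_eval u v%:P by rewrite /horner_eval hornerC.
  by rewrite {1}e horner_map.
by rewrite E E -swapXY_map horner2_swapXY.
Qed.

Lemma algdep_sym f g : algdep f g -> algdep g f.
Proof.
by move=> [p /swap_poly [q q0 e] hp]; exists q; rewrite ?e.
Qed.

Lemma transcendental_inj u : ~ algebraicOver io u -> forall r, evp io u r = 0 -> r = 0.
Proof.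
move=> nu r hr; apply: contrapT => r0; apply: nu; exists r; first exact/eqP.
by apply/eqP; rewrite -evpE.
Qed.

Section FractionField.
Variables (u : K) (Pu : {rmorphism {fraction {poly k}} -> K}).
Hypothesis hP : forall r, Pu (tofrac r) = evp io u r.

Lemma algdep_algebraic w : algdep u w -> algebraicOver Pu w.
Proof.
move=> [p p0 e]; exists (map_poly (@tofrac _) p).
  by rewrite map_poly_eq0_id0 // tofrac_eq0 lead_coef_eq0.
apply/eqP; rewrite -map_poly_comp -[RHS]e /ev2 evpE; congr _.[_].
by apply: eq_map_poly => r /=.
Qed.

Lemma algebraic_algdep w : algebraicOver Pu w -> algdep u w.
Proof.
move=> [p p0 e].
have [q [c [q0 c0 eq]]] : exists (q : {poly {poly k}}) c, [/\ q != 0, c != 0 &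
    map_poly (@tofrac _) q = c *: p].
  have /choice [n /choice [d hnd]] := @fractionP {poly k}.
  pose D := \prod_(i < size p) d p`_i.
  have D0 : D != 0 by apply/prodf_neq0 => i _; have [] := hnd p`_i.
  have /choice [m hm] : forall i, exists m, tofrac m = tofrac D * p`_i.
    move=> i; case: (ltnP i (size p)) => hi; last first.
      by exists 0; rewrite (nth_default _ hi) mulr0 tofrac0.
    exists (\prod_(j < size p | j != Ordinal hi) d p`_j * n p`_i).
    have -> : D = d p`_i * \prod_(j < size p | j != Ordinal hi) d p`_j.
      by rewrite /D (bigD1 (Ordinal hi)).
    rewrite !tofracM.
    have [d0 ei] := hnd p`_i; rewrite [X in _ = _ * X]ei.
    by apply: frac_cancel; rewrite tofrac_eq0.
  exists (\poly_(i < size p) m i), (tofrac D).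
  have E : map_poly (@tofrac _) (\poly_(i < size p) m i) = tofrac D *: p.
    apply/polyP => i; rewrite coef_map /= coef_poly coefZ; case: ltnP => hi; rewrite ?hm //.
    by rewrite tofrac0 nth_default // mulr0.
  split=> //; last by rewrite tofrac_eq0.
  apply/eqP => q0; move: E; rewrite q0 rmorph0 => /eqP; rewrite eq_sym scaler_eq0 tofrac_eq0.
  by rewrite (negPf D0) (negPf p0).
exists q => //; rewrite /ev2 evpE.
have -> : map_poly (evp io u) q = map_poly Pu (map_poly (@tofrac _) q).
  by rewrite -map_poly_comp; apply: eq_map_poly => r /=.
rewrite eq -mul_polyC rmorphM hornerM; move/eqP: e => ->; exact: mulr0.
Qed.

End FractionField.

(* Steinitz exchange in transcendence degree one. *)
Lemma algdep_trans t f g : ~ algebraicOver io t -> algdep t f -> algdep t g -> algdep f g.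
Proof.
move=> nt tf tg.
have [af|nf] := EM (algebraicOver io f); first exact: algdep_const.
have [Pf hPf] := fraction_hom (transcendental_inj nf).
have [Pt hPt] := fraction_hom (transcendental_inj nt).
have tF : integralOver Pf t.
  by apply/integral_algebraic; apply: algdep_algebraic hPf _ (algdep_sym tf).
have ctF r : integralOver Pf (evp io t r).
  rewrite evpE; apply: integral_horner tF; apply/integral_poly => i; rewrite coef_map /=.
  have -> : io r`_i = Pf (tofrac (r`_i)%:P) by rewrite hPf evpC.
  exact: integral_id.
have gF : integralOver Pf g.
  have [p p0 e] : algebraicOver Pt g by apply: algdep_algebraic hPt _ tg.
  apply: (@integral_root _ _ _ (map_poly Pt p)) => //; first by rewrite map_poly_eq0.
  apply/integral_poly => i; rewrite coef_map /=.
  have [n [d [d0 ->]]] := fractionP p`_i.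
  by rewrite fmorph_div !hPt; apply: integral_div; apply: ctF.
by apply: algebraic_algdep hPf _ _; apply/integral_algebraic.
Qed.

End AlgebraicDependence.

(** * Noether normalization *)

Lemma nat_nonroot (p : {poly int}) : p != 0 -> exists T : nat, (0 < T)%N /\ p.[T%:Z] != 0.
Proof.
move=> p0; apply: contrapT => ne.
have hall : all (root p) [seq (i%:Z) | i <- iota 1 (size p)].
  apply/allP => z /mapP [i]; rewrite mem_iota => /andP [i0 _] ->.
  by apply/eqP; apply: contrapT => /eqP h; apply: ne; exists i.
have huniq : uniq [seq (i%:Z) | i <- iota 1 (size p)].
  by rewrite map_inj_uniq ?iota_uniq // => i j [].
by have := max_poly_roots p0 hall huniq; rewrite size_map size_iota ltnn.
Qed.

Lemma seq_argmax (T : eqType) (s : seq T) (W : T -> nat) : s != [::] ->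
  exists2 x, x \in s & forall y, y \in s -> (W y <= W x)%N.
Proof.
elim: s => // a [|b s] IH _.
  by exists a; rewrite ?mem_head // => y; rewrite inE => /eqP ->.
have [//|x xs hx] := IH; case: (leqP (W x) (W a)) => h.
  exists a; first exact: mem_head.
  by move=> y; rewrite inE => /orP [/eqP ->|/hx /leq_trans -> //].
exists x; first by rewrite inE xs orbT.
by move=> y; rewrite inE => /orP [/eqP ->|/hx //]; apply: ltnW.
Qed.

Section IntegralPolys.
Variables (R : comNzRingType) (K : fieldType) (f : {rmorphism R -> K}).
Definition ipoly (p : {poly K}) := forall i, integralOver f p`_i.

Lemma ipolyD p q : ipoly p -> ipoly q -> ipoly (p + q).
Proof. by move=> hp hq i; rewrite coefD; apply: integral_add. Qed.

Lemma integral_sum (J : Type) (r : seq J) (F : J -> K) :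
  (forall i, integralOver f (F i)) -> integralOver f (\sum_(i <- r) F i).
Proof. by move=> h; elim/big_ind: _ => //; [apply: integral0|apply: integral_add]. Qed.

Lemma ipolyM p q : ipoly p -> ipoly q -> ipoly (p * q).
Proof.
by move=> hp hq i; rewrite coefM; apply: integral_sum => j; apply: integral_mul.
Qed.

Lemma ipolyC c : integralOver f c -> ipoly c%:P.
Proof. by move=> h i; rewrite coefC; case: eqP => // _; apply: integral0. Qed.

Lemma ipolyXn n : ipoly 'X^n.
Proof. by move=> i; rewrite coefXn; case: eqP => // _; [apply: integral1|apply: integral0]. Qed.

Lemma ipolyX p n : ipoly p -> ipoly (p ^+ n).
Proof.
move=> h; elim: n => [|n IH]; first by rewrite expr0; apply: ipolyC; apply: integral1.
by rewrite exprS; apply: ipolyM.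
Qed.

Lemma integral_exp z n : integralOver f z -> integralOver f (z ^+ n).
Proof.
move=> h; elim: n => [|n IH]; first by rewrite expr0; apply: integral1.
by rewrite exprS; apply: integral_mul.
Qed.

End IntegralPolys.

Section Noether.
Variables (k K : fieldType) (io : {rmorphism k -> K}).

Definition inalg n (a : 'I_n -> K) z := exists F, z = mmap io a F.

Definition algindep n (a : 'I_n -> K) := forall F, mmap io a F = 0 -> F = 0.

Lemma integral_mmap n d (a : 'I_n -> K) (f : {rmorphism {mpoly k[d]} -> K}) F :
  (forall c, integralOver f (io c)) -> (forall i, integralOver f (a i)) ->
  integralOver f (mmap io a F).
Proof.
move=> hc ha; rewrite /mmap; apply: integral_sum => m; apply: integral_mul => //.
rewrite /mmap1; elim/big_ind: _ => //; [exact: integral1|exact: integral_mul|].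
by move=> i _; apply: integral_exp.
Qed.

Lemma integral_scalar d (t : 'I_d -> K) c : integralOver (mmap io t) (io c).
Proof. by rewrite -(mmapC t io c); apply: integral_id. Qed.

(** Nagata's substitution, valid over every field: [a (lift ord0 j)] gives way to its difference
    with [a ord0 ^+ (T ^ j.+1)]. For suitable [T] the monomials of a relation [F] then have distinct
    degrees in [a ord0], so [F] is monic in [a ord0] up to a scalar. *)
Lemma noether_normalization n (a : 'I_n -> K) : exists d (t : 'I_d -> K),
  [/\ algindep t, forall j, inalg a (t j) & forall i, integralOver (mmap io t) (a i)].
Proof.
elim: n a => [|n IH] a.
  exists 0%N, a; split; [|by case|by case].
  move=> F; rewrite (nvar0_mpolyC F) mmapC => /eqP; rewrite fmorph_eq0 => /eqP ->.
  by rewrite mpolyC0.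
have [ind|/existsNP [F /not_implyP [F0 /eqP nF]]] := EM (algindep a).
  exists n.+1, a; split=> // i; first by exists 'X_i; rewrite mmapX mmap1U.
  by rewrite -[a i](mmap1U a i) -(mmapX a io); apply: integral_id.
pose P (m : 'X_{1..n.+1}) : {poly int} := \poly_(i < n.+1) (m (inord i))%:Z.
have Pinj m m' : P m = P m' -> m = m'.
  move=> e; apply/mnmP => i; have := congr1 (fun p : {poly int} => p`_i) e.
  by rewrite !coef_poly ltn_ord inord_val => -[].
(* The weight [W m] is the value at [T] of the polynomial [P m] whose coefficients are the
   exponents. A nonroot [T] of the product of all differences keeps the weights of distinct
   monomials apart. *)
pose Q : {poly int} := \prod_(m <- msupp F) \prod_(m' <- msupp F | m != m') (P m - P m').
have [T [T0 QT]] : exists T : nat, (0 < T)%N /\ Q.[T%:Z] != 0.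
  apply: nat_nonroot; rewrite /Q prodf_seq_neq0; apply/allP => m _ /=.
  rewrite prodf_seq_neq0; apply/allP => m' _; apply/implyP => mm.
  by rewrite subr_eq0; apply: contra mm => /eqP /Pinj ->.
pose W (m : 'X_{1..n.+1}) := (\sum_(i < n.+1) m i * T ^ i)%N.
have PW m : (P m).[T%:Z] = (W m)%:Z.
  rewrite horner_poly /W (big_morph Posz PoszD (erefl _)); apply: eq_bigr => i _.
  by rewrite inord_val PoszM; congr (_ * _); rewrite -!natz natrX.
pose b (j : 'I_n) := a (lift ord0 j) - a ord0 ^+ (T ^ j.+1).
have [d [t [ind hin hint]]] := IH b.
have ib (F' : {mpoly k[n]}) : inalg a (mmap io b F').
  exists (mmap (@mpolyC _ _) (fun j => 'X_(lift ord0 j) - 'X_ord0 ^+ (T ^ j.+1)) F').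
  rewrite rmorph_mmap; apply: eq_mmap => [c|j] /=; first by rewrite mmapC.
  by rewrite rmorphB rmorphXn /= !mmapX !mmap1U.
exists d, t; split=> //.
  by move=> j; have [G ->] := hin j; apply: ib.
(* [a i] written as a polynomial in [a ord0], monic of degree [T ^ i], over the ring of the
   [b j]. *)
pose q (i : 'I_n.+1) : {poly K} :=
  if unlift ord0 i is Some j then (b j)%:P + 'X^(T ^ j.+1) else 'X.
have qev i : (q i).[a ord0] = a i.
  rewrite /q; case: unliftP => [j ->|->]; last by rewrite hornerX.
  by rewrite hornerD hornerC hornerXn /b subrK.
have Ti i : (0 < T ^ i)%N by rewrite expn_gt0 T0.
have sizeq i : size (q i) = (T ^ i).+1.
  rewrite /q; case: unliftP => [j ->|->]; last by rewrite size_polyX expn0.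
  rewrite addrC size_polyDl size_polyXn ?lift0 //.
  by apply: leq_ltn_trans (size_polyC_leq1 _) _; rewrite ltnS.
have monq i : q i \is monic.
  rewrite /q; case: unliftP => [j _|_]; last exact: monicX.
  rewrite monicE addrC lead_coefDl ?lead_coefXn //.
  by rewrite size_polyXn; apply: leq_ltn_trans (size_polyC_leq1 _) _; rewrite ltnS.
have monM m : mmap1 q m \is monic.
  by rewrite /mmap1; apply: monic_prod => i _; apply: monic_exp.
have sizeM m : size (mmap1 q m) = (W m).+1.
  have : (size (mmap1 q m)).-1 = W m.
    rewrite /mmap1 /W; elim: (index_enum _) => [|i r IHr].
      by rewrite !big_nil size_poly1.
    rewrite !big_cons size_mul ?monic_neq0 //; last first.
    - by apply: monic_prod => j _; apply: monic_exp.
    - exact: monic_exp.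
    have /eqP := size_exp (q i) (m i); rewrite sizeq /= mulnC => /eqP e1.
    have s1 : (0 < size (q i ^+ m i)%R)%N by rewrite size_poly_gt0 monic_neq0 // monic_exp.
    have s2 : (0 < size (\prod_(j <- r) q j ^+ m j)%R)%N.
      by rewrite size_poly_gt0 monic_neq0 //; apply: monic_prod => j _; apply: monic_exp.
    rewrite -IHr -e1; move: s1 s2; case: (size _) => // s1; case: (size _) => // s2 _ _.
    by rewrite addnS addSn.
  by move=> <-; rewrite prednK // size_poly_gt0 monic_neq0.
pose p : {poly K} := mmap (polyC \o io) q F.
have p_root : p.[a ord0] = 0.
  rewrite -[LHS]/(horner_eval (a ord0) p) rmorph_mmap -[RHS]F0.
  by apply: eq_mmap => [c|i] /=; rewrite /horner_eval ?hornerC ?qev.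
have ep : p = \sum_(m <- msupp F) io F@_m *: mmap1 q m.
  by rewrite /p /mmap; apply: eq_bigr => m _; rewrite /= mul_polyC.
have [ms msF msmax] : exists2 m, m \in msupp F & forall m', m' \in msupp F -> (W m' <= W m)%N.
  by apply: seq_argmax; rewrite msupp_eq0.
have ltW m : m \in msupp F -> m != ms -> (W m < W ms)%N.
  move=> mF mm; rewrite ltn_neqAle msmax // andbT.
  apply: contraNneq QT => e; rewrite /Q (big_rem m) //= (big_rem ms) //= mm.
  by rewrite !hornerM hornerD hornerN !PW e subrr !mul0r.
have ptop : p`_(W ms) = io F@_ms.
  rewrite ep coef_sum (bigD1_seq ms) ?msupp_uniq //= coefZ.
  have -> : (mmap1 q ms)`_(W ms) = 1.
    by have /monicP := monM ms; rewrite lead_coefE sizeM.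
  rewrite mulr1 big_seq_cond big1 ?addr0 // => m /andP [mF mm].
  by rewrite coefZ nth_default ?mulr0 // sizeM ltW.
have F0m : io F@_ms != 0 by rewrite fmorph_eq0 -mcoeff_msupp.
have sizep : (size p <= (W ms).+1)%N.
  apply/leq_sizeP => i hi; rewrite ep coef_sum big_seq big1 // => m mF.
  rewrite coefZ nth_default ?mulr0 // sizeM; apply: leq_trans hi; rewrite ltnS; exact: msmax.
have szp : size p = (W ms).+1.
  apply/eqP; rewrite eqn_leq sizep ltnNge; apply/negP => /leq_sizeP /(_ _ (leqnn _)).
  by rewrite ptop => /eqP; rewrite (negPf F0m).
have ipp : ipoly (mmap io t) p.
  rewrite /p /mmap; elim/big_ind: _ => [|u v|m _].
  - by move=> i; rewrite coef0; apply: integral0.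
  - exact: ipolyD.
  - apply: ipolyM; first by apply: ipolyC; apply: integral_scalar.
    rewrite /mmap1; elim/big_ind: _ => [|u v|i _].
    + by apply: ipolyC; apply: integral1.
    + exact: ipolyM.
    + apply: ipolyX; rewrite /q; case: unliftP => [j _|_].
        by apply: ipolyD; [apply: ipolyC|apply: ipolyXn].
      by rewrite -['X]expr1; apply: ipolyXn.
have ia0 : integralOver (mmap io t) (a ord0).
  apply: (@integral_root_monic _ _ _ _ ((io F@_ms)^-1 *: p)).
  - by rewrite monicE lead_coefZ lead_coefE szp ptop mulVf.
  - by rewrite /root hornerZ p_root mulr0.
  - apply/integral_poly => i; rewrite coefZ; apply: integral_mul; last exact: ipp.
    by rewrite -fmorphV; apply: integral_scalar.
move=> i; have [j ->|->//] := unliftP ord0 i.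
have -> : a (lift ord0 j) = b j + a ord0 ^+ (T ^ j.+1) by rewrite subrK.
by apply: integral_add => //; apply: integral_exp.
Qed.
End Noether.

(* Leading monomials show that a fraction p/q all of whose powers have a common
   denominator s is a polynomial. *)
Lemma mpoly_completely_integrally_closed (k : fieldType) d (p q s : {mpoly k[d]}) :
  q != 0 -> s != 0 -> (forall n, exists w, s * p ^+ n = q ^+ n * w) ->
  exists a, p = q * a.
Proof.
move=> q0 s0; move: {-2}(mlead p) (erefl (mlead p)) => m; move: p.
elim/(well_founded_induction_type (@ltom_wf d)): m => m IH p em hp.
have [->|p0] := eqVneq p 0; first by exists 0; rewrite mulr0.
have dv : (mlead q <= mlead p)%MM.
  apply/mnm_lepP => i; pose n := (mlead s i).+1.
  have [w e] := hp n.
  have w0 : w != 0.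
    by apply: contra_eq_neq e => ->; rewrite mulr0 mulf_neq0 // expf_neq0.
  have := congr1 (fun r => mlead r i) e; rewrite !mleadM ?mleadX ?expf_neq0 //.
  rewrite !mnmDE !mulmnE => e'; rewrite leqNgt; apply/negP => lt.
  move: e' lt; rewrite /n; move: (mlead s i) (mlead p i) (mlead q i) (mlead w i).
  by move=> a1 a2 a3 a4; nia.
pose mu := (mleadc p / mleadc q) *: 'X_[(mlead p - mlead q)%MM] : {mpoly k[d]}.
have lq0 : mleadc q != 0 by rewrite mleadc_eq0.
have lp0 : mleadc p != 0 by rewrite mleadc_eq0.
have mu0 : mu != 0.
  apply/eqP => h; have := congr1 (fun r => r@_(mlead p - mlead q)%MM) h.
  rewrite mcoeffZ mcoeffX eqxx mulr1 mcoeff0 => /eqP.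
  by rewrite mulf_eq0 invr_eq0 (negPf lq0) (negPf lp0).
have lmu : mlead mu = (mlead p - mlead q)%MM.
  by rewrite mleadZ ?mulf_neq0 ?invr_eq0 // mleadXm.
have lmuq : mlead (mu * q) = mlead p by rewrite mleadM // lmu submK.
have cmuq : mleadc (mu * q) = mleadc p.
  by rewrite mleadcM_proper ?mulf_neq0 ?mleadc_eq0 // lmu mcoeffZ mcoeffX eqxx mulr1 divfK.
have [p'0|p'0] := eqVneq (p - mu * q) 0.
  by exists mu; rewrite mulrC; apply/eqP; rewrite -subr_eq0 p'0.
have lt' : (mlead (p - mu * q) < m)%O.
  rewrite em Order.POrderTheory.lt_neqAle; apply/andP; split.
    apply/eqP => h; have := p'0; rewrite -mleadc_eq0 h mcoeffB -{2}lmuq cmuq subrr eqxx //.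
  by apply: Order.POrderTheory.le_trans (mleadB_le _ _) _; rewrite lmuq Order.JoinTheory.joinxx.
have [n|a ea] := IH _ lt' (p - mu * q) erefl; last first.
  by exists (a + mu); rewrite mulrDr -ea [q * mu]mulrC subrK.
have /choice [w hw] := hp.
exists (\sum_(i < n.+1) ((-1) ^+ i * w (n - i)%N * mu ^+ i) *+ 'C(n, i)).
rewrite exprBn !mulr_sumr; apply: eq_bigr => i _.
rewrite !mulrnAr; congr (_ *+ _).
have -> : q ^+ n = q ^+ (n - i) * q ^+ i by rewrite -exprD subnK // -ltnS.
rewrite exprMn.
transitivity ((s * p ^+ (n - i)) * ((-1) ^+ i * (mu ^+ i * q ^+ i))); first by ring.
by rewrite hw; ring.
Qed.

(** * Norms of integral elements over a polynomial ring *)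

Section Determinants.
Variables (k K : fieldType) (d : nat) (f : {rmorphism {mpoly k[d]} -> K}).
Hypothesis f_inj : forall F, f F = 0 -> F = 0.

Definition inS z := exists F, z = f F.
Definition inF z := exists2 s, s != 0 & inS (f s * z).

Lemma inS1 : inS 1. Proof. by exists 1; rewrite rmorph1. Qed.
Lemma inS0 : inS 0. Proof. by exists 0; rewrite rmorph0. Qed.
Lemma inSD a b : inS a -> inS b -> inS (a + b).
Proof. by move=> [F ->] [G ->]; exists (F + G); rewrite rmorphD. Qed.
Lemma inSB a b : inS a -> inS b -> inS (a - b).
Proof. by move=> [F ->] [G ->]; exists (F - G); rewrite rmorphB. Qed.
Lemma inSM a b : inS a -> inS b -> inS (a * b).
Proof. by move=> [F ->] [G ->]; exists (F * G); rewrite rmorphM. Qed.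
Lemma inSX a n : inS a -> inS (a ^+ n).
Proof. by move=> [F ->]; exists (F ^+ n); rewrite rmorphXn. Qed.
Lemma inS_sum (J : Type) (r : seq J) F : (forall i, inS (F i)) -> inS (\sum_(i <- r) F i).
Proof. by move=> h; elim/big_ind: _ => //; [apply: inS0|apply: inSD]. Qed.
Lemma inS_prod (J : Type) (r : seq J) F : (forall i, inS (F i)) -> inS (\prod_(i <- r) F i).
Proof. by move=> h; elim/big_ind: _ => //; [apply: inS1|apply: inSM]. Qed.
Lemma inS_F a : inS a -> inF a.
Proof. by move=> h; exists 1; rewrite ?oner_neq0 // rmorph1 mul1r. Qed.
Lemma f0 s : s != 0 -> f s != 0.
Proof. by apply: contraNneq => /f_inj ->. Qed.
Lemma inFD a b : inF a -> inF b -> inF (a + b).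
Proof.
move=> [s s0 h] [t t0 h']; exists (s * t); first by rewrite mulf_neq0.
rewrite rmorphM (_ : _ * _ = f t * (f s * a) + f s * (f t * b)); last by ring.
by apply: inSD; apply: inSM => //; [exists t|exists s].
Qed.
Lemma inFM a b : inF a -> inF b -> inF (a * b).
Proof.
move=> [s s0 h] [t t0 h']; exists (s * t); first by rewrite mulf_neq0.
by rewrite rmorphM mulrACA; apply: inSM.
Qed.
Lemma inF_div a s : s != 0 -> inS a -> inF (a / f s).
Proof. by move=> s0 h; exists s => //; rewrite mulrC divfK ?f0. Qed.
Lemma inF_sum (J : Type) (r : seq J) F : (forall i, inF (F i)) -> inF (\sum_(i <- r) F i).
Proof. by move=> h; elim/big_ind: _ => //; [apply: inS_F; apply: inS0|apply: inFD]. Qed.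

Lemma common_denom n (g : 'I_n -> K) : (forall i, inF (g i)) ->
  exists2 s, s != 0 & forall i, inS (f s * g i).
Proof.
move=> hg; have /choice [s hs] : forall i, exists s, s != 0 /\ inS (f s * g i).
  by move=> i; have [s s0 h] := hg i; exists s.
exists (\prod_i s i); first by apply/prodf_neq0 => i _; have [] := hs i.
move=> i; rewrite (bigD1 i) //= rmorphM mulrAC; apply: inSM; first by have [] := hs i.
by exists (\prod_(j < n | j != i) s j).
Qed.

Variables (x : K) (e : nat).
Hypothesis indep : forall g : 'I_e.+1 -> K, (forall i, inF (g i)) ->
  \sum_i g i * x ^+ i = 0 -> forall i, g i = 0.

(** A matrix over the fraction field that has [xvec] as an eigenvector with eigenvalue [al]
    represents multiplication by [al] in the basis of powers of [x]; its determinant is the norm of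
    [al]. *)
Definition xvec : 'cV[K]_e.+1 := \col_i x ^+ i.

Lemma mx_eq0 (A : 'M[K]_e.+1) : (forall i j, inF (A i j)) -> A *m xvec = 0 -> A = 0.
Proof.
move=> hA h; apply/matrixP => i j; rewrite [RHS]mxE; apply: (indep (g := A i)) => //.
have : (A *m xvec) i ord0 = 0 by rewrite h mxE.
rewrite mxE => e0; rewrite -[RHS]e0; by apply: eq_bigr => l _; rewrite mxE.
Qed.

Lemma integral_powers al : integralOver f al -> exists E, forall n,
  exists g : 'I_E -> K, (forall l, inS (g l)) /\ al ^+ n = \sum_(l < E) g l * al ^+ l.
Proof.
move=> [p mp rp]; exists (size p) => n.
have := Pdiv.RingMonic.rdivp_eq mp 'X^n.
set r := Pdiv.Ring.rmodp _ _ => ep.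
exists (fun l => f r`_l); split; first by move=> l; exists r`_l.
have sr : (size (map_poly f r) <= size p)%N.
  apply: leq_trans (size_poly _ _) _; apply: ltnW.
  by rewrite Pdiv.Ring.ltn_rmodp monic_neq0.
have : (map_poly f 'X^n).[al] = al ^+ n by rewrite map_polyXn hornerXn.
rewrite ep rmorphD rmorphM hornerD hornerM (eqP rp) mulr0 add0r => <-.
rewrite (horner_coef_wide _ sr); apply: eq_bigr => l _; by rewrite coef_map.
Qed.

Lemma mx_pow A n al : A *m xvec = al *: xvec -> A ^+ n *m xvec = al ^+ n *: xvec.
Proof.
move=> h; elim: n => [|n IH]; first by rewrite !expr0 mul1mx scale1r.
by rewrite exprSr -[A ^+ n * A]/(A ^+ n *m A) -mulmxA h -scalemxAr IH scalerA exprS.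
Qed.

Lemma inF_pow (A : 'M[K]_e.+1) n : (forall i j, inF (A i j)) -> forall i j, inF ((A ^+ n) i j).
Proof.
move=> hA; elim: n => [|n IH] i j; last first.
  rewrite exprS mxE; apply: inF_sum => l; exact: inFM.
rewrite expr0 mxE; apply: inS_F; case: (i == j); [exact: inS1|exact: inS0].
Qed.

Lemma det_inS0 (A : 'M[K]_e.+1) : (forall i j, inS (A i j)) -> inS (\det A).
Proof.
move=> h; rewrite /determinant; apply: inS_sum => s; apply: inSM; last exact: inS_prod.
apply: inSX; exists (- 1); by rewrite rmorphN1.
Qed.

(** The norm of an integral element lies in the polynomial ring. The powers of [A] are combinations
    over that ring of finitely many of them, so they share a denominator [s]. Then [s^(e+1)] is a
    denominator for all powers of the determinant, and the ring is completely integrally closed. *)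
Lemma det_inS (A : 'M[K]_e.+1) al : (forall i j, inF (A i j)) ->
  A *m xvec = al *: xvec -> integralOver f al -> inS (\det A).
Proof.
move=> hA hv /integral_powers [E hE].
have [s s0 hs] : exists2 s, s != 0 & forall l : 'I_E, forall i j, inS (f s * (A ^+ l) i j).
  have [|s s0 hs] := @common_denom _ (fun u : 'I_(#|{: 'I_E * 'I_e.+1 * 'I_e.+1}|) =>
     let v := enum_val u in (A ^+ v.1.1) v.1.2 v.2).
    by move=> u /=; apply: inF_pow.
  exists s => // l i j; by have := hs (enum_rank (l, i, j)); rewrite enum_rankK.
have hpow n i j : inS (f s * (A ^+ n) i j).
  have [g [gS eg]] := hE n.
  have -> : A ^+ n = \sum_(l < E) g l *: A ^+ l.
    apply/eqP; rewrite -subr_eq0; apply/eqP; apply: mx_eq0.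
      move=> i' j'; rewrite !mxE -mulN1r; apply: inFD; first exact: inF_pow.
      apply: inFM; first by apply: inS_F; exists (- 1); rewrite rmorphN1.
      rewrite summxE; apply: inF_sum => l; rewrite mxE; apply: inFM; last exact: inF_pow.
      exact: inS_F.
    rewrite mulmxBl mulmx_suml (mx_pow n hv) eg scaler_suml -sumrB big1 // => l _.
    by rewrite -scalemxAl (mx_pow l hv) scalerA subrr.
  rewrite summxE mulr_sumr; apply: inS_sum => l.
  by rewrite mxE mulrCA; apply: inSM.
have hdet n : inS (f (s ^+ e.+1) * \det A ^+ n).
  have -> : f (s ^+ e.+1) * \det A ^+ n = \det (f s *: A ^+ n).
    rewrite detZ rmorphXn; congr (_ * _).
    by elim: n => [|n IHn]; rewrite ?expr0 ?det1 // !exprS IHn -[A * _]/(A *m _) det_mulmx.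
  by apply: det_inS0 => i j; rewrite mxE.
have : s ^+ e.+1 != 0 by rewrite expf_neq0.
move: (s ^+ e.+1) hdet => q hdet q0.
have [p ep] := hdet 1%N; rewrite expr1 in ep.
have [|a ea] := @mpoly_completely_integrally_closed k d p q q q0 q0.
  move=> n; have [w ew] := hdet n; exists w.
  apply/eqP; rewrite -subr_eq0; apply/eqP; apply: f_inj.
  by rewrite rmorphB !rmorphM !rmorphXn -ep -ew exprMn; ring.
exists a; apply: (mulfI (f0 q0)); by rewrite -rmorphM -ea ep.
Qed.

End Determinants.

(** * Zeros of one function are not isolated in dimension two *)

Lemma closed_fresh (k : closedFieldType) (s : seq k) : exists c, c \notin s.
Proof.
have p0 : \prod_(b <- s) ('X - b%:P) != 0 :> {poly k}.
  by rewrite monic_neq0 // monic_prod_XsubC.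
have /closed_nonrootP [c hc] := p0; exists c.
by rewrite root_prod_XsubC in hc.
Qed.

Lemma integral_factor (R S : nzRingType) (K : fieldType) (f : {rmorphism R -> K})
    (g : {rmorphism R -> S}) (j : {rmorphism S -> K}) z :
  (forall r, f r = j (g r)) -> integralOver f z -> integralOver j z.
Proof.
move=> h [p mp rp]; exists (map_poly g p); first exact: monic_map.
by rewrite -map_poly_comp (eq_map_poly (g := f)) // => r /=; rewrite h.
Qed.

Section Dimension.
Variables (k : closedFieldType) (K : fieldType) (io : {rmorphism k -> K}).

(** Interpolation at constants: dividing [p - p(c0)] by [X - c0] lowers the degree and adds only
    [c0] to the excluded constants, which never exhaust the infinite field [k]. *)
Lemma inS_coefs d (t : 'I_d -> K) (p : {poly K}) (bad : seq k) :
  (forall c, c \notin bad -> inS (mmap io t) p.[io c]) -> forall i, inS (mmap io t) p`_i.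
Proof.
have hio c : inS (mmap io t) (io c) by exists c%:MP; rewrite /= mmapC.
have : exists n, (size p <= n)%N by exists (size p).
move=> [n]; elim: n p bad => [|n IH] p bad sp hb i.
  by move: sp; rewrite leqn0 size_poly_eq0 => /eqP ->; rewrite coef0; apply: inS0.
have [c0 nc0] := closed_fresh bad.
have : root (p - (p.[io c0])%:P) (io c0) by rewrite /root hornerD hornerN hornerC subrr.
move=> /factor_theorem [q eq].
have sq : (size q <= n)%N.
  have [->|q0] := eqVneq q 0; first by rewrite size_poly0.
  have : (size (q * ('X - (io c0)%:P))%R <= n.+1)%N.
    rewrite -eq; apply: leq_trans (size_polyD _ _) _; rewrite geq_max sp size_polyN.
    by apply: leq_trans (size_polyC_leq1 _) _.
  by rewrite size_mul ?polyXsubC_eq0 // size_XsubC addn2.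
have hq : forall i, inS (mmap io t) q`_i.
  apply: (IH q (c0 :: bad)) => // c; rewrite inE negb_or => /andP [cc0 nc].
  have -> : q.[io c] = (p.[io c] - p.[io c0]) * io (c - c0)^-1.
    have := congr1 (fun r : {poly K} => r.[io c]) eq.
    rewrite hornerD hornerN hornerC hornerM hornerXsubC => ->.
    by rewrite fmorphV rmorphB mulfK // -rmorphB fmorph_eq0 subr_eq0.
  by apply: inSM => //; apply: inSB; apply: hb.
have -> : p = q * ('X - (io c0)%:P) + (p.[io c0])%:P by rewrite -eq subrK.
rewrite coefD mulrBr coefB coefMX coefMC coefC.
apply: inSD; last by case: eqP => _; [apply: hb|apply: inS0].
by apply: inSB; [case: eqP => _; [apply: inS0|]|apply: inSM].
Qed.

(* Noether normalization makes the ring R = k[a] integral over a polynomial ring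
   S.  If x generated the maximal ideal of R up to radical, its norm would divide
   powers of two independent linear forms of S, hence be constant, and x would be
   a unit. *)
Lemma no_isolated_zero n (a : 'I_n -> K) (V : K -> k -> Prop) x f' g' :
  hrel V -> hconst io V -> (forall i, fin V (a i)) ->
  inalg io a x -> V x 0 -> x != 0 ->
  (forall z, inalg io a z -> V z 0 -> exists N w, inalg io a w /\ z ^+ N = x * w) ->
  (forall u, exists r w, [/\ inalg io a r, inalg io a w, w != 0 & u = r / w]) ->
  ~ algdep io f' g' -> False.
Proof.
move=> hV cV fa ax Vx x0 hrad hfr nalg.
have [d [t [ind tin hint]]] := noether_normalization io a.
have Rint0 d0 (t0 : 'I_d0 -> K) z : (forall i, integralOver (mmap io t0) (a i)) ->
    inalg io a z -> integralOver (mmap io t0) z.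
  by move=> h [F ->]; apply: integral_mmap => // c; apply: integral_scalar.
(* With at most one variable every element of [K] would be algebraic over [k] or over one fixed
   element, and any two would be dependent. *)
have d2 : (1 < d)%N.
  rewrite ltnNge; apply/negP => d1; apply: nalg.
  case: d t ind tin hint d1 => [|[|//]] t ind tin hint _;
    pose f : {rmorphism {mpoly k[_]} -> K} := mmap io t; have Rint z := Rint0 _ t z hint.
    apply: algdep_const; apply/integral_algebraic.
    pose g : {rmorphism {mpoly k[0]} -> k} := mmap idfun (fun=> 0).
    have fg F : f F = io (g F) by rewrite rmorph_mmap /f /=; apply: eq_mmap => // -[].
    have [r [w [hr hw w0 ->]]] := hfr f'.
    by apply: integral_div; apply: integral_factor fg _; apply: Rint.
  pose g : {rmorphism {mpoly k[1]} -> {poly k}} := mmap polyC (fun=> 'X).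
  have fg F : f F = evp io (t ord0) (g F).
    rewrite rmorph_mmap /f /=; apply: eq_mmap => [c|i] /=; first by rewrite evpC.
    by rewrite evpX (ord1 i).
  have inj r : evp io (t ord0) r = 0 -> r = 0.
    move=> e; pose F : {mpoly k[1]} := evp (@mpolyC 1 k) 'X_ord0 r.
    have gF : g F = r.
      rewrite /F evpE -horner_map -map_poly_comp /= mmapX mmap1U.
      rewrite (eq_map_poly (g := polyC)); last by move=> c /=; rewrite mmapC.
      by rewrite -[RHS]comp_polyXr /comp_poly.
    by rewrite -gF (ind F) ?rmorph0 // -[LHS]/(f F) fg gF.
  have [Pt hPt] := fraction_hom inj.
  have key u : algdep io (t ord0) u.
    apply: (algebraic_algdep hPt); apply/integral_algebraic.
    have [r [w [hr hw w0 ->]]] := hfr u.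
    have fP F : f F = Pt (tofrac (g F)) by rewrite hPt.
    have fP' : forall F, f F = Pt ((@tofrac _ \o g) F) by [].
    by apply: integral_div; apply: (integral_factor fP'); apply: Rint.
  apply: (@algdep_trans _ _ _ (t ord0)) => //.
  by move=> [p p0 rp]; move/eqP: p0; apply; apply: inj; rewrite evpE; exact/eqP.
pose f : {rmorphism {mpoly k[d]} -> K} := mmap io t.
have f_inj F : f F = 0 -> F = 0 by apply: ind.
have Rint z : inalg io a z -> integralOver f z by apply: Rint0.
have [e [P [sP rP minP]]] : exists e (P : {poly {mpoly k[d]}}), [/\ size P = e.+2,
    (map_poly f P).[x] = 0 & forall Q : {poly {mpoly k[d]}}, (map_poly f Q).[x] = 0 ->
      (size Q <= e.+1)%N -> Q = 0].
  have exn : exists n, `[< exists P : {poly {mpoly k[d]}}, [/\ P != 0, (map_poly f P).[x] = 0 & size P = n] >].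
    have [P mP rP] := Rint x ax; exists (size P); apply/asboolP; exists P; split=> //.
      exact: monic_neq0.
    exact/eqP.
  case: (ex_minnP exn) => m /asboolP [P [P0 rP sP]] minm.
  have m2 : (1 < m)%N.
    rewrite -sP ltnNge; apply/negP => s1.
    have [c c0 eP] : exists2 c, c != 0 & P = c%:P.
      by apply/size_poly1P; rewrite eqn_leq s1 size_poly_gt0.
    by move: rP; rewrite eP map_polyC hornerC => /f_inj /eqP; rewrite (negPf c0).
  exists m.-2, P; split=> //; first by rewrite sP; case: (m) m2 => [|[]].
  move=> Q rQ sQ; apply: contrapT => /eqP Q0.
  have : (m <= size Q)%N by apply: minm; apply/asboolP; exists Q.
  by move: sQ; case: (m) m2 => [|[|m']] //= _ h1 h2; have := leq_trans h2 h1; rewrite ltnn.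
have indep (g : 'I_e.+1 -> K) : (forall i, inF f (g i)) ->
    \sum_i g i * x ^+ i = 0 -> forall i, g i = 0.
  move=> hg e0; have [s s0 /choice [G hG]] := common_denom hg.
  pose Q : {poly {mpoly k[d]}} := \poly_(i < e.+1) G (inord i).
  have Q0 : Q = 0.
    apply: minP; last exact: size_poly.
    have sQ : (size (map_poly f Q) <= e.+1)%N.
      by apply: leq_trans (size_poly _ _) _; apply: size_poly.
    transitivity (f s * \sum_i g i * x ^+ i); last by rewrite e0 mulr0.
    rewrite (horner_coef_wide _ sQ) mulr_sumr.
    by apply: eq_bigr => i _; rewrite coef_map /= coef_poly ltn_ord inord_val -hG mulrA.
  move=> i; apply: (mulfI (f0 f_inj s0)); rewrite hG mulr0.
  have : Q`_i = 0 by rewrite Q0 coef0.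
  by rewrite coef_poly ltn_ord inord_val => ->; rewrite rmorph0.
pose l := P`_e.+1.
have P0 : P != 0 by rewrite -size_poly_gt0 sP.
have l0 : l != 0 by have := P0; rewrite -lead_coef_eq0 lead_coefE sP.
have fl0 : f l != 0 := f0 f_inj l0.
have eP : \sum_(i < e.+2) f P`_i * x ^+ i = 0.
  have sfP : (size (map_poly f P) <= e.+2)%N by rewrite -sP size_poly.
  transitivity (map_poly f P).[x] => //.
  by rewrite (horner_coef_wide _ sfP); apply: eq_bigr => i _; rewrite coef_map.
have c00 : P`_0 != 0.
  apply/eqP => c0; pose Q1 : {poly {mpoly k[d]}} := \poly_(i < e.+1) P`_i.+1.
  have : Q1 = 0.
    apply: minP; last exact: size_poly.
    have sQ : (size (map_poly f Q1) <= e.+1)%N.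
      by apply: leq_trans (size_poly _ _) _; apply: size_poly.
    apply: (mulfI x0); rewrite mulr0.
    move: eP; rewrite big_ord_recl c0 rmorph0 mul0r add0r => eP'; apply: etrans eP'.
    rewrite (horner_coef_wide _ sQ) mulr_sumr; apply: eq_bigr => i _; rewrite coef_map /= coef_poly ltn_ord /bump /= add1n exprS; ring.
  move=> /(congr1 (fun r : {poly {mpoly k[d]}} => r`_e)); rewrite coef_poly ltnSn coef0 => h.
  by move: l0; rewrite /l h eqxx.
have fc00 := f0 f_inj c00.
(* The companion matrix of the least relation [P] on [x]. It represents multiplication by [x], so
   [c] below is the norm of [x]. *)
pose C : 'M[K]_e.+1 := \matrix_(i, j) if i == ord_max then - f P`_j / f l else (j == i.+1 :> nat)%:R.
have CF i j : inF f (C i j).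
  rewrite mxE; case: eqP => _.
    by apply: inF_div => //; exists (- P`_j); rewrite rmorphN.
  by apply: inS_F; case: eqP => _; [apply: inS1|apply: inS0].
have Cx : C *m xvec x e = x *: xvec x e.
  apply/colP => i; rewrite !mxE -exprS.
  have [->|ni] := eqVneq i ord_max.
    apply: (mulfI fl0); move: eP; rewrite big_ord_recr /= -/l => /eqP; rewrite addr_eq0 => /eqP eP'.
    rewrite -[RHS]opprK -eP' mulr_sumr -sumrN; apply: eq_bigr => j _; rewrite !mxE eqxx.
    by field.
  have hi : (i.+1 < e.+1)%N.
    by rewrite ltn_neqAle ltn_ord andbT; apply: contraNneq ni => -[h]; apply/eqP; apply: val_inj.
  rewrite (bigD1 (Ordinal hi)) //= big1 ?addr0.
    by rewrite !mxE (negPf ni) /= eqxx mul1r.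
  move=> j hj; rewrite !mxE (negPf ni); case: eqP => [h|_]; rewrite ?mul0r //.
  by move: hj; rewrite -val_eqE /= h eqxx.
(* The matrix of multiplication by [x^-1], which the relation [P] expresses as a polynomial in
   [x]. *)
pose G : 'M[K]_e.+1 := \sum_(j < e.+1) (- f P`_j.+1 / f P`_0) *: C ^+ j.
have GF i j : inF f (G i j).
  rewrite summxE; apply: inF_sum => l1; rewrite mxE; apply: inFM; last exact: inF_pow.
  by apply: inF_div => //; exists (- P`_l1.+1); rewrite rmorphN.
have Gx : G *m xvec x e = x^-1 *: xvec x e.
  rewrite mulmx_suml.
  under eq_bigr => j _ do rewrite -scalemxAl (mx_pow j Cx) scalerA.
  rewrite -scaler_suml; congr (_ *: _); apply: (mulfI x0); rewrite mulfV // mulr_sumr.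
  apply: (mulfI fc00); rewrite mulr1.
  move: eP; rewrite big_ord_recl expr0 mulr1 => /eqP; rewrite addr_eq0 => /eqP e1.
  rewrite [RHS]e1 mulr_sumr -sumrN; apply: eq_bigr => j _.
  by rewrite lift0 exprS; field.
have GC : G * C = 1.
  apply/eqP; rewrite -subr_eq0; apply/eqP; apply: (mx_eq0 indep).
    move=> i j; rewrite mxE; apply: inFD.
      by rewrite mxE; apply: inF_sum => l1; apply: inFM.
    rewrite !mxE; apply: inS_F; case: eqP => _; last by rewrite oppr0; apply: inS0.
    by exists (- 1); rewrite rmorphN1.
  rewrite mulmxBl -[G * C]/(G *m C) -mulmxA Cx -scalemxAr Gx scalerA mulfV // scale1r mul1mx.
  exact: subrr.
have [c ec] : inS f (\det C) by apply: (det_inS f_inj indep CF Cx); apply: Rint.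
have fint c' : integralOver f (io c') by rewrite -(mmapC t io c'); apply: integral_id.
(* A power of [t i - v] has the form [x * w] with [w] integral; taking norms makes [c] divide a
   power of ['X_i - v]. *)
have divides (i : 'I_d) : exists M w v, c * w = ('X_i - v%:MP) ^+ M /\ V (t i) v.
  have [F eF] := tin i.
  have Vt : fin V (t i).
    rewrite eF /mmap; elim/big_ind: _ => [|u v [cu hu] [cv hv]|m _].
    - by exists 0; apply: hrel0.
    - by exists (cu + cv); apply: (hrelD hV).
    - have [c1 h1] : fin V (mmap1 a m).
        rewrite /mmap1; elim/big_ind: _ => [|u v [cu hu] [cv hv]|j _].
        + by exists 1; apply: (hrel1 hV).
        + by exists (cu * cv); apply: (hrelM hV).
        + by have [cj hj] := fa j; exists (cj ^+ m j); apply: (hrelX hV).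
      by exists (F@_m * c1); apply: (hrelM hV).
  have [v hv] := Vt.
  have atv : inalg io a (t i - io v) by exists (F - v%:MP); rewrite rmorphB /= mmapC -eF.
  have [|N [w [aw ew]]] := hrad _ atv.
    by have := hrelB hV hv (cV v); rewrite subrr.
  have eT : f (('X_i - v%:MP) ^+ N) = x * w.
    by rewrite rmorphXn rmorphB /= mmapX mmap1U mmapC.
  pose Z : 'M[K]_e.+1 := (x * w) *: G.
  have [z ez] : inS f (\det Z).
    apply: (det_inS f_inj indep (al := w)).
    - by move=> i' j'; rewrite mxE -eT; apply: inFM => //; apply: inS_F; exists (('X_i - v%:MP) ^+ N).
    - by rewrite -scalemxAl Gx scalerA mulrAC mulfV // mul1r.
    - exact: Rint.
  exists (N * e.+1)%N, z, v; split=> //.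
  apply/eqP; rewrite -subr_eq0; apply/eqP; apply: f_inj.
  rewrite rmorphB rmorphM -ec -ez exprM [X in _ - X]rmorphXn eT mulrC -det_mulmx.
  by rewrite -scalemxAl -[G *m C]/(G * C) GC detZ det1 mulr1 subrr.
(* The leading monomial of [c] divides powers of two different variables. *)
have lc : mlead c = 0%MM.
  have lead i : exists M, (mlead c <= U_(i) *+ M)%MM.
    have [M [w [v [ew _]]]] := divides i; exists M.
    have lX : mlead ('X_i - v%:MP : {mpoly k[d]}) = U_(i)%MM.
      rewrite mleadDl ?mleadXm // mleadN mleadC.
      rewrite Order.POrderTheory.lt_neqAle; apply/andP; split; last exact: le0m.
      by rewrite eq_sym mnm1_eq0.
    have X0 : 'X_i - v%:MP != 0 :> {mpoly k[d]}.
      apply/eqP => h; have := lX; rewrite h mlead0 => /esym/eqP; by rewrite mnm1_eq0.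
    have cw0 : c * w != 0 by rewrite ew expf_neq0.
    have c0 : c != 0 by apply: contraNneq cw0 => ->; rewrite mul0r.
    have w0 : w != 0 by apply: contraNneq cw0 => ->; rewrite mulr0.
    have := congr1 (fun r => mlead r) ew; rewrite mleadM // mleadX // lX => <-.
    apply/mnm_lepP => j; rewrite mnmDE; exact: leq_addr.
  pose i0 : 'I_d := Ordinal (ltnW d2); pose i1 : 'I_d := Ordinal d2.
  have [M0 /mnm_lepP h0] := lead i0; have [M1 /mnm_lepP h1] := lead i1.
  apply/mnmP => j; apply/eqP; rewrite mnm0E -leqn0.
  have [ej|nj] := eqVneq j i0.
    by have := h1 j; rewrite mulmnE mnm1E ej -val_eqE /= mul0n.
  by have := h0 j; rewrite mulmnE mnm1E eq_sym (negPf nj) /= mul0n.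
have [c0 [ec0 c0n]] : exists c0, c = c0%:MP /\ c0 != 0.
  have c0 : c != 0.
    apply/eqP => c0; have [M [w [v [ew _]]]] := divides (Ordinal (ltnW d2)).
    have : (\det C == 0) = false.
      have := congr1 determinant GC; rewrite -[G * C]/(G *m C) det_mulmx det1 => h.
      apply/eqP => dC; move/eqP: h; by rewrite dC mulr0 eq_sym oner_eq0.
    by rewrite ec c0 rmorph0 eqxx.
  have e1 : c = (c@_0)%:MP by apply: msize1_polyC; rewrite -mlead_deg // lc mdeg0.
  by exists c@_0; split=> //; apply: contraNneq c0 => h; rewrite e1 h mpolyC0.
(* The constant coefficient of [chi] is the nonzero constant [c0] up to sign. But [chi.[x] = 0] and
   [x] has value 0, so that coefficient also has value 0. *)
pose chi := char_poly C.
have chiE z : chi.[z] = \det (z%:M - C).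
  rewrite /chi /char_poly -horner_evalE -det_map_mx; congr (\det _).
  apply/matrixP => i j; rewrite /char_poly_mx !mxE /= /horner_eval hornerD hornerN hornerC.
  by rewrite hornerMn hornerX.
have chiS : forall i, inS f chi`_i.
  apply: (@inS_coefs _ _ _ [::]) => c1 _; rewrite chiE.
  apply: (det_inS f_inj indep (al := io c1 - x)).
  - move=> i j; rewrite mxE [(- C) i j]mxE [(_%:M) i j]mxE; apply: inFD.
      by apply: inS_F; case: eqP => _; [exists c1%:MP; rewrite /= mmapC|apply: inS0].
    rewrite -mulN1r; apply: inFM => //; apply: inS_F; exists (- 1); by rewrite rmorphN1.
  - by rewrite mulmxBl mul_scalar_mx Cx scalerBl.
  - by apply: integral_sub => //; apply: Rint.
have chix : chi.[x] = 0.
  rewrite chiE -det_tr; apply/eqP/det0P; exists (xvec x e)^T.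
    apply/eqP => /rowP /(_ ord0); rewrite !mxE expr0 => /eqP; by rewrite oner_eq0.
  by rewrite -trmx_mul mulmxBl mul_scalar_mx Cx subrr trmx0.
have tfin F : fin V (f F).
  rewrite /f /= /mmap; elim/big_ind: _ => [|u v [cu hu] [cv hv]|m _].
  - by exists 0; apply: hrel0.
  - by exists (cu + cv); apply: (hrelD hV).
  - have [c1 h1] : fin V (mmap1 t m).
      rewrite /mmap1; elim/big_ind: _ => [|u v [cu hu] [cv hv]|j _].
      + by exists 1; apply: (hrel1 hV).
      + by exists (cu * cv); apply: (hrelM hV).
      + have [_ [_ [cj [_ hj]]]] := divides j.
        by exists (cj ^+ m j); apply: (hrelX hV).
    by exists (F@_m * c1); apply: (hrelM hV).
have /choice [q hq] : forall i, exists c1, V chi`_i c1.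
  by move=> i; have [F ->] := chiS i; apply: tfin.
have Vchi : V chi.[x] (q 0%N).
  have -> : q 0%N = \sum_(i < e.+2) q i * 0 ^+ i.
    rewrite big_ord_recl expr0 mulr1 big1 ?addr0 // => i _.
    by rewrite lift0 exprS mul0r mulr0.
  rewrite horner_coef size_char_poly; apply: (hrel_sum hV) => i _.
  by apply: (hrelM hV) => //; apply: (hrelX hV).
have q00 : q 0%N = 0 by apply: (hrel0P hV); rewrite -{1}chix.
have Vdet : V chi`_0 ((-1) ^+ e.+1 * c0).
  have -> : chi`_0 = (-1) ^+ e.+1 * io c0.
    rewrite -horner_coef0 chiE raddf0 sub0r -scaleN1r detZ ec ec0; congr (_ * _).
    by rewrite /f /= mmapC.
  apply: (hrelM hV) => //; apply: (hrelX hV); apply: hrelN => //; exact: (hrel1 hV).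
have := hrel_fun hV Vdet (hq 0%N); rewrite q00 => /eqP.
by rewrite mulf_eq0 expf_eq0 oppr_eq0 oner_eq0 andbF orFb (negPf c0n).
Qed.

End Dimension.

(** * Local rings and neighbourhoods *)

Section Homogenization.
Variables (n : nat) (k : fieldType).

Lemma mmap1_scale (K : fieldType) (h : 'I_n -> K) c (m : 'X_{1..n}) :
  mmap1 (fun i => c * h i) m = c ^+ mdeg m * mmap1 h m.
Proof.
rewrite /mmap1 mdegE (_ : _ ^+ _ = \prod_(i < n) c ^+ m i).
  by rewrite -big_split /=; apply: eq_bigr => i _; rewrite exprMn.
by rewrite prodrXr.
Qed.

Lemma mmap_homog (K : fieldType) (f : k -> K) (h : 'I_n -> K) c d F :
  F \is d.-homog -> mmap f (fun i => c * h i) F = c ^+ d * mmap f h F.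
Proof.
move=> /dhomogP hF; rewrite /mmap mulr_sumr big_seq [RHS]big_seq.
by apply: eq_bigr => m /hF <-; rewrite mmap1_scale mulrCA.
Qed.

Definition homogenize D (j : 'I_n) (F : {mpoly k[n]}) : {mpoly k[n]} :=
  \sum_(m <- msupp F) F@_m *: ('X_[m] * 'X_j ^+ (D - mdeg m)).

Lemma homogenize_homog D j F : (msize F <= D.+1)%N -> homogenize D j F \is D.-homog.
Proof.
move=> hD; rewrite /homogenize big_seq; apply: rpred_sum => m hm.
apply: dhomogZ; have le : (mdeg m <= D)%N.
  by rewrite -ltnS; apply: leq_trans hD; apply: msize_mdeg_lt.
rewrite -(subnKC le); apply: dhomogM; first by rewrite dhomogX.
rewrite subnKC // -[X in X.-homog]mul1n; apply: dhomogMn.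
by rewrite dhomogX /= mdeg1.
Qed.

Lemma mmap_homogenize (K : fieldType) (f : {rmorphism k -> K}) (h : 'I_n -> K) D j F :
  (msize F <= D.+1)%N -> h j != 0 ->
  mmap f h (homogenize D j F) = h j ^+ D * mmap f (fun i => h i / h j) F.
Proof.
move=> hD hj; rewrite /homogenize rmorph_sum /= /mmap mulr_sumr big_seq [RHS]big_seq.
apply: eq_bigr => m hm; have le : (mdeg m <= D)%N.
  by rewrite -ltnS; apply: leq_trans hD; apply: msize_mdeg_lt.
rewrite -[LHS]/(mmap f h _) mmapZ rmorphM rmorphXn /= !mmapX mmap1U.
have -> : mmap1 (fun i => h i / h j) m = (h j)^-1 ^+ mdeg m * mmap1 h m.
  by rewrite -mmap1_scale /mmap1; apply: eq_bigr => i _; rewrite mulrC.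
rewrite -{2}(subnKC le) exprD exprVn; have : h j ^+ mdeg m != 0 by rewrite expf_neq0.
by move=> e; field.
Qed.

End Homogenization.

Lemma normalized_coord (k : closedFieldType) n (P : ppoint k n) : exists j, pcoord P j = 1.
Proof.
case: P => v hv; have /existsP [j /andP [/eqP e _]] := hv.
by exists j; rewrite /pcoord /= e.
Qed.

Lemma coordX_homog (k : fieldType) n (j : 'I_n) : ('X_j : {mpoly k[n]}) \is 1.-homog.
Proof. by rewrite dhomogX /= mdeg1. Qed.

Section Geometry.
Variables (k : closedFieldType) (X : projVar k).
Local Notation K := (ffield X).
Local Notation io := (fconst X).
Local Notation point := (ppoint k (pdim X)).
Local Notation y := (gpoint X).
Implicit Types (P Q : point) (f g : K).

(* Evaluation at P, as a partial homomorphism: f is regular at P with value c. *)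
Definition val P f c := exists d F G, [/\ F \is d.-homog, G \is d.-homog,
  G.@[pcoord P] != 0, F.@[pcoord P] = c * G.@[pcoord P] & f = gval F / gval G].

Lemma val_vanishes P f : vanishes_at P f <-> val P f 0.
Proof.
by split=> -[d [F [G [hF hG nG eF ->]]]]; exists d, F, G; split; rewrite ?mul0r //;
   move: eF; rewrite mul0r.
Qed.

Lemma fin_regular P f : regular_at P f <-> fin (val P) f.
Proof.
split=> [[d [F [G [hF hG nG ->]]]]|[c [d [F [G [hF hG nG _ ->]]]]]]; last by exists d, F, G.
by exists (F.@[pcoord P] / G.@[pcoord P]), d, F, G; split=> //; rewrite divfK.
Qed.

Lemma gval_neq0 P d G : on_var P -> G \is d.-homog -> G.@[pcoord P] != 0 -> gval G != 0.
Proof. by move=> oP hG; apply: contraNneq => /(oP _ _ hG) ->. Qed.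

Lemma val_lring P : on_var P -> lring (val P).
Proof.
move=> oP; split; first split.
- exists 0%N, 1, 1; rewrite dhomog1 /gval !rmorph1 oner_neq0 mulr1 divr1; split=> //.
- move=> a a' b b' [d [F [G [hF hG nG eF ->]]]] [e [F' [G' [hF' hG' nG' eF' ->]]]].
  have g0 := gval_neq0 oP hG nG; have g0' := gval_neq0 oP hG' nG'.
  exists (d + e)%N, (F * G' - F' * G), (G * G'); rewrite /gval in g0 g0' *.
  rewrite dhomogM // !rmorphB !rmorphM /= mulf_neq0 //; split=> //.
  + by apply: rpredB; [|rewrite addnC]; apply: dhomogM.
  + by rewrite eF eF' mulrBl -!mulrA [G.@[_] * _]mulrC; ring.
  + by field; rewrite g0 g0'.
- move=> a a' b b' [d [F [G [hF hG nG eF ->]]]] [e [F' [G' [hF' hG' nG' eF' ->]]]].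
  exists (d + e)%N, (F * F'), (G * G'); rewrite /gval.
  rewrite !dhomogM // !rmorphM /= mulf_neq0 //; split=> //; first by rewrite eF eF'; ring.
  by rewrite invfM mulrACA.
- move=> c [d [F [G [hF hG nG eF]]]] /esym/eqP.
  rewrite mulf_eq0 invr_eq0 (negPf (gval_neq0 oP hG nG)) orbF => /eqP /(oP _ _ hF).
  by rewrite eF => /eqP; rewrite mulf_eq0 (negPf nG) orbF => /eqP.
move=> a c [d [F [G [hF hG nG eF ->]]]] c0; exists d, G, F; split=> //.
- by rewrite eF mulf_neq0.
- by rewrite eF mulKf.
- by rewrite invf_div.
Qed.

Lemma val_const P : hconst io (val P).
Proof.
move=> c; exists 0%N, c%:MP, 1; rewrite dhomog1 /gval !rmorph1 oner_neq0 mulr1 divr1.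
rewrite mevalC mmapC; split=> //.
by rewrite -[c%:MP]mulr1 mul_mpolyC dhomogZ // dhomog1.
Qed.

Lemma val_shift P f c : on_var P -> vanishes_at P (f - io c) <-> val P f c.
Proof.
move=> oP; have V := val_lring oP; split=> [/val_vanishes h|h].
  by have := hrelD V h (val_const P c); rewrite subrK add0r.
by apply/val_vanishes; have := hrelB V h (val_const P c); rewrite subrr.
Qed.

Lemma form_val P d F G : on_var P -> F \is d.-homog -> G \is d.-homog ->
  G.@[pcoord P] != 0 -> val P (gval F / gval G) (F.@[pcoord P] / G.@[pcoord P]).
Proof. by move=> oP hF hG nG; exists d, F, G; split=> //; rewrite divfK. Qed.

Definition chart j (i : 'I_(pdim X).+1) := y i / y j.

Lemma gvalX j : gval 'X_j = y j.
Proof. by rewrite /gval mmapX mmap1U. Qed.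

Lemma chart_neq0 P j : on_var P -> pcoord P j = 1 -> y j != 0.
Proof.
move=> oP e; rewrite -gvalX; apply: (gval_neq0 oP (coordX_homog k j)).
by rewrite mevalXU e oner_neq0.
Qed.

Lemma gval_chart j d F : y j != 0 -> F \is d.-homog ->
  gval F = y j ^+ d * mmap io (chart j) F.
Proof.
move=> j0 hF; rewrite -(mmap_homog _ _ _ hF) /gval; apply: eq_mmap => // i.
by rewrite /chart mulrC divfK.
Qed.

Lemma val_chart P j f c : on_var P -> pcoord P j = 1 ->
  val P f c <-> exists F G, [/\ G.@[pcoord P] != 0, F.@[pcoord P] = c * G.@[pcoord P] &
    f = mmap io (chart j) F / mmap io (chart j) G].
Proof.
move=> oP e; have j0 := chart_neq0 oP e; split=> [[d [F [G [hF hG nG eF ->]]]]|].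
  exists F, G; split=> //; rewrite (gval_chart j0 hF) (gval_chart j0 hG).
  by rewrite -mulf_div divff ?mul1r // expf_neq0.
move=> [F [G [nG eF ->]]]; pose D := (msize F + msize G)%N.
have hF : (msize F <= D.+1)%N by rewrite /D leqW // leq_addr.
have hG : (msize G <= D.+1)%N by rewrite /D leqW // leq_addl.
have ev H : (msize H <= D.+1)%N -> (homogenize D j H).@[pcoord P] = H.@[pcoord P].
  move=> hH; rewrite /meval mmap_homogenize ?e ?oner_neq0 //.
  by rewrite expr1n mul1r; apply: eq_mmap => // i; rewrite divr1.
exists D, (homogenize D j F), (homogenize D j G).
rewrite !homogenize_homog // !ev //; split=> //.
rewrite /gval !mmap_homogenize //.
by rewrite -mulf_div divff ?mul1r // expf_neq0.
Qed.

Lemma mmap_val P j F : on_var P -> pcoord P j = 1 ->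
  val P (mmap io (chart j) F) F.@[pcoord P].
Proof.
move=> oP e; apply/(val_chart _ _ oP e); exists F, 1.
by rewrite !rmorph1 oner_neq0 mulr1 divr1.
Qed.

Lemma val_noeth P : on_var P -> onoeth (val P).
Proof.
move=> oP I hI; have V := val_lring oP; have [j e] := normalized_coord P.
have hJ : ideal (fun F => I (mmap io (chart j) F)).
  split=> [|F G|F G]; rewrite ?rmorph0 ?rmorphD ?rmorphM /=; first exact: oi0 hI.
    by move=> a b; apply: (oiD hI).
  by move=> a; apply: (oiM hI) => //; exists F.@[pcoord P]; apply: mmap_val.
have [s [hs ss]] := noeth_mpoly hJ.
exists (map (mmap io (chart j)) s); split=> [z /mapP [F /hs h ->] //|z hz].
have [c /(val_chart _ _ oP e) [F [G [nG eF ez]]]] := oi_fin hI hz.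
have nG' : mmap io (chart j) G != 0 by exact: (unit_neq0 V (mmap_val G oP e) nG).
have : ispan s F.
  apply: ss; rewrite (_ : mmap _ _ F = mmap io (chart j) G * z); last by rewrite ez mulrC divfK.
  by apply: (oiM hI) => //; exists G.@[pcoord P]; apply: mmap_val.
rewrite {}ez mulrC.
elim: s F {hs ss eF hz} => [|a s IH] F /=; first by move=> ->; rewrite rmorph0 mulr0.
move=> [b /IH hb]; exists ((mmap io (chart j) G)^-1 * mmap io (chart j) b); split.
  apply: (finM V); first exact: (unit_fin V (mmap_val G oP e) nG).
  by exists b.@[pcoord P]; apply: mmap_val.
by move: hb; rewrite rmorphB rmorphM /= mulrBr mulrA.
Qed.

Lemma val_fracs P : on_var P -> fracs (val P).
Proof.
move=> oP f; have [j e] := normalized_coord P; have j0 := chart_neq0 oP e.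
have [d [F [G [hF hG nG ->]]]] := gpoint_gen f.
exists (mmap io (chart j) G).
  by apply: contraNneq nG => h; rewrite -/(gval G) (gval_chart j0 hG) h mulr0.
split; first by exists G.@[pcoord P]; apply: mmap_val.
rewrite -/(gval F) -/(gval G) (gval_chart j0 hF) (gval_chart j0 hG) -mulf_div divff ?expf_neq0 // mul1r.
rewrite mulrC divfK; first by exists F.@[pcoord P]; apply: mmap_val.
by apply: contraNneq nG => h; rewrite -/(gval G) (gval_chart j0 hG) h mulr0.
Qed.

(* The basic neighbourhoods of P are complements of hypersurfaces; U may hold or
   fail arbitrarily off the variety. *)
Definition nb P (U : point -> Prop) := exists d G, [/\ G \is d.-homog,
  G.@[pcoord P] != 0 & forall P', on_var P' -> G.@[pcoord P'] != 0 -> U P'].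

Lemma nbT P (U : point -> Prop) : (forall P', on_var P' -> U P') -> nb P U.
Proof. by move=> h; exists 0%N, 1; rewrite dhomog1 rmorph1 oner_neq0; split=> // P' /h. Qed.

Lemma nbI P U U' : nb P U -> nb P U' -> nb P (fun P' => U P' /\ U' P').
Proof.
move=> [d [G [hG nG hU]]] [d' [G' [hG' nG' hU']]]; exists (d + d')%N, (G * G').
rewrite dhomogM // rmorphM mulf_neq0 //; split=> // P' oP.
by rewrite rmorphM mulf_eq0 negb_or => /andP [/hU ? /hU' ?]; split; auto.
Qed.

Lemma nbS P (U U' : point -> Prop) : (forall P', on_var P' -> U P' -> U' P') -> nb P U -> nb P U'.
Proof. by move=> h [d [G [hG nG hU]]]; exists d, G; split=> // P' o /hU; auto. Qed.

Lemma nb_mem P U : on_var P -> nb P U -> U P.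
Proof. by move=> o [d [G [hG nG hU]]]; auto. Qed.

Lemma nb_nb P U : nb P U -> nb P (fun P' => nb P' U).
Proof. by move=> [d [G [hG nG hU]]]; exists d, G; split=> // P' o n; exists d, G. Qed.

Lemma nb_all P n (U : 'I_n -> point -> Prop) : (forall i, nb P (U i)) ->
  nb P (fun P' => forall i, U i P').
Proof.
move=> h; suff: nb P (fun P' => forall i, i \in enum 'I_n -> U i P').
  by apply: nbS => P' _ w i; apply: w; rewrite mem_enum.
elim: (enum 'I_n) => [|a s IH]; first by apply: nbT.
apply: nbS (nbI (h a) IH) => P' _ [w w'] i; rewrite inE => /orP [/eqP -> //|]; exact: w'.
Qed.

Lemma nb_fin P f : fin (val P) f -> nb P (fun P' => fin (val P') f).
Proof.
move=> [c [d [F [G [hF hG nG eF ->]]]]]; exists d, G; split=> // P' oP' n.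
by exists (F.@[pcoord P'] / G.@[pcoord P']); apply: (form_val (d := d)).
Qed.

Definition vunit P f := exists2 c, c != 0 & val P f c.

Lemma nb_unit P f : on_var P -> vunit P f -> nb P (fun P' => vunit P' f).
Proof.
move=> oP [c c0 [d [F [G [hF hG nG eF ->]]]]]; exists (d + d)%N, (F * G).
rewrite dhomogM // rmorphM /= eF !mulf_neq0 //; split=> // P' oP'.
rewrite rmorphM mulf_eq0 negb_or => /andP [nF' nG'].
by exists (F.@[pcoord P'] / G.@[pcoord P']); rewrite ?mulf_neq0 ?invr_eq0 //; apply: (form_val (d := d)).
Qed.

Lemma nb_zopen P V : zopen V -> V P -> nb P V.
Proof.
move=> [S hS] VP.
have : ~ forall d F, F \is d.-homog -> S F -> F.@[pcoord P] = 0 by move/hS.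
move=> /existsNP [d] /existsNP [F] /not_implyP [hF] /not_implyP [SF /eqP nF].
exists d, F; split=> // P' _ n; apply: contrapT => /hS h.
by move: n; rewrite (h _ _ hF SF) eqxx.
Qed.

(** The defining forms are all those that vanish on [Z]; at a point outside [Z], the form of a basic
    neighbourhood disjoint from [Z] is one of them and does not vanish. *)
Lemma nb_zclosed (Z : point -> Prop) :
  (forall P, on_var P -> ~ Z P -> nb P (fun P' => ~ Z P')) ->
  zclosed (fun P => on_var P /\ Z P).
Proof.
move=> h; exists (fun F => forall P, on_var P -> Z P -> F.@[pcoord P] = 0) => P.
split=> [[oP ZP] d F hF hS|hS]; first exact: hS.
have oP : on_var P.
  by move=> d F hF e; apply: (hS d) => // P' oP' _; apply: oP' hF e.
split=> //; apply: contrapT => nZ; have [d [G [hG nG hU]]] := h P oP nZ.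
move: nG; rewrite (hS d) ?eqxx // => P' oP' ZP'; apply/eqP.
by apply: contraPT ZP' => n; apply: hU.
Qed.

Lemma nb_zopen_compl (U : point -> Prop) : (forall P, on_var P -> U P -> nb P U) ->
  zopen (fun P => ~ (on_var P /\ ~ U P)).
Proof.
move=> h; have [S hS] : zclosed (fun P => on_var P /\ ~ U P).
  apply: nb_zclosed => P oP /contrapT UP; apply: nbS (h P oP UP) => P' _ w; tauto.
exists S => P; rewrite -hS; split; first exact: contrapT.
tauto.
Qed.

Lemma zclosed_nb P Z : zclosed Z -> ~ Z P -> nb P (fun P' => ~ Z P').
Proof.
move=> [S hS] ZP; apply: nb_zopen => //; exists S => P'; rewrite -hS.
by split; [exact: contrapT|tauto].
Qed.

Lemma zclosed_on_var : zclosed (@on_var k X).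
Proof.
have [|S hS] := @nb_zclosed (fun=> True); first by tauto.
by exists S => P; rewrite -hS; tauto.
Qed.

End Geometry.

Section Points.
Variables (k : closedFieldType) (n : nat).
Implicit Types P Q : ppoint k n.

Lemma point_of_vec (v : 'I_n.+1 -> k) : (exists i, v i != 0) ->
  exists P c, c != 0 /\ forall i, pcoord P i = c * v i.
Proof.
move=> [i0 h0]; have [i hi mi] := @arg_minnP _ i0 (fun i => v i != 0) (fun i : 'I_n.+1 => i : nat) h0.
have nv : normalized [ffun l => (v i)^-1 * v l].
  apply/existsP; exists i; rewrite ffunE mulVf // eqxx; apply/forallP => l.
  apply/implyP => hl; rewrite ffunE mulf_eq0; apply/orP; right.
  by apply: contraTT hl => /mi; rewrite -leqNgt.
exists (exist (fun w => is_true (normalized w)) _ nv), (v i)^-1; split; first by rewrite invr_eq0.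
by move=> l; rewrite /pcoord /= ffunE.
Qed.

Lemma point_prop P Q c : (forall i, pcoord P i = c * pcoord Q i) -> P = Q.
Proof.
case: P Q => v nv [w nw] h; apply: val_inj => /=; apply/ffunP => l.
have {}h i : v i = c * w i := h i.
have /existsP [i /andP [/eqP vi /forallP zi]] := nv.
have /existsP [j /andP [/eqP wj /forallP zj]] := nw.
have c0 : c != 0 by apply: contra_eq_neq vi => c00; rewrite h c00 mul0r eq_sym oner_neq0.
case: (ltngtP i j) => ij.
- by have := zj i; rewrite ij /= => /eqP e; move: vi; rewrite h e mulr0 => /esym/eqP; rewrite oner_eq0.
- have := zi j; rewrite ij /= h wj mulr1 => /eqP e; by rewrite e eqxx in c0.
- by have := h i; rewrite vi (ord_inj ij) wj mulr1 h => <-; rewrite mul1r.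
Qed.

Lemma minor_neq0 P Q : P <> Q -> exists i l, pcoord P i * pcoord Q l != pcoord P l * pcoord Q i.
Proof.
move=> ne; apply: contrapT => h; apply: ne.
have [j e] := normalized_coord Q.
apply: (point_prop (c := pcoord P j)) => i; apply/eqP; apply: contrapT => /negP n0.
by apply: h; exists i, j; rewrite e mulr1.
Qed.

End Points.

Section InAlg.
Variables (k K : fieldType) (io : {rmorphism k -> K}) (n : nat) (b : 'I_n -> K).
Local Notation inb := (inalg io b).

Lemma inalg_const c : inb (io c). Proof. by exists c%:MP; rewrite mmapC. Qed.
Lemma inalg_gen i : inb (b i). Proof. by exists 'X_i; rewrite mmapX mmap1U. Qed.
Lemma inalgD u v : inb u -> inb v -> inb (u + v).
Proof. by move=> [F ->] [G ->]; exists (F + G); rewrite rmorphD. Qed.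
Lemma inalgN u : inb u -> inb (- u).
Proof. by move=> [F ->]; exists (- F); rewrite rmorphN. Qed.
Lemma inalgM u v : inb u -> inb v -> inb (u * v).
Proof. by move=> [F ->] [G ->]; exists (F * G); rewrite rmorphM. Qed.
Lemma inalgX u m : inb u -> inb (u ^+ m).
Proof. by move=> [F ->]; exists (F ^+ m); rewrite rmorphXn. Qed.

Lemma mmap_ind d (a : 'I_d -> K) (T : K -> Prop) F : (forall c, T (io c)) -> (forall i, T (a i)) ->
  (forall u v, T u -> T v -> T (u + v)) -> (forall u v, T u -> T v -> T (u * v)) ->
  T (mmap io a F).
Proof.
move=> Tc Tb TD TM; have T0 := Tc 0; have T1 := Tc 1; rewrite ?rmorph0 ?rmorph1 in T0 T1.
rewrite /mmap; elim: (msupp F : seq _) => [|m s IHs]; rewrite ?big_nil // big_cons.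
apply: (TD _ _ _ IHs); apply: (TM) => //; rewrite /mmap1.
elim: (index_enum _) => [|i r IHr]; rewrite ?big_nil // big_cons; apply: (TM _ _ _ IHr).
by elim: (m i) => [|e IH]; rewrite ?expr0 ?exprS //; apply: (TM).
Qed.

Lemma inalg_mmap d (a : 'I_d -> K) F : (forall i, inb (a i)) -> inb (mmap io a F).
Proof.
move=> h; apply: mmap_ind => //; [exact: inalg_const|exact: inalgD|exact: inalgM].
Qed.
End InAlg.

(** * The local ring of a surface at a point *)

Section Isolated.
Variables (k : closedFieldType) (X : projVar k).
Local Notation K := (ffield X).
Local Notation io := (fconst X).
Local Notation point := (ppoint k (pdim X)).
Implicit Types (P Q : point) (f g : K).

Lemma chart_val P j v e F G : on_var P -> v j = 1 -> e != 0 ->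
  (forall i, pcoord P i = e * v i) -> G.@[v] != 0 ->
  val P (mmap io (@chart k X j) F / mmap io (@chart k X j) G) (F.@[v] / G.@[v]).
Proof.
move=> oP vj e0 hv nG; pose D := (msize F + msize G)%N.
have Pj : pcoord P j != 0 by rewrite hv vj mulr1.
have j0 : gpoint X j != 0.
  by rewrite -gvalX; apply: (gval_neq0 oP (coordX_homog k j)); rewrite mevalXU.
have hF : (msize F <= D.+1)%N by rewrite /D leqW // leq_addr.
have hG : (msize G <= D.+1)%N by rewrite /D leqW // leq_addl.
have ev H : (msize H <= D.+1)%N -> (homogenize D j H).@[pcoord P] = e ^+ D * H.@[v].
  move=> hH; rewrite /meval mmap_homogenize // hv vj mulr1; congr (_ * _).
  by apply: eq_mmap => // i; rewrite hv mulrC mulKf.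
have D0 : e ^+ D != 0 by rewrite expf_neq0.
exists D, (homogenize D j F), (homogenize D j G).
rewrite !homogenize_homog // !ev // mulf_neq0 //; split=> //.
  by rewrite [RHS]mulrCA divfK.
rewrite /gval !mmap_homogenize //.
by rewrite -mulf_div divff ?mul1r // expf_neq0.
Qed.

(** Passage from the local ring to a finitely generated algebra. The hypothesis is applied to the
    finitely many functions [a i - io (pcoord P i)]; after the product [c] of the denominators
    involved is inverted, the resulting relations hold in the algebra generated by the chart
    coordinates and [ca^-1]. *)
Lemma no_isolated P x f' g' : on_var P -> val P x 0 -> x != 0 ->
  (forall z, val P z 0 -> exists N, mulO (val P) x (z ^+ N)) -> ~ algdep io f' g' -> False.
Proof.
move=> oP Vx x0 hz nal; have V := val_lring oP; have [j e] := normalized_coord P.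
pose a := @chart k X j; pose n := (pdim X).+1.
have finE u : fin (val P) u -> exists F G, G.@[pcoord P] != 0 /\ u = mmap io a F / mmap io a G.
  by move=> [c /(val_chart _ _ oP e) [F [G [nG _ ->]]]]; exists F, G.
have [Fx [Gx [nGx ex]]] : exists F G, G.@[pcoord P] != 0 /\ x = mmap io a F / mmap io a G.
  by apply: finE; exists 0.
have Va i : val P (a i) (pcoord P i) by have := mmap_val 'X_i oP e; rewrite mmapX mmap1U mevalXU.
have /choice [Nu hNu] : forall i : 'I_n, exists Nu, exists FG,
    (FG.2).@[pcoord P] != 0 /\ (a i - io (pcoord P i)) ^+ Nu = x * (mmap io a FG.1 / mmap io a FG.2).
  move=> i; have := hrelB V (Va i) (val_const P (pcoord P i)); rewrite subrr.
  by move=> /hz [N [u /finE [F [G [nG eu]]] ez]]; exists N, (F, G); rewrite ez eu.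
have /choice [FG hFG] := hNu => {hNu}.
pose c := Gx * \prod_(i < n) (FG i).2; pose ca := mmap io a c.
have nc : c.@[pcoord P] != 0.
  rewrite rmorphM rmorph_prod mulf_neq0 //; apply/prodf_neq0 => i _; exact: (hFG i).1.
have Vc : val P ca c.@[pcoord P] by apply: mmap_val.
have ca0 : ca != 0 := unit_neq0 V Vc nc.
pose b (i : 'I_n.+1) := if unlift ord0 i is Some i' then a i' else ca^-1.
have ba i : b (lift ord0 i) = a i by rewrite /b liftK.
have b0 : b ord0 = ca^-1 by rewrite /b unlift_none.
have inca : inalg io b ca^-1 by rewrite -b0; apply: inalg_gen.
have inF F : inalg io b (mmap io a F) by apply: inalg_mmap => i; rewrite -ba; apply: inalg_gen.
have inV (H H' : {mpoly k[n]}) : c = H * H' -> inalg io b (mmap io a H)^-1.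
  move=> ec; have h0 : mmap io a H' != 0.
    by apply: contraNneq ca0 => h; rewrite /ca ec rmorphM /= h mulr0.
  have -> : (mmap io a H)^-1 = mmap io a H' * ca^-1 by rewrite /ca ec rmorphM invfM /= mulrCA divff ?mulr1.
  by apply: inalgM.
have inG i : inalg io b (mmap io a (FG i).2)^-1.
  apply: (inV _ (Gx * \prod_(l < n | l != i) (FG l).2)).
  by rewrite /c (bigD1 i) //= mulrCA.
have inx : inalg io b x by rewrite ex; apply: inalgM => //; apply: inV erefl.
pose Rad z := exists N w, inalg io b w /\ z ^+ N = x * w.
have RadM z u : inalg io b u -> Rad z -> Rad (u * z).
  move=> iu [N [w [iw ew]]]; exists N, (u ^+ N * w); split; first by apply: inalgM => //; apply: inalgX.
  by rewrite exprMn ew mulrCA.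
have RadD z u : inalg io b z -> inalg io b u -> Rad z -> Rad u -> Rad (z + u).
  move=> iz iu [N [w [iw ew]]] [M [w' [iw' ew']]]; exists (N + M)%N.
  pose S u := exists w, inalg io b w /\ u = x * w; rewrite -/(S _) exprDn.
  apply: (big_ind S) => [|_ _ [p [ip ->]] [q [iq ->]]|i _].
  - by exists 0; rewrite mulr0; split=> //; have := inalg_const io b 0; rewrite rmorph0.
  - by exists (p + q); rewrite mulrDr; split=> //; apply: inalgD.
  - rewrite -mulr_natr -(rmorph_nat io).
    have [le|lt] := leqP M i.
      exists (z ^+ (N + M - i) * u ^+ (i - M) * w' * io ('C(N + M, i))%:R); split.
        by do !apply: inalgM; rewrite //; do ?[exact: inalgX | exact: inalg_const].
      have -> : u ^+ i = u ^+ (i - M) * (x * w') by rewrite -ew' -exprD subnK.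
      by move: (_ ^+ (N + M - i)) (u ^+ _) (io _) => A B C; ring.
    have le : (N <= N + M - i)%N by move: lt; lia.
    exists (z ^+ (N + M - i - N) * u ^+ i * w * io ('C(N + M, i))%:R); split.
      by do !apply: inalgM; rewrite //; do ?[exact: inalgX | exact: inalg_const].
    have -> : z ^+ (N + M - i) = z ^+ (N + M - i - N) * (x * w) by rewrite -ew -exprD subnK.
    by move: (z ^+ _) (u ^+ _) (io _) => A B C; ring.
have bV i : fin (val P) (b i).
  case: (unliftP ord0 i) => [l|] ->; rewrite ?ba ?b0; first by exists (pcoord P l).
  exact: (unit_fin V Vc nc).
have finb z : inalg io b z -> fin (val P) z.
  move=> [F ->]; apply: mmap_ind => [r||u w|u w]; [|exact: bV|exact: finD|exact: finM].
  by exists r; apply: val_const.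
(* The elements congruent to a constant modulo the radical of [x]. They form a subalgebra that
   contains all generators, including [ca^-1]; so an element of value 0 has a power divisible by
   [x]. *)
pose T z := inalg io b z /\ exists r, Rad (z - io r).
have TD u w : T u -> T w -> T (u + w).
  move=> [iu [r hr]] [iw [s hs]]; split; first exact: inalgD.
  exists (r + s); rewrite rmorphD opprD addrACA; apply: RadD => //; apply: inalgD => //;
    by apply: inalgN; apply: inalg_const.
have TM u w : T u -> T w -> T (u * w).
  move=> [iu [r hr]] [iw [s hs]]; split; first exact: inalgM.
  exists (r * s); rewrite rmorphM (_ : _ - _ = u * (w - io s) + io s * (u - io r)); last by ring.
  have ir := inalg_const io b r; have is_ := inalg_const io b s.
  apply: RadD; try apply: RadM => //; by apply: inalgM => //; apply: inalgD => //; apply: inalgN.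
have Tc r : T (io r).
  split; first exact: inalg_const; exists r; rewrite subrr; exists 1%N, 0; rewrite mulr0 expr1; split=> //.
  by have := inalg_const io b 0; rewrite rmorph0.
have Ta i : T (a i).
  split; first by rewrite -ba; apply: inalg_gen.
  exists (pcoord P i), (Nu i), (mmap io a (FG i).1 / mmap io a (FG i).2); split; last exact: (hFG i).2.
  exact: inalgM.
have Rval z r : inalg io b z -> Rad (z - io r) -> val P z r.
  move=> iz [N [w [iw ew]]]; have [s Vs] := finb _ iz.
  have h1 := hrelX V N (hrelB V Vs (val_const P r)).
  have h2 : val P ((z - io r) ^+ N) 0 by rewrite ew mulrC; apply: maxM => //; apply: finb.
  have /eqP := hrel_fun V h1 h2; rewrite expf_eq0 subr_eq0 => /andP [_ /eqP <-] //.
have Tca : T ca^-1.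
  split=> //; have [ic [r hr]] : T ca by apply: mmap_ind.
  have r0 : r != 0 by rewrite (hrel_fun V (Rval _ _ ic hr) Vc).
  have ir0 : io r != 0 by rewrite fmorph_eq0.
  exists r^-1; rewrite fmorphV (_ : _ - _ = - (ca^-1 * (io r)^-1) * (ca - io r)).
    by apply: RadM => //; apply: inalgN; rewrite -fmorphV; apply: inalgM => //; apply: inalg_const.
  by field; rewrite ca0 ir0.
apply: (@no_isolated_zero k K io _ b (val P) x f' g' (lr_hrel V) (@val_const _ _ P) bV) => //.
- move=> z iz Vz; have [_ [r hr]] : T z.
    have Tb i : T (b i) by case: (unliftP ord0 i) => [l|] ->; rewrite ?ba ?b0.
    by case: iz => [F ->]; apply: mmap_ind.
  have -> // : z = z - io 0 by rewrite rmorph0 subr0.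
  by rewrite -(hrel_fun V (Rval _ _ iz hr) Vz).
move=> u; have [d d0 [fd fdu]] := val_fracs oP u.
have [F [G [nG ed]]] := finE _ fd; have [F' [G' [nG' edu]]] := finE _ fdu.
have g0 := unit_neq0 V (mmap_val G oP e) nG; have g0' := unit_neq0 V (mmap_val G' oP e) nG'.
have f0 : mmap io a F != 0 by apply: contraNneq d0 => h; rewrite ed h mul0r.
exists (mmap io a (F' * G)), (mmap io a (F * G')); split=> //.
  by rewrite rmorphM mulf_neq0.
rewrite !rmorphM /=; have -> : u = (d * u) / d by rewrite mulrC mulKf.
by rewrite edu ed invf_div mulf_div [mmap io a G' * _]mulrC.
Qed.

End Isolated.

Section AlgebraicRelations.
Variables (k : closedFieldType) (K : fieldType) (io : {rmorphism k -> K}).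

Lemma horner_map_sum (R S : comNzRingType) (rho : {rmorphism R -> S}) (p : {poly R}) a :
  (map_poly rho p).[a] = \sum_(i < size p) rho p`_i * a ^+ i.
Proof.
rewrite (horner_coef_wide _ (size_poly _ _)); apply: eq_bigr => i _.
by rewrite coef_map.
Qed.

Lemma hrel_horner (V : K -> k -> Prop) f c q : hrel V -> hconst io V -> V f c ->
  V (evp io f q) q.[c].
Proof.
move=> hV Vc Vf; rewrite evpE horner_map_sum horner_coef; apply: (hrel_sum hV) => i _.
by apply: (hrelM hV) => //; apply: hrelX.
Qed.

Lemma hrel_ev2 (V : K -> k -> Prop) f g a c p : hrel V -> hconst io V -> V f a -> V g c ->
  V (ev2 io f g p) (map_poly (horner_eval a) p).[c].
Proof.
move=> hV Vc Vf Vg; rewrite [ev2 _ _ _ _]evpE !horner_map_sum; apply: (hrel_sum hV) => i _.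
by apply: (hrelM hV); [exact: hrel_horner|apply: hrelX].
Qed.

(* A relation of minimal degree is not divisible by its first variable. *)
Lemma relation_at0 f g : f != 0 -> algdep io f g ->
  exists p, ev2 io f g p = 0 /\ map_poly (horner_eval (0 : k)) p != 0.
Proof.
move=> f0 [p p0 ep]; have [n] := ubnP (size (lead_coef p)).
elim: n p p0 ep => // n IH p p0 ep hn.
have [h|] := eqVneq (map_poly (horner_eval (0 : k)) p) 0; last by exists p.
have hX i : p`_i = 'X * (p`_i %/ 'X).
  have /polyP/(_ i) := h; rewrite coef_map coef0 /= /horner_eval => r.
  rewrite mulrC divpK // -['X]subr0 dvdp_XsubCl; exact/eqP.
pose p' := \poly_(i < size p) (p`_i %/ 'X).
have e' : p = 'X *: p'.
  apply/polyP => i; rewrite coefZ coef_poly; case: ltnP => le; first exact: hX.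
  by rewrite mulr0 nth_default.
have p'0 : p' != 0 by apply: contra_neq p0 => h'; rewrite e' h' scaler0.
apply: (IH p') => //.
  move: ep; rewrite e' /ev2 evpZ evpX => /eqP.
  by rewrite mulf_eq0 (negPf f0) => /eqP.
move: hn; rewrite e' lead_coefZ mulrC size_mulX ?lead_coef_eq0 //.
Qed.

End AlgebraicRelations.

Section Independent.
Variables (k : closedFieldType) (X : projVar k).
Local Notation K := (ffield X).
Local Notation io := (fconst X).
Local Notation point := (ppoint k (pdim X)).
Implicit Types (P Q : point) (f g : K).

Lemma zclosed_form n (Z : pset k n) (P : ppoint k n) : zclosed Z -> ~ Z P -> exists d F,
  [/\ F \is d.-homog, F.@[pcoord P] != 0 & forall P' : ppoint k n, Z P' -> F.@[pcoord P'] = 0].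
Proof.
move=> [S hS]; rewrite hS => /existsNP [d] /existsNP [F] /not_implyP [hF] /not_implyP [SF /eqP nF].
by exists d, F; split=> // P' /hS /(_ d F hF SF).
Qed.

Lemma form_zclosed n d (F : {mpoly k[n.+1]}) : F \is d.-homog ->
  zclosed (fun P : ppoint k n => F.@[pcoord P] = 0).
Proof. by move=> hF; exists (fun G => G = F) => P; split=> [h ? ? _ -> //|/(_ d F hF erefl)]. Qed.

(** [f] vanishes on [Z 1] but not on [Z 2], and [g] vanishes on [Z 0] but not on [Z 1]. Restricted
    to [f = 0], a relation reads [q(T) T^m] with [q(0) <> 0]. By irreducibility either [g] or [q(g)]
    vanishes on all of [Z 1]; the first fails on [Z 1] and the second on [Z 0]. *)
Lemma indep_pair : has_chain (@on_var k X) 2 -> exists f g, ~ algdep io f g.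
Proof.
move=> [Z [hZ cZ]].
have [[c0 [P0 Z0] _] s0] := hZ 0%N isT; have [[c1 _ i1] s1] := hZ 1%N isT.
have [_ s2] := hZ 2%N isT; have [s01 n01] := cZ 0%N isT; have [_ n12] := cZ 1%N isT.
have /existsNP [P1 /not_implyP [Z1 nZ1]] : ~ forall P, Z 1%N P -> Z 0%N P := n01.
have /existsNP [P2 /not_implyP [Z2 nZ2]] : ~ forall P, Z 2%N P -> Z 1%N P := n12.
have [d [F [hF nF vF]]] := zclosed_form c1 nZ2.
have [e [G [hG nG vG]]] := zclosed_form c0 nZ1.
have [j ej] := normalized_coord P0; have o0 := s0 _ Z0; have o2 := s2 _ Z2.
have j0 := chart_neq0 o0 ej.
pose Y m : {mpoly k[(pdim X).+1]} := 'X_j ^+ m.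
have hY m : Y m \is m.-homog by rewrite -[X in X.-homog]mul1n dhomogMn // coordX_homog.
have gY m : gval (Y m : {mpoly k[(pdim X).+1]}) != 0 by rewrite /gval rmorphXn /= expf_neq0 // -/(gval _) gvalX.
pose f := gval F / gval (Y d); pose g := gval G / gval (Y e).
have f0 : f != 0 by rewrite mulf_neq0 ?invr_eq0 //; apply: (gval_neq0 o2 hF nF).
exists f, g => /(relation_at0 f0) [p [ep p0]].
have [m [q nq eq0]] := multiplicity_XsubC (map_poly (horner_eval (0:k)) p) 0.
rewrite p0 /= in nq; rewrite subr0 in eq0.
have Ye P : pcoord P j != 0 -> forall m, (Y m).@[pcoord P] != 0.
  by move=> n m'; rewrite rmorphXn /= mevalXU expf_neq0.
have vg P : on_var P -> pcoord P j != 0 -> val P g (G.@[pcoord P] / (Y e).@[pcoord P]).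
  by move=> o n; apply: (form_val o hG (hY e)); apply: Ye.
pose A := fun P : point => (G * 'X_j).@[pcoord P] = 0.
pose B := fun P => on_var P /\ (pcoord P j != 0 -> val P (evp io g q) 0).
have cA : zclosed A by apply: (form_zclosed (d := e + 1)); apply: dhomogM => //; apply: coordX_homog.
have cB : zclosed B.
  apply: nb_zclosed => P o /not_implyP [n nv].
  have vq := hrel_horner q (val_lring o) (@val_const _ _ P) (vg P o n).
  have uq : vunit P (evp io g q).
    exists q.[G.@[pcoord P] / (Y e).@[pcoord P]] => //.
    by apply/negP => /eqP h; apply: nv; rewrite -h.
  apply: nbS (nbI (nb_unit o uq) (_ : nb P (fun P' => pcoord P' j != 0))).
    move=> P' o' [[c cn vc] n'] /(_ n') v0.
    by rewrite (hrel_fun (val_lring o') vc v0) eqxx in cn.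
  by exists 1%N, 'X_j; rewrite coordX_homog mevalXU; split=> // P' _; rewrite mevalXU.
have sAB : psub (Z 1%N) (fun P => A P \/ B P).
  move=> P ZP; have o := s1 _ ZP; have [z|n] := eqVneq (pcoord P j) 0.
    by left; rewrite /A rmorphM /= mevalXU z mulr0.
  have V := val_lring o.
  have vf : val P f 0 by have := form_val o hF (hY d) (Ye P n d); rewrite vF // mul0r.
  have := hrel_ev2 p V (@val_const _ _ P) vf (vg P o n).
  rewrite ep => /(hrel0P V) /eqP; rewrite eq0 hornerM hornerXn mulf_eq0 expf_eq0.
  case/orP => [r|/andP [_ h]]; [right|left; move: h].
    by split=> // _; rewrite -(eqP r); apply: hrel_horner V (@val_const _ _ P) (vg P o n).
  rewrite mulf_eq0 invr_eq0 (negPf (Ye P n e)) orbF => /eqP h.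
  by rewrite /A rmorphM /= h mul0r.
have [sA|sB] := i1 _ _ cA cB sAB; last first.
  have [_ /(_ _) h] := sB _ (s01 _ Z0); move: h; rewrite ej oner_neq0 => /(_ isT) h.
  have n : pcoord P0 j != 0 by rewrite ej oner_neq0.
  have := hrel_fun (val_lring o0) (hrel_horner q (val_lring o0) (@val_const _ _ P0) (vg P0 o0 n)) h.
  by rewrite vG // mul0r => h'; move: nq; rewrite /root h' eqxx.
have [|s|s] := i1 _ _ (form_zclosed hG) (form_zclosed (coordX_homog k j)).
- by move=> P /sA; rewrite /A rmorphM /= => /eqP; rewrite mulf_eq0 => /orP [] /eqP; auto.
- by move: nG; rewrite s ?eqxx.
- by have := s _ (s01 _ Z0); rewrite mevalXU ej => /eqP; rewrite oner_eq0.
Qed.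

(** What is used later of a two-dimensional regular local ring. It refers to the residue map alone,
    so it also applies to rings not yet known to be local rings of a variety and transfers along
    automorphisms of the field. *)
Definition good (K0 : fieldType) (V : K0 -> k -> Prop) := [/\ lring V, onoeth V, fracs V &
  exists x y, [/\ params V x y, depth2 V x y, x != 0 & y != 0]].

(** If a power of one generator of the maximal ideal lay in the ideal of the other, the latter would
    generate the maximal ideal up to radical, which [no_isolated] excludes. If both generators were
    0 the local ring would be [k] and [K] would be algebraic over it. *)
Lemma surface_good P : surface X -> on_var P -> good (val P).
Proof.
move=> [[ch _] hP] oP; have [u [Vu hu]] := hP P oP.
have [f' [g' nal]] := indep_pair ch; have V := val_lring oP; have nO := val_noeth oP.
split=> //; first by apply: val_fracs.
pose x := u ord0; pose y := u (lift ord0 ord0).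
have pxy : params (val P) x y.
  split; [exact: (val_vanishes _ _).1 (Vu _)|exact: (val_vanishes _ _).1 (Vu _)|move=> w /val_vanishes /hu [a [ra ->]]].
  exists (a ord0), (a (lift ord0 ord0)); rewrite big_ord_recl big_ord1; split=> //; exact/fin_regular.
have [Vx Vy gen] := pxy; exists x, y.
have main s t : params (val P) s t -> s != 0 -> forall n, ~ mulO (val P) s (t ^+ n).
  move=> [Vs Vt hst] s0 n [w fw ew]; apply: (no_isolated oP Vs s0 _ nal) => z /hst [a [b [fa fb ->]]].
  exists n; pose S u := exists2 a, fin (val P) a & u = s * a; rewrite -/(S _) exprDn.
  apply: (big_ind S) => [|_ _ [p fp ->] [q fq ->]|[i hi] _ /=].
  - by exists 0; rewrite ?mulr0 //; exists 0; exact: (hrel0 V).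
  - by exists (p + q); rewrite ?mulrDr //; apply: finD.
  have fs := max_fin Vs; have ft := max_fin Vt.
  rewrite -mulr_natr -(rmorph_nat io); have fn : fin (val P) (io ('C(n, i))%:R) by eexists; apply: val_const.
  have [e|lt] := eqVneq i n.
    exists ((a * s) ^+ (n - i) * b ^+ i * w * io ('C(n, i))%:R).
      by do !apply: (finM V) => //; apply: (finX V) => //; apply: finM.
    by rewrite e subnn !expr0 exprMn ew; move: (io _) (b ^+ n) => C D; ring.
  exists (a * (a * s) ^+ (n - i).-1 * (b * t) ^+ i * io ('C(n, i))%:R).
    by do !apply: (finM V) => //; apply: (finX V) => //; apply: finM.
  have -> : (n - i)%N = (n - i).-1.+1 by move: lt hi; lia.
  by rewrite exprS /=; move: (io _) ((a * s) ^+ _) ((b * t) ^+ _) => A B C; ring.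
have [s0|s0] := eqVneq x 0; last first.
  have [t0|t0] := eqVneq y 0.
    have := main x y pxy s0 1%N; case; rewrite expr1 t0; exists 0; rewrite ?mulr0 //.
    by exists 0; apply: (hrel0 V).
  by split=> //; apply: (depth2_of_dim V nO pxy) => //; apply: main.
have [t0|t0] := eqVneq y 0; last first.
  have [] := main y x (paramsC pxy) t0 1%N; exists 0; first by exists 0; apply: (hrel0 V).
  by rewrite s0 expr1 mulr0.
case: nal.
have cst f : fin (val P) f -> exists c, f = io c.
  move=> [c Vc]; exists c; have := hrelB V Vc (val_const P c); rewrite subrr.
  move=> /gen [a [b [_ _]]]; rewrite s0 t0 !mulr0 addr0 => /eqP.
  by rewrite subr_eq0 => /eqP.
apply: algdep_const; have [d d0 [/cst [c ec] /cst [c' ec']]] := val_fracs oP f'.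
have c0 : c != 0 by apply: contraNneq d0 => c0; rewrite ec c0 rmorph0.
have -> : f' = io (c' / c) by rewrite fmorph_div -ec -ec' mulrC mulKf.
by exists ('X - (c' / c)%:P); rewrite ?polyXsubC_eq0 // rmorphB /= map_polyX map_polyC /= rootE hornerXsubC subrr.
Qed.

(** If no power of [z] lies in the ideal, some prime of the affine coordinate ring contains the
    contracted ideal but not [F * W], where [W] collects the denominators and the form cutting out
    the neighbourhood. A zero of this prime with [F * W] nonzero is a nearby point where the [c i]
    vanish and [z] does not. *)
Lemma local_nullstellensatz P m (c : 'I_m -> K) z : on_var P ->
  (forall i, fin (val P) (c i)) -> fin (val P) z ->
  nb P (fun P' => (forall i, val P' (c i) 0) -> val P' z 0) ->
  exists N, inspan (val P) c (z ^+ N).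
Proof.
move=> oP fc [cz Vz] [d [H [hH nH hU]]]; have [j e] := normalized_coord P.
have V := val_lring oP; pose a := @chart k X j.
have /choice [FG hFG] : forall i, exists FG : _ * _, FG.2.@[pcoord P] != 0 /\
    c i = mmap io a FG.1 / mmap io a FG.2.
  by move=> i; have [r /(val_chart _ _ oP e) [F [G [nG _ ->]]]] := fc i; exists (F, G).
have [F [G [nG _ ez]]] := (val_chart _ _ oP e).1 Vz.
pose J Phi := inspan (val P) c (mmap io a Phi).
have fm Phi : fin (val P) (mmap io a Phi) by eexists; apply: mmap_val.
have hJ : ideal J.
  split=> [|p q hp hq|p q hq]; rewrite /J ?rmorph0.
  - exists (fun=> 0); split=> [_|]; first by exists 0; apply: (hrel0 V).
    by rewrite big1 // => i _; rewrite mul0r.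
  - by rewrite rmorphD; apply: (inspanD V).
  - by rewrite rmorphM; exact: (inspanM V (fm p) hq).
pose W := H * G * \prod_i (FG i).2; pose u := F * W.
have nW : W.@[pcoord P] != 0.
  rewrite /W !rmorphM rmorph_prod !mulf_neq0 //; apply/prodf_neq0 => i _; exact: (hFG i).1.
apply: contrapT => no.
have [n Ju|] := @prime_avoiding _ J u hJ.
  apply: no; exists n; rewrite ez -[mmap io a F](mulfK (unit_neq0 V (mmap_val W oP e) nW)).
  rewrite -rmorphM -/u -mulrA -invfM exprMn mulrC -rmorphXn; apply: (inspanM V) => //.
  apply: (finX V); apply: (unit_fin V (hrelM V (mmap_val W oP e) (mmap_val G oP e))).
  by rewrite mulf_neq0.
move=> pr [ppr Jpr npr].
have [v [vJ vu]] := nullstellensatz_prime ppr (Jpr _ (idl0 hJ)) npr.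
have vj : v j = 1.
  have := vJ ('X_j - 1); rewrite rmorphB rmorph1 /= mevalXU => h; apply/eqP; rewrite -subr_eq0.
  apply/eqP/h/Jpr; rewrite /J rmorphB rmorph1 /= mmapX mmap1U /a /chart divff ?subrr; last exact: chart_neq0 oP e.
  by have := idl0 hJ; rewrite /J rmorph0.
have vj0 : v j != 0 by rewrite vj oner_neq0.
have [P' [r [r0 hr]]] := point_of_vec (ex_intro (fun i => is_true (v i != 0)) j vj0).
have evr d' Phi : Phi \is d'.-homog -> Phi.@[pcoord P'] = r ^+ d' * Phi.@[v].
  move=> hPhi; rewrite /meval -mmap_homog //; apply: eq_mmap => // i; exact: hr.
have oP' : on_var P'.
  move=> d' Phi hPhi e0; rewrite (evr d') // vJ ?mulr0 //; apply: Jpr; rewrite /J.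
  have /eqP := e0; rewrite (gval_chart (chart_neq0 oP e) hPhi) mulf_eq0 expf_eq0.
  rewrite (negPf (chart_neq0 oP e)) andbF /= => /eqP ->.
  by have := idl0 hJ; rewrite /J rmorph0.
move: vu; rewrite /u /W !rmorphM rmorph_prod !mulf_eq0 !negb_or /=.
move=> /andP [vF /andP [/andP [vH vG] /prodf_neq0 vFG]].
have := hU P' oP'; rewrite (evr d) // mulf_neq0 ?expf_neq0 // => /(_ isT) h.
have V' := val_lring oP'; have cv F' G' (n' : G'.@[v] != 0) := chart_val F' oP' vj r0 hr n'.
have := cv F G vG; rewrite -ez => hz.
suff hc i : val P' (c i) 0.
  have /eqP := hrel_fun V' hz (h hc); by rewrite mulf_eq0 invr_eq0 (negPf vF) (negPf vG).
have [nGi ei] := hFG i; have vGi := vFG i isT; have := cv (FG i).1 _ vGi; rewrite -/a -ei.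
rewrite (_ : (FG i).1.@[v] = 0) ?mul0r //; apply: vJ; apply: Jpr; rewrite /J.
have -> : mmap io a (FG i).1 = mmap io a (FG i).2 * c i.
  by rewrite ei mulrC divfK //; apply: (unit_neq0 V (mmap_val _ oP e) nGi).
by apply: (inspanM V) => //; exact: (inspan_mem V).
Qed.

End Independent.

(** * Zariski topology, Hartogs extension and curves *)

Section Topology.
Variables (k : closedFieldType) (n : nat).
Local Notation point := (ppoint k n).
Implicit Types (P Q : point).

Lemma forms_noeth (T : {mpoly k[n.+1]} -> Prop) : exists s : seq {mpoly k[n.+1]},
  (forall G, G \in s -> T G) /\ forall G, T G -> ispan s G.
Proof.
pose I F := exists s : seq {mpoly k[n.+1]}, (forall G, G \in s -> T G) /\ ispan s F.
have hI : ideal I.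
  split=> [|F G [s [hs sF]] [t [ht tG]]|F G [s [hs sG]]].
  - by exists [::].
  - exists (s ++ t); split; first by move=> H; rewrite mem_cat => /orP []; auto.
    by apply: ispanD; [apply: ispan_sub sF|apply: ispan_sub tG] => H; rewrite mem_cat => ->; rewrite ?orbT.
  - by exists s; split=> //; apply: ispanM.
have [s0 [hs0 gen]] := noeth_mpoly hI.
have [s [hs ss]] : exists s : seq {mpoly k[n.+1]}, (forall G, G \in s -> T G) /\
    forall F, F \in s0 -> ispan s F.
  elim: s0 {gen} hs0 => [|F s0 IH] h; first by exists [::].
  have [|s [hs ss]] := IH; first by move=> G hG; apply: h; rewrite inE hG orbT.
  have [t [ht tF]] := h F (mem_head _ _).
  exists (t ++ s); split=> [G|G]; first by rewrite mem_cat => /orP []; auto.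
  rewrite inE => /orP [/eqP ->|/ss w]; [apply: ispan_sub tF|apply: ispan_sub w];
    by move=> H; rewrite mem_cat => ->; rewrite ?orbT.
exists s; split=> // G TG; apply: (ispan_min (ispan_ideal s) ss); apply: gen.
exists [:: G]; split; first by move=> H; rewrite inE => /eqP ->.
by apply: ispan_mem; rewrite inE.
Qed.

Lemma ispan_eval (s : seq {mpoly k[n.+1]}) G v : ispan s G ->
  (forall F, F \in s -> F.@[v] = 0) -> G.@[v] = 0.
Proof.
move=> sG h; apply: (ispan_min (I := fun F => F.@[v] = 0)) sG => //; split.
- by rewrite rmorph0.
- by move=> F H e e'; rewrite rmorphD /= e e' addr0.
- by move=> F H e; rewrite rmorphM /= e mulr0.
Qed.

(** Along a strictly decreasing sequence of closed sets, the forms vanishing on some member are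
    generated by finitely many, all of which already vanish at one stage [M]. *)
Lemma minimal_closed (FF : pset k n -> Prop) Z0 : (forall Z, FF Z -> zclosed Z) -> FF Z0 ->
  exists Z, FF Z /\ forall Z', FF Z' -> psub Z' Z -> psub Z Z'.
Proof.
move=> cF F0; apply: contrapT => no.
have /choice [nx hnx] : forall Z, exists Z', FF Z -> [/\ FF Z', psub Z' Z & ~ psub Z Z'].
  move=> Z; have [FZ|nF] := EM (FF Z); last by exists Z.
  apply: contrapT => h; apply: no; exists Z; split=> // Z' FZ' s.
  by apply: contrapT => ns; apply: h; exists Z'.
pose Z m := iter m nx Z0; have FZ m : FF (Z m) by elim: m => //= m /hnx [].
have dec m r : psub (Z (r + m)%N) (Z m).
  by elim: r => // r IH P h; apply: IH; have [_ s _] := hnx _ (FZ (r + m)%N); apply: s.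
pose T G := exists m d, G \is d.-homog /\ forall P, Z m P -> G.@[pcoord P] = 0.
have [s [hs ss]] := forms_noeth T.
have [M hM] : exists M, forall G, G \in s -> forall P, Z M P -> G.@[pcoord P] = 0.
  elim: s {ss} hs => [|G s IH] hs; first by exists 0%N.
  have [|M hM] := IH; first by move=> H hH; apply: hs; rewrite inE hH orbT.
  have [m [d [_ hm]]] := hs G (mem_head _ _).
  exists (M + m)%N => H; rewrite inE => /orP [/eqP -> P /dec /hm //|hH P].
  by rewrite addnC => /dec; apply: hM.
have [_ _] := hnx _ (FZ M); apply=> P ZP; apply: contrapT => nP.
have [d [G [hG nG vG]]] := zclosed_form (cF _ (FZ M.+1)) nP.
move: nG; rewrite (ispan_eval (s := s)) ?eqxx //; first by apply: ss; exists M.+1, d.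
by move=> F hF; apply: hM hF P ZP.
Qed.

Lemma zclosedI (A B : pset k n) : zclosed A -> zclosed B -> zclosed (fun P => A P /\ B P).
Proof.
move=> [S hS] [S' hS']; exists (fun F => S F \/ S' F) => P; rewrite hS hS'; split.
  by move=> [h h'] d F hF []; [apply: h hF|apply: h' hF].
by move=> h; split=> d F hF SF; apply: h hF _; auto.
Qed.

Lemma zclosed1 Q : zclosed (fun P => P = Q).
Proof.
exists (fun F => F.@[pcoord Q] = 0) => P; split=> [-> //|h].
apply: contrapT => ne; have [i [l]] := minor_neq0 ne; rewrite -subr_eq0 => /eqP; apply.
pose F : {mpoly k[n.+1]} := pcoord Q l *: 'X_i - pcoord Q i *: 'X_l.
have hF : F \is 1.-homog by apply: rpredB; apply: dhomogZ; apply: coordX_homog.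
have eF R : F.@[pcoord R] = pcoord R i * pcoord Q l - pcoord R l * pcoord Q i.
  by rewrite rmorphB /= !mevalZ !mevalXU ![pcoord Q _ * _]mulrC.
by rewrite -eF; apply: h hF _; rewrite eF mulrC subrr.
Qed.

Definition inf (S : point -> Prop) := forall s : seq point, exists2 P, S P & P \notin s.

Lemma infS (S S' : point -> Prop) : (forall P, S P -> S' P) -> inf S -> inf S'.
Proof. by move=> h i s; have [P SP nP] := i s; exists P; auto. Qed.

Lemma infU (S S' : point -> Prop) : inf (fun P => S P \/ S' P) -> inf S \/ inf S'.
Proof.
move=> h; apply: contrapT => /not_orP [/existsNP [s hs] /existsNP [t ht]].
have [P SP] := h (s ++ t); rewrite mem_cat negb_or => /andP [ns nt].
by case: SP => SP; [apply: hs|apply: ht]; exists P.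
Qed.

(** [Z] is minimal among the closed subsets of [Z0] with infinitely many points of [S]. Minimality
    gives irreducibility and a density of [S] in [Z] that only needs infinitely many points to
    detect containment. *)
Lemma inf_irreducible (S Z0 : pset k n) : zclosed Z0 -> inf (fun P => S P /\ Z0 P) ->
  exists Z, [/\ irreducible_closed Z, psub Z Z0, inf (fun P => S P /\ Z P) &
    forall A, zclosed A -> inf (fun P => S P /\ (Z P /\ A P)) -> psub Z A].
Proof.
move=> c0 i0; have [||Z [[cZ sZ iZ] mZ]] := @minimal_closed
    (fun Z => [/\ zclosed Z, psub Z Z0 & inf (fun P => S P /\ Z P)]) Z0.
- by move=> Z [].
- by split.
have mA A : zclosed A -> inf (fun P => S P /\ (Z P /\ A P)) -> psub Z A.
  move=> cA h; have s : psub Z (fun P => Z P /\ A P).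
    by apply: mZ => [|Q []//]; split=> //; [apply: zclosedI|move=> Q [/sZ]].
  by move=> P /s [].
exists Z; split=> //; split=> //; first by have [P [_ ZP] _] := iZ [::]; exists P.
move=> A B cA cB sAB.
have : inf (fun P => S P /\ (Z P /\ A P)) \/ inf (fun P => S P /\ (Z P /\ B P)).
  apply: infU; apply: infS iZ => P [SP ZP]; have [] := sAB P ZP; tauto.
by case=> h; [left|right]; apply: mA.
Qed.

Lemma irreducible1 Q : irreducible_closed (fun P => P = Q).
Proof.
split; [exact: zclosed1|by exists Q|move=> A B _ _ h].
by have [a|b] := h Q erefl; [left|right] => P ->.
Qed.

End Topology.

Section Local.
Variables (k : closedFieldType) (X : projVar k).
Local Notation K := (ffield X).
Local Notation io := (fconst X).
Local Notation point := (ppoint k (pdim X)).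
Implicit Types (P Q : point) (f g : K).

Lemma qcompact (T : {mpoly k[(pdim X).+1]} -> Prop) :
  (forall P, on_var P -> exists G, T G /\ G.@[pcoord P] != 0) ->
  exists s : seq {mpoly k[(pdim X).+1]}, (forall G, G \in s -> T G) /\
    forall P : point, on_var P -> exists2 G, G \in s & G.@[pcoord P] != 0.
Proof.
move=> h; have [s [hs ss]] := forms_noeth T; exists s; split=> // P oP.
have [G [TG nG]] := h P oP; apply: contrapT => no; move: nG.
rewrite (ispan_eval (ss _ TG)) ?eqxx // => F hF; apply/eqP.
by apply: contraPT (hF) => nF _; apply: no; exists F.
Qed.

Lemma discrete_finite (D : point -> Prop) :
  (forall P, on_var P -> nb P (fun P' => P' <> P -> ~ D P')) ->
  exists s : seq point, forall P, on_var P -> D P -> P \in s.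
Proof.
move=> h; pose T G := exists Q, forall P, on_var P -> G.@[pcoord P] != 0 -> P <> Q -> ~ D P.
have [P oP|s [hs cs]] := @qcompact T.
  by have [d [G [_ nG hG]]] := h P oP; exists G; split=> //; exists P.
have : exists t : seq point, forall P, on_var P -> (exists2 G, G \in s & G.@[pcoord P] != 0) ->
    D P -> P \in t.
  elim: s hs {cs} => [|G s IH] hs; first by exists [::] => P _ [].
  have [|t ht] := IH; first by move=> H hH; apply: hs; rewrite inE hH orbT.
  have [Q hQ] := hs G (mem_head _ _); exists (Q :: t) => P oP [H].
  rewrite !inE => /orP [/eqP ->|hH] nH DP; last by rewrite ht ?orbT //; exists H.
  by case: eqP => // ne; case: (hQ P oP nH ne).
by move=> [t ht]; exists t => P oP; apply: ht => //; apply: cs.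
Qed.

Lemma nb_neq P Q : on_var P -> P <> Q -> nb P (fun P' => P' <> Q).
Proof. by move=> oP ne; apply: (zclosed_nb (zclosed1 Q)). Qed.

Lemma nb_notin P (s : seq point) : on_var P -> nb P (fun P' => P' \in s -> P' = P).
Proof.
move=> oP; elim: s => [|Q s IH]; first by apply: nbT.
have [e|ne] := EM (P = Q).
  by apply: nbS IH => P' _ h; rewrite inE => /orP [/eqP ->|/h].
by apply: nbS (nbI (nb_neq oP ne) IH) => P' _ [h h']; rewrite inE => /orP [/eqP|/h'].
Qed.

Lemma coord_val P j i : on_var P -> pcoord P j != 0 -> val P (@chart k X j i) (pcoord P i / pcoord P j).
Proof.
move=> oP n; have := form_val oP (coordX_homog k i) (coordX_homog k j).
by rewrite !mevalXU !gvalX; apply.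
Qed.

Lemma near_params P x y : on_var P -> params (val P) x y ->
  nb P (fun P' => val P' x 0 -> val P' y 0 -> P' = P).
Proof.
move=> oP [Vx Vy gen]; have V := val_lring oP; have [j e] := normalized_coord P.
have j1 : pcoord P j != 0 by rewrite e oner_neq0.
have nj : nb P (fun P' => pcoord P' j != 0).
  exists 1%N, 'X_j; rewrite coordX_homog mevalXU e oner_neq0; split=> // P' _.
  by rewrite mevalXU.
have na : nb P (fun P' => forall i, val P' x 0 -> val P' y 0 ->
    val P' (chart j i - io (pcoord P i)) 0).
  apply: nb_all => i; have := hrelB V (coord_val i oP j1) (val_const P (pcoord P i)).
  rewrite e divr1 subrr => /gen [a [b [fa fb ->]]].
  apply: nbS (nbI (nb_fin fa) (nb_fin fb)) => P' o' [fa' fb'] x' y'.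
  by apply: (maxD (val_lring o')); apply: (maxM (val_lring o')).
apply: nbS (nbI nj na) => P' o' [n' h] x' y'; have V' := val_lring o'.
apply: (@point_prop _ _ _ _ (pcoord P' j)) => i.
have := hrelD V' (h i x' y') (val_const P' (pcoord P i)); rewrite subrK add0r.
by move=> /(hrel_fun V' (coord_val i o' n')) <-; rewrite mulrC divfK.
Qed.

Lemma fin_nonunit P f : fin (val P) f -> ~ vunit P f -> val P f 0.
Proof. by move=> [c Vc] nu; have [<- //|c0] := eqVneq c 0; case: nu; exists c. Qed.

Lemma nb_inspan P m (c : 'I_m -> K) z : inspan (val P) c z -> nb P (fun P' => inspan (val P') c z).
Proof.
move=> [a [fa ->]]; apply: nbS (nb_all (fun i => nb_fin (fa i))) => P' _ h.
by exists a.
Qed.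

Lemma inspan_max P m (c : 'I_m -> K) z : on_var P -> (forall i, val P (c i) 0) ->
  inspan (val P) c z -> val P z 0.
Proof.
move=> o h [a [fa ->]]; apply: (max_sum (val_lring o)) => i _.
by apply: (maxM (val_lring o)).
Qed.

Lemma val_root P z m : on_var P -> fin (val P) z -> val P (z ^+ m) 0 -> val P z 0.
Proof.
move=> o [c Vc] h; have /eqP := hrel_fun (val_lring o) (hrelX (val_lring o) m Vc) h.
by rewrite expf_eq0 => /andP [_ /eqP <-].
Qed.

Lemma prim_nb P m x y (c : 'I_m -> K) : on_var P -> params (val P) x y ->
  primitive (val P) x y c ->
  nb P (fun P' => (forall i, fin (val P') (c i)) /\ (P' <> P -> exists i, vunit P' (c i))).
Proof.
move=> oP pxy [fc [N [sx sy]]].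
have [Vx Vy _] := pxy; have fx := max_fin Vx; have fy := max_fin Vy.
have n1 := nb_all (fun i => nb_fin (fc i)).
have n2 := nbI (nb_inspan sx) (nb_inspan sy).
have n3 := nbI (nb_fin fx) (nb_fin fy).
apply: nbS (nbI (nbI n1 n2) (nbI n3 (near_params oP pxy))) => P' o' [[fc' [ix iy]] [[fx' fy'] h]].
split=> // ne; apply: contrapT => no; apply: ne; apply: h.
  apply: (val_root (m := N)) => //; apply: inspan_max ix => // i; apply: fin_nonunit => // u; apply: no; by exists i.
apply: (val_root (m := N)) => //; apply: inspan_max iy => // i; apply: fin_nonunit => // u; apply: no; by exists i.
Qed.

(** If there were finitely many zeros, [P] would be the only one nearby. Powers of both parameters
    would be multiples of [b], and [depth2] would make [b] a unit. *)
Lemma zeros_inf P b U : on_var P -> good (val P) -> val P b 0 -> b != 0 -> nb P U ->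
  inf (fun P' => [/\ on_var P', U P' & val P' b 0]).
Proof.
move=> oP [V nO _ [x [y [pxy dxy x0 y0]]]] Vb b0 nU; apply: contrapT => /existsNP [s hs].
have hs' P' : on_var P' -> U P' -> val P' b 0 -> P' \in s.
  by move=> o u v; apply: contrapT => /negP n; apply: hs; exists P'.
have [Vx Vy _] := pxy.
have near z : val P z 0 -> exists N, inspan (val P) (fun _ : 'I_1 => b) (z ^+ N).
  move=> Vz; apply: local_nullstellensatz => //; [by exists 0|by exists 0|].
  apply: nbS (nbI nU (nb_notin s oP)) => P' o' [u h] /(_ ord0) v.
  by rewrite (h (hs' _ o' u v)).
have [N [a [fa ea]]] := near x Vx; have [M [a' [fa' ea']]] := near y Vy.
rewrite !big_ord1 in ea ea'.
have [c Vc] : fin (val P) b^-1.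
  apply: (dxy _ (N + M)%N).
    rewrite exprD ea -mulrA [_ * b^-1]mulrC mulrA mulfK //.
    by apply: (finM V) => //; apply: (finX V); exists 0.
  rewrite addnC exprD ea' -mulrA [_ * b^-1]mulrC mulrA mulfK //.
  by apply: (finM V) => //; apply: (finX V); exists 0.
by have := hrelM V Vb Vc; rewrite divff // mul0r; apply: (max_one V).
Qed.

(** In lowest terms, a denominator that is not a unit has a zero near [P] other than [P]. There [f]
    is regular, so the numerator vanishes too, against coprimality. *)
Lemma hartogs P f : on_var P -> good (val P) ->
  nb P (fun P' => P' <> P -> fin (val P') f) -> fin (val P) f.
Proof.
move=> oP gP nf; have [V nO fr [x [y [pxy dxy x0 y0]]]] := gP.
pose h (i : 'I_2) := if i == ord0 then 1 else f.
have [|g [c [g0 hc pc]]] := gcd_exists V nO (h := h) fr pxy.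
  by exists ord0; rewrite /h eqxx oner_neq0.
have c0 : c ord0 != 0.
  by apply/eqP => e; have := hc ord0; rewrite e mulr0 /h eqxx => /eqP; rewrite oner_eq0.
have ef : c (lift ord0 ord0) = f * c ord0.
  have := hc ord0; have := hc (lift ord0 ord0); rewrite /h eqxx /= => -> e1.
  by rewrite mulrAC -e1 mul1r.
have [w0 w1] : fin (val P) (c ord0) /\ fin (val P) (c (lift ord0 ord0)) by case: pc.
have [Vc|[r r0 Vr]] := max_or_unit w0; last first.
  have -> : f = c (lift ord0 ord0) * (c ord0)^-1 by rewrite ef mulfK.
  by apply: (finM V) => //; apply: (unit_fin V Vr r0).
have [P'] := zeros_inf oP gP Vc c0 (nbI (prim_nb oP pxy pc) nf) [:: P].
move=> [o' [[fc u] f'] v']; rewrite inE => /eqP ne.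
have V' := val_lring o'; have [i [r r0]] := u ne.
case: (unliftP ord0 i) => [i'|] -> Vr.
  have := maxM V' (f' ne) v'; rewrite -ef => h'; rewrite (ord1 i') in Vr.
  by rewrite (hrel_fun V' Vr h') eqxx in r0.
by rewrite (hrel_fun V' Vr v') eqxx in r0.
Qed.

Lemma form_nonzero P d F : on_var P -> F \is d.-homog -> gval F != 0 ->
  forall U, nb P U -> exists P', [/\ on_var P', U P' & F.@[pcoord P'] != 0].
Proof.
move=> oP hF F0 U nU; apply: contrapT => no.
have [j e] := normalized_coord P; have j0 := chart_neq0 oP e.
have [|||N [a [_ ea]]] := @local_nullstellensatz _ _ P 0 (fun=> 0) (mmap io (chart j) F) oP.
- by case.
- by exists F.@[pcoord P]; apply: mmap_val.
- have nj : nb P (fun P' => pcoord P' j != 0).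
    exists 1%N, 'X_j; rewrite coordX_homog mevalXU e oner_neq0; split=> // P' _.
    by rewrite mevalXU.
  apply: nbS (nbI nU nj) => P' o' [u n'] _.
  have F'0 : F.@[pcoord P'] = 0.
    by apply/eqP; apply: contrapT => /negP n; apply: no; exists P'.
  have hY : ('X_j : {mpoly k[(pdim X).+1]}) ^+ d \is d.-homog.
    by rewrite -[X in X.-homog]mul1n dhomogMn // coordX_homog.
  have := form_val o' hF hY; rewrite rmorphXn /= mevalXU expf_neq0 // F'0 mul0r => /(_ isT).
  rewrite (gval_chart j0 hF) /gval rmorphXn /= -/(gval _) gvalX mulrC mulKf ?expf_neq0 //.
move/eqP: ea; rewrite big_ord0 expf_eq0 => /andP [_ /eqP h].
by move: F0; rewrite (gval_chart j0 hF) h mulr0 eqxx.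
Qed.

Lemma on_var_irreducible P : on_var P -> irreducible_closed (@on_var k X).
Proof.
move=> oP; split; [exact: zclosed_on_var|by exists P|move=> A B cA cB sAB].
apply: contrapT => /not_orP [/existsNP [P1 /not_implyP [o1 n1]] /existsNP [P2 /not_implyP [o2 n2]]].
have [d [F [hF nF vF]]] := zclosed_form cA n1; have [e [G [hG nG vG]]] := zclosed_form cB n2.
have g0 : gval (F * G) != 0.
  by rewrite /gval rmorphM mulf_neq0 //; [apply: gval_neq0 o1 hF nF|apply: gval_neq0 o2 hG nG].
have [P' [o' _]] := form_nonzero oP (dhomogM hF hG) g0 (nbT P (fun _ _ => I)).
by rewrite rmorphM /=; have [/vF ->|/vG ->] := sAB P' o'; rewrite ?mul0r ?mulr0 eqxx.
Qed.

(** Infinitely many points give a chain of length one that starts at a point; a chain of length two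
    inside [C] would be lengthened by the surface itself, which contains [R]. *)
Lemma inf_curve (C : pset k (pdim X)) R : surface X -> irreducible_closed C ->
  psub C (@on_var k X) -> inf C -> on_var R -> ~ C R -> curve C.
Proof.
move=> [[_ no3] _] iC sC infC oR nR; split=> //; split.
  have [Q CQ _] := infC [::]; have [Q' CQ' nQ'] := infC [:: Q].
  exists (fun i => if i is 0%N then fun P => P = Q else C); split.
    by case=> [|i] _; split=> //; [exact: irreducible1|move=> P ->].
  case=> // _; split=> [P -> //|h]; move: nQ'.
  by have /= -> := h Q' CQ'; rewrite mem_head.
move=> [Z [hZ cZ]]; apply: no3.
exists (fun i => if (i <= 2)%N then Z i else @on_var k X); split.
  move=> i _; case: leqP => le; last by split=> //; apply: on_var_irreducible oR.
  by have [? s] := hZ i le; split=> // P /s /sC.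
move=> i hi; have [->|ne] := eqVneq i 2%N.
  by have [_ s] := hZ 2%N isT; split=> [P /s /sC //|h]; apply: nR; apply: s; apply: h.
have lt : (i < 2)%N by move: hi ne; lia.
by rewrite lt (ltnW lt); apply: cZ.
Qed.

End Local.

(** * Centers of places and the domain of a birational map *)

Lemma meval_scale (k : fieldType) n (p c : 'I_n -> k) e d F : F \is d.-homog ->
  (forall i, p i = e * c i) -> F.@[p] = e ^+ d * F.@[c].
Proof.
by move=> hF h; rewrite /meval -(mmap_homog _ _ _ hF); apply: eq_mmap.
Qed.

Lemma pow_sum (K k : fieldType) (V : K -> k -> Prop) (T : K -> Prop) p q M : lring V ->
  (forall a b, T a -> T b -> T (a + b)) -> (forall a b, fin V a -> T b -> T (a * b)) ->
  fin V p -> fin V q -> T (p ^+ M) -> T (q ^+ M) -> T ((p + q) ^+ (M + M)).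
Proof.
move=> hV TD TM fp fq Tp Tq.
have T0 : T 0 by rewrite -(mul0r (p ^+ M)); apply: TM => //; exists 0; apply: (hrel0 hV).
rewrite exprDn; elim: (index_enum _) => [|i r IH]; rewrite ?big_nil // big_cons; apply: (TD) => //.
elim: ('C(_, _)) => [|c IHc]; rewrite ?mulr0n // mulrS; apply: (TD) => //.
have [le|lt] := leqP M i.
  by rewrite -(subnK le) exprD mulrA; apply: (TM) => //; apply: finM => //; apply: finX.
have le : (M <= M + M - i)%N by move: lt; lia.
by rewrite -(subnK le) exprD mulrC mulrA; apply: (TM) => //; apply: finM => //; apply: finX.
Qed.

(** The coefficients run along the moment curve: each point lies on the hyperplane with parameter
    [c] only for the roots [c] of a nonzero polynomial. *)
Lemma avoid_hyperplanes (k : closedFieldType) n (s : seq (ppoint k n)) :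
  exists t : 'I_n.+1 -> k, forall Q, Q \in s -> \sum_i t i * pcoord Q i != 0.
Proof.
pose p (Q : ppoint k n) : {poly k} := \poly_(i < n.+1) pcoord Q (inord i).
have p0 : \prod_(Q <- s) p Q != 0.
  rewrite prodf_seq_neq0; apply/allP => Q _ /=; have [j e] := normalized_coord Q.
  apply/eqP => h; have := congr1 (fun q : {poly k} => q`_j) h.
  by rewrite coef_poly ltn_ord inord_val e coef0 => /eqP; rewrite oner_eq0.
have [r [er]] := closed_field_poly_normal (\prod_(Q <- s) p Q).
have [c hc] := closed_fresh r.
have nc : (\prod_(Q <- s) p Q).[c] != 0.
  rewrite er hornerZ mulf_neq0 ?lead_coef_eq0 // -/(root _ _) root_prod_XsubC //.
exists (fun i => c ^+ i) => Q hQ; apply: contraNneq nc => e.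
rewrite horner_prod prodf_seq_eq0; apply/hasP; exists Q => //=.
rewrite horner_poly -[X in _ == X]e; apply/eqP; apply: eq_bigr => i _.
by rewrite inord_val mulrC.
Qed.

Section PlaceFacts.
Variables (k : closedFieldType) (K : fieldType) (io : {rmorphism k -> K}).

Lemma place_lring v : place io v -> lring v.
Proof.
move=> pv; have hv := place_hrel pv; split=> // a c Va c0.
have [[d Vd]|] := place_total pv a^-1.
  have a0 : a != 0 by apply: contraNneq c0 => a0; rewrite a0 in Va; rewrite (hrel0P hv Va).
  have := hrelM hv Va Vd; rewrite divff // => /(hrel_fun hv (hrel1 hv)) /esym h.
  by rewrite (_ : c^-1 = d) // -[d](mulKf c0) h mulr1.
by rewrite invrK => /(hrel_fun hv Va) e; rewrite e eqxx in c0.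
Qed.

Lemma place_max_coord v n (y : 'I_n.+1 -> K) : place io v -> (exists i, y i != 0) ->
  exists j, y j != 0 /\ forall i, fin v (y i / y j).
Proof.
move=> pv [i0 h0]; have V := place_lring pv.
suff: exists j, y j != 0 /\ forall i, i \in enum 'I_n.+1 -> fin v (y i / y j).
  by move=> [j [hj h]]; exists j; split=> // i; apply: h; rewrite mem_enum.
elim: (enum 'I_n.+1) => [|a s [j [hj h]]]; first by exists i0.
have [fa|vj] := place_total pv (y a / y j).
  by exists j; split=> // i; rewrite inE => /orP [/eqP ->|/h].
have [e|ya] := eqVneq (y a) 0.
  exists j; split=> // i; rewrite inE => /orP [/eqP ->|/h //].
  by rewrite e mul0r; exists 0; apply: (hrel0 V).
rewrite invf_div in vj; exists a; split=> // i; rewrite inE => /orP [/eqP ->|/h fi].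
  by rewrite divff //; exists 1; apply: (hrel1 V).
have -> : y i / y a = y i / y j * (y j / y a) by rewrite mulrA divfK.
by apply: (finM V) => //; exists 0.
Qed.

Lemma hrel_mmap (v : K -> k -> Prop) n (a : 'I_n -> K) c F : hrel v -> hconst io v ->
  (forall i, v (a i) (c i)) -> v (mmap io a F) F.@[c].
Proof.
move=> hv vc h; rewrite /meval /mmap; apply: (hrel_sum hv) => m _.
apply: (hrelM hv) => //; rewrite /mmap1; elim: (index_enum _) => [|i r IH].
  by rewrite !big_nil; apply: (hrel1 hv).
by rewrite !big_cons; apply: (hrelM hv) => //; apply: hrelX.
Qed.

End PlaceFacts.

Section Centers.
Variables (k : closedFieldType) (X : projVar k).
Local Notation K := (ffield X).
Local Notation io := (fconst X).
Local Notation point := (ppoint k (pdim X)).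
Local Notation y := (gpoint X).
Implicit Types (P Q : point) (f g : K) (v : K -> k -> Prop).

Definition center v P := on_var P /\ hle (val P) v.

Lemma vec_on_var v j (c : 'I_(pdim X).+1 -> k) e P : hrel v -> hconst io v -> y j != 0 ->
  (forall i, v (chart j i) (c i)) -> e != 0 -> (forall i, pcoord P i = e * c i) -> on_var P.
Proof.
move=> hv vc j0 hc e0 hP d F hF; rewrite (gval_chart j0 hF) => /eqP.
rewrite mulf_eq0 expf_eq0 (negPf j0) andbF /= => /eqP h.
have := hrel_mmap F hv vc hc; rewrite h => /(hrel0P hv) h'.
by rewrite (meval_scale hF hP) h' mulr0.
Qed.

Lemma center_ex v : place io v -> exists P, center v P.
Proof.
move=> pv; have [j [j0 /choice [c hc]]] := place_max_coord pv (gpoint_neq0 X).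
have V := place_lring pv; have vc := place_const pv.
have cj : c j != 0.
  by have := hc j; rewrite divff // => /(hrel_fun V (hrel1 V)) <-; rewrite oner_neq0.
have [P [e [e0 hP]]] := point_of_vec (ex_intro (fun i => is_true (c i != 0)) j cj).
exists P; have oP : on_var P by apply: (vec_on_var V vc j0 hc e0 hP).
split=> // f r [d [F [G [hF hG nG eF ->]]]].
have ev H : H \is d.-homog -> H.@[pcoord P] = e ^+ d * H.@[c].
  by move=> hH; rewrite /meval -mmap_homog //; apply: eq_mmap => // i; rewrite hP.
rewrite (gval_chart j0 hF) (gval_chart j0 hG) -mulf_div divff ?expf_neq0 // mul1r.
have nGc : G.@[c] != 0 by apply: contraNneq nG => h; rewrite ev // h mulr0.
have := hrelM V (hrel_mmap F V vc hc) (lr_inv V (hrel_mmap G V vc hc) nGc).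
rewrite (_ : F.@[c] / G.@[c] = r) //; apply: (canLR (mulfK nGc)).
by apply: (mulfI (expf_neq0 d e0)); rewrite mulrCA -!ev.
Qed.

Lemma center_uniq v P Q : place io v -> center v P -> center v Q -> P = Q.
Proof.
move=> pv [oP hP] [oQ hQ]; have V := place_lring pv; have [j e] := normalized_coord P.
have j1 : pcoord P j != 0 by rewrite e oner_neq0.
have vP i := hP _ _ (coord_val i oP j1).
have [z|nz] := eqVneq (pcoord Q j) 0.
  have [l el] := normalized_coord Q; have l1 : pcoord Q l != 0 by rewrite el oner_neq0.
  have := hrelM V (vP l) (hQ _ _ (coord_val j oQ l1)).
  rewrite /chart mulrA divfK ?(chart_neq0 oP e) // divff ?(chart_neq0 oQ el) //.
  by rewrite z mul0r mulr0 => /(max_one V).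
apply: (@point_prop _ _ _ _ (pcoord Q j)^-1) => i.
have := hrel_fun V (vP i) (hQ _ _ (coord_val i oQ nz)).
by rewrite e divr1 mulrC.
Qed.

Lemma center_place P : on_var P -> exists2 v, place io v & center v P.
Proof.
move=> oP; have [v pv h] := place_ext (lr_hrel (val_lring oP)) (@val_const _ _ P).
by exists v.
Qed.

(** An element finite at all places over the local ring is integral over it, and the ring is
    normal. *)
Lemma fin_places P f : on_var P -> good (val P) ->
  (forall v, place io v -> center v P -> fin v f) -> fin (val P) f.
Proof.
move=> oP [V nO fr [x [y [pxy dxy x0 y0]]]] h; apply: (normal V nO fr pxy dxy).
apply: (@place_integral _ _ io) => //; first exact: V.
  exact: val_const.
by move=> v pv hv; apply: h.
Qed.

End Centers.

Section Maps.
Variables (k : closedFieldType) (X Y : projVar k) (s : birat X Y).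
Local Notation io := (fconst X).
Implicit Types (P : ppoint k (pdim X)) (Q : ppoint k (pdim Y)).

Definition pull (v : ffield X -> k -> Prop) : ffield Y -> k -> Prop :=
  fun f c => v (bpull s f) c.

Lemma pull_place v : place io v -> place (fconst Y) (pull v).
Proof.
move=> pv; have hv := place_hrel pv; rewrite /pull; split.
- split=> [|a a' b b'|a a' b b'|c]; rewrite ?rmorph1 ?rmorphB ?rmorphM ?rmorph0.
  + exact: hrel1.
  + exact: hrelB.
  + exact: hrelM.
  + exact: hrel0P.
- by move=> c; rewrite bpull_const; apply: (place_const pv).
- by move=> f; rewrite fmorphV; apply: (place_total pv).
Qed.

(** A reformulation of [maps_to] without coordinates, in terms of residue maps; in this form
    definedness composes and transfers to places. *)
Definition dom P Q := [/\ on_var P, on_var Q & forall f c, val Q f c -> val P (bpull s f) c].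

Lemma dom_vec P l (r : 'I_(pdim Y).+1 -> k) : on_var P ->
  (forall j, val P (l * bpull s (gpoint Y j)) (r j)) -> (exists j, r j != 0) ->
  exists Q e, [/\ e != 0, forall j, pcoord Q j = e * r j & dom P Q].
Proof.
move=> oP hl [j rj]; have V := val_lring oP.
have [Q [e [e0 hQ]]] := point_of_vec (ex_intro (fun i => is_true (r i != 0)) j rj).
exists Q, e; split=> //.
have sg F : bpull s (gval F) = mmap io (fun i => bpull s (gpoint Y i)) F.
  rewrite /gval rmorph_mmap; apply: eq_mmap => // c; exact: bpull_const.
have vF F : val P (mmap io (fun i => l * bpull s (gpoint Y i)) F) F.@[r].
  by apply: hrel_mmap => //; [exact: V|exact: val_const].
have l0 : l != 0.
  apply: contraNneq rj => l0; have := hl j; rewrite l0 mul0r => h.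
  by rewrite (hrel0P V h).
have ev d H : H \is d.-homog -> H.@[pcoord Q] = e ^+ d * H.@[r].
  by move=> hH; rewrite /meval -mmap_homog //; apply: eq_mmap => // i; rewrite hQ.
split=> // [d F hF e1|f c [d [F [G [hF hG nG eF ->]]]]].
  have := vF F; rewrite (mmap_homog _ _ _ hF) -sg e1 rmorph0 mulr0 => /(hrel0P V) h.
  by rewrite (ev d) // h mulr0.
have nGr : G.@[r] != 0 by apply: contraNneq nG => h; rewrite (ev d) // h mulr0.
have := hrelM V (vF F) (lr_inv V (vF G) nGr).
rewrite !(mmap_homog _ _ _ hF) !(mmap_homog _ _ _ hG) -mulf_div divff ?expf_neq0 // mul1r.
rewrite -!sg -fmorph_div (_ : F.@[r] / G.@[r] = c) //; apply: (canLR (mulfK nGr)).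
by apply: (mulfI (expf_neq0 d e0)); rewrite mulrCA -!(ev d).
Qed.

Lemma maps_to_dom P Q : maps_to s P Q <-> dom P Q.
Proof.
split=> [[oP oQ [l hl]]|[oP oQ h]].
  have [j ej] := normalized_coord Q.
  have [||Q' [e [e0 hQ' dQ']]] := @dom_vec P l (pcoord Q) oP.
  - by move=> i; apply/(val_shift _ _ oP).
  - by exists j; rewrite ej oner_neq0.
  by rewrite (point_prop (P := Q) (Q := Q') (c := e^-1)) // => i; rewrite hQ' mulKf.
split=> //; have [j ej] := normalized_coord Q; have nj : pcoord Q j != 0 by rewrite ej oner_neq0.
exists (bpull s (gpoint Y j))^-1 => i; apply/(val_shift _ _ oP).
have := h _ _ (coord_val i oQ nj); rewrite ej divr1 /chart fmorph_div.
by rewrite mulrC.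
Qed.

Lemma dom_center v P Q : place io v -> center v P -> dom P Q -> center (pull v) Q.
Proof. by move=> pv [oP hv] [_ oQ h]; split=> // f c /h /hv. Qed.

Lemma dom_uniq P Q Q' : dom P Q -> dom P Q' -> Q = Q'.
Proof.
move=> h h'; have [oP _ _] := h; have [v pv cv] := center_place oP.
exact: (center_uniq (pull_place pv) (dom_center pv cv h) (dom_center pv cv h')).
Qed.

Lemma nb_dom P Q U : dom P Q -> nb Q U -> nb P (fun P' => exists2 Q', dom P' Q' & U Q').
Proof.
move=> dPQ [d [G [hG nG hU]]]; have /maps_to_dom [oP oQ [l hl]] := dPQ.
have vl j : val P (l * bpull s (gpoint Y j)) (pcoord Q j) by apply/(val_shift _ _ oP).
have V := val_lring oP; pose a j := l * bpull s (gpoint Y j).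
have [j ej] := normalized_coord Q.
have uj : vunit P (a j) by exists (pcoord Q j); [rewrite ej oner_neq0|exact: vl].
have uG : vunit P (mmap io a G).
  by exists G.@[pcoord Q] => //; apply: hrel_mmap => //; [exact: V|exact: val_const].
have fa := nb_all (fun i => nb_fin (ex_intro (val P (a i)) _ (vl i))).
apply: nbS (nbI fa (nbI (nb_unit oP uj) (nb_unit oP uG))) => P' o' [/choice [r hr] [[c c0 hc] [b b0 hb]]].
have V' := val_lring o'.
have [||Q' [e [e0 hQ' dQ']]] := @dom_vec P' l r o'; first exact: hr.
  by exists j; rewrite (hrel_fun V' (hr j) hc).
exists Q' => //; apply: hU; first by case: dQ'.
rewrite (meval_scale hG hQ').
rewrite mulf_neq0 ?expf_neq0 // (hrel_fun V' (hrel_mmap G V' (@val_const _ _ P') hr) hb) //.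
Qed.

(* Q lies over P in the closure of the graph of s. *)
Definition fiber P Q := exists v, [/\ place io v, center v P & center (pull v) Q].

(** Zariski's main theorem. If the fibre were finite, some hyperplane [el] would miss it. The ratios
    of the coordinates to [el] would then pull back to functions finite at every place centered at
    [P], hence regular at [P], and they would define [s] there. *)
Lemma zariski_main P : on_var P -> good (val P) -> ~ (exists Q, dom P Q) -> inf (fiber P).
Proof.
move=> oP gP nd t; apply: contrapT => no; apply: nd.
have ht v Q : place io v -> center v P -> center (pull v) Q -> Q \in t.
  by move=> pv cP cQ; apply: contrapT => /negP n; apply: no; exists Q => //; exists v.
have [c hc] := avoid_hyperplanes t; have V := val_lring oP.
pose el : ffield Y := \sum_i fconst Y (c i) * gpoint Y i.
pose L : {mpoly k[(pdim Y).+1]} := \sum_i c i *: 'X_i.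
have gL : gval L = el.
  rewrite /gval rmorph_sum /=; apply: eq_bigr => i _.
  by rewrite -[LHS]/(mmap _ _ _) mmapZ mmapX mmap1U.
have hL : L \is 1.-homog by apply: rpred_sum => i _; apply: dhomogZ; apply: coordX_homog.
have eL Q : L.@[pcoord Q] = \sum_i c i * pcoord Q i.
  by rewrite rmorph_sum /=; apply: eq_bigr => i _; rewrite mevalZ mevalXU.
have key v Q i : place io v -> center v P -> center (pull v) Q ->
    v (bpull s (gpoint Y i / el)) (pcoord Q i / L.@[pcoord Q]).
  move=> pv cP cQ; have [oQ hQ] := cQ; apply: hQ.
  have nL : L.@[pcoord Q] != 0 by rewrite eL; apply: hc; apply: ht pv cP cQ.
  by have := form_val oQ (coordX_homog k i) hL nL; rewrite mevalXU gvalX gL.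
have [v pv cv] := center_place oP; have [Q cQ] := center_ex (pull_place pv).
have nLQ : L.@[pcoord Q] != 0 by rewrite eL; apply: hc; apply: ht pv cv cQ.
have [||Q' [e [_ _ dQ']]] := @dom_vec P (bpull s el)^-1 (fun i => pcoord Q i / L.@[pcoord Q]) oP.
- move=> i; have [r Vr] : fin (val P) (bpull s (gpoint Y i / el)).
    apply: fin_places => // w pw cw; have [R cR] := center_ex (pull_place pw).
    by eexists; apply: key cR.
  rewrite mulrC -fmorph_div (hrel_fun (place_hrel pv) (key _ _ i pv cv cQ) (_ : v _ r)) //.
  exact: cv.2.
- have [j ej] := normalized_coord Q; exists j.
  by rewrite ej mul1r invr_eq0.
by exists Q'.
Qed.

(** [Q] belongs to the fibre when the residue maps at [P] and [Q] are compatible on the ring that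
    the two local rings generate. An incompatibility is a single relation with sum 0 whose values
    have sum [c <> 0], and it persists at the points near [Q]. *)
Lemma fiber_closed P : on_var P -> zclosed (fun Q => on_var Q /\ fiber P Q).
Proof.
move=> oP; apply: nb_zclosed => Q oQ nF; have V := val_lring oP; have W := val_lring oQ.
pose wf (l : seq ((ffield X * k) * (ffield Y * k))) :=
  forall t, t \in l -> val P t.1.1 t.1.2 /\ val Q t.2.1 t.2.2.
pose ev (l : seq ((ffield X * k) * (ffield Y * k))) := \sum_(t <- l) t.1.1 * bpull s t.2.1.
pose vl (l : seq ((ffield X * k) * (ffield Y * k))) := \sum_(t <- l) t.1.2 * t.2.2.
pose H f c := exists l, [/\ wf l, f = ev l & c = vl l].
have [hH|nH] := EM (forall c, H 0 c -> c = 0).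
  case: nF; have HP f c : val P f c -> H f c.
    move=> h; exists [:: ((f, c), (1, 1))]; split.
    - by move=> t; rewrite inE => /eqP -> /=; split=> //; apply: (hrel1 W).
    - by rewrite /ev big_seq1 /= rmorph1 mulr1.
    - by rewrite /vl big_seq1 /= mulr1.
  have HQ f c : val Q f c -> H (bpull s f) c.
    move=> h; exists [:: ((1, 1), (f, c))]; split.
    - by move=> t; rewrite inE => /eqP -> /=; split=> //; apply: (hrel1 V).
    - by rewrite /ev big_seq1 /= mul1r.
    - by rewrite /vl big_seq1 /= mul1r.
  have [||v pv hv] := @place_ext _ _ io H.
  - split=> //; first by apply: HP; apply: (hrel1 V).
      move=> _ _ _ _ [l [wl -> ->]] [l' [wl' -> ->]].
      exists (l ++ [seq ((- t.1.1, - t.1.2), t.2) | t <- l']); split.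
      + move=> t; rewrite mem_cat => /orP [/wl //|/mapP [t' /wl' [h h'] ->]] /=.
        by split=> //; apply: (hrelN V).
      + rewrite /ev big_cat big_map -sumrN; congr (_ + _).
        by apply: eq_bigr => t _ /=; rewrite mulNr.
      + rewrite /vl big_cat big_map -sumrN; congr (_ + _).
        by apply: eq_bigr => t _ /=; rewrite mulNr.
    move=> _ _ _ _ [l [wl -> ->]] [l' [wl' -> ->]].
    exists [seq ((t.1.1 * t'.1.1, t.1.2 * t'.1.2), (t.2.1 * t'.2.1, t.2.2 * t'.2.2)) | t <- l, t' <- l'].
    split.
    + move=> _ /allpairsP [[t t'] [/wl [h1 h2] /wl' [h3 h4] ->]] /=.
      by split; [apply: (hrelM V)|apply: (hrelM W)].
    + rewrite /ev big_allpairs_dep mulr_suml; apply: eq_bigr => t _; rewrite mulr_sumr.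
      by apply: eq_bigr => t' _ /=; rewrite rmorphM mulrACA.
    + rewrite /vl big_allpairs_dep mulr_suml; apply: eq_bigr => t _; rewrite mulr_sumr.
      by apply: eq_bigr => t' _ /=; rewrite mulrACA.
  - by move=> c; apply: HP; apply: val_const.
  - by exists v; split=> //; split=> // f c; [move/HP/hv|move/HQ/hv].
move/existsNP: nH => [c /not_implyP [[l [wl e0 ec]] c0]].
pose b := \sum_(t <- l) fconst Y t.1.2 * t.2.1.
have ub : vunit Q b.
  exists c; first exact/eqP.
  rewrite ec /b /vl big_seq [X in val Q _ X]big_seq; apply: (hrel_sum W) => t /wl [_ h].
  by apply: (hrelM W) => //; apply: val_const.
have fl : nb Q (fun Q' => forall t, t \in l -> fin (val Q') t.2.1).
  elim: (l) wl => [|t l' IH] wl; first by apply: nbT.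
  have [_ ht] := wl t (mem_head _ _).
  have wl' : wf l' by move=> t' h; apply: wl; rewrite inE h orbT.
  apply: nbS (nbI (nb_fin (ex_intro _ _ ht)) (IH wl')) => Q' _ [h h'] t'.
  by rewrite inE => /orP [/eqP ->|/h'].
apply: nbS (nbI fl (nb_unit oQ ub)) => Q' oQ' [fQ' [d d0 hd]] [v [pv [_ hP] [_ hQ]]].
have hv := place_hrel pv.
have : forall t, exists r, t \in l -> val Q' t.2.1 r.
  by move=> t; have [/fQ' [r hr]|] := EM (t \in l); [exists r|exists 0].
move=> /choice [r hr].
have e1 : v (ev l) (\sum_(t <- l) t.1.2 * r t).
  rewrite /ev big_seq [X in v _ X]big_seq; apply: (hrel_sum hv) => t ht.
  by apply: (hrelM hv); [apply: hP; have [] := wl t ht|apply: hQ; apply: hr].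
have e2 : val Q' b (\sum_(t <- l) t.1.2 * r t).
  rewrite /b big_seq [X in val _ _ X]big_seq; apply: (hrel_sum (val_lring oQ')) => t ht.
  by apply: (hrelM (val_lring oQ')); [apply: val_const|apply: hr].
rewrite -e0 in e1; have e3 := hrel0P hv e1.
by rewrite (hrel_fun (val_lring oQ') hd e2) e3 eqxx in d0.
Qed.

(* With [dom P Q] this says that s is a local isomorphism from P to Q. *)
Definition reflects P Q := forall f, fin (val P) (bpull s f) -> fin (val Q) f.

(** Let [g] be the gcd of the pulled-back parameters of [Q]. If it is not a unit, its zeros near [P]
    go to [Q]. If it is a unit, write a function [f] with regular pullback in lowest terms with
    denominator [b]: powers of the parameters of [Q] pull back into the ideal of [bpull s b], hence
    so do powers of the parameters of [P], and [depth2] makes [b] a unit. *)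
Lemma contracted P Q : good (val P) -> good (val Q) -> dom P Q -> ~ reflects P Q ->
  forall U, nb P U -> inf (fun R => U R /\ dom R Q).
Proof.
move=> gP gQ dPQ nr U nU; have [oP oQ hd] := dPQ.
have [V nO fr [u [w [puw duw u0 w0]]]] := gP; have [W nO' fr' [x [y [pxy dxy x0 y0]]]] := gQ.
have [Vx Vy gen] := pxy; pose h (i : 'I_2) := if i == ord0 then bpull s x else bpull s y.
have [|g [c [g0 hc pc]]] := gcd_exists V nO (h := h) fr puw.
  by exists ord0; rewrite /h eqxx fmorph_eq0.
have fc : forall i, fin (val P) (c i) by case: pc.
have Vh i : val P (h i) 0 by rewrite /h; case: ifP => _; apply: hd.
have fg : fin (val P) g.
  apply: (primitive_fin V puw duw pc) => i; rewrite -hc; by exists 0.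
have [Vg|[r r0 Vr]] := max_or_unit fg.
  have nU' := nb_dom dPQ (nbI (nbI (nb_fin (max_fin Vx)) (nb_fin (max_fin Vy))) (near_params oQ pxy)).
  have := zeros_inf oP gP Vg g0 (nbI (nbI nU (nb_all (fun i => nb_fin (fc i)))) nU').
  apply: infS => R [oR [[UR fcR] [Q' dRQ' [[fx fy] hQ']]] vR]; split=> //.
  have V' := val_lring oR; have Vh' i : val R (h i) 0 by rewrite hc mulrC; exact: (maxM V' (fcR i) vR).
  have [_ oQ' hd'] := dRQ'; suff <- : Q' = Q by [].
  have fx' z : fin (val Q') z -> val R (bpull s z) 0 -> val Q' z 0.
    by move=> [a ha] e; rewrite -(hrel_fun V' (hd' _ _ ha) e).
  apply: hQ'; apply: fx' => //; first exact: (Vh' ord0).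
  exact: (Vh' (lift ord0 ord0)).
case: nr => f ff; pose h' (i : 'I_2) := if i == ord0 then 1 else f.
have [|g' [c' [g'0 hc' pc']]] := gcd_exists W nO' (h := h') fr' pxy.
  by exists ord0; rewrite /h' eqxx oner_neq0.
pose b := c' ord0.
have b0 : b != 0.
  by apply/eqP => e; have := hc' ord0; rewrite -/b e mulr0 /h' eqxx => /eqP; rewrite oner_eq0.
have ef : c' (lift ord0 ord0) = f * b.
  have := hc' ord0; have := hc' (lift ord0 ord0); rewrite /h' eqxx /= => -> e1.
  by rewrite mulrAC -e1 mul1r.
have [fb fa] : fin (val Q) b /\ fin (val Q) (c' (lift ord0 ord0)).
  by have [fc' _] := pc'; split; apply: fc'.
have sfin z : fin (val Q) z -> fin (val P) (bpull s z) by move=> [a /hd]; exists a.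
have sb0 : bpull s b != 0 by rewrite fmorph_eq0.
have [Vb|[r' r'0 Vr']] := max_or_unit fb; last first.
  have -> : f = c' (lift ord0 ord0) * b^-1 by rewrite ef mulfK.
  by apply: (finM W) => //; apply: (unit_fin W Vr' r'0).
pose T z := fin (val P) (z / bpull s b).
have TD p q : T p -> T q -> T (p + q) by move=> hp hq; rewrite /T mulrDl; apply: (finD V).
have TM p q : fin (val P) p -> T q -> T (p * q) by move=> hp hq; rewrite /T -mulrA; apply: (finM V).
have [_ [M [hx hy]]] := pc'.
have Tz z : inspan (val Q) c' z -> T (bpull s z).
  move=> [a [fa' ->]]; rewrite big_ord_recl big_ord1 ef -/b mulrA -mulrDl rmorphM /T mulfK //.
  by rewrite rmorphD rmorphM; apply: (finD V); [|apply: (finM V)]; auto.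
have Tx := Tz _ hx; have Ty := Tz _ hy; rewrite !rmorphXn in Tx Ty.
have gi : fin (val P) g^-1 by apply: (unit_fin V Vr r0).
have [_ [N [hu hw]]] := pc.
have Tu z : inspan (val P) c (z ^+ N) -> T (z ^+ (N * (M + M))).
  move=> [a [fa' e]]; rewrite exprM e big_ord_recl big_ord1.
  have ci i : c i = h i / g by rewrite hc mulrC mulKf.
  have fxy t : fin (val Q) t -> fin (val P) (bpull s t) := @sfin t.
  rewrite !ci; apply: (pow_sum V TD TM).
  - by do !apply: (finM V) => //; apply: fxy; exists 0.
  - by do !apply: (finM V) => //; apply: fxy; exists 0.
  - have -> : a ord0 * (h ord0 / g) = a ord0 / g * bpull s x by rewrite /h eqxx mulrCA mulrC mulrAC.
    by rewrite exprMn; apply: TM => //; apply: (finX V); apply: (finM V).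
  - have -> : a (lift ord0 ord0) * (h (lift ord0 ord0) / g) = a (lift ord0 ord0) / g * bpull s y.
      by rewrite /h /= mulrCA mulrC mulrAC.
    by rewrite exprMn; apply: TM => //; apply: (finX V); apply: (finM V).
have [d Vd] : fin (val P) (bpull s b)^-1 by apply: (duw _ (N * (M + M))%N); apply: Tu.
have := hrelM V (hd _ _ Vb) Vd; rewrite divff // mul0r => /(max_one V) //.
Qed.

End Maps.

(** * Iterates of a stable map *)

Section Iterates.
Variables (k : closedFieldType) (X : projVar k) (sigma : birat X X).
Local Notation it := (birat_iter sigma).

Lemma itS n f : bpull (it n.+1) f = bpull (it n) (bpull sigma f).
Proof. by []. Qed.

Lemma itD m n f : bpull (it (m + n)) f = bpull (it m) (bpull (it n) f).
Proof. by elim: n f => [|n IH] f; rewrite ?addn0 // addnS !itS IH. Qed.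

Lemma itSr n f : bpull (it n.+1) f = bpull sigma (bpull (it n) f).
Proof. by rewrite -add1n itD. Qed.

End Iterates.

Lemma dom_comp (k : closedFieldType) (X Y Z : projVar k) (s : birat X Y) (t : birat Y Z)
    (u : birat X Z) P Q R : dom s P Q -> dom t Q R ->
  (forall f, bpull u f = bpull s (bpull t f)) -> dom u P R.
Proof.
by move=> [oP _ h] [_ oR h'] e; split=> // f c /h' /h; rewrite e.
Qed.

Section Stable.
Variables (k : closedFieldType) (X : projVar k) (sigma : birat X X).
Local Notation K := (ffield X).
Local Notation point := (ppoint k (pdim X)).
Local Notation it := (birat_iter sigma).
Hypothesis sX : surface X.
Implicit Types P Q R : point.

Lemma gX P : on_var P -> good (val P).
Proof. exact: surface_good. Qed.

Lemma dom_id P : on_var P -> dom (it 0) P P.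
Proof. by []. Qed.

Lemma dom_it m n P Q R : dom (it m) P Q -> dom (it n) Q R -> dom (it (m + n)) P R.
Proof. by move=> h h'; apply: dom_comp h h' _ => f; rewrite itD. Qed.

Lemma fundamentalP P : on_var P -> fundamental sigma P <-> ~ exists Q, dom sigma P Q.
Proof.
move=> oP; split=> [[_ h] [Q d]|h]; first by apply: h; exists Q; apply/maps_to_dom.
by split=> // -[Q /maps_to_dom d]; apply: h; exists Q.
Qed.

(** The preimages of [Q] lie in the proper closed set where the numerator [F] of a pulled-back
    parameter vanishes. An irreducible closed subset that contains infinitely many of them is a
    curve, and going to [Q] is a closed condition on it. *)
Lemma not_stable_curve n Q : on_var Q -> inf (fun R => dom (it n) R Q) ->
  exists C, curve C /\ forall R, proper_image (it n) C R <-> R = Q.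
Proof.
move=> oQ infS0; have [V nO _ [x [_ [[Vx _ _] _ x0 _]]]] := gX oQ.
have [d [F [G [hF hG nG0 eb]]]] := gpoint_gen (bpull (it n) x).
rewrite -!/(gval _) in nG0 eb.
have F0 : gval F != 0 by apply: contraNneq x0 => h; rewrite h mul0r in eb; move/eqP: eb; rewrite fmorph_eq0.
have vF R : dom (it n) R Q -> F.@[pcoord R] = 0.
  move=> [oR _ h]; have := h _ _ Vx; rewrite eb => hv; apply/eqP; apply: contrapT => /negP nF.
  have := hrelM (val_lring oR) hv (form_val oR hG hF nF); rewrite mulf_div mul0r.
  by rewrite [gval G * _]mulrC divff ?mulf_neq0 // => /(max_one (val_lring oR)).
pose Z0 := fun R : point => on_var R /\ F.@[pcoord R] = 0.
have cZ0 : zclosed Z0 by apply: zclosedI; [exact: zclosed_on_var|exact: form_zclosed hF].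
have i0 : inf (fun R => dom (it n) R Q /\ Z0 R).
  by apply: infS infS0 => R h; split=> //; split; [case: h|apply: vF].
have [C [iC sC infC mC]] := inf_irreducible cZ0 i0.
have [P' [oP' _ nP']] := form_nonzero oQ hF F0 (nbT Q (fun _ _ => I)).
exists C; split.
  apply: (inf_curve (R := P')) => //; first by move=> R /sC [].
    by apply: infS infC => R [].
  by move=> /sC [_ h]; rewrite h eqxx in nP'.
pose A R := on_var R /\ forall Q', dom (it n) R Q' -> Q' = Q.
have cA : zclosed A.
  apply: nb_zclosed => R oR /existsNP [Q' /not_implyP [dR ne]]; have [_ oQ' _] := dR.
  apply: nbS (nb_dom dR (nb_neq oQ' ne)) => R' _ [Q'' d' ne'] h.
  by apply: ne'; apply: h.
have sCA : psub C A.
  apply: mC cA _; apply: infS infC => R [dR CR]; split=> //; split=> //; split; first by case: dR.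
  by move=> Q' d'; apply: dom_uniq d' dR.
move=> R; split=> [h|->].
  apply: (h (fun R => R = Q) (zclosed1 Q)) => R' [P CP /maps_to_dom dP].
  by have [_ w] := sCA P CP; apply: w.
move=> Z cZ hZ; have [P [dP CP] _] := infC [::].
by apply: hZ; exists P => //; apply/maps_to_dom.
Qed.

(** The curve that [sigma^n] contracts to [Q] is contracted by [sigma^(n+j)] to the [j]-th image of
    [Q], which therefore is not fundamental. *)
Lemma stable_orbit n Q : stable sigma -> (1 <= n)%N -> on_var Q ->
  inf (fun R => dom (it n) R Q) -> forall j, exists2 Q', dom (it j) Q Q' & exists Q'', dom sigma Q' Q''.
Proof.
move=> st n1 oQ iQ.
have nf Q' m : (1 <= m)%N -> on_var Q' -> inf (fun R => dom (it m) R Q') -> exists Q'', dom sigma Q' Q''.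
  move=> m1 oQ' i'; apply: contrapT => h; apply: st; have [C [cC hC]] := not_stable_curve oQ' i'.
  by exists C, m, Q'; split=> //; apply/fundamentalP.
have nd j Q' : dom (it j) Q Q' -> exists Q'', dom sigma Q' Q''.
  move=> dj; apply: (nf Q' (n + j)%N); first by rewrite addn_gt0 n1.
    by case: dj.
  by apply: infS iQ => R dR; apply: dom_it dj.
elim=> [|j [Q' dj [Q'' d']]]; first by exists Q; [exact: dom_id|apply: (nd 0%N); exact: dom_id].
have dj1 : dom (it j.+1) Q Q'' by rewrite -addn1; apply: dom_it dj _.
by exists Q''; last exact: nd dj1.
Qed.

(** A form of [primitive] that mentions no parameters, so that it can be compared at different
    points. *)
Definition prim P m (c : 'I_m -> K) := (forall i, fin (val P) (c i)) /\
  forall z, val P z 0 -> exists N, inspan (val P) c (z ^+ N).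

Lemma primitive_prim P m x y (c : 'I_m -> K) : on_var P -> params (val P) x y ->
  primitive (val P) x y c -> prim P c.
Proof.
move=> oP [Vx Vy gen] [fc [N [hx hy]]]; have V := val_lring oP; split=> // z /gen [a [b [fa fb ->]]].
exists (N + N)%N; apply: (@pow_sum _ _ (val P) (inspan (val P) c)) => //.
- by move=> u v; apply: inspanD.
- by move=> u v; apply: inspanM.
- by apply: (finM V) => //; exists 0.
- by apply: (finM V) => //; exists 0.
- by rewrite exprMn; apply: inspanM => //; apply: finX.
- by rewrite exprMn; apply: inspanM => //; apply: finX.
Qed.

Lemma prim_primitive P m x y (c : 'I_m -> K) : on_var P -> params (val P) x y ->
  prim P c -> primitive (val P) x y c.
Proof.
move=> oP [Vx Vy gen] [fc hc]; have V := val_lring oP; split=> //.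
have [N hN] := hc _ Vx; have [M hM] := hc _ Vy; exists (N + M)%N.
by split; [rewrite addnC exprD|rewrite exprD]; apply: inspanM => //; apply: finX => //; exists 0.
Qed.

Lemma prim_fin P m (c : 'I_m -> K) w : on_var P -> prim P c ->
  (forall i, fin (val P) (w * c i)) -> fin (val P) w.
Proof.
move=> oP pc; have [V nO _ [x [y [pxy dxy _ _]]]] := gX oP.
exact: (primitive_fin V pxy dxy (prim_primitive oP pxy pc)).
Qed.

Lemma prim_unit P m (c : 'I_m -> K) i : on_var P -> (forall i, fin (val P) (c i)) ->
  vunit P (c i) -> prim P c.
Proof.
move=> oP fc [r r0 Vr]; have V := val_lring oP; split=> // z Vz; exists 1%N; rewrite expr1.
have -> : z = z * (c i)^-1 * c i by rewrite divfK //; apply: (unit_neq0 V Vr r0).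
apply: inspanM; [exact: V| |exact: inspan_mem].
by apply: (finM V); [exists 0|apply: (unit_fin V Vr r0)].
Qed.

Lemma prim_near P m (c : 'I_m -> K) : on_var P -> prim P c ->
  nb P (fun P' => prim P' c /\ (P' <> P -> exists i, vunit P' (c i))).
Proof.
move=> oP pc; have [V nO _ [x [y [pxy dxy _ _]]]] := gX oP.
apply: nbS (prim_nb oP pxy (prim_primitive oP pxy pc)) => P' oP' [fc h]; split=> //.
have [->|ne] := EM (P' = P); first by [].
by have [i u] := h ne; apply: prim_unit u.
Qed.

(* g generates the stalk at P of the invertible sheaf that agrees with the ideal
   of w off finitely many points. *)
Definition gcdat P m (w : 'I_m -> K) g := g != 0 /\ prim P (fun i => w i / g).

Lemma gcdat_ex P m (w : 'I_m -> K) : on_var P -> (exists i, w i != 0) -> exists g, gcdat P w g.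
Proof.
move=> oP hw; have [V nO fr [x [y [pxy dxy _ _]]]] := gX oP.
have [g [c [g0 hc pc]]] := gcd_exists V nO fr pxy hw.
exists g; split=> //; have -> : (fun i => w i / g) = c.
  by apply: funext => i; rewrite hc mulrC mulKf.
exact: primitive_prim pc.
Qed.

Lemma gcdat_fin P m (w : 'I_m -> K) g z : on_var P -> gcdat P w g ->
  (forall i, fin (val P) (z * w i)) -> fin (val P) (z * g).
Proof.
move=> oP [g0 pc] h; apply: (prim_fin oP pc) => i.
by have -> : z * g * (w i / g) = z * w i by field.
Qed.

Lemma gcdat_uniq P m (w : 'I_m -> K) g g' : on_var P -> gcdat P w g -> gcdat P w g' ->
  fin (val P) (g / g').
Proof.
move=> oP hg [g'0 [f' _]]; rewrite mulrC; apply: (gcdat_fin oP hg) => i.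
by rewrite mulrC; apply: f'.
Qed.

Lemma gcdat_near P m (w : 'I_m -> K) g : on_var P -> gcdat P w g ->
  nb P (fun P' => gcdat P' w g /\ (P' <> P -> exists i, vunit P' (w i / g))).
Proof.
move=> oP [g0 pc]; apply: nbS (prim_near oP pc) => P' oP' [pc' h]; split=> //.
Qed.

Lemma vunit_gcdat P m (w : 'I_m -> K) i : on_var P -> w i != 0 ->
  (forall l, fin (val P) (w l / w i)) -> gcdat P w (w i).
Proof.
move=> oP w0 h; split=> //; apply: (prim_unit (i := i)) => //.
exists 1; rewrite ?oner_neq0 // divff //; apply: (hrel1 (val_lring oP)).
Qed.

(** Divided by their gcd at [P], the coordinates of [s] have no common zero near [P] except possibly
    [P]. *)
Lemma dom_near (Y : projVar k) (s : birat X Y) P : on_var P ->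
  nb P (fun P' => P' <> P -> exists Q : ppoint k (pdim Y), dom s P' Q).
Proof.
move=> oP; pose w i := bpull s (gpoint Y i).
have [|g hg] := @gcdat_ex P _ w oP.
  by have [i hi] := gpoint_neq0 Y; exists i; rewrite fmorph_eq0.
apply: nbS (gcdat_near oP hg) => P' oP' [[g0 [/choice [r hr] _]] h] /h [i [c c0 hc]].
have [||Q [e [_ _ dQ]]] := @dom_vec _ _ _ s P' g^-1 r oP'; last by exists Q.
  by move=> j; rewrite mulrC; apply: hr.
by exists i; rewrite (hrel_fun (val_lring oP') (hr i) hc).
Qed.

Lemma fund_finite (Y : projVar k) (s : birat X Y) : exists t : seq point,
  forall P, on_var P -> ~ (exists Q : ppoint k (pdim Y), dom s P Q) -> P \in t.
Proof.
apply: discrete_finite => P oP; apply: nbS (dom_near s oP) => P' _ h /h d; tauto.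
Qed.

End Stable.

(** * Pullbacks of invertible sheaves *)

Section Pullbacks.
Variables (k : closedFieldType) (X : projVar k) (sigma : birat X X) (L : subsheaf X).
Local Notation K := (ffield X).
Local Notation point := (ppoint k (pdim X)).
Local Notation it := (birat_iter sigma).
Hypothesis sX : surface X.
Hypothesis iL : invertible L.
Implicit Types P Q R : point.

Lemma invertible_mod P a b : on_var P -> fin (val P) a -> L P b -> L P (a * b).
Proof.
move=> oP fa; have [g g0 [V [_ VP h]]] := iL oP.
move=> /(h P oP VP) /fin_regular fb; apply/(h P oP VP)/fin_regular.
by rewrite -mulrA; apply: (finM (val_lring oP)).
Qed.

Lemma pullback_id P s : on_var P -> pullback (it 0) L P s <-> L P s.
Proof.
move=> oP; have ps Q : on_var Q -> forall z, pull_stalk (it 0) L Q Q z <-> L Q z.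
  move=> oQ z; split=> [[a [b [/fin_regular fa Lb ->]]]|Lz]; first exact: invertible_mod.
  exists 1, z; rewrite mul1r; split=> //; apply/fin_regular; exists 1.
  exact: hrel1 (val_lring oQ).
have dP : maps_to (it 0) P P by apply/maps_to_dom; apply: dom_id.
split=> [[M [[_ hM] MP]]|LP]; first by apply/(ps P oP)/(hM P P dP).
exists L; split=> //; split=> // P' Q' d z; have [oP' oQ' _] := d.
have <- : P' = Q' by move/maps_to_dom: d => d; apply: dom_uniq (dom_id sigma oP') d.
by rewrite ps.
Qed.

Lemma twist1 P s : on_var P -> twist L sigma 1 P s <-> L P s.
Proof.
move=> oP; split=> [[a [b [/fin_regular fa /(pullback_id _ oP) Lb ->]]]|Ls].
  exact: invertible_mod.
exists 1, s; rewrite mul1r; split=> //; last exact/(pullback_id _ oP).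
by apply/fin_regular; exists 1; apply: hrel1 (val_lring oP).
Qed.

(** Finitely many global sections such that at every point one of them generates the stalk;
    computations with [L] are carried out on them. *)
Definition gens m (h : 'I_m -> K) := (forall P i, on_var P -> L P (h i)) /\
  forall P, on_var P -> exists2 i, h i != 0 & forall s, L P s <-> fin (val P) (s / h i).

Lemma gens_ex : globally_generated (twist L sigma 1) -> exists m (h : 'I_m -> K), gens h.
Proof.
move=> gg; pose T (G : {mpoly k[(pdim X).+1]}) := exists h0 : K, [/\ h0 != 0,
  forall P, on_var P -> L P h0 & forall P, on_var P -> G.@[pcoord P] != 0 ->
  forall s, L P s <-> fin (val P) (s / h0)].
have [P oP|s [hs cs]] := @qcompact _ X T.
  have [g g0 [V [oV VP hg]]] := iL oP; have W := val_lring oP.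
  have Lg : L P g.
    by apply/(hg P oP VP)/fin_regular; exists 1; rewrite divff //; apply: (hrel1 W).
  have [m [a [h [fa gh eg]]]] := gg P oP g (proj2 (twist1 g oP) Lg).
  have Lh i P' : on_var P' -> L P' (h i) by move=> o'; apply/(twist1 _ o'); apply: gh.
  have fh i : fin (val P) (h i / g) by apply/fin_regular/(hg P oP VP); apply: Lh.
  have [i ui] : exists i, vunit P (h i / g).
    apply: contrapT => no; apply: (max_one W).
    have -> : 1 = \sum_i a i * (h i / g) by rewrite -(divff g0) {1}eg mulr_suml; apply: eq_bigr => i _; rewrite mulrA.
    apply: (max_sum W) => i _; apply: (maxM W); first exact/fin_regular.
    by apply: fin_nonunit => // u; apply: no; exists i.
  have h0 : h i != 0 by case: ui => c c0 /(unit_neq0 W) /(_ c0); apply: contraNneq => ->; rewrite mul0r.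
  have [d [G [_ nG hG]]] := nbI (nb_zopen oV VP) (nb_unit oP ui).
  exists G; split=> //; exists (h i); split=> // [P' o'|P' o' n' s]; first exact: Lh.
  have [VP' [c c0 Vc]] := hG P' o' n'; have W' := val_lring o'.
  rewrite (hg P' o' VP') fin_regular; split=> fs.
    have -> : s / h i = s / g * (h i / g)^-1 by field; rewrite h0 g0.
    by apply: (finM W') => //; apply: (unit_fin W' Vc c0).
  have -> : s / g = s / h i * (h i / g) by rewrite mulrA divfK.
  by apply: (finM W') => //; exists c.
have /choice [hh hhP] : forall G, exists h0 : K, G \in s -> [/\ h0 != 0,
    forall P, on_var P -> L P h0 & forall P, on_var P -> G.@[pcoord P] != 0 ->
    forall s, L P s <-> fin (val P) (s / h0)].
  by move=> G; have [/hs [h0 h]|n] := EM (G \in s); [exists h0|exists 0].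
exists (size s), (fun i => hh (nth 0 s i)); split=> [P i oP|P oP].
  by have [] := hhP _ (mem_nth 0 (ltn_ord i)) => _ h _; apply: h.
have [G hG nG] := cs P oP; have lt : (index G s < size s)%N by rewrite index_mem.
by exists (Ordinal lt); rewrite /= nth_index //; have [h0 _ h] := hhP G hG; last exact: h.
Qed.

Variables (m : nat) (h : 'I_m -> K).
Hypothesis hL : gens h.
Definition wt t i := bpull (it t) (h i).

Lemma wtE t i : wt t i = bpull (it t) (h i).
Proof. by []. Qed.

Lemma wt_neq0 P t : on_var P -> exists i, wt t i != 0.
Proof. by move=> /hL.2 [i h0 _]; exists i; rewrite fmorph_eq0. Qed.

Lemma gcdwt_ex P t : on_var P -> exists g, gcdat P (wt t) g.
Proof. by move=> oP; apply: gcdat_ex => //; apply: wt_neq0 oP. Qed.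

Lemma gcdwt_dom P Q t i : dom (it t) P Q -> h i != 0 ->
  (forall s, L Q s <-> fin (val Q) (s / h i)) -> gcdat P (wt t) (wt t i).
Proof.
move=> [oP oQ hd] h0 hi; apply: vunit_gcdat => //; first by rewrite fmorph_eq0.
move=> l; have [c Vc] := (hi (h l)).1 (hL.1 Q l oQ).
by exists c; rewrite /wt -fmorph_div; apply: hd.
Qed.

Lemma nb_zopen_sub P U : nb P U -> exists V, [/\ zopen V, V P &
  forall P', on_var P' -> V P' -> U P'].
Proof.
move=> [d [G [hG nG hU]]]; exists (fun P' => G.@[pcoord P'] != 0); split=> //.
exists (fun F => F = G) => P'; split=> [/negP|/(_ d G hG erefl) -> /eqP //].
by rewrite negbK => /eqP h0 _ _ _ ->.
Qed.

(** Near [P] but away from it the map is defined, and the gcd generates any candidate for the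
    pullback; [hartogs] then compares the generators at [P]. Conversely, the gcds at all points
    define an invertible sheaf that is a candidate. *)
Lemma pullback_gcd P t g s : on_var P -> gcdat P (wt t) g ->
  pullback (it t) L P s <-> fin (val P) (s / g).
Proof.
move=> oP hg; have W := val_lring oP; have g0 := hg.1; split=> [[M [[iM hM] MP]]|fs].
  have [q q0 [V [oV VP hV]]] := iM P oP.
  have nP : nb P (fun P' => P' <> P -> fin (val P') (g / q) /\ fin (val P') (q / g)).
    apply: nbS (nbI (nb_zopen oV VP) (nbI (gcdat_near sX oP hg) (dom_near sX (it t) oP))).
    move=> P' o' [VP' [[[_ [fw _]] hu] hd]] ne; have W' := val_lring o'.
    have [Q' d'] := hd ne; have [i [c c0 Vc]] := hu ne; have [_ oQ' dQ'] := d'.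
    have hM' := hM P' Q' (proj2 (maps_to_dom _ _ _) d').
    have w0 : wt t i != 0 by have := unit_neq0 W' Vc c0; apply: contraNneq => ->; rewrite mul0r.
    split.
      apply/fin_regular/(hV P' o' VP')/hM'; exists (wt t i / g)^-1, (h i); split.
      - by apply/fin_regular; apply: (unit_fin W' Vc c0).
      - exact: hL.1.
      - by rewrite invf_div -/(wt t i) divfK.
    have /hM' [a [b [/fin_regular fa Lb ->]]] : M P' q.
      by apply/(hV P' o' VP')/fin_regular; exists 1; rewrite divff //; apply: (hrel1 W').
    have [l hl0 hl] := hL.2 _ oQ'; have [r Vr] := (hl b).1 Lb.
    have -> : a * bpull (it t) b / g = a * bpull (it t) (b / h l) * (wt t l / g).
      by rewrite /wt fmorph_div; field; rewrite g0 fmorph_eq0.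
    by apply: (finM W') => //; apply: (finM W') => //; exists r; apply: dQ'.
  have fq : fin (val P) (q / g).
    by apply: hartogs (gX sX oP) _ => //; apply: nbS nP => P' _ w ne; have [] := w ne.
  move/(hV P oP VP)/fin_regular: MP => MP.
  have -> : s / g = s / q * (q / g) by rewrite mulrA divfK.
  exact: (finM W).
pose M P s := exists2 g, gcdat P (wt t) g & fin (val P) (s / g).
have MP P' g' z : on_var P' -> gcdat P' (wt t) g' -> M P' z <-> fin (val P') (z / g').
  move=> o' hg'; split=> [[g1 hg1 f1]|f1]; last by exists g'.
  have -> : z / g' = z / g1 * (g1 / g') by rewrite mulrA divfK //; exact: hg1.1.
  by apply: (finM (val_lring o')) => //; apply: (gcdat_uniq sX o' hg1 hg').
exists M; split; last by exists g.
split.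
  move=> P' o'; have [g' hg'] := gcdwt_ex t o'; exists g'; first exact: hg'.1.
  have [V [oV VP hV]] := nb_zopen_sub (gcdat_near sX o' hg').
  exists V; split=> // P1 o1 /(hV _ o1) [hg1 _] z; rewrite fin_regular; exact: MP.
move=> P' Q' /maps_to_dom d' z; have [o' oQ' dQ'] := d'; have W' := val_lring o'.
have [i hi0 hi] := hL.2 _ oQ'; have hg' := gcdwt_dom d' hi0 hi.
rewrite (MP _ _ _ o' hg'); split=> [fz|[a [b [/fin_regular fa Lb ->]]]].
  exists (z / wt t i), (h i); split; [exact/fin_regular|exact: hL.1|by rewrite divfK //; exact: hg'.1].
have [r Vr] := (hi b).1 Lb.
rewrite -mulrA /wt -fmorph_div; apply: (finM W') => //; exists r; exact: dQ'.
Qed.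

Lemma twist_gcd P n (g : nat -> K) s : on_var P ->
  (forall t, (t < n)%N -> gcdat P (wt t) (g t)) ->
  twist L sigma n P s <-> fin (val P) (s / \prod_(t < n) g t).
Proof.
move=> oP; elim: n s => [|n IH] s hg; first by rewrite big_ord0 divr1 /=; apply: fin_regular.
have {}IH := fun z => IH z (fun t lt => hg t (ltnW lt)).
have gn := hg n (ltnSn n); have W := val_lring oP; rewrite big_ord_recr /=.
have p0 : \prod_(t < n) g t != 0.
  by apply/prodf_neq0 => t _; exact: (hg t (ltnW (ltn_ord t))).1.
split=> [[a [b [/IH fa /(pullback_gcd _ oP gn) fb ->]]]|fs].
  by rewrite -mulf_div; apply: (finM W).
exists (s / g n), (g n); split; last by rewrite divfK //; exact: gn.1.
  by apply/IH; rewrite -mulrA -invfM mulrC [g n * _]mulrC mulrC.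
by apply/(pullback_gcd _ oP gn); rewrite divff; [exists 1; exact: (hrel1 W)|exact: gn.1].
Qed.

Hypothesis st : stable sigma.

(* If [sigma^i] contracted a curve through [P] to [Q], stability would make
   every [sigma^t] defined at [Q], so no common factor can appear. *)
Lemma gcdat_pull P Q i t g : dom (it i) P Q -> gcdat Q (wt t) g ->
  gcdat P (wt (i + t)) (bpull (it i) g).
Proof.
move=> d [g0 [fc pc]]; have [oP oQ hd] := d; have W := val_lring oP; have V := val_lring oQ.
have [i0|i1] := posnP i.
  have eQ : P = Q by rewrite i0 in d; apply: dom_uniq (dom_id sigma oP) d.
  by rewrite i0 add0n eQ.
pose c l := wt t l / g; pose sc l := bpull (it i) (c l).
have esc l : wt (i + t) l / bpull (it i) g = sc l by rewrite /sc fmorph_div /wt itD.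
have fsc l : fin (val P) (sc l) by have [r /hd hr] := fc l; exists r.
have [l0 hl0] := wt_neq0 t oQ.
have [|y [y0 py]] := @gcdat_ex _ _ sX P _ sc oP.
  by exists l0; rewrite fmorph_eq0 mulf_neq0 ?invr_eq0.
have fy : fin (val P) y.
  by apply: (prim_fin sX oP py) => l; rewrite mulrC divfK.
split; first by rewrite fmorph_eq0.
rewrite (_ : (fun l => _) = sc); last by apply: funext => l; rewrite esc.
have [Vy|[r r0 Vr]] := max_or_unit fy; last first.
  split=> // z /py.2 [N [a [fa ez]]]; exists N, (fun l => a l / y); split=> [l|].
    by apply: (finM W) => //; apply: (unit_fin W Vr r0).
  by rewrite ez; apply: eq_bigr => l _; rewrite mulrA mulrAC.
have pcQ : prim Q c by split.
have iR : inf (fun R => dom (it i) R Q).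
  have nU := nbI (nb_all (fun l => nb_fin (py.1 l))) (nb_dom d (prim_near sX oQ pcQ)).
  apply: infS (zeros_inf oP (gX sX oP) Vy y0 nU) => R [oR [fR [Q' dR [[fQ' _] hQ']]] vR].
  suff <- : Q' = Q by [].
  apply: contrapT => /hQ' [l [b b0 Vb]]; have [_ _ hR] := dR; have WR := val_lring oR.
  have := maxM WR (fR l) vR; rewrite divfK // => h0.
  by rewrite (hrel_fun WR (hR _ _ Vb) h0) eqxx in b0.
have [Q' dQ' _] := stable_orbit sX st i1 oQ iR t; have [_ oQ' _] := dQ'.
have [l hl hLl] := hL.2 _ oQ'; have hg' := gcdwt_dom dQ' hl hLl.
have fgl := gcdat_uniq sX oQ (conj g0 (conj fc pc)) hg'.
have [b0 Vb] := fgl; have [b1 Vb1] := fc l.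
have b10 : b1 != 0.
  apply/eqP => e; have := hrelM V Vb Vb1; rewrite mulf_div [g * _]mulrC divff; last first.
    by rewrite mulf_neq0 //; exact: hg'.1.
  by rewrite e mulr0; apply: (max_one V).
have := maxM W (py.1 l) Vy; rewrite divfK // => h0.
by move: b10; rewrite (hrel_fun W (hd _ _ Vb1) h0) eqxx.
Qed.

(* The sections of L_j^e: the product of the gcds generates L_j. *)
Definition sec e j b := forall P g, on_var P -> (forall t, (t < j)%N -> gcdat P (wt t) (g t)) ->
  fin (val P) (b / (\prod_(t < j) g t) ^+ e).

Lemma global_sec j b : global_section (twist L sigma j) b <-> sec 1 j b.
Proof.
split=> [hb P g oP hg|hb P oP _].
  by rewrite expr1; apply/(twist_gcd _ oP hg); apply: hb.
have /choice [g hg] : forall t, exists g, gcdat P (wt t) g by move=> t; apply: gcdwt_ex.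
apply/(twist_gcd (n := j) (g := g) _ oP) => [t _|]; first exact: hg.
by have := hb P g oP (fun t _ => hg t); rewrite expr1.
Qed.

(** Where [sigma^i] is defined, stability carries gcds at the image to gcds at the point. The points
    left over are isolated, and [hartogs] extends across them. *)
Lemma sec_pull e i j b P g : sec e j b -> on_var P ->
  (forall t, (t < j)%N -> gcdat P (wt (i + t)) (g t)) ->
  fin (val P) (bpull (it i) b / (\prod_(t < j) g t) ^+ e).
Proof.
move=> hb oP hg.
have main P' : on_var P' -> (forall t, (t < j)%N -> gcdat P' (wt (i + t)) (g t)) ->
    (exists Q, dom (it i) P' Q) -> fin (val P') (bpull (it i) b / (\prod_(t < j) g t) ^+ e).
  move=> o' hg' [Q d]; have [_ oQ hd] := d; have W' := val_lring o'.
  have /choice [q hq] : forall t, exists q, gcdat Q (wt t) q by move=> t; apply: gcdwt_ex.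
  have [r /hd Vr] := hb Q q oQ (fun t _ => hq t).
  have p0 : \prod_(t < j) bpull (it i) (q t) != 0.
    by apply/prodf_neq0 => t _; rewrite fmorph_eq0; exact: (hq t).1.
  have g0 : \prod_(t < j) g t != 0 by apply/prodf_neq0 => t _; exact: (hg' t (ltn_ord t)).1.
  rewrite fmorph_div rmorphXn rmorph_prod /= in Vr.
  have -> : bpull (it i) b / (\prod_(t < j) g t) ^+ e = bpull (it i) b / (\prod_(t < j) bpull (it i) (q t)) ^+ e *
      (\prod_(t < j) (bpull (it i) (q t) / g t)) ^+ e.
    by rewrite prodf_div expr_div_n mulrA divfK // expf_neq0.
  apply: (finM W'); first by exists r.
  apply: (finX W'); apply: (fin_prod W') => t _.
  by apply: (gcdat_uniq sX o' (gcdat_pull d (hq t))); apply: hg'.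
apply: hartogs (gX sX oP) _ => //.
have n1 : nb P (fun P' => forall t, (t < j)%N -> gcdat P' (wt (i + t)) (g t)).
  apply: nbS (@nb_all _ _ P j (fun t P' => gcdat P' (wt (i + t)) (g t)) _).
    by move=> P' _ w t lt; apply: (w (Ordinal lt)).
  by move=> t; apply: nbS (gcdat_near sX oP (hg t (ltn_ord t))) => P' _ [].
by apply: nbS (nbI n1 (dom_near sX (it i) oP)) => P' o' [w w'] ne; apply: main; auto.
Qed.

End Pullbacks.

(** * Sections of a very ample power *)

Section VeryAmple.
Variables (k : closedFieldType) (X : projVar k) (L : subsheaf X).
Local Notation K := (ffield X).
Implicit Types P : ppoint k (pdim X).

Lemma tensor_powP P e g s : on_var P -> g != 0 -> (forall s, L P s <-> fin (val P) (s / g)) ->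
  tensor_pow L e P s <-> fin (val P) (s / g ^+ e).
Proof.
move=> oP g0 hg; have W := val_lring oP; elim: e s => [|e IH] s.
  by rewrite expr0 divr1; apply: fin_regular.
rewrite exprSr; split=> [[a [b [/IH fa /hg fb ->]]]|fs].
  by rewrite -mulf_div; apply: (finM W).
exists (s / g), g; split; last by rewrite divfK.
  by apply/IH; rewrite -mulrA -invfM [g * _]mulrC.
by apply/hg; rewrite divff //; exists 1; exact: (hrel1 W).
Qed.

Variables (e : nat) (Y : projVar k) (f : birat X Y) (h0 : K).
Hypotheses (jf : isomorphism f) (h00 : h0 != 0).
Hypothesis hf : forall P Q, maps_to f P Q ->
  forall s, tensor_pow L e P s <-> pull_stalk f (@serre_twist k Y) P Q (s / h0).
(** The homogeneous coordinates of the embedding, as sections of the [e]-th power of [L]. *)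
Definition va i := h0 * bpull f (gpoint Y i).

Lemma va_val P Q i j : dom f P Q -> pcoord Q j != 0 -> val P (va i / va j) (pcoord Q i / pcoord Q j).
Proof.
move=> [oP oQ hd] nj; have := hd _ _ (coord_val i oQ nj).
by rewrite /va /chart fmorph_div -mulf_div divff // mul1r.
Qed.

Lemma va_neq0 P Q j : dom f P Q -> pcoord Q j != 0 -> va j != 0.
Proof.
move=> [oP oQ hd] nj; rewrite mulf_neq0 // fmorph_eq0 -gvalX.
by apply: (gval_neq0 oQ (coordX_homog k j)); rewrite mevalXU.
Qed.

Lemma va_fin P g i : on_var P -> g != 0 -> (forall s, L P s <-> fin (val P) (s / g)) ->
  fin (val P) (va i / g ^+ e).
Proof.
move=> oP g0 hg; apply/(tensor_powP _ _ oP g0 hg); have [Q dQ] := jf.1 P oP.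
apply/(hf dQ); have [_ oQ _] := dQ; have [j ej] := normalized_coord Q.
have nj : pcoord Q j != 0 by rewrite ej oner_neq0.
exists 1, (gpoint Y i); rewrite mul1r /va mulrC mulKf //; split=> //.
  by apply/fin_regular; exists 1; apply: hrel1 (val_lring oP).
exists j, (gpoint Y i / gpoint Y j); split=> //; last by rewrite divfK // (chart_neq0 oQ ej).
by apply/fin_regular; eexists; apply: (coord_val i oQ nj).
Qed.

Lemma va_unit P Q g j : dom f P Q -> pcoord Q j != 0 -> g != 0 ->
  (forall s, L P s <-> fin (val P) (s / g)) -> vunit P (va j / g ^+ e).
Proof.
move=> dQ nj g0 hg; have [oP oQ hd] := dQ; have W := val_lring oP.
have [r Vr] := va_fin j oP g0 hg; exists r => //; apply/eqP => r0.
have : tensor_pow L e P (g ^+ e).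
  by apply/(tensor_powP _ _ oP g0 hg); rewrite divff ?expf_neq0 //; exists 1; exact: (hrel1 W).
move/(hf (proj2 (maps_to_dom _ _ _) dQ)) => [a [b [/fin_regular fa [i [a' [ni /fin_regular [ra' Vra'] eb]]] eg]]].
have ge0 : g ^+ e != 0 by rewrite expf_neq0.
have vj0 := va_neq0 dQ nj.
have b0 : bpull f (gpoint Y j) != 0 by move: vj0; rewrite /va mulf_eq0 negb_or => /andP [].
have [q Vq] : fin (val P) (g ^+ e / va j).
  have -> : g ^+ e / va j = a * bpull f a' * (va i / va j).
    rewrite -[g ^+ e](divfK h00) eg eb rmorphM /va; field.
    by rewrite ?h00 ?b0.
  apply: (finM W); last by eexists; apply: va_val dQ nj.
  by apply: (finM W) => //; exists ra'; apply: hd.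
have := hrelM W Vr Vq; rewrite r0 mul0r mulf_div [_ * g ^+ e]mulrC divff ?mulf_neq0 //.
exact: (max_one W).
Qed.

Lemma va_inj P P' Q : dom f P Q -> dom f P' Q -> P = P'.
Proof.
move=> d d'; have [oP oQ _] := d; have [R /maps_to_dom dR] := jf.2 Q oQ.
have id1 T : dom f T Q -> dom (birat_id X) T R.
  by move=> dT; apply: dom_comp dT dR _ => z /=; rewrite bpull_invK.
have id2 T : on_var T -> dom (birat_id X) T T by [].
have [oP' _ _] := d'.
by rewrite (dom_uniq (id2 P oP) (id1 P d)) (dom_uniq (id2 P' oP') (id1 P' d')).
Qed.

End VeryAmple.

(** * Consequences of finite generation *)


Lemma cross_solve (F : fieldType) (q x y c r : F) : x != 0 -> y != 0 ->
  q / y * x = c * r -> q = c * y / x * r.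
Proof.
move=> x0 y0 e; have -> : q = (q / y * x) * (y / x) by field; rewrite x0 y0.
by rewrite e; field.
Qed.

Section Vanishing.
Variables (k : closedFieldType) (X : projVar k) (sigma : birat X X) (L : subsheaf X).
Local Notation K := (ffield X).
Local Notation point := (ppoint k (pdim X)).
Local Notation it := (birat_iter sigma).
Hypotheses (sX : surface X) (iL : invertible L) (st : stable sigma).
Variables (m : nat) (h : 'I_m -> K).
Hypothesis hL : gens L h.
Local Notation wt := (wt sigma h).
Variables (e : nat) (Y : projVar k) (f : birat X Y) (h0 : K).
Hypotheses (jf : isomorphism f) (h00 : h0 != 0).
Hypothesis hf : forall P Q, maps_to f P Q ->
  forall s, tensor_pow L e P s <-> pull_stalk f (@serre_twist k Y) P Q (s / h0).
Local Notation va := (va f h0).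
Implicit Types P Q R : point.

Lemma gcdwt0 P g : on_var P -> gcdat P (wt 0) g -> forall s, L P s <-> fin (val P) (s / g).
Proof.
move=> oP hg s; rewrite -(pullback_id sigma iL s oP).
exact: (pullback_gcd sX hL).
Qed.

(** The very ample sections live in the first factor of the [e]-th power of L_(j+1). The other
    factors are filled with pulled-back generators, whose indices [l] remain free so that they can
    be chosen to generate at a given point. *)
Lemma sec_va j (l : nat -> 'I_m) a :
  sec sigma h e j.+1 (va a * (\prod_(t < j) wt t.+1 (l t.+1)) ^+ e).
Proof.
move=> P g oP hg; have W := val_lring oP.
have g0 t : (t < j.+1)%N -> g t != 0 by move=> lt; exact: (hg t lt).1.
rewrite big_ord_recl exprMn -mulf_div -expr_div_n -prodf_div.
apply: (finM W).
  by apply: (va_fin jf h00 hf) => //; [exact: g0|apply: gcdwt0 => //; exact: hg].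
apply: (finX W); apply: (fin_prod W) => t _.
by have [_ [fw _]] := hg t.+1 (ltn_ord t); apply: fw.
Qed.

(** Suppose the quotient is a unit at [P]. For a point [Q] of the infinite fibre outside a finite
    set [T], the coordinates of [Q] in the embedding are, up to a common factor, the values at [P]
    of the pulled-back sections of [sec_va]: a place joining [P] to [Q] compares them through [b].
    Two points of the fibre would then have the same coordinates. *)
Lemma sec_vanish i j P b (g : nat -> K) : on_var P -> ~ (exists Q, dom (it i) P Q) ->
  (forall t, (t < j.+1)%N -> gcdat P (wt (i + t)) (g t)) -> sec sigma h 1 j.+1 b ->
  val P (bpull (it i) b / \prod_(t < j.+1) g t) 0.
Proof.
move=> oP nd hg hb; have W := val_lring oP; pose G := \prod_(t < j.+1) g t.
have G0 : G != 0 by apply/prodf_neq0 => t _; exact: (hg t (ltn_ord t)).1.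
have fu := sec_pull sX hL st hb oP hg; rewrite expr1 -/G in fu.
rewrite -/G; apply: fin_nonunit => // -[r r0 Vr].
have b0 : b != 0.
  by have := unit_neq0 W Vr r0; apply: contraNneq => ->; rewrite rmorph0 mul0r.
have iF := zariski_main oP (gX sX oP) nd.
have [T hT] : exists T : seq point, forall Q, on_var Q -> Q \notin T ->
    forall t, (t < j.+1)%N -> exists Q', dom (it t) Q Q'.
  elim: (j.+1) => [|n [T hT]]; first by exists [::].
  have [T' hT'] := fund_finite sX (it n); exists (T' ++ T) => Q oQ.
  rewrite mem_cat negb_or => /andP [n1 n2] t; rewrite ltnS leq_eqVlt => /orP [/eqP ->|]; last exact: hT.
  by apply: contrapT => no; move: n1; rewrite hT'.
have data Q : fiber (it i) P Q -> Q \notin T -> exists (l : nat -> 'I_m) (q : 'I_(pdim Y).+1 -> k)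
    (R : ppoint k (pdim Y)) (c : k),
    [/\ c != 0, dom f Q R, forall a, q a = c * pcoord R a &
    forall a, val P (bpull (it i) (va a * (\prod_(t < j) wt t.+1 (l t.+1)) ^+ e) / G ^+ e) (q a)].
  move=> [v [pv cP cQ]] nT; have [oQ hQ] := cQ; have V := val_lring oQ.
  have Vv := place_lring pv; have Vq := place_lring (pull_place (it i) pv).
  have [i0 _ _] := hL.2 Q oQ.
  have /choice [l hl] : forall t, exists l, (t < j.+1)%N -> gcdat Q (wt t) (wt t l).
    move=> t; have [lt|ge] := boolP (t < j.+1)%N; last by exists i0.
    have [Q' dQ'] := hT Q oQ nT t lt; have [_ oQ' _] := dQ'.
    by have [l l0 hl] := hL.2 _ oQ'; exists l => _; apply: gcdwt_dom dQ' l0 hl.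
  have g0 t : (t < j.+1)%N -> wt t (l t) != 0 by move=> lt; exact: (hl t lt).1.
  have [R dR] : exists R : ppoint k (pdim Y), dom f Q R by have [R /maps_to_dom] := jf.1 Q oQ; exists R.
  have [j0 e0] := normalized_coord R; have n0 : pcoord R j0 != 0 by rewrite e0 oner_neq0.
  have hl0 := gcdwt0 oQ (hl 0%N isT).
  have [c c0 Vc] := va_unit jf h00 hf dR n0 (g0 0%N isT) hl0.
  have Va a : val Q (va a / wt 0 (l 0%N) ^+ e) (c * pcoord R a).
    have := hrelM V Vc (va_val h00 a dR n0); rewrite e0 divr1 mulrC mulrA divfK //.
    exact: va_neq0 dR n0.
  have [be Vbe] := hb Q (fun t => wt t (l t)) oQ hl; rewrite expr1 in Vbe.
  have fz a : fin (val P) (bpull (it i) (va a * (\prod_(t < j) wt t.+1 (l t.+1)) ^+ e) / G ^+ e).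
    exact: (sec_pull sX hL st (sec_va l a) oP hg).
  have /choice [q hq] := fz.
  pose S := \prod_(t < j) wt t.+1 (l t.+1).
  have S0 : S != 0 by apply/prodf_neq0 => t _; apply: (g0 t.+1); exact: ltn_ord.
  rewrite big_ord_recl -/S in Vbe.
  have eqn a : q a / r ^+ e * be ^+ e = c * pcoord R a.
    have h1 := hrelM Vv (cP.2 _ _ (hq a)) (lr_inv Vv (cP.2 _ _ (hrelX W e Vr)) (expf_neq0 e r0)).
    have h2 := hQ _ _ (hrelX V e Vbe); have h3 := hQ _ _ (Va a).
    apply: (hrel_fun Vv (hrelM Vv h1 h2)); rewrite -/S.
    rewrite (_ : _ * _ = bpull (it i) (va a / wt 0 (l 0%N) ^+ e)) //.
    have sb0 : bpull (it i) b != 0 by rewrite fmorph_eq0.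
    have l00 : bpull (it i) (wt 0 (l 0%N)) != 0 by rewrite fmorph_eq0; exact: (g0 0%N isT).
    have sS0 : bpull (it i) S != 0 by rewrite fmorph_eq0.
    move: (va a) (wt 0 (l 0%N)) l00 => A U l00; clearbody S G.
    rewrite !(rmorphXn, fmorphV, rmorphM) /= !expr_div_n !exprMn.
    move: (expf_neq0 e sb0) (expf_neq0 e l00) (expf_neq0 e sS0) (expf_neq0 e G0).
    move: (bpull _ A) (bpull _ b ^+ e) (bpull _ U ^+ e) (bpull _ S ^+ e) (G ^+ e).
    by move=> x1 x2 x3 x4 x5 y2 y3 y4 y5; field; rewrite y2 y3 y4 y5.
  have be0 : be ^+ e != 0.
    by apply: contraNneq c0 => z; have := eqn j0; rewrite z mulr0 e0 mulr1 => <-.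
  exists l, q, R, (c * r ^+ e / be ^+ e); split=> //.
    by rewrite mulf_neq0 ?invr_eq0 // mulf_neq0 // expf_neq0.
  by move=> a; apply: (cross_solve be0 (expf_neq0 e r0) (eqn a)).
have [Q1 F1 n1] := iF T; have [Q2 F2] := iF (Q1 :: T).
rewrite inE negb_or => /andP [/eqP ne n2]; apply: ne.
have [l1 [q1 [R1 [c1 [c10 d1 e1 v1]]]]] := data Q1 F1 n1.
have [l2 [q2 [R2 [c2 [c20 d2 e2 v2]]]]] := data Q2 F2 n2.
suff eR : R1 = R2 by rewrite eR in d1; apply: (va_inj jf d2 d1).
apply: contrapT => /minor_neq0 [a [a']]; apply/negP; rewrite negbK; apply/eqP.
have h1 := hrelM W (v1 a) (v2 a'); have h2 := hrelM W (v1 a') (v2 a).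
apply: (mulfI (mulf_neq0 c10 c20)); rewrite mulrACA [RHS]mulrACA -!e1 -!e2.
(* The fillers [C] and [C'] chosen at the two points differ, but exchanging the coordinate sections
   does not change the product, so all minors vanish. *)
have sw A A' C C' D : bpull (it i) (A * C) / D * (bpull (it i) (A' * C') / D) =
    bpull (it i) (A' * C) / D * (bpull (it i) (A * C') / D) by rewrite !rmorphM /=; ring.
by apply: (hrel_fun W h1); rewrite sw.
Qed.

End Vanishing.

Section FinitelyGenerated.
Variables (k : closedFieldType) (X : projVar k) (sigma : birat X X) (L : subsheaf X).
Local Notation K := (ffield X).
Local Notation point := (ppoint k (pdim X)).
Local Notation it := (birat_iter sigma).
Hypotheses (sX : surface X) (iL : invertible L) (st : stable sigma).
Variables (m : nat) (h : 'I_m -> K).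
Hypothesis hL : gens L h.
Local Notation wt := (wt sigma h).
Hypothesis vanish : forall i j P b (g : nat -> K), on_var P -> ~ (exists Q, dom (it i) P Q) ->
  (forall t, (t < j.+1)%N -> gcdat P (wt (i + t)) (g t)) -> sec sigma h 1 j.+1 b ->
  val P (bpull (it i) b / \prod_(t < j.+1) g t) 0.
Implicit Types P Q R : point.
Local Notation B := (twisted_section_ring sigma L).

(* Degrees that are reached at P by products of generators of degree at most N
   without crossing an indeterminacy point. *)
Inductive reach (N : nat) P : nat -> Prop :=
| Reach0 : reach N P 0
| ReachS e d : reach N P e -> (exists Q, dom (it e) P Q) -> (d <= N)%N -> reach N P (e + d).

Lemma reach_shift N P Q a b : dom (it a) P Q -> reach N P a -> reach N Q b -> reach N P (a + b).
Proof.
move=> d ra; elim=> [|b' d' _ IH [R hR] hd]; first by rewrite addn0.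
by rewrite addnA; apply: ReachS => //; exists R; apply: dom_it hR.
Qed.

(** The step that crosses [N] starts at a degree [e] at most [N], and [e] is positive because a step
    has length at most [N]. *)
Lemma reach_def N P n : reach N P n -> (N < n)%N ->
  exists e, [/\ (1 <= e)%N, (e <= N)%N & exists Q, dom (it e) P Q].
Proof.
elim=> [|e d _ IH de hd] lt; first by [].
have [/IH //|le] := ltnP N e.
by exists e; split=> //; move: lt hd; case: (e) => //; rewrite add0n ltnNge => /negP.
Qed.

Lemma skew_coeff (T : K -> Prop) (p q : skewLaurent X) n :
  T 0 -> (forall a b, T a -> T b -> T (a + b)) ->
  (forall i j : int, (i + j)%R = n -> T (monalg.mcoeff i p * autpow sigma i (monalg.mcoeff j q))) ->
  T (monalg.mcoeff n (skew_mul sigma p q)).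
Proof.
move=> T0 TD Tp; have mS J (s : seq J) (F : J -> skewLaurent X) : monalg.mcoeff n (\sum_(i <- s) F i) =
    \sum_(i <- s) monalg.mcoeff n (F i).
  by apply: (big_morph _ (monalg.mcoeffD n) (monalg.mcoeff0 n)).
rewrite /skew_mul mS.
elim: (finmap.enum_fset _) => [|i s IH]; rewrite ?big_nil // big_cons; apply: (TD) => //.
rewrite mS; elim: (finmap.enum_fset _) => [|j s' IH']; rewrite ?big_nil // big_cons; apply: (TD) => //.
by rewrite monalg.mcoeffU; case: eqP => [/Tp|_]; rewrite ?mulr1n ?mulr0n.
Qed.

(** The subalgebra to which the generators are confined: at [P] its coefficients vanish in every
    degree that is not reached there. *)
Definition Sub N (p : skewLaurent X) := B p /\ forall P n (g : nat -> K), on_var P ->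
  (forall t, (t < n)%N -> gcdat P (wt t) (g t)) -> ~ reach N P n ->
  val P (monalg.mcoeff (Posz n) p / \prod_(t < n) g t) 0.

Lemma gcds P : on_var P -> exists g : nat -> K, forall t, gcdat P (wt t) (g t).
Proof.
move=> oP; have /choice [g hg] : forall t, exists g, gcdat P (wt t) g.
  by move=> t; apply: (gcdwt_ex sigma sX hL).
by exists g.
Qed.

Lemma B_sec p n : B p -> sec sigma h 1 n (monalg.mcoeff (Posz n) p).
Proof. by move=> /(_ (Posz n)) /(global_sec sigma sX hL). Qed.

Lemma B_neg p n : B p -> monalg.mcoeff (Negz n) p = 0.
Proof. by move=> /(_ (Negz n)). Qed.

Lemma prod_shift (g : nat -> K) a b :
  \prod_(t < a + b) g t = (\prod_(t < a) g t) * \prod_(t < b) g (a + t)%N.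
Proof. by rewrite big_split_ord. Qed.

Lemma term_sec p q a b P g : B p -> B q -> on_var P ->
  (forall t, (t < a + b)%N -> gcdat P (wt t) (g t)) ->
  fin (val P) (monalg.mcoeff (Posz a) p / \prod_(t < a) g t) /\
  fin (val P) (bpull (it a) (monalg.mcoeff (Posz b) q) / \prod_(t < b) g (a + t)%N).
Proof.
move=> Bp Bq oP hg; split.
  have := B_sec (n := a) Bp oP (g := g); rewrite expr1; apply=> t lt.
  by apply: hg; apply: leq_trans lt (leq_addr _ _).
have := sec_pull sX hL st (i := a) (g := fun t => g (a + t)%N) (B_sec (n := b) Bq) oP.
by rewrite expr1; apply=> t lt; apply: hg; rewrite ltn_add2l.
Qed.

(** Consider a product of coefficients of degrees [a] and [b] with [a + b] unreached. Either [a] is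
    unreached and the first factor vanishes; or [sigma^a] is undefined at [P] and the second
    vanishes by [vanish]; or [b] is unreached at the image of [P], and the second factor vanishes
    there. *)
Lemma Sub_subalgebra N : subalgebra sigma (Sub N).
Proof.
have divM (x y g g' : K) : x * y / (g * g') = (x / g) * (y / g') by rewrite -mulf_div.
split=> [c|p q [Bp hp] [Bq hq]|p q [Bp hp] [Bq hq]].
- have e n : monalg.mcoeff n (monalg.mkmalgU 0 (fconst X c) : skewLaurent X) = fconst X c *+ (0 == n).
    by rewrite monalg.mcoeffU.
  split=> [[n|n]|P [|n] g oP hg nr]; rewrite e //.
  + apply: (proj2 (global_sec sigma sX hL n _)) => P g oP; case: n => [|n] hg.
      by rewrite big_ord0 expr1 divr1; exists c; apply: val_const.
    by rewrite mul0r; exists 0; apply: (hrel0 (val_lring oP)).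
  + by case: nr; apply: Reach0.
  + by rewrite mul0r; apply: (hrel0 (val_lring oP)).
- split=> [[n|n]|P n g oP hg nr]; rewrite monalg.mcoeffD.
  + apply/(global_sec sigma sX hL) => P g oP hg; rewrite mulrDl.
    by apply: (finD (val_lring oP)); apply: B_sec.
  + by rewrite !B_neg // addr0.
  + by rewrite mulrDl; apply: (maxD (val_lring oP)); auto.
split=> [[n|n]|P n g oP hg nr].
- apply/(global_sec sigma sX hL) => P g oP hg; have W := val_lring oP; rewrite expr1.
  apply: (skew_coeff (T := fun x => fin (val P) (x / \prod_(t < n) g t))).
  + by rewrite mul0r; exists 0; apply: (hrel0 W).
  + by move=> a b; rewrite mulrDl; apply: (finD W).
  move=> [a|a] j e; last by rewrite B_neg // !mul0r; exists 0; apply: (hrel0 W).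
  case: j e => [b|b] e; last by rewrite B_neg //= rmorph0 mulr0 mul0r; exists 0; apply: (hrel0 W).
  have {}e : n = (a + b)%N by case: e.
  by rewrite e prod_shift divM in hg *; have [] := term_sec Bp Bq oP hg; apply: (finM W).
- apply: (skew_coeff (T := fun x => x = 0)) => // [a b -> ->|]; first by rewrite addr0.
  move=> [a|a] j e; last by rewrite B_neg // mul0r.
  by case: j e => [b|b] e //; rewrite B_neg //= rmorph0 mulr0.
have W := val_lring oP.
apply: (skew_coeff (T := fun x => val P (x / \prod_(t < n) g t) 0)).
- by rewrite mul0r; apply: (hrel0 W).
- by move=> a b; rewrite mulrDl; apply: (maxD W).
move=> [a|a] j e; last by rewrite B_neg // !mul0r; apply: (hrel0 W).
case: j e => [b|b] e; last by rewrite B_neg //= rmorph0 mulr0 mul0r; apply: (hrel0 W).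
have {}e : n = (a + b)%N by case: e.
rewrite {}e prod_shift divM in hg nr *; have [fa fb] := term_sec Bp Bq oP hg.
have hga t : (t < a)%N -> gcdat P (wt t) (g t) by move=> lt; apply: hg; apply: leq_trans lt (leq_addr _ _).
have hgb t : (t < b)%N -> gcdat P (wt (a + t)) (g (a + t)%N) by move=> lt; apply: hg; rewrite ltn_add2l.
have [ra|nra] := EM (reach N P a); last first.
  by rewrite mulrC; apply: (maxM W) => //; apply: hp.
case: b => [|b] in hgb nr fb hg *; first by case: nr; rewrite addn0.
apply: (maxM W fa); have [[Q d]|nd] := EM (exists Q, dom (it a) P Q); last first.
  exact: (@vanish a b P _ (fun t => g (a + t)%N) oP nd hgb (B_sec Bq)).
have nrQ : ~ reach N Q b.+1 by move=> rQ; apply: nr; apply: reach_shift rQ.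
have [_ oQ hd] := d; have [q' hq'] := gcds oQ.
have := hd _ _ (hq Q b.+1 q' oQ (fun t _ => hq' t) nrQ); rewrite fmorph_div rmorph_prod /= => h1.
have p0 : \prod_(t < b.+1) bpull (it a) (q' t) != 0.
  by apply/prodf_neq0 => t _; rewrite fmorph_eq0; exact: (hq' t).1.
rewrite -[X in X / _](divfK p0) -mulrA mulrC -prodf_div; apply: (maxM W) => //.
apply: (fin_prod W) => t _; apply: (gcdat_uniq sX oP (gcdat_pull sX hL st d (hq' t))).
exact: hgb.
Qed.

Lemma coeff_bound (p : skewLaurent X) : exists N, forall n, (N < n)%N -> monalg.mcoeff (Posz n) p = 0.
Proof.
exists (\max_(i <- finmap.enum_fset (monalg.msupp p)) `|i|%N) => n lt; apply/eqP; apply: contraTT lt.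
rewrite monalg.mcoeff_neq0 -leqNgt => hn.
by apply: (@leq_bigmax_seq _ _ _ (fun i : int => `|i|%N) (Posz n)).
Qed.

Hypothesis gg : forall n, (1 <= n)%N -> globally_generated (twist L sigma n).

Lemma fg_reach : finitely_generated sigma B -> exists N, forall P n, on_var P -> reach N P n.
Proof.
move=> [gs [hgs hS]].
have [N hN] : exists N, forall p, p \in gs -> forall n, (N < n)%N -> monalg.mcoeff (Posz n) p = 0.
  elim: gs {hgs hS} => [|p s [N IH]]; first by exists 0%N.
  have [M hM] := coeff_bound p; exists (N + M)%N => q; rewrite inE => /orP [/eqP ->|hq] n lt.
    by apply: hM; move: lt; lia.
  by apply: (IH q hq); move: lt; lia.
have key p : B p -> Sub N p.
  apply: hS; first exact: Sub_subalgebra.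
  move=> p' hp'; split; first exact: hgs.
  move=> P n g oP hg nr; have [le|lt] := leqP n N; last first.
    by rewrite hN // mul0r; apply: (hrel0 (val_lring oP)).
  case: nr; rewrite -[n]add0n; apply: ReachS => //; first exact: Reach0.
  by exists P; apply: dom_id.
exists N => P [|n] oP; first exact: Reach0.
apply: contrapT => nr; have [g hg] := gcds oP; have W := val_lring oP.
pose G := \prod_(t < n.+1) g t.
have G0 : G != 0 by apply/prodf_neq0 => t _; exact: (hg t).1.
have tG : twist L sigma n.+1 P G.
  apply/(twist_gcd sX hL (n := n.+1) (g := g) _ oP) => [t _|]; first exact: hg.
  by rewrite divff //; exists 1; apply: (hrel1 W).
(* Global generation: if all sections vanished at [P] relative to the stalk generator [G], so would
   [G / G]. *)
have [r [a [u [fa hu eG]]]] := gg (ltn0Sn n) oP tG.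
apply: (max_one W); rewrite -(divff G0) {1}eG mulr_suml; apply: (max_sum W) => i _.
rewrite -mulrA; apply: (maxM W); first exact/fin_regular.
pose p : skewLaurent X := monalg.mkmalgU (Posz n.+1) (u i).
have ep l : monalg.mcoeff l p = u i *+ (Posz n.+1 == l) by rewrite monalg.mcoeffU.
have Bp : B p.
  move=> [l|l]; rewrite ep //; have [[<-]|_] := eqVneq; first exact: hu.
  apply/(global_sec sigma sX hL) => P' g' o' _; rewrite mul0r; exists 0.
  exact: (hrel0 (val_lring o')).
have [_ /(_ P n.+1 g oP (fun t _ => hg t) nr)] := key p Bp.
by rewrite ep eqxx.
Qed.

(** Reaching degree [N.+1] from a fundamental point [P] forces some [sigma^e] with [e <= N] to be
    defined at [P], and [e = 1] is excluded. Then [sigma^(e-1)] sends all but finitely many points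
    of the fibre of [sigma] over [P] to the one point [q], so stability defines every iterate at
    [q]. *)
Lemma fundamental_orbit : finitely_generated sigma B -> exists N, forall P, on_var P ->
  ~ (exists Q, dom sigma P Q) -> exists e q, [/\ (e <= N)%N, (2 <= e)%N, dom (it e) P q,
    inf (fun R => fiber sigma P R /\ dom (it e.-1) R q) &
    forall j, exists2 Q', dom (it j) q Q' & exists Q'', dom sigma Q' Q''].
Proof.
move=> /fg_reach [N hN]; exists N => P oP nd.
have [e [e1 eN [q dq]]] := reach_def (hN P N.+1 oP) (ltnSn N).
have e2 : (2 <= e)%N.
  by case: e e1 dq {eN} => [|[|e]] // _ dq; case: nd; exists q.
have [T hT] := fund_finite sX (it e.-1); have [_ oq _] := dq.
have iR : inf (fun R => fiber sigma P R /\ dom (it e.-1) R q).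
  move=> s; have [R [v [pv cP cR]] ] := zariski_main oP (gX sX oP) nd (s ++ T).
  rewrite mem_cat negb_or => /andP [ns nT]; exists R => //; have [oR _] := cR.
  have [[Q' dQ']|no] := EM (exists Q', dom (it e.-1) R Q'); last by move: nT; rewrite hT.
  split; first by exists v.
  suff <- : Q' = q by [].
  have c1 := dom_center pv cP dq; have c2 := dom_center (pull_place sigma pv) cR dQ'.
  apply: center_uniq (pull_place (it e) pv) _ c1; split; first exact: c2.1.
  by move=> z c /c2.2; rewrite /pull -itSr prednK.
exists e, q; split=> //; apply: (stable_orbit sX st (n := e.-1)) => //.
  by rewrite -ltnS prednK // (leq_trans _ e2).
by apply: infS iR => R [].
Qed.

End FinitelyGenerated.

(** * Counting points over finite fields *)

Section FiniteModel.

Lemma fin_root (t : finFieldType) (p : {poly t}) : size p != 1%N ->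
  exists (t' : finFieldType) (j : {rmorphism t -> t'}) x,
    root (map_poly j p) x /\ forall r : int, j (intr r) = intr r.
Proof.
move=> hp; have [->|p0] := eqVneq p 0.
  by exists t, idfun, 0; rewrite rmorph0 root0.
have [L [rs e _]] := FinSplittingFieldFor p0.
pose j : {rmorphism t -> finvect_type L} := GRing.in_alg L.
exists (finvect_type L : finFieldType), j.
case: rs e => [|x rs] e.
  by have := eqp_size e; rewrite big_nil size_poly1 size_map_poly => h; rewrite h in hp.
exists x; split; last by move=> r; rewrite rmorph_int.
have : root (map_poly (GRing.in_alg L) p) x by rewrite (eqp_root e) root_prod_XsubC mem_head.
by [].
Qed.

Lemma intr_abs (S : nzRingType) (s : int) : (s%:~R == 0 :> S) = (`|s|%N%:R == 0 :> S).
Proof. by case: s => s //; rewrite NegzE mulrNz oppr_eq0. Qed.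

(** In positive characteristic the prime field serves; in characteristic 0 any prime larger than the
    absolute value of [r] does. *)
Lemma int_char_target (k : fieldType) (r : int) : (intr r : k) != 0 ->
  exists t : finFieldType, (intr r : t) != 0 /\ forall s : int, (intr s : k) = 0 -> (intr s : t) = 0.
Proof.
move=> hr; have [[p pk]|n0] := EM (exists p, p \in [pchar k]).
  have pp : prime p by move: pk; rewrite inE => /andP [].
  have pF := pchar_Fp pp; exists 'F_p.
  have eqp (s : int) : (intr s == 0 :> k) = (intr s == 0 :> 'F_p).
    by rewrite !intr_abs -(dvdn_pcharf pk) -(dvdn_pcharf pF).
  by split; [rewrite -eqp|move=> s /eqP; rewrite eqp => /eqP].
have c0 : [pchar k] =i pred0.
  by move=> p; apply/negP => h; apply: n0; exists p.
have zs (s : int) : (intr s : k) = 0 -> s = 0.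
  by move/eqP; rewrite intr_abs ((pcharf0P k).1 c0) absz_eq0 => /eqP.
have r0 : r != 0 by apply: contraNneq hr => ->; rewrite rmorph0.
have [p lt pp] := prime_above `|r|%N; have pF := pchar_Fp pp.
exists 'F_p; split; last by move=> s /zs ->; rewrite rmorph0.
have h : ~~ (p %| `|r|)%N.
  by apply/negP => /dvdn_leq; rewrite absz_gt0 => /(_ r0); rewrite leqNgt lt.
by rewrite intr_abs -(dvdn_pcharf pF).
Qed.

(* Specialization of finitely many scalars to a finite field: [al] and [be] are
   the two evaluations of a common ring of integer polynomials. *)
Lemma finite_model (k : fieldType) (cs : seq k) (u : k) : u != 0 ->
  exists (F : finFieldType) (R : comNzRingType) (al : {rmorphism R -> k}) (be : {rmorphism R -> F}),
  [/\ forall a, al a = 0 -> be a = 0, forall c, c \in cs -> exists a, al a = c &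
      forall a, al a = u -> be a != 0].
Proof.
move=> u0; pose s := u :: cs; pose n := size s.
pose al : {rmorphism {mpoly int[n]} -> k} := mmap intr (fun i : 'I_n => nth 0 s i).
have hc c : c \in s -> exists a, al a = c.
  move=> hc; have lt : (index c s < n)%N by rewrite index_mem.
  by exists 'X_(Ordinal lt); rewrite /al /= mmapX mmap1U /= nth_index.
have [a0 ea0] := hc u (mem_head _ _).
pose pr a := al a = 0.
have ppr : prime_pred pr.
  split=> [a b|a b|a b|]; rewrite /pr.
  - move=> ha hb; by rewrite rmorphB ha hb subr0.
  - by move=> hb; rewrite rmorphM hb mulr0.
  - by move/eqP; rewrite rmorphM mulf_eq0 => /orP [] /eqP; auto.
  - by rewrite rmorph1 => /eqP; rewrite oner_eq0.
have Hr : forall (t : finFieldType) (p : {poly t}), size p != 1%N ->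
  exists (t' : finFieldType) (j : {rmorphism t -> t'}) x, root (map_poly j p) x /\
     forall r : int, j ((intr : {rmorphism int -> t}) r) = (intr : {rmorphism int -> t'}) r.
  by move=> t p /fin_root.
have [|r nr||F [z [hz nz]]] := @generic_point _ _ (fun t : finFieldType => t : fieldType)
    (fun t => (intr : {rmorphism int -> t})) Hr n pr a0 ppr.
- by rewrite /pr rmorph0.
- have er (x : int) : al x%:MP = intr x by rewrite /al /= mmapC.
  have [|t [nt ht]] := @int_char_target k r; first by apply/eqP => h; apply: nr; rewrite /pr er.
  by exists t; split=> // x; rewrite /pr er; apply: ht.
- by rewrite /pr ea0; apply/eqP.
exists F, {mpoly int[n]}, al, (mmap (intr : {rmorphism int -> F}) z); split.
- exact: hz.
- by move=> c h; apply: hc; rewrite inE h orbT.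
- move=> a ea; have : mmap (intr : {rmorphism int -> F}) z (a - a0) = 0.
    by apply: hz; rewrite /pr rmorphB ea ea0 subrr.
  by rewrite rmorphB => /eqP; rewrite subr_eq0 => /eqP ->.
Qed.

End FiniteModel.

Section Transfer.
Variables (k F : fieldType) (R : comNzRingType) (al : {rmorphism R -> k}) (be : {rmorphism R -> F}).
Hypothesis hker : forall a, al a = 0 -> be a = 0.

(** The lift may not introduce monomials, so that the lift of a form has only monomials of the same
    degree. *)
Definition lifted n (p : {mpoly k[n]}) := exists2 q : {mpoly R[n]}, map_mpoly al q = p &
  {subset msupp q <= msupp p}.

(** The value at [z] of the reduction of [p], as a relation, since not every scalar of [k] lifts
    through [al]. By [hker] it does not depend on the lift. *)
Definition spec n (z : 'I_n -> F) p y := exists q : {mpoly R[n]},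
  map_mpoly al q = p /\ mmap be z q = y.

Lemma spec_fun n (z : 'I_n -> F) p y y' : spec z p y -> spec z p y' -> y = y'.
Proof.
move=> [q [eq ey]] [q' [eq' ey']]; apply/eqP; rewrite -subr_eq0 -ey -ey' -rmorphB /= /mmap.
rewrite big1 // => m _; rewrite hker ?mul0r //.
have := congr1 (mcoeff m) (_ : map_mpoly al (q - q') = 0).
by rewrite mcoeff_map_mpoly mcoeff0; apply; rewrite rmorphB /= eq eq' subrr.
Qed.

Lemma specD n (z : 'I_n -> F) p y p' y' : spec z p y -> spec z p' y' -> spec z (p + p') (y + y').
Proof. by move=> [q [<- <-]] [q' [<- <-]]; exists (q + q'); rewrite !rmorphD. Qed.

Lemma specN n (z : 'I_n -> F) p y : spec z p y -> spec z (- p) (- y).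
Proof. by move=> [q [<- <-]]; exists (- q); rewrite !rmorphN. Qed.

Lemma specB n (z : 'I_n -> F) p y p' y' : spec z p y -> spec z p' y' -> spec z (p - p') (y - y').
Proof. by move=> h /specN h'; apply: specD. Qed.

Lemma specM n (z : 'I_n -> F) p y p' y' : spec z p y -> spec z p' y' -> spec z (p * p') (y * y').
Proof. by move=> [q [<- <-]] [q' [<- <-]]; exists (q * q'); rewrite !rmorphM. Qed.

Lemma specC n (z : 'I_n -> F) c : spec z (al c)%:MP (be c).
Proof. by exists c%:MP; rewrite map_mpolyC ?rmorph0 // mmapC. Qed.

Lemma spec0 n (z : 'I_n -> F) : spec z 0 0.
Proof. by have := specC z 0; rewrite !rmorph0. Qed.

Lemma spec1 n (z : 'I_n -> F) : spec z 1 1.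
Proof. by have := specC z 1; rewrite !rmorph1. Qed.

Lemma specX n (z : 'I_n -> F) i : spec z 'X_i (z i).
Proof. by exists 'X_i; rewrite map_mpolyX mmapX mmap1U. Qed.

Lemma specXn n (z : 'I_n -> F) p y m : spec z p y -> spec z (p ^+ m) (y ^+ m).
Proof. by move=> h; elim: m => [|m IH]; [exact: spec1|rewrite !exprS; apply: specM]. Qed.

Lemma lifted_spec n (z : 'I_n -> F) p : lifted p -> exists y, spec z p y.
Proof. by move=> [q eq _]; exists (mmap be z q), q. Qed.

Definition gcomp n M (G : {mpoly k[n]}) (w : 'I_n -> {mpoly k[M]}) : {mpoly k[M]} :=
  mmap (@mpolyC M k) w G.

Lemma spec_gcomp n M (z : 'I_M -> F) (G : {mpoly R[n]}) w y :
  (forall i, spec z (w i) (y i)) -> spec z (gcomp (map_mpoly al G) w) (mmap be y G).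
Proof.
move=> /choice [q hq]; exists (mmap (@mpolyC M R) q G); split.
  rewrite rmorph_mmap /gcomp [in RHS]/map_mpoly [RHS]rmorph_mmap; apply: eq_mmap => [c|i] /=.
    by rewrite map_mpolyC ?rmorph0 // mmapC.
  by rewrite mmapX mmap1U; have [<- _] := hq i.
rewrite rmorph_mmap; apply: eq_mmap => [c|i] /=; first by rewrite mmapC.
by have [_ <-] := hq i.
Qed.

End Transfer.

(* A clause "[z] kills [E] implies [z] kills [g]" over [k] has a finite
   certificate by the Nullstellensatz, so it specializes once the coefficients
   of the certificate are lifted. *)
Lemma clause_transfer (k : closedFieldType) n (E : seq {mpoly k[n]}) g :
  (forall z : 'I_n -> k, (forall e, e \in E -> e.@[z] = 0) -> g.@[z] = 0) ->
  exists qs : seq {mpoly k[n]}, forall (F : fieldType) (R : comNzRingType)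
    (al : {rmorphism R -> k}) (be : {rmorphism R -> F}) (z : 'I_n -> F),
    (forall a, al a = 0 -> be a = 0) -> (forall q, q \in qs -> lifted al q) ->
    (forall e, e \in E -> spec al be z e 0) -> forall y, spec al be z g y -> y = 0.
Proof.
move=> h; have [m hm] : exists m, ispan E (g ^+ m).
  apply: contrapT => no.
  have [||pr [ppr Epr ng]] := @prime_avoiding _ (ispan E) g; first exact: ispan_ideal.
    by move=> m hm; apply: no; exists m.
  have [z [hz nz]] := nullstellensatz_prime ppr (Epr _ (ispan0 E)) ng.
  by move: nz; rewrite h ?eqxx // => e he; apply: hz; apply: Epr; apply: ispan_mem.
suff [qs hqs] : exists qs : seq {mpoly k[n]}, forall (F : fieldType) (R : comNzRingType)
    (al : {rmorphism R -> k}) (be : {rmorphism R -> F}) (z : 'I_n -> F),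
    (forall a, al a = 0 -> be a = 0) -> (forall q, q \in qs -> lifted al q) ->
    (forall e, e \in E -> spec al be z e 0) -> forall y, spec al be z (g ^+ m) y -> y = 0.
  exists qs => F R al be z hk hl hE y hy; have := hqs F R al be z hk hl hE _ (specXn m hy).
  by move/eqP; rewrite expf_eq0 => /andP [_ /eqP].
move: (g ^+ m) hm; clear h; elim: E => [|a E IH] x /=.
  move=> ->; exists [::] => F R al be z hk _ _ y hy; exact: (spec_fun hk hy (spec0 _ _ _)).
move=> [c /IH [qs hqs]]; exists (c :: qs) => F R al be z hk hl hE y hy.
have [y' hy'] := lifted_spec be z (hl c (mem_head _ _)).
have := specM hy' (hE a (mem_head _ _)); rewrite mulr0 => ha.
have := specB hy ha; rewrite subr0; apply: hqs => // [q hq|e he].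
  by apply: hl; rewrite inE hq orbT.
by apply: hE; rewrite inE he orbT.
Qed.

Lemma lifted_ex (k : fieldType) n (ps : seq {mpoly k[n]}) : exists cs : seq k,
  forall (R : comNzRingType) (al : {rmorphism R -> k}), (forall c, c \in cs -> exists a, al a = c) ->
  forall p, p \in ps -> lifted al p.
Proof.
exists (flatten [seq [seq p@_m | m <- msupp p] | p <- ps]) => R al hc p hp.
have /choice [ps' hps'] : forall m : 'X_{1..n}, exists a, m \in msupp p -> al a = p@_m.
  move=> m; have [hm|_] := boolP (m \in msupp p); last by exists 0.
  have [|a ea] := hc p@_m; last by exists a.
  by apply/flattenP; exists [seq p@_m | m <- msupp p]; [exact: map_f|apply: map_f].
exists (\sum_(m <- msupp p) ps' m *: 'X_[m]); last first.
  move=> m'; rewrite mcoeff_msupp; apply: contraNT => nm'; rewrite raddf_sum /= big_seq big1 // => m hm.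
  by rewrite mcoeffZ mcoeffX; case: eqP => [e|_]; rewrite ?mulr0 //; rewrite -e hm in nm'.
rewrite rmorph_sum /= [RHS]mpolyE.
rewrite big_seq [RHS]big_seq; apply: eq_bigr => m hm.
rewrite -(hps' m hm); apply/mpolyP => m'.
rewrite mcoeff_map_mpoly !mcoeffZ !mcoeffX.
by case: eqP => _; rewrite ?mulr1 ?mulr0 ?raddf0.
Qed.

Lemma clauses_transfer (k : closedFieldType) n (I : finType) (E : I -> seq {mpoly k[n]}) g :
  (forall i (z : 'I_n -> k), (forall e, e \in E i -> e.@[z] = 0) -> (g i).@[z] = 0) ->
  exists qs : seq {mpoly k[n]}, forall (F : fieldType) (R : comNzRingType)
    (al : {rmorphism R -> k}) (be : {rmorphism R -> F}),
    (forall a, al a = 0 -> be a = 0) -> (forall q, q \in qs -> lifted al q) -> forall i (z : 'I_n -> F),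
    (forall e, e \in E i -> spec al be z e 0) -> forall y, spec al be z (g i) y -> y = 0.
Proof.
move=> h; have /choice [qs hqs] := fun i => clause_transfer (h i).
exists (flatten [seq qs i | i <- enum I]) => F R al be hk hl i z; apply: hqs => // q hq.
by apply: hl; apply/flattenP; exists (qs i) => //; apply: map_f; rewrite mem_enum.
Qed.

Definition proportional (F : fieldType) n (v w : 'I_n -> F) := forall a b, v a * w b = v b * w a.

Section FiniteCount.
Variables (F : finFieldType) (n c r : nat).
Local Notation vec := {ffun 'I_n.+1 -> F}.
Variables (inS : pred vec) (tau : 'I_c -> vec -> vec) (T : 'I_r -> vec) (R : 'I_r.+1 -> vec).

Definition nrm (v : vec) := [exists i, (v i == 1) && [forall j : 'I_n.+1, (j < i)%N ==> (v j == 0)]].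

Lemma nrm_ex (v : vec) : v != 0 -> exists2 l, l != 0 & nrm [ffun i => l * v i].
Proof.
move=> v0; have [i0 h0] : exists i, v i != 0.
  apply: contrapT => no; move/eqP: v0; apply; apply/ffunP => i; rewrite ffunE.
  by apply/eqP; apply: contrapT => /negP h; apply: no; exists i.
have [i hi mi] := @arg_minnP _ i0 (fun i => v i != 0) (fun i : 'I_n.+1 => i : nat) h0.
exists (v i)^-1; rewrite ?invr_eq0 //; apply/existsP; exists i; rewrite ffunE mulVf // eqxx.
apply/forallP => l; apply/implyP => hl; rewrite ffunE mulf_eq0; apply/orP; right.
by apply: contraTT hl => /mi; rewrite -leqNgt.
Qed.

Lemma nrm_prop (v w : vec) : nrm v -> nrm w -> proportional v w -> v = w.
Proof.
move=> /existsP [i /andP [/eqP vi /forallP zi]] /existsP [j /andP [/eqP wj /forallP zj]] h.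
have eij : i = j.
  case: (ltngtP i j) => ij; last exact: ord_inj.
    have := h i j; rewrite vi wj mul1r; have := zj i; rewrite ij => /eqP ->.
    by rewrite mulr0 => /eqP; rewrite oner_eq0.
  have := h i j; rewrite vi wj mul1r; have := zi j; rewrite ij => /eqP ->.
  by rewrite mul0r => /eqP; rewrite oner_eq0.
apply/ffunP => l; have := h l i; rewrite vi mul1r -[w i]/(w i) [in w i]eij wj mulr1 //.
Qed.

Hypotheses (sS : forall l v, l != 0 -> inS v -> inS [ffun i => l * v i])
  (tS : forall j v, inS v -> tau j v != 0 -> inS (tau j v))
  (inj : forall j j' v v', inS v -> inS v' -> tau j v != 0 -> tau j' v' != 0 ->
    proportional (tau j v) (tau j' v') -> proportional v v')
  (hT : forall v, inS v -> (forall j, tau j v = 0) -> exists i, proportional v (T i))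
  (nT : forall i, nrm (T i)) (nR : forall i, nrm (R i)) (sR : forall i, inS (R i))
  (iR : injective R)
  (mR : forall j v i, inS v -> tau j v != 0 -> ~ proportional (tau j v) (R i)).

(** Together the [tau j] give an injective map on projective points that is undefined at no more
    than [r] of them and misses at least [r.+1]: its domain has at least [#|S| - r] points and its
    image at most [#|S| - r.+1]. *)
Lemma finite_count : False.
Proof.
pose S := [set v | nrm v && inS v]; pose S2 := [set v in S | [exists j, tau j v != 0]].
have /choice [f hf] : forall v, exists w, v \in S2 -> exists j l,
    [/\ tau j v != 0, l != 0, w = [ffun i => l * tau j v i] & nrm w].
  move=> v; have [|_] := boolP (v \in S2); last by exists v.
  rewrite inE => /andP [_ /existsP [j hj]]; have [l l0 hl] := nrm_ex hj.
  by exists [ffun i => l * tau j v i] => _; exists j, l.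
have f_inj : {in S2 &, injective f}.
  move=> v v' hv hv' e; have [j [l [tv l0 ef nf]]] := hf v hv; have [j' [l' [tv' l0' ef' nf']]] := hf v' hv'.
  move: hv hv'; rewrite !inE => /andP [/andP [nv sv] _] /andP [/andP [nv' sv'] _].
  apply: nrm_prop => //; apply: (inj sv sv' tv tv') => a b.
  have ea i : l * tau j v i = l' * tau j' v' i.
    by have := congr1 (fun g : vec => g i) e; rewrite ef ef' !ffunE.
  apply: (mulfI l0); rewrite !mulrA !ea; ring.
have sub : f @: S2 \subset S :\: [set R i | i in 'I_r.+1].
  apply/subsetP => _ /imsetP [v hv ->]; have [j [l [tv l0 ef nf]]] := hf v hv.
  move: hv; rewrite !inE => /andP [/andP [nv sv] _]; rewrite nf ef sS ?andbT //; last exact: tS.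
  apply/imsetP => -[i _ eR]; apply: (mR (i := i) sv tv) => a b.
  by rewrite -eR !ffunE; ring.
have h1 : (#|S2| <= #|S| - r.+1)%N.
  rewrite -(card_in_imset f_inj) (leq_trans (subset_leq_card sub)) // cardsD.
  rewrite (_ : _ :&: _ = [set R i | i in 'I_r.+1]) ?card_imset ?card_ord //.
  apply/setIidPr/subsetP => _ /imsetP [i _ ->]; by rewrite inE nR sR.
have h2 : (#|S :\: S2| <= r)%N.
  have sT : S :\: S2 \subset [set T i | i in 'I_r].
    apply/subsetP => v; rewrite !inE => /andP [h /andP [nv sv]].
    move: h; rewrite nv sv /= => /existsPn h.
    have [|i hi] := hT sv; first by move=> j; apply/eqP; have := h j; rewrite negbK.
    by apply/imsetP; exists i => //; apply: nrm_prop.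
  by rewrite (leq_trans (subset_leq_card sT)) // (leq_trans (leq_imset_card _ _)) // card_ord.
have h3 : (r.+1 <= #|S|)%N.
  rewrite -[r.+1]card_ord -(card_imset _ iR); apply: subset_leq_card.
  by apply/subsetP => _ /imsetP [i _ ->]; rewrite inE nR sR.
have := cardsID S2 S; rewrite (setIidPr _); first by move: h1 h2 h3; lia.
by apply/subsetP => v; rewrite inE => /andP [].
Qed.

End FiniteCount.

Lemma meval_gcomp (k : fieldType) n M (G : {mpoly k[n]}) (w : 'I_n -> {mpoly k[M]}) z :
  (gcomp G w).@[z] = G.@[fun i => (w i).@[z]].
Proof.
rewrite /gcomp -[LHS]/((meval z) _) rmorph_mmap; apply: eq_mmap => // c /=.
by rewrite mevalC.
Qed.

Section CountingCore.
Variables (k : closedFieldType) (n a b c r : nat).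
Local Notation vec := ('I_n.+1 -> k).
Local Notation poly_n := {mpoly k[n.+1]}.
Variables (eX : 'I_a -> poly_n) (eD : 'I_b -> poly_n) (tau : 'I_c -> 'I_n.+1 -> poly_n).
Variables (T : 'I_r -> vec) (R : 'I_r.+1 -> vec).
Definition inX v := forall i, (eX i).@[v] = 0.
Definition inU v := inX v /\ exists i, (eD i).@[v] != 0.
Definition tv j v : vec := fun l => (tau j l).@[v].
Definition nz (v : vec) := exists l, v l != 0.
Definition nrmk (v : vec) := exists i, v i = 1 /\ forall j : 'I_n.+1, (j < i)%N -> v j = 0.
Hypotheses (hX : forall i, exists d, eX i \is d.-homog) (hD : forall i, exists d, eD i \is d.-homog).
Hypotheses (tU : forall j v, inU v -> nz (tv j v) -> inU (tv j v))
  (inj : forall j j' v v', inU v -> inU v' -> nz (tv j v) -> nz (tv j' v') ->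
    proportional (tv j v) (tv j' v') -> proportional v v')
  (hT : forall v, inU v -> (forall j, ~ nz (tv j v)) -> exists i, proportional v (T i))
  (nT : forall i, nrmk (T i)) (nR : forall i, nrmk (R i)) (sR : forall i, inU (R i))
  (iR : forall i i', i != i' -> exists l, R i l != R i' l)
  (mR : forall j v i, inU v -> nz (tv j v) -> ~ proportional (tv j v) (R i)).

(** The hypotheses amount to finitely many implications between polynomial equations. Their
    certificates, the polynomials and the points involve finitely many scalars, which are
    specialized to a finite field. *)
Lemma counting_core : False.
Proof.
(* Two groups of variables, because injectivity speaks of a pair of points. *)
pose M := (n.+1 + n.+1)%N.
pose w1 (i : 'I_n.+1) : {mpoly k[M]} := 'X_(lshift n.+1 i).
pose w2 (i : 'I_n.+1) : {mpoly k[M]} := 'X_(rshift n.+1 i).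
pose v1 (z : 'I_M -> k) : vec := fun i => z (lshift n.+1 i).
pose v2 (z : 'I_M -> k) : vec := fun i => z (rshift n.+1 i).
have ew1 G z : (gcomp G w1).@[z] = G.@[v1 z].
  by rewrite meval_gcomp; apply: eq_mmap => // i; rewrite mevalXU.
have ew2 G z : (gcomp G w2).@[z] = G.@[v2 z].
  by rewrite meval_gcomp; apply: eq_mmap => // i; rewrite mevalXU.
pose t1 j l := gcomp (tau j l) w1; pose t2 j l := gcomp (tau j l) w2.
have et1 G j z : (gcomp G (t1 j)).@[z] = G.@[tv j (v1 z)].
  by rewrite meval_gcomp; apply: eq_mmap => // i; rewrite ew1.
pose E1 := [seq gcomp (eX i) w1 | i <- enum 'I_a].
pose E2 := [seq gcomp (eX i) w2 | i <- enum 'I_a].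
have inE1 i : gcomp (eX i) w1 \in E1 by apply/mapP; exists i; rewrite ?mem_enum.
have inE2 i : gcomp (eX i) w2 \in E2 by apply/mapP; exists i; rewrite ?mem_enum.
have hE1 (s : seq {mpoly k[M]}) z : (forall e, e \in E1 ++ s -> e.@[z] = 0) -> inX (v1 z).
  by move=> h i; rewrite -ew1; apply: h; rewrite mem_cat inE1.
have orz (x y : k) : (x != 0 -> y = 0) -> x * y = 0.
  by have [->|x0] := eqVneq x 0; rewrite ?mul0r // => ->; rewrite ?mulr0.
(* In this and the following clauses, open conditions are absorbed by multiplying the conclusion by
   the functions required to be nonzero. [q1] and [q2] keep the image in the closed and in the open
   part, [q3] is injectivity, [q4] bounds the indeterminacy and [q5] keeps the points [R i] out of
   the image. *)
have [|q1 C1] := @clauses_transfer k M ('I_c * 'I_a * 'I_n.+1 * 'I_b)%type (fun i => E1 ++ [::])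
  (fun i => gcomp (eD i.2) w1 * (t1 i.1.1.1 i.1.2 * gcomp (eX i.1.1.2) (t1 i.1.1.1))).
  move=> [[[j i] l] d] z /hE1 h; rewrite !rmorphM /= !ew1 et1; apply: (orz) => nd; apply: (orz) => nt.
  by apply: (tU (j := j) (v := v1 z) _ _).1; [split=> //; exists d|exists l].
have [|q2 C2] := @clauses_transfer k M ('I_c * 'I_n.+1 * 'I_b)%type
  (fun i => E1 ++ [seq gcomp (eD d) (t1 i.1.1) | d <- enum 'I_b])
  (fun i => gcomp (eD i.2) w1 * t1 i.1.1 i.1.2).
  move=> [[j l] d] z /= hz; have h := hE1 _ _ hz; rewrite !rmorphM /= !ew1; apply: (orz) => nd.
  apply/eqP; apply: contrapT => /negP nt.
  have [||_ [d']] := @tU j (v1 z); [by split=> //; exists d|by exists l|].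
  rewrite -et1 hz ?eqxx // mem_cat; apply/orP; right.
  by apply/mapP; exists d'; rewrite ?mem_enum.
have [|q3 C3] := @clauses_transfer k M (('I_c * 'I_c) * ('I_b * 'I_b) * ('I_n.+1 * 'I_n.+1) * ('I_n.+1 * 'I_n.+1))%type
  (fun i => E1 ++ (E2 ++ [seq t1 i.1.1.1.1 p.1 * t2 i.1.1.1.2 p.2 - t1 i.1.1.1.1 p.2 * t2 i.1.1.1.2 p.1
                  | p <- enum {: 'I_n.+1 * 'I_n.+1}]))
  (fun i => gcomp (eD i.1.1.2.1) w1 * (gcomp (eD i.1.1.2.2) w2 * (t1 i.1.1.1.1 i.1.2.1 *
    (t2 i.1.1.1.2 i.1.2.2 * (w1 i.2.1 * w2 i.2.2 - w1 i.2.2 * w2 i.2.1))))).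
  move=> [[[[j j'] [d d']] [l l']] [x y]] z /= hz; have h := hE1 _ _ hz.
  have h2 : inX (v2 z) by move=> i; rewrite -ew2; apply: hz; rewrite !mem_cat inE2 orbT.
  rewrite !(rmorphM, rmorphB) /= !ew1 !ew2 !mevalXU.
  apply: (orz) => nd; apply: (orz) => nd'; apply: (orz) => nl; apply: (orz) => nl'.
  apply/eqP; rewrite subr_eq0; apply/eqP; apply: (inj (j := j) (j' := j') (v := v1 z) (v' := v2 z)).
  - by split=> //; exists d.
  - by split=> //; exists d'.
  - by exists l.
  - by exists l'.
  - move=> p q; apply/eqP; rewrite -subr_eq0; apply/eqP; rewrite /tv -!ew1 -!ew2 -!rmorphM -rmorphB.
    apply: hz; rewrite !mem_cat; apply/orP; right; apply/orP; right.
    by apply/mapP; exists (p, q); rewrite ?mem_enum.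
(* Being proportional to some [T s] is a disjunction; it is expressed by the vanishing of every
   product that takes one minor for each [s]. *)
have [|q4 C4] := @clauses_transfer k M ('I_b * {ffun 'I_r -> 'I_n.+1 * 'I_n.+1})%type
  (fun i => E1 ++ [seq t1 p.1 p.2 | p <- enum {: 'I_c * 'I_n.+1}])
  (fun i => gcomp (eD i.1) w1 * \prod_(s < r) (w1 (i.2 s).1 * (T s (i.2 s).2)%:MP - w1 (i.2 s).2 * (T s (i.2 s).1)%:MP)).
  move=> [d ch] z /= hz; have h := hE1 _ _ hz; rewrite rmorphM /= ew1; apply: (orz) => nd.
  have [|j [l]|s hs] := @hT (v1 z); first by split=> //; exists d.
    rewrite /tv -ew1 hz ?eqxx // mem_cat; apply/orP; right.
    by apply/mapP; exists (j, l); rewrite ?mem_enum.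
  rewrite rmorph_prod (bigD1 s) //= rmorphB !rmorphM /= !mevalXU !mevalC.
  by have := hs (ch s).1 (ch s).2; rewrite /v1 => ->; rewrite subrr mul0r.
have [|q5 C5] := @clauses_transfer k M ('I_c * 'I_r.+1 * 'I_b * 'I_n.+1)%type
  (fun i => E1 ++ [seq t1 i.1.1.1 p.1 * (R i.1.1.2 p.2)%:MP - t1 i.1.1.1 p.2 * (R i.1.1.2 p.1)%:MP
      | p <- enum {: 'I_n.+1 * 'I_n.+1}])
  (fun i => gcomp (eD i.1.2) w1 * t1 i.1.1.1 i.2).
  move=> [[[j s] d] l] z /= hz; have h := hE1 _ _ hz; rewrite rmorphM /= !ew1; apply: (orz) => nd.
  apply/eqP; apply: contrapT => /negP nt.
  apply: (@mR j (v1 z) s); [by split=> //; exists d|by exists l|move=> p q].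
  apply/eqP; rewrite -subr_eq0; apply/eqP; rewrite /tv -!ew1.
  have := hz (t1 j p * (R s q)%:MP - t1 j q * (R s p)%:MP); rewrite rmorphB !rmorphM /= !mevalC; apply.
  by rewrite mem_cat; apply/orP; right; apply/mapP; exists (p, q); rewrite ?mem_enum.
have [cs1 L1] := lifted_ex (q1 ++ q2 ++ q3 ++ q4 ++ q5).
pose base := [seq eX i | i <- enum 'I_a] ++ [seq eD i | i <- enum 'I_b] ++
  [seq tau p.1 p.2 | p <- enum {: 'I_c * 'I_n.+1}].
have [cs2 L2] := lifted_ex base.
pose cs3 := [seq T p.1 p.2 | p <- enum {: 'I_r * 'I_n.+1}] ++
  [seq R p.1 p.2 | p <- enum {: 'I_r.+1 * 'I_n.+1}].
have /choice [dR hdR] : forall i, exists d, (eD d).@[R i] != 0 by move=> i; have [_ [d h]] := sR i; exists d.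
have /choice [df hdf] : forall p : 'I_r.+1 * 'I_r.+1, exists l, p.1 != p.2 -> R p.1 l != R p.2 l.
  by move=> [i i'] /=; have [_|/iR [l hl]] := eqVneq i i'; [exists ord0|exists l].
(* Since [u] stays nonzero, the specialized points [R i] remain in the open part and pairwise
   distinct. *)
pose u := (\prod_(i < r.+1) (eD (dR i)).@[R i]) *
  \prod_(p : 'I_r.+1 * 'I_r.+1 | p.1 != p.2) (R p.1 (df p) - R p.2 (df p)).
have u0 : u != 0.
  by rewrite mulf_neq0 //; apply/prodf_neq0 => p hp; rewrite ?hdR // subr_eq0 hdf.
have [F [A [al [be [hk hcs hu]]]]] := finite_model (cs1 ++ cs2 ++ cs3) u0.
have l1 q : q \in q1 ++ q2 ++ q3 ++ q4 ++ q5 -> lifted al q.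
  by apply: L1 => x hx; apply: hcs; rewrite mem_cat hx.
have l2 q : q \in base -> lifted al q.
  by apply: L2 => x hx; apply: hcs; rewrite !mem_cat hx orbT.
have l3 x : x \in cs3 -> exists y, al y = x.
  by move=> hx; apply: hcs; rewrite mem_cat; apply/orP; right; rewrite mem_cat hx orbT.
have /choice [X' hX'] : forall i, exists G, map_mpoly al G = eX i /\ {subset msupp G <= msupp (eX i)}.
  move=> i; have [|G] := l2 (eX i); last by exists G.
  by rewrite mem_cat; apply/orP; left; apply/mapP; exists i; rewrite ?mem_enum.
have /choice [D' hD'] : forall i, exists G, map_mpoly al G = eD i /\ {subset msupp G <= msupp (eD i)}.
  move=> i; have [|G] := l2 (eD i); last by exists G.
  by rewrite !mem_cat; apply/orP; right; apply/orP; left; apply/mapP; exists i; rewrite ?mem_enum.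
have /choice [ta' hta'] : forall p, exists G, map_mpoly al G = tau p.1 p.2.
  move=> p; have [|G] := l2 (tau p.1 p.2); last by exists G.
  by rewrite !mem_cat; apply/orP; right; apply/orP; right; apply/mapP; exists p; rewrite ?mem_enum.
have /choice [T' hT'] : forall p, exists y, al y = T p.1 p.2.
  move=> p; apply: l3; rewrite mem_cat; apply/orP; left.
  by apply/mapP; exists p; rewrite ?mem_enum.
have /choice [R' hR'] : forall p, exists y, al y = R p.1 p.2.
  move=> p; apply: l3; rewrite mem_cat; apply/orP; right.
  by apply/mapP; exists p; rewrite ?mem_enum.
pose XF i (y : {ffun 'I_n.+1 -> F}) := mmap be y (X' i); pose DF i (y : {ffun 'I_n.+1 -> F}) := mmap be y (D' i).
pose tF j (y : {ffun 'I_n.+1 -> F}) : {ffun 'I_n.+1 -> F} := [ffun l => mmap be y (ta' (j, l))].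
pose TF s : {ffun 'I_n.+1 -> F} := [ffun l => be (T' (s, l))].
pose RF s : {ffun 'I_n.+1 -> F} := [ffun l => be (R' (s, l))].
pose inS y := [forall i, XF i y == 0] && [exists i, DF i y != 0].
pose zz (y y' : {ffun 'I_n.+1 -> F}) (i : 'I_M) := match split i with inl i => y i | inr i => y' i end.
have zl y y' i : zz y y' (lshift _ i) = y i by rewrite /zz (unsplitK (inl i)).
have zr y y' i : zz y y' (rshift _ i) = y' i by rewrite /zz (unsplitK (inr i)).
have s1 y y' i : spec al be (zz y y') (w1 i) (y i) by rewrite -(zl y y'); apply: specX.
have s2 y y' i : spec al be (zz y y') (w2 i) (y' i) by rewrite -(zr y y'); apply: specX.
have sX1 y y' i : spec al be (zz y y') (gcomp (eX i) w1) (XF i y).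
  by rewrite -(hX' i).1; apply: spec_gcomp.
have sX2 y y' i : spec al be (zz y y') (gcomp (eX i) w2) (XF i y').
  by rewrite -(hX' i).1; apply: spec_gcomp.
have sD1 y y' i : spec al be (zz y y') (gcomp (eD i) w1) (DF i y).
  by rewrite -(hD' i).1; apply: spec_gcomp.
have sD2 y y' i : spec al be (zz y y') (gcomp (eD i) w2) (DF i y').
  by rewrite -(hD' i).1; apply: spec_gcomp.
have st1 y y' j l : spec al be (zz y y') (t1 j l) (tF j y l).
  by rewrite /t1 -(hta' (j, l)) ffunE; apply: spec_gcomp.
have st2 y y' j l : spec al be (zz y y') (t2 j l) (tF j y' l).
  by rewrite /t2 -(hta' (j, l)) ffunE; apply: spec_gcomp.
have sT y y' s l : spec al be (zz y y') (T s l)%:MP (TF s l).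
  by rewrite -(hT' (s, l)) ffunE; apply: specC.
have sRR y y' s l : spec al be (zz y y') (R s l)%:MP (RF s l).
  by rewrite -(hR' (s, l)) ffunE; apply: specC.
have z0 y : (forall i, XF i y = 0) -> forall y' e, e \in E1 -> spec al be (zz y y') e 0.
  by move=> h y' e /mapP [i _ ->]; rewrite -(h i).
have nzF (y : {ffun 'I_n.+1 -> F}) : y != 0 -> exists l, y l != 0.
  move=> y0; apply: contrapT => no; move/eqP: y0; apply; apply/ffunP => i; rewrite ffunE.
  by apply/eqP; apply: contrapT => /negP h; apply: no; exists i.
have inSP y : inS y -> (forall i, XF i y = 0) /\ exists i, DF i y != 0.
  by move=> /andP [/forallP h /existsP h']; split=> // i; apply/eqP.
have kn (x y : F) : x != 0 -> x * y = 0 -> y = 0 by move=> x0 /eqP; rewrite mulf_eq0 (negPf x0) => /eqP.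
have subl (s t : seq {mpoly k[M]}) : {subset s <= t} -> (forall q, q \in t -> lifted al q) -> forall q, q \in s -> lifted al q.
  by move=> h h' q /h /h'.
have m1 : forall q, q \in q1 -> lifted al q by apply: subl l1 => q h; rewrite !mem_cat h.
have m2 : forall q, q \in q2 -> lifted al q by apply: subl l1 => q h; rewrite !mem_cat h !orbT.
have m3 : forall q, q \in q3 -> lifted al q by apply: subl l1 => q h; rewrite !mem_cat h !orbT.
have m4 : forall q, q \in q4 -> lifted al q by apply: subl l1 => q h; rewrite !mem_cat h !orbT.
have m5 : forall q, q \in q5 -> lifted al q by apply: subl l1 => q h; rewrite !mem_cat h !orbT.
have al1 x : al x = 1 -> be x = 1.
  by move=> e; apply/eqP; rewrite -subr_eq0 -(rmorph1 be) -rmorphB hk // rmorphB e rmorph1 subrr.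
have nrmF (v : 'I_n.+1 -> A) : nrmk (fun l => al (v l)) -> nrm [ffun l => be (v l)].
  move=> [i [ei hi]]; apply/existsP; exists i; rewrite ffunE al1 // eqxx; apply/forallP => j.
  by apply/implyP => lt; rewrite ffunE hk ?hi.
have bu : be (\prod_(i < r.+1) mmap idfun (fun l => R' (i, l)) (D' (dR i)) *
    \prod_(p : 'I_r.+1 * 'I_r.+1 | p.1 != p.2) (R' (p.1, df p) - R' (p.2, df p))) != 0.
  apply: hu; rewrite rmorphM !rmorph_prod /u; congr (_ * _); apply: eq_bigr => p _.
    rewrite rmorph_mmap -(hD' (dR p)).1 /meval /map_mpoly rmorph_mmap; apply: eq_mmap => [x|l] /=.
      by rewrite mmapC.
    by rewrite mmapX mmap1U hR'.
  by rewrite rmorphB !hR'.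
move: bu; rewrite rmorphM mulf_eq0 negb_or !rmorph_prod => /andP [/prodf_neq0 bu1 /prodf_neq0 bu2].
have hom (G : {mpoly A[n.+1]}) (H : poly_n) d l (y : {ffun 'I_n.+1 -> F}) : H \is d.-homog -> {subset msupp G <= msupp H} ->
    mmap be [ffun i => l * y i] G = l ^+ d * mmap be y G.
  move=> /dhomogP hH sub; rewrite /mmap mulr_sumr big_seq [RHS]big_seq; apply: eq_bigr => m hm.
  rewrite -(hH m (sub m hm)) mulrCA -mmap1_scale; congr (_ * _); rewrite /mmap1.
  by apply: eq_bigr => i _; rewrite ffunE.
apply: (@finite_count F n c r inS tF TF RF).
- move=> l y l0 /inSP [hy [d hd]]; apply/andP; split.
    by apply/forallP => i; have [e he] := hX i; rewrite /XF (hom _ _ _ _ _ he (hX' i).2) -/(XF i y) hy mulr0.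
  apply/existsP; exists d; have [e he] := hD d; rewrite /DF (hom _ _ _ _ _ he (hD' d).2).
  by rewrite mulf_neq0 ?expf_neq0.
- move=> j y /inSP [hy [d hd]] /nzF [l hl]; apply/andP; split.
    apply/forallP => i; apply/eqP; apply: (kn _ _ hl); apply: (kn _ _ hd).
    apply: (C1 _ _ al be hk m1 (j, i, l, d) (zz y y)).
      by move=> e; rewrite cats0 /=; apply: z0.
    apply: specM => //; apply: specM => //; rewrite -(hX' i).1; apply: spec_gcomp => l'; exact: st1.
  apply/existsP; apply: contrapT => no; suff h0 : tF j y l = 0 by rewrite h0 eqxx in hl.
  apply: (kn _ _ hd); apply: (C2 _ _ al be hk m2 (j, l, d) (zz y y)) => [e|]; last exact: specM.
  rewrite mem_cat => /orP [|/mapP [d' _ ->]] /=; first exact: z0.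
  have [e0|ne] := eqVneq (DF d' (tF j y)) 0; last by case: no; exists d'.
  rewrite -e0 -(hD' d').1; apply: spec_gcomp => l'; exact: st1.
- move=> j j' y y' /inSP [hy [d hd]] /inSP [hy' [d' hd']] /nzF [l hl] /nzF [l' hl'] pr p q.
  apply/eqP; rewrite -subr_eq0; apply/eqP; apply: (kn _ _ hl'); apply: (kn _ _ hl); apply: (kn _ _ hd'); apply: (kn _ _ hd).
  apply: (C3 _ _ al be hk m3 ((j, j'), (d, d'), (l, l'), (p, q)) (zz y y')).
    move=> e; rewrite !mem_cat => /orP [|/orP [/mapP [i _ ->]|/mapP [[p' q'] _ ->]]] /=; first exact: z0.
      by rewrite -(hy' i).
    rewrite -(subrr (tF j y p' * tF j' y' q')) {2}pr; apply: specB; exact: specM.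
  by do !apply: specM => //; apply: specB; apply: specM.
- move=> y /inSP [hy [d hd]] ht; apply: contrapT => no.
  have /choice [ch hch] : forall s, exists p, y p.1 * TF s p.2 - y p.2 * TF s p.1 != 0.
    move=> s; apply: contrapT => nc; apply: no; exists s => p q; apply/eqP; rewrite -subr_eq0.
    by apply: contrapT => /negP h; apply: nc; exists (p, q).
  have h : \prod_(s < r) (y (ch s).1 * TF s (ch s).2 - y (ch s).2 * TF s (ch s).1) = 0.
    apply: (kn _ _ hd); apply: (C4 _ _ al be hk m4 (d, [ffun s => ch s]) (zz y y)).
      move=> e; rewrite mem_cat => /orP [|/mapP [[j l] _ ->]] /=; first exact: z0.
      by rewrite (_ : 0 = tF j y l) // ht ffunE.
    apply: specM => //=; elim: (index_enum _) => [|s ss IH]; rewrite ?big_nil ?big_cons; first exact: spec1.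
    by rewrite ffunE; apply: specM => //; apply: specB; apply: specM.
  by move/eqP: h; apply/negP; apply/prodf_neq0 => s _; apply: hch.
- move=> s; apply: nrmF; have [i [ei hi]] := nT s; exists i; rewrite hT'; split=> // j /hi; by rewrite hT'.
- move=> s; apply: nrmF; have [i [ei hi]] := nR s; exists i; rewrite hR'; split=> // j /hi; by rewrite hR'.
- move=> s; apply/andP; split.
    apply/forallP => i; apply/eqP; have [h _] := sR s.
    have : spec al be (RF s) (gcomp (eX i) (fun l => (R s l)%:MP)) (XF i (RF s)).
      by rewrite -(hX' i).1; apply: spec_gcomp => l; rewrite -(hR' (s, l)) ffunE; apply: specC.
    rewrite (_ : gcomp _ _ = 0); last first.
      have /(congr1 (@mpolyC n.+1 k)) := h i; rewrite mpolyC0 => <-.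
      by rewrite /meval rmorph_mmap; apply: eq_mmap.
    by move=> h'; apply: (spec_fun hk h' (spec0 _ _ _)).
  apply/existsP; exists (dR s); have := bu1 s isT; rewrite rmorph_mmap /DF.
  rewrite (eq_mmap _ (f := _ \o _) (g := be) (h := _ \o _) (h' := RF s)) // => l /=; by rewrite ffunE.
- move=> s s' e; apply/eqP; apply: contrapT => /negP ne; have := bu2 (s, s') ne.
  by have := congr1 (fun g : {ffun 'I_n.+1 -> F} => g (df (s, s'))) e; rewrite !ffunE rmorphB /= => ->; rewrite subrr eqxx.
- move=> j y s /inSP [hy [d hd]] /nzF [l hl] pr; suff h0 : tF j y l = 0 by rewrite h0 eqxx in hl.
  apply: (kn _ _ hd); apply: (C5 _ _ al be hk m5 (j, s, d, l) (zz y y)) => [e|]; last exact: specM.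
  rewrite mem_cat => /orP [|/mapP [[p q] _ ->]] /=; first exact: z0.
  rewrite -(subrr (tF j y p * RF s q)) {2}pr; apply: specB; exact: specM.
Qed.

End CountingCore.

Section GeometricCount.
Variables (k : closedFieldType) (X : projVar k).
Local Notation K := (ffield X).
Local Notation point := (ppoint k (pdim X)).
Local Notation N := (pdim X).+1.
Implicit Types P Q : point.

Lemma inf_seq (S : point -> Prop) m : inf S -> exists s : seq point,
  [/\ uniq s, size s = m & forall P, P \in s -> S P].
Proof.
move=> iS; elim: m => [|m [s [us ss hs]]]; first by exists [::].
have [P SP nP] := iS s; exists (P :: s); split; rewrite /= ?nP ?ss //.
by move=> Q; rewrite inE => /orP [/eqP ->|/hs].
Qed.

Lemma prod_homog n (I : Type) (s : seq I) (p : pred I) (G : I -> {mpoly k[n]}) (d : I -> nat) :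
  (forall i, G i \is (d i).-homog) -> \prod_(i <- s | p i) G i \is (\sum_(i <- s | p i) d i)%N.-homog.
Proof.
move=> h; elim: s => [|i s IH]; first by rewrite !big_nil dhomog1.
by rewrite !big_cons; case: (p i) => //; apply: dhomogM.
Qed.

Lemma prop_point P Q (v w : 'I_N -> k) e e' : (forall i, pcoord P i = e * v i) ->
  (forall i, pcoord Q i = e' * w i) -> proportional v w -> P = Q.
Proof.
move=> hP hQ h; apply: contrapT => /minor_neq0 [i [l]]; rewrite !hP !hQ.
by rewrite mulrACA [X in _ != X]mulrACA h eqxx.
Qed.

Lemma prop_scale P (v w : 'I_N -> k) e e' : e != 0 -> e' != 0 -> (forall i, pcoord P i = e * v i) ->
  (forall i, pcoord P i = e' * w i) -> proportional v w.
Proof.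
move=> e0 e'0 hP hQ a b; apply: (mulfI e0); apply: (mulfI e'0).
have c (x y z t : k) : x * (y * (z * t)) = (y * z) * (x * t) by rewrite mulrCA mulrA mulrACA.
by rewrite !c -!hP -!hQ mulrC.
Qed.

(** Forms of one degree that represent [t] generically; they compute it wherever they do not all
    vanish, and several tuples cover the domain. *)
Definition form_tuple (t : birat X X) (ta : 'I_N -> {mpoly k[N]}) := exists (d : nat) l,
  [/\ forall i, ta i \is d.-homog, l != 0 & forall i, gval (ta i) = l * bpull t (gpoint X i)].

Lemma form_tuple_ex t P Q : dom t P Q -> exists ta, form_tuple t ta /\ exists j, (ta j).@[pcoord P] != 0.
Proof.
move=> /maps_to_dom [oP oQ [l hl]].
have /choice [dFG hFG] : forall j, exists dFG : nat * {mpoly k[N]} * {mpoly k[N]},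
    [/\ dFG.1.2 \is dFG.1.1.-homog, dFG.2 \is dFG.1.1.-homog, dFG.2.@[pcoord P] != 0,
     dFG.1.2.@[pcoord P] = pcoord Q j * dFG.2.@[pcoord P] & l * bpull t (gpoint X j) = gval dFG.1.2 / gval dFG.2].
  move=> j; have /(val_shift _ _ oP) [d [F [G [h1 h2 h3 h4 h5]]]] := hl j.
  by exists (d, F, G).
pose G := \prod_(j < N) (dFG j).2; pose ta i := (dFG i).1.2 * \prod_(j < N | j != i) (dFG j).2.
have [j ej] := normalized_coord Q.
have g0 i : gval (dFG i).2 != 0 by have [_ h2 h3 _ _] := hFG i; apply: gval_neq0 oP h2 h3.
have l0 : l != 0.
  apply/eqP => l0; have /(val_shift _ _ oP) := hl j; rewrite l0 mul0r => /(hrel0P (val_lring oP)) h.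
  by move: ej; rewrite h => /esym/eqP; rewrite oner_eq0.
exists ta; split; last first.
  exists j; rewrite /ta rmorphM rmorph_prod /=; have [_ _ h3 -> _] := hFG j.
  rewrite ej mul1r mulf_neq0 //; apply/prodf_neq0 => i _; by have [] := hFG i.
exists (\sum_(i < N) (dFG i).1.1)%N, (l * gval G); split.
- move=> i; rewrite (bigD1 i) //=; apply: dhomogM; first by have [] := hFG i.
  by apply: prod_homog => q; have [] := hFG q.
- by rewrite mulf_neq0 // /gval rmorph_prod; apply/prodf_neq0 => i _; apply: g0.
- move=> i; rewrite mulrAC; have [_ _ _ _ ->] := hFG i.
  rewrite /G (bigD1 i) //= /ta /gval !rmorphM /= -/(gval _) -/(gval _).
  by move: (g0 i); rewrite /gval => gi; rewrite mulrA divfK.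
Qed.

Lemma form_tuple_dom t ta P : form_tuple t ta -> on_var P -> (exists j, (ta j).@[pcoord P] != 0) ->
  exists Q e, [/\ e != 0, forall i, pcoord Q i = e * (ta i).@[pcoord P] & dom t P Q].
Proof.
move=> [d [l [hd l0 hl]]] oP [j nj].
have gj : gval (ta j) != 0 := gval_neq0 oP (hd j) nj.
have [||Q [e [e0 hQ dQ]]] := @dom_vec _ _ _ t P (l / gval (ta j))
    (fun i => (ta i).@[pcoord P] / (ta j).@[pcoord P]) oP.
- by move=> i; rewrite mulrAC -hl; apply: (form_val oP (hd i) (hd j) nj).
- by exists j; rewrite divff ?oner_neq0.
exists Q, (e / (ta j).@[pcoord P]); split=> //; first by rewrite mulf_neq0 ?invr_eq0.
by move=> i; rewrite hQ mulrA mulrAC.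
Qed.

(** A version of Ax's theorem on injective self-maps that allows finitely many points of
    indeterminacy. By the basis theorem finitely many tuples of forms cover the domain of [t], and
    finitely many forms describe [X] and [U]. *)
Lemma counting (U : point -> Prop) (t : birat X X) :
  (forall P, on_var P -> U P -> nb P U) ->
  (forall P Q, U P -> dom t P Q -> U Q) ->
  (forall P P' Q, U P -> U P' -> dom t P Q -> dom t P' Q -> P = P') ->
  (exists T : seq point, forall P, on_var P -> ~ (exists Q, dom t P Q) -> P \in T) ->
  ~ inf (fun R => [/\ on_var R, U R & forall P, U P -> ~ dom t P R]).
Proof.
move=> hU hstab hinj [T hT] iS.
have [Rs [uR szR hR]] := inf_seq (size T).+1 iS.
have [P0 [oP0 _ _] _] := iS [::].
have [sX [hsX gX]] := forms_noeth (fun G : {mpoly k[N]} => exists d, G \is d.-homog /\ gval G = 0).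
(* Positive degree excludes the zero vector from the open set described by these forms. *)
have [sD [hsD gD]] := forms_noeth (fun G : {mpoly k[N]} => exists d, [/\ (0 < d)%N, G \is d.-homog &
   forall P, on_var P -> ~ U P -> G.@[pcoord P] = 0]).
have [sT [hsT gT]] := forms_noeth (fun G : {mpoly k[N]} => exists ta, form_tuple t ta /\ exists j, G = ta j).
have /choice [tt htt] : forall G, exists ta, G \in sT -> form_tuple t ta /\ exists j, G = ta j.
  by move=> G; have [/hsT [ta h]|_] := boolP (G \in sT); [exists ta|exists (fun=> 0)].
pose eX (i : 'I_(size sX)) := nth 0 sX i; pose eD (i : 'I_(size sD)) := nth 0 sD i.
pose tau (i : 'I_(size sT)) := tt (nth 0 sT i).
pose TT (i : 'I_(size T)) := pcoord (nth P0 T i).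
pose RR (i : 'I_(size T).+1) := pcoord (nth P0 Rs i).
have ix (S : eqType) (s : seq S) x0 x : x \in s -> exists i : 'I_(size s), nth x0 s i = x.
  by move=> h; have lt : (index x s < size s)%N by [rewrite index_mem]; exists (Ordinal lt); rewrite /= nth_index.
have hX i : exists d, eX i \is d.-homog by have [d []] := hsX _ (mem_nth 0 (ltn_ord i)); exists d.
have hD i : exists d, (0 < d)%N /\ eD i \is d.-homog by have [d []] := hsD _ (mem_nth 0 (ltn_ord i)); exists d.
have ft j : form_tuple t (tau j) by have [] := htt _ (mem_nth 0 (ltn_ord j)).
have Xv P v e : e != 0 -> (forall i, pcoord P i = e * v i) -> on_var P <-> inX eX v.
  move=> e0 hP; split=> [oP i|hv d F hF e1].
    have [d [hd g0]] := hsX _ (mem_nth 0 (ltn_ord i)).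
    have := oP d _ hd g0; rewrite (meval_scale hd hP) => /eqP.
    by rewrite mulf_eq0 expf_eq0 (negPf e0) andbF => /eqP.
  rewrite (meval_scale hF hP) (ispan_eval (gX F _)) ?mulr0 //; first by exists d.
  by move=> G /(ix _ _ 0) [i <-]; apply: hv.
have Uv P v e : e != 0 -> (forall i, pcoord P i = e * v i) -> (on_var P /\ U P) <-> inU eX eD v.
  move=> e0 hP; rewrite /inU -(Xv P v e e0 hP); split=> [[oP UP]|[oP [i ni]]]; split=> //.
    apply: contrapT => no; have [d [G [hG nG hGU]]] := hU P oP UP.
    have [j ej] := normalized_coord P.
    have : (G * 'X_j).@[v] = 0.
      apply: (ispan_eval (gD _ _)).
        exists (d + 1)%N; split; [by rewrite addn1|by apply: dhomogM => //; apply: coordX_homog|].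
        move=> P' o' nU'; rewrite rmorphM /=; have [->|/(hGU _ o') //] := eqVneq G.@[pcoord P'] 0.
        by rewrite mul0r.
      by move=> F /(ix _ _ 0) [i <-]; apply/eqP; apply: contrapT => /negP h; apply: no; exists i.
    have := meval_scale (dhomogM hG (coordX_homog k j)) hP => e1 e2.
    by move/eqP: e1; rewrite e2 mulr0 rmorphM /= mevalXU ej mulr1 (negPf nG).
  apply: contrapT => nU; have [d [_ hd h]] := hsD _ (mem_nth 0 (ltn_ord i)).
  have := h P oP nU; rewrite (meval_scale hd hP) => /eqP.
  by rewrite mulf_eq0 expf_eq0 (negPf e0) andbF (negPf ni).
have pt v : inU eX eD v -> exists P e, [/\ e != 0, forall i, pcoord P i = e * v i, on_var P & U P].
  move=> hv; have [_ [i ni]] := hv; have [d [d0 hd]] := hD i.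
  have [v0|nv] := EM (exists l, v l != 0).
    have [P [e [e0 hP]]] := point_of_vec v0; have [oP UP] := (Uv P v e e0 hP).2 hv.
    by exists P, e.
  case/negP: ni; rewrite (meval_scale (c := v) (e := 0) hd); first by rewrite expr0n eqn0Ngt d0 mul0r.
  by move=> l; rewrite mul0r; apply/eqP; apply: contrapT => /negP h; apply: nv; exists l.
have td j v P e : e != 0 -> (forall i, pcoord P i = e * v i) -> on_var P -> nz (tv tau j v) ->
    exists Q e', [/\ e' != 0, forall i, pcoord Q i = e' * tv tau j v i & dom t P Q].
  move=> e0 hP oP [l nl]; have [d [c [hd _ _]]] := ft j.
  have es i : (tau j i).@[pcoord P] = e ^+ d * tv tau j v i by apply: meval_scale.
  have [|Q [e' [e'0 hQ dQ]]] := form_tuple_dom (ft j) oP.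
    by exists l; rewrite es mulf_neq0 ?expf_neq0.
  exists Q, (e' * e ^+ d); split=> //; first by rewrite mulf_neq0 ?expf_neq0.
  by move=> i; rewrite hQ es mulrA.
have one P i : pcoord P i = 1 * pcoord P i by rewrite mul1r.
have nrmP P : nrmk (pcoord P).
  case: P => v hv; have /existsP [i /andP [/eqP ei /forallP hi]] := hv; exists i; split=> // j lt.
  by apply/eqP; have := hi j; rewrite lt.
have szR' (i : 'I_(size T).+1) : (i < size Rs)%N by rewrite szR.
have hRR (i : 'I_(size T).+1) := hR _ (mem_nth P0 (szR' i)).
apply: (@counting_core k (pdim X) _ _ _ _ eX eD tau TT RR) => //.
- by move=> i; have [d [_ h]] := hD i; exists d.
- move=> j v hv nv; have [P [e [e0 hP oP UP]]] := pt v hv.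
  have [Q [e' [e'0 hQ dQ]]] := td j v P e e0 hP oP nv.
  by apply/(Uv Q _ e' e'0 hQ); split; [case: dQ|apply: hstab dQ].
- move=> j j' v v' hv hv' nv nv' pr.
  have [P [e [e0 hP oP UP]]] := pt v hv; have [P' [f [f0 hP' oP' UP']]] := pt v' hv'.
  have [Q [e' [e'0 hQ dQ]]] := td j v P e e0 hP oP nv.
  have [Q' [f' [f'0 hQ' dQ']]] := td j' v' P' f f0 hP' oP' nv'.
  have eQ : Q = Q' := prop_point hQ hQ' pr; rewrite -eQ in dQ'.
  have eP := hinj _ _ _ UP UP' dQ dQ'; rewrite -eP in hP'.
  exact: prop_scale hP hP'.
- move=> v hv nv; have [P [e [e0 hP oP UP]]] := pt v hv.
  have [|i ei] := ix _ _ P0 P (_ : P \in T); last first.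
    by exists i; apply: (prop_scale e0 (oner_neq0 k) hP) => l; rewrite /TT ei mul1r.
  apply: hT => // -[Q dQ]; have [ta [fta [l nl]]] := form_tuple_ex dQ.
  move: nl; rewrite (ispan_eval (gT (ta l) _)) ?eqxx //; first by exists ta; split=> //; exists l.
  move=> G hG; have [[d [c [hd _ _]]] [l' eG]] := htt G hG; have [j ej] := ix _ _ 0 G hG.
  apply/eqP; apply: contrapT => /negP n0; apply: (nv j); exists l'.
  have et : tau j l' = G by rewrite /tau ej -eG.
  rewrite /tv et; apply: contraNneq n0 => h0; rewrite {1}eG (meval_scale (hd l') hP) -eG h0 mulr0 //.
- by move=> i; apply: nrmP.
- by move=> i; apply: nrmP.
- by move=> i; have [oR UR _] := hRR i; apply/(Uv _ _ 1 (oner_neq0 k) (one _)).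
- move=> i i' ne; apply: contrapT => no; move/eqP: ne; apply; apply: ord_inj.
  apply/eqP; rewrite -(nth_uniq P0 (szR' i) (szR' i') uR); apply/eqP.
  apply: (point_prop (c := 1)) => l; rewrite mul1r; apply/eqP; apply: contrapT => /negP h.
  by apply: no; exists l.
move=> j v i hv nv pr; have [P [e [e0 hP oP UP]]] := pt v hv.
have [Q [e' [e'0 hQ dQ]]] := td j v P e e0 hP oP nv.
have [_ _ h] := hRR i; apply: (h P UP).
by rewrite -(prop_point hQ (one _) pr).
Qed.

End GeometricCount.

(** * The local rings along the orbit of a place *)

Section IntegerIterates.
Variables (k : closedFieldType) (X : projVar k) (sigma : birat X X).
Local Notation K := (ffield X).
Local Notation point := (ppoint k (pdim X)).
Local Notation it := (birat_iter sigma).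

Definition zpow (n : int) : birat X X :=
  match n with Posz m => it m | Negz m => birat_iter (birat_inv sigma) m.+1 end.

Lemma zpow1 n f : bpull (zpow (1 + n)) f = bpull sigma (bpull (zpow n) f).
Proof.
case: n => [n|[|n]]; first by rewrite -itSr.
  by rewrite /= bpull_invK.
rewrite (_ : (1 + Negz n.+1)%R = Negz n); last by lia.
by rewrite [bpull (zpow (Negz n.+1)) f](itSr (birat_inv sigma)) /= bpull_invK.
Qed.

Lemma zpowV1 n f : bpull (zpow (-1 + n)) f = bpull_inv sigma (bpull (zpow n) f).
Proof. by rewrite -[in RHS](_ : 1 + (-1 + n) = n) ?zpow1 ?bpullK // addrA subrr add0r. Qed.

Lemma zpowD m n f : bpull (zpow (m + n)) f = bpull (zpow m) (bpull (zpow n) f).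
Proof.
case: m => m.
  elim: m => [|m IH]; first by rewrite add0r.
  by rewrite -add1n PoszD -addrA !zpow1 IH.
elim: m => [|m IH]; first by rewrite (_ : Negz 0 = -1) // zpowV1 -[-1]addr0 zpowV1.
rewrite (_ : Negz m.+1 = -1 + Negz m); last by lia.
by rewrite -addrA !zpowV1 IH.
Qed.

Lemma zpowK n f : bpull (zpow (- n)) (bpull (zpow n) f) = f.
Proof. by rewrite -zpowD addNr. Qed.

Lemma zpowVK n f : bpull (zpow n) (bpull (zpow (- n)) f) = f.
Proof. by rewrite -zpowD subrr. Qed.

Implicit Types (v : K -> k -> Prop) (P Q : point).

Lemma dom_zpow m n P Q R : dom (zpow m) P Q -> dom (zpow n) Q R -> dom (zpow (m + n)) P R.
Proof. by move=> h h'; apply: dom_comp h h' _ => f; rewrite zpowD. Qed.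

Definition zcenter v n P := center (pull (zpow n) v) P.

Lemma zcenter_ex v n : place (fconst X) v -> exists P, zcenter v n P.
Proof. by move=> pv; apply: center_ex; apply: pull_place. Qed.

Lemma zcenter_uniq v n P Q : place (fconst X) v -> zcenter v n P -> zcenter v n Q -> P = Q.
Proof. by move=> pv; apply: center_uniq; apply: pull_place. Qed.

Lemma zcenter_pull v m n P : zcenter (pull (zpow m) v) n P <-> zcenter v (m + n) P.
Proof.
have e f c : pull (zpow n) (pull (zpow m) v) f c <-> pull (zpow (m + n)) v f c by rewrite /pull zpowD.
by split=> -[oP h]; split=> // f c /h /e.
Qed.

Lemma zcenter_dom v m d P Q : place (fconst X) v -> zcenter v m P -> dom (zpow d) P Q -> zcenter v (m + d) Q.
Proof. by move=> pv cP dPQ; apply/zcenter_pull; apply: dom_center cP dPQ; apply: pull_place. Qed.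

Lemma zcenter0 v P : zcenter v 0 P <-> center v P.
Proof. by []. Qed.

(* The local ring of the center of sigma^n v, carried back into the same copy of
   the function field. *)
Definition zlocal v n f := exists2 P, zcenter v n P & fin (val P) (bpull (zpow (- n)) f).
Definition incl v n m := forall f, zlocal v n f -> zlocal v m f.

Lemma zlocalP v n P f : place (fconst X) v -> zcenter v n P -> zlocal v n f <-> fin (val P) (bpull (zpow (- n)) f).
Proof.
move=> pv cP; split=> [[P' cP' h]|h]; last by exists P.
by rewrite (zcenter_uniq pv cP cP').
Qed.

(** Containment of the two rings already implies compatibility of values, because both residue maps
    are restrictions of the place [v]. *)
Lemma incl_dom v n m P Q : place (fconst X) v -> zcenter v m P -> zcenter v n Q ->
  incl v n m <-> dom (zpow (n - m)) P Q.
Proof.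
move=> pv cP cQ; split=> [h|[oP oQ h] f].
  have [oP hP] := cP; have [oQ hQ] := cQ; split=> // f c Vc.
  have /h /(zlocalP _ pv cP) [r] : zlocal v n (bpull (zpow n) f).
    by apply/(zlocalP _ pv cQ); rewrite zpowK; exists c.
  rewrite -zpowD addrC => Vr; have := hP _ _ Vr; rewrite /pull -zpowD (_ : m + (n - m) = n) => [h1|]; last by lia.
  by rewrite (hrel_fun (place_hrel pv) (hQ _ _ Vc) h1).
move=> /(zlocalP _ pv cQ) [c /h]; rewrite -zpowD addrAC subrr add0r => Vc.
by apply/(zlocalP _ pv cP); exists c.
Qed.

Lemma incl_trans v a b c : incl v a b -> incl v b c -> incl v a c.
Proof. by move=> h h' f /h /h'. Qed.

(* By [upP], sigma is undefined at the n-th center of v. *)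
Definition up v n := ~ incl v (n + 1) n.

Lemma upP v n P : place (fconst X) v -> zcenter v n P -> up v n <-> ~ exists Q, dom sigma P Q.
Proof.
move=> pv cP; have [Q cQ] := zcenter_ex (n + 1) pv.
rewrite /up (incl_dom pv cP cQ) addrAC subrr add0r; split=> [h [Q' d]|h d]; last by apply: h; exists Q.
by apply: h; rewrite (zcenter_uniq pv cQ (zcenter_dom pv cP (d : dom (zpow 1) P Q'))).
Qed.

Lemma no_up v m d : (forall i : nat, (i < d)%N -> ~ up v (m + i%:Z)) -> incl v (m + d%:Z) m.
Proof.
elim: d => [|d IH] h; first by rewrite addr0.
apply: incl_trans (IH _) => [|i lt]; last by apply: h; apply: leq_trans lt _.
by have /contrapT := h d (ltnSn d); rewrite -addrA -PoszD addn1.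
Qed.

End IntegerIterates.

(** * Where the N-th iterate is a local isomorphism *)

Section Reflection.
Variables (k : closedFieldType) (X : projVar k) (sigma : birat X X).
Local Notation K := (ffield X).
Local Notation point := (ppoint k (pdim X)).
Local Notation it := (birat_iter sigma).
Local Notation zpow := (zpow sigma).
Local Notation zcenter := (zcenter sigma).
Local Notation up := (up sigma).
Local Notation incl := (incl sigma).
Hypothesis sX : surface X.
Variable N : nat.
Hypothesis FO : forall P, on_var P -> ~ (exists Q, dom sigma P Q) ->
  forall j, (N <= j)%N -> exists Q, dom (it j) P Q /\ exists Q', dom sigma Q Q'.
Implicit Types (v : K -> k -> Prop) (P Q R : point).

Definition bad p i := [/\ on_var p, (1 <= i)%N, (i < N)%N, ~ (exists Q, dom sigma p Q) & ~ (exists Q, dom (it i) p Q)].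

(* The locus which sigma^N must avoid to be a local isomorphism. *)
Definition over_bad P := exists p i, bad p i /\ fiber (it i) p P.

(** The bad locus is a finite union of closed fibres, since there are finitely many fundamental
    points and [i < N]. *)
Lemma over_bad_nb P : on_var P -> ~ over_bad P -> nb P (fun P' => ~ over_bad P').
Proof.
move=> oP nD; have [T hT] := fund_finite sX sigma.
suff h : nb P (fun P' => forall p, p \in T -> forall i : 'I_N, bad p i -> ~ fiber (it i) p P').
  apply: nbS h => P' _ h [p [i [b fp]]]; have [op i1 iN nd _] := b.
  by apply: (h p (hT p op nd) (Ordinal iN)).
elim: T {hT} => [|p T IH]; first by apply: nbT.
have hp : nb P (fun P' => forall i : 'I_N, bad p i -> ~ fiber (it i) p P').
  apply: nb_all => i; have [b|nb_] := EM (bad p i); last by apply: nbT => P' _ /nb_.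
  have [op _ _ _ _] := b; have cF := fiber_closed (it i) op.
  apply: nbS (zclosed_nb cF _) => [P' o' h _ fp|[_ fp]]; first by apply: h.
  by apply: nD; exists p, i.
apply: nbS (nbI hp IH) => P' _ [h h'] q; rewrite inE => /orP [/eqP -> //|]; exact: h'.
Qed.

Lemma over_bad_place v P p (i : nat) : place (fconst X) v -> center v P -> zcenter v (- i%:Z) p -> bad p i -> over_bad P.
Proof.
move=> pv cP cp b; exists p, i; split=> //; exists (pull (zpow (- i%:Z)) v); split=> //.
  exact: pull_place.
by apply: (proj2 (zcenter_pull sigma v (- i%:Z) i P)); rewrite addNr.
Qed.

Lemma FO_dom P j : on_var P -> ~ (exists Q, dom sigma P Q) -> (N <= j)%N -> exists Q, dom (it j) P Q.
Proof. by move=> oP nd /(FO oP nd) [Q [d _]]; exists Q. Qed.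

(** Let [p] be the first fundamental point on the orbit from time [-N] to time 0. The remaining
    [N - i] steps are defined at [p]: for [i = 0] by the orbit condition, for [i > 0] because [P]
    does not lie over a bad pair. *)
Lemma back_reflects P Q : ~ over_bad P -> dom (zpow (- N%:Z)) P Q -> dom (it N) Q P.
Proof.
move=> nD d; have [oP oQ _] := d; have [v pv cP] := center_place oP.
have cQ : zcenter v (- N%:Z) Q by have := zcenter_dom pv (proj2 (zcenter0 sigma v P) cP) d; rewrite add0r.
suff h : incl v 0 (- N%:Z).
  by have := (incl_dom pv cQ (proj2 (zcenter0 sigma v P) cP)).1 h; rewrite sub0r opprK.
have [h|] := EM (forall i : nat, (i < N)%N -> ~ up v (- N%:Z + i%:Z)).
  by have := no_up h; rewrite addNr.
move=> hex; have ex : exists i : nat, `[< (i < N)%N /\ up v (- N%:Z + i%:Z) >].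
  apply: contrapT => no; apply: hex => i lt u; apply: no; exists i; exact/asboolP.
have [i /asboolP [iN ui] mi] := ex_minnP ex.
have h1 : incl v (- N%:Z + i%:Z) (- N%:Z).
  apply: no_up => l lt u; have := mi l (introT (asboolP _) (conj (ltn_trans lt iN) u)).
  by rewrite leqNgt lt.
apply: incl_trans h1.
have [p cp] := zcenter_ex sigma (- N%:Z + i%:Z) pv; have [op _] := cp; have nd := (upP pv cp).1 ui.
have ei : - N%:Z + i%:Z = - (N - i)%:Z by move: iN; lia.
have [R dR] : exists R, dom (it (N - i)) p R.
  have [i0|i0] := posnP i; first by rewrite i0 subn0; apply: FO_dom op nd _.
  apply: contrapT => nR; apply: nD; apply: (over_bad_place pv cP (p := p) (i := (N - i)%N)).
    by rewrite -ei.
  by split=> //; move: i0 iN; lia.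
have cR := zcenter_dom pv cp (dR : dom (zpow (N - i)%:Z) p R).
rewrite ei addNr in cR; apply: (proj2 (incl_dom pv cp cR)).
by rewrite ei sub0r opprK.
Qed.

(** If [Q] lies over a bad pair [p], [i], the orbit condition defines [sigma^(i+N)] at [p] with
    value [P]. Followed by [sigma^-N] it defines [sigma^i] at [p], which badness denies. *)
Lemma back_avoids P Q : ~ over_bad P -> dom (zpow (- N%:Z)) P Q -> ~ over_bad Q.
Proof.
move=> nD d [p [i [[op i1 iN nd ni] [w [pw cw cQ]]]]].
have d' := back_reflects nD d; have [R dR] := @FO_dom p (i + N)%N op nd (leq_addl _ _).
have eR : R = P.
  have h1 := dom_center pw cw dR.
  apply: center_uniq (pull_place _ pw) h1 _; have [oQ hQ] := cQ; have [_ oP hd] := d'; split=> // f c.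
  by move=> /hd /hQ; rewrite /pull itD.
rewrite eR in dR; apply: ni; exists Q.
have := dom_zpow (dR : dom (zpow (i + N)%:Z) p P) d; rewrite PoszD addrK //.
Qed.

Lemma reflects_inv n R Q : reflects (zpow n) R Q -> dom (zpow n) R Q -> dom (zpow (- n)) Q R.
Proof.
move=> h [oR oQ hd]; split=> // f c Vc.
have [r Vr] : fin (val Q) (bpull (zpow (- n)) f) by apply: h; rewrite zpowVK; exists c.
by have := hd _ _ Vr; rewrite zpowVK => /(hrel_fun (val_lring oR) Vc) ->.
Qed.

(** Otherwise [sigma^N] sends infinitely many points off the bad locus to [Q]. If [sigma^-N] hits
    such a point from off the bad locus, [sigma^N] is a local isomorphism there, which happens for
    at most one of them. So the injective self-map [sigma^-N] of the complement misses infinitely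
    many points, against [counting]. *)
Lemma reflects_off R Q : ~ over_bad R -> dom (it N) R Q -> reflects (it N) R Q.
Proof.
move=> nD d; apply: contrapT => nr; have [oR oQ _] := d.
have iS := contracted (gX sX oR) (gX sX oQ) d nr (over_bad_nb oR nD).
have count := @counting _ X (fun P => ~ over_bad P) (zpow (- N%:Z)) over_bad_nb back_avoids _ (fund_finite sX _).
apply: count => [P P' Q' nP nP' dP dP'|s].
  exact: dom_uniq (back_reflects nP dP) (back_reflects nP' dP').
have [R0 h0] : exists R0, forall R', dom (it N) R' Q -> reflects (it N) R' Q -> R' = R0.
  have [[R0 [d0 r0]]|no] := EM (exists R0, dom (it N) R0 Q /\ reflects (it N) R0 Q).
    exists R0 => R' d1 r1; apply: dom_uniq (reflects_inv (n := N) r1 d1) (reflects_inv (n := N) r0 d0).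
  by exists R => R' d1 r1; case: no; exists R'.
have [R' [nD' d'] ns] := iS (R0 :: s); move: ns; rewrite inE negb_or => /andP [/eqP ne ns].
exists R' => //; split=> //; first by case: d'.
move=> P nP dP; apply: ne; apply: h0 => //.
have dP' := back_reflects nP dP; have eP := dom_uniq d' dP'; rewrite -eP in dP.
move=> f [c Vc]; have [_ _ h] := dP; exists c.
by have := h _ _ Vc; rewrite (zpowK sigma N%:Z).
Qed.

End Reflection.

Import Order.TTheory Num.Theory.

(** * Indeterminacies and contractions along the orbit of a place *)

Section Structure.
Variables (k : closedFieldType) (X : projVar k) (sigma : birat X X).
Local Notation K := (ffield X).
Local Notation point := (ppoint k (pdim X)).
Local Notation it := (birat_iter sigma).
Local Notation zpow := (zpow sigma).
Local Notation zcenter := (zcenter sigma).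
Local Notation up := (up sigma).
Local Notation incl := (incl sigma).
Local Notation zlocal := (zlocal sigma).
Hypotheses (sX : surface X) (st : stable sigma).
Variable N : nat.
Hypothesis N1 : (1 <= N)%N.
Hypothesis FO : forall P, on_var P -> ~ (exists Q, dom sigma P Q) ->
  forall j, (N <= j)%N -> exists Q, dom (it j) P Q /\ exists Q', dom sigma Q Q'.
Implicit Types (v w : K -> k -> Prop) (P Q R : point).

(** By [zariski_main] the fibre of [sigma^-1] over [Q] is infinite, and [sigma] is defined at all
    but finitely many of its points. *)
Lemma back_undefined Q : on_var Q -> ~ (exists R, dom (birat_inv sigma) Q R) ->
  inf (fun R => dom (it 1) R Q).
Proof.
move=> oQ nd; have iF := zariski_main oQ (gX sX oQ) nd.
have [T hT] := fund_finite sX sigma => s.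
have [R [v [pv cQ cR]]] := iF (s ++ T); rewrite mem_cat negb_or => /andP [ns nT].
exists R => //; have [oR _] := cR.
have [[Q' d]|no] := EM (exists Q', dom sigma R Q'); last by rewrite hT in nT.
have c1 := dom_center (pull_place _ pv) cR d.
suff <- : Q' = Q by [].
apply: center_uniq pv _ cQ; have [oQ' h] := c1; split=> // f c /h.
by rewrite /pull /= bpullK.
Qed.

(** A failure of [incl v n (n + 1)] means that [sigma] contracts a curve to the next center, whose
    forward orbit is then free of indeterminacy. *)
Lemma after_down v n : place (fconst X) v -> ~ incl v n (n + 1) -> forall j : nat, ~ up v (n + 1 + j%:Z).
Proof.
move=> pv nd j; have [P cP] := zcenter_ex sigma n pv; have [Q cQ] := zcenter_ex sigma (n + 1) pv.
have [oQ _] := cQ; have iR : inf (fun R => dom (it 1) R Q).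
  apply: back_undefined oQ _ => -[R dR]; apply: nd; apply/(incl_dom pv cQ cP).
  have cR := zcenter_dom pv cQ (dR : dom (zpow (-1)) Q R); rewrite addrK in cR.
  by rewrite (zcenter_uniq pv cP cR) (_ : n - (n + 1) = -1) //; lia.
have [Q' dQ' dS] := stable_orbit sX st (leqnn 1) oQ iR j.
have cQ' := zcenter_dom pv cQ (dQ' : dom (zpow j) Q Q').
by move/(upP pv cQ'); apply.
Qed.

Lemma no_down v n m (d : nat) : place (fconst X) v -> up v n -> m + d%:Z <= n -> incl v m (m + d%:Z).
Proof.
move=> pv un; elim: d => [|d IH] le; first by rewrite addr0.
apply: incl_trans (IH _) _; first by lia.
have [h|nd] := EM (incl v (m + d%:Z) (m + d%:Z + 1)).
  by rewrite (_ : m + d.+1%:Z = m + d%:Z + 1) //; lia.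
have [j ej] : exists j : nat, n = m + d%:Z + 1 + j%:Z.
  by exists (absz (n - (m + d%:Z + 1))%R); lia.
by case: (after_down pv nd (j := j)); rewrite -ej.
Qed.

Lemma up_later v n (j : nat) : place (fconst X) v -> up v n -> (N <= j)%N ->
  incl v (n + j%:Z) n /\ ~ up v (n + j%:Z).
Proof.
move=> pv un jN; have [P cP] := zcenter_ex sigma n pv; have [oP _] := cP.
have [Q [dQ dS]] := FO oP ((upP pv cP).1 un) jN.
have cQ := zcenter_dom pv cP (dQ : dom (zpow j) P Q); split; last by move/(upP pv cQ); apply.
by apply/(incl_dom pv cP cQ); rewrite addrAC subrr add0r.
Qed.

(** Otherwise [sigma^-d] is defined at [P] and fixes it, since no contraction precedes an
    indeterminacy. Its [N]-th power followed by [sigma^(d N + 1)], which the orbit condition defines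
    at [P], would define [sigma] at [P]. *)
Lemma up_no_return v n d P : place (fconst X) v -> up v n -> (1 <= d)%N ->
  zcenter v n P -> zcenter v (n - d%:Z) P -> False.
Proof.
move=> pv un d1 cP cP'; have [oP _] := cP; have nd := (upP pv cP).1 un.
have h1 : dom (zpow (- d%:Z)) P P.
  have h := @no_down v n (n - d%:Z) d pv un; have := (incl_dom pv cP cP').1.
  rewrite (_ : n - d%:Z - n = - d%:Z); last by lia.
  by apply; have := h; rewrite subrK lexx => /(_ isT).
have hr r : dom (zpow (- (d * r)%:Z)) P P.
  elim: r => [|r IH]; first by rewrite muln0.
  have := dom_zpow IH h1; rewrite (_ : - (d * r)%:Z - d%:Z = - (d * r.+1)%:Z) //.
  by rewrite mulnS; lia.
have lej : (N <= d * N + 1)%N by rewrite (leq_trans _ (leq_addr _ _)) // leq_pmull.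
have [Q [dQ _]] := FO oP nd lej.
apply: nd; exists Q; have := dom_zpow (hr N) (dQ : dom (zpow (d * N + 1)%:Z) P Q).
by rewrite (_ : - (d * N)%:Z + (d * N + 1)%:Z = 1) //; lia.
Qed.

Definition first_up v u := up v u /\ forall i, i < u -> ~ up v i.

(** By [up_no_return] indeterminacies at different times have different centers, and there are
    finitely many fundamental points. *)
Lemma first_up_ex v n : place (fconst X) v -> up v n -> exists2 u, first_up v u & u <= n.
Proof.
move=> pv; have [T hT] := fund_finite sX sigma.
have : forall u P, u <= n -> up v u -> zcenter v u P -> P \in T.
  by move=> u P _ uu cP; have [oP _] := cP; apply: hT oP ((upP pv cP).1 uu).
have [m] := ubnP (size T); elim: m T n {hT} => // m IH T n sz hT un.
have [[u [lt uu]]|no] := EM (exists u, u < n /\ up v u); last first.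
  by exists n => //; split=> // i lt ui; apply: no; exists i.
have [P cP] := zcenter_ex sigma n pv; have PT := hT n P (lexx n) un cP.
have [|||u' fu le] := IH [seq Q <- T | Q != P] u => //.
- rewrite size_filter; move: sz; rewrite ltnS => /(leq_trans _); apply.
  rewrite -(count_predC (pred1 P)) -[X in (X < _)%N]add0n ltn_add2r -has_count.
  by apply/hasP; exists P => /=.
- move=> u' Q le uu' cQ; rewrite mem_filter (hT u' Q) // ?andbT; last by lia.
  apply/eqP => eQ; apply: (@up_no_return v n (absz (n - u')%R) P pv un _ cP); first by lia.
  by rewrite -eQ (_ : n - (absz (n - u')%R)%:Z = u') //; lia.
by exists u' => //; lia.
Qed.

(** [reflects_off] is applied with [j] in place of [N]. A bad pair below the center at time [u]
    would place an indeterminacy earlier on the orbit. *)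
Lemma first_up_const v u (j : nat) : place (fconst X) v -> first_up v u -> (N <= j)%N -> incl v u (u + j%:Z).
Proof.
move=> pv [uu fu] jN; have [P cP] := zcenter_ex sigma u pv; have [oP _] := cP; have nd := (upP pv cP).1 uu.
have FOj P' : on_var P' -> ~ (exists Q, dom sigma P' Q) ->
    forall i, (j <= i)%N -> exists Q, dom (it i) P' Q /\ exists Q', dom sigma Q Q'.
  by move=> o' n' i ji; apply: FO => //; apply: leq_trans ji.
have [Q [dQ _]] := FO oP nd jN; have cQ := zcenter_dom pv cP (dQ : dom (zpow j) P Q).
have nD : ~ over_bad sigma j P.
  move=> [p [i [[op i1 ij np ni] [w [pw cw cPw]]]]].
  pose w' := pull (it i) w; have pw' : place (fconst X) w' := pull_place _ pw.
  have c0 : zcenter w' 0 P by [].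
  have ci : zcenter w' (- i%:Z) p by apply/(zcenter_pull sigma w i); rewrite subrr.
  have u0 : up w' 0 by apply/(upP pw' c0).
  have h : incl w' (- i%:Z) 0 by have := @no_down w' 0 (- i%:Z) i pw' u0; rewrite addNr lexx => /(_ isT).
  have di := (incl_dom pw' c0 ci).1 h; rewrite subr0 in di.
  apply: (fu (u - i%:Z)); first by lia.
  by apply/(upP pv (zcenter_dom pv cP di)).
have r := reflects_off sX FOj nD dQ.
apply/(incl_dom pv cQ cP); rewrite (_ : u - (u + j%:Z) = - j%:Z); last by lia.
exact: (reflects_inv (n := j) r dQ).
Qed.

(** For [m <= u] and for [m >= u + N] the rings compare directly. In between, a contraction before
    [m] excludes later indeterminacies, which puts the ring at [u + N] inside the one at [m];
    without a contraction the rings increase from [u] on. *)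
Lemma first_up_min v u m : place (fconst X) v -> first_up v u -> incl v u m.
Proof.
move=> pv fu; have [le|lt] := lerP m u.
  have e : u = m + (absz (u - m)%R)%:Z by lia.
  rewrite {1}e; apply: no_up => i hi; apply: fu.2; lia.
have [ge|lt'] := lerP (u + N%:Z) m.
  have -> : m = u + (absz (m - u)%R)%:Z by lia.
  by apply: first_up_const => //; lia.
have [[d [le [ltd nd]]]|no] := EM (exists d, u <= d /\ d < m /\ ~ incl v d (d + 1)).
  apply: incl_trans (first_up_const pv fu (leqnn N)) _.
  have e : u + N%:Z = m + (absz (u + N%:Z - m)%R)%:Z by lia.
  rewrite e; apply: no_up => i hi.
  have -> : m + i%:Z = d + 1 + (absz (m + i%:Z - d - 1)%R)%:Z by lia.
  exact: after_down.
have -> : m = u + (absz (m - u)%R)%:Z by lia.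
have : u + (absz (m - u)%R)%:Z <= m by lia.
elim: (absz (m - u)%R) => [|i IH] hi; first by rewrite addr0.
apply: incl_trans (IH _) _; first by lia.
rewrite (_ : u + i.+1%:Z = u + i%:Z + 1); last by lia.
by apply: contrapT => nd; apply: no; exists (u + i%:Z); split; [lia|split=> //; lia].
Qed.

(** If the center [R] lay over a bad pair, another place with center [R] would have a first
    indeterminacy, at some time [u]. Its ring there is contained in the local ring of [R], so
    [sigma^u] is defined at [R] with a fundamental value, and [v] has an indeterminacy too. *)
Lemma no_ups_const v n : place (fconst X) v -> (forall i, ~ up v i) -> incl v n (n + 1).
Proof.
move=> pv nu; have [R cR] := zcenter_ex sigma n pv; have [oR _] := cR.
have [Q cQ] := zcenter_ex sigma (n + N%:Z) pv.
have dQ : dom (it N) R Q.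
  have := (incl_dom pv cR cQ).1; rewrite (_ : n + N%:Z - n = N%:Z); last by lia.
  by apply; apply: no_up => i _; apply: nu.
have [[p [i [[op i1 iN np ni] [w [pw cw cRw]]]]]|nD] := EM (over_bad sigma N R); last first.
  have h : incl v n (n + N%:Z).
    apply/(incl_dom pv cQ cR); rewrite (_ : n - (n + N%:Z) = - N%:Z); last by lia.
    exact: (reflects_inv (n := N) (reflects_off sX FO nD dQ) dQ).
  apply: incl_trans h _; rewrite (_ : n + N%:Z = n + 1 + (N.-1)%:Z); last by move: N1; lia.
  by apply: no_up => j _; apply: nu.
pose w' := pull (it i) w; have pw' : place (fconst X) w' := pull_place _ pw.
have c0 : zcenter w' 0 R by [].
have ci : zcenter w' (- i%:Z) p by apply/(zcenter_pull sigma w i); rewrite subrr.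
have [u fu _] := first_up_ex pw' ((upP pw' ci).2 np).
have [P1 cP1] := zcenter_ex sigma u pw'; have h := first_up_min 0 pw' fu.
have du := (incl_dom pw' c0 cP1).1 h; rewrite subr0 in du.
case: (nu (n + u)); apply/(upP pv (zcenter_dom pv cR du)).
exact: (upP pw' cP1).1 fu.1.
Qed.

Definition local_meet v f := forall n, zlocal v n f.

(** Let [u] be the first indeterminacy. If [u >= 0], the ring at 0 lies in the one at [u] because no
    contraction comes before [u]; if [u < 0], time [N] is at least [N] steps after [u]. Fixing two
    times for all places lets the contracted surface be described by [X] and [sigma^N] alone. *)
Lemma local_meet_cases v : place (fconst X) v ->
  (forall f, zlocal v 0 f -> local_meet v f) \/ (forall f, zlocal v N f -> local_meet v f).
Proof.
move=> pv; have [[n un]|nu] := EM (exists n, up v n); last first.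
  left=> f hf n; suff: incl v 0 n by apply.
  have {}nu i : ~ up v i by move=> ui; apply: nu; exists i.
  have [le|lt] := lerP n 0.
    have -> : 0 = n + (absz (n)%R)%:Z by lia.
    by apply: no_up => i _; apply: nu.
  have -> : n = (absz (n)%R)%:Z by lia.
  elim: (absz (n)%R) => [|m IH] //; apply: incl_trans IH _.
  by rewrite -addn1 PoszD; apply: no_ups_const.
have [u fu _] := first_up_ex pv un.
have [le|lt] := lerP 0 u; [left|right] => f hf n'; apply: (first_up_min n' pv fu).
  have -> : u = 0 + (absz (u)%R)%:Z by lia.
  have h := @no_down v u 0 (absz (u)%R) pv fu.1; apply: h => //; lia.
have e : N%:Z = u + (absz (N%:Z - u)%R)%:Z by lia.
by rewrite e in hf; apply: (up_later pv fu.1 _).1 hf; lia.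
Qed.

Lemma local_meet_zt v n f : place (fconst X) v -> local_meet (pull (zpow n) v) f <-> local_meet v (bpull (zpow n) f).
Proof.
move=> pv; have e m : zlocal (pull (zpow n) v) m f <-> zlocal v (n + m) (bpull (zpow n) f).
  split=> -[P cP fP]; exists P.
  - exact/zcenter_pull.
  - by rewrite -zpowD (_ : - (n + m) + n = - m) //; lia.
  - exact/zcenter_pull.
  - by move: fP; rewrite -zpowD (_ : - (n + m) + n = - m) //; lia.
split=> h m; last exact/e.
by have /e := h (m - n); rewrite addrC subrK.
Qed.

End Structure.

(** * Sections on the contracted surface *)

Lemma zclosed_ext (k : closedFieldType) n (A B : pset k n) : (forall P, A P <-> B P) -> zclosed A -> zclosed B.
Proof. by move=> h [S hS]; exists S => P; rewrite -h. Qed.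

Section Sections.
Variables (k : closedFieldType) (X : projVar k) (sigma : birat X X) (L : subsheaf X).
Local Notation K := (ffield X).
Local Notation point := (ppoint k (pdim X)).
Local Notation it := (birat_iter sigma).
Local Notation zpow := (zpow sigma).
Local Notation zcenter := (zcenter sigma).
Local Notation zlocal := (zlocal sigma).
Local Notation local_meet := (local_meet sigma).
Local Notation incl := (incl sigma).
Hypotheses (sX : surface X) (iL : invertible L).
Variables (m : nat) (h : 'I_m -> K).
Hypothesis hL : gens L h.
Local Notation wt := (wt sigma h).
Variable N : nat.
Implicit Types (v w : K -> k -> Prop) (P Q R : point).
Hypothesis cases : forall v, place (fconst X) v ->
  (forall f, zlocal v 0 f -> local_meet v f) \/ (forall f, zlocal v N f -> local_meet v f).
Hypothesis vanN : forall P g l, on_var P -> ~ (exists Q, dom (it N) P Q) -> gcdat P (wt N) g ->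
  val P (wt N l / g) 0.
Hypothesis H1 : cech_vanishes_succ (twist L sigma 1) 0.

Definition gen_at Q l := h l != 0 /\ forall s, L Q s <-> fin (val Q) (s / h l).

(* g generates the stalk of (sigma^N)^* L on the contracted surface at the center
   of v: that surface agrees with the target of sigma^N where sigma^N is defined
   and with its source at the finitely many other points. *)
Definition isgen v g := exists2 P, zcenter v 0 P &
  (~ (exists Q, dom (it N) P Q) /\ gcdat P (wt N) g) \/
  exists Q l, [/\ dom (it N) P Q, gen_at Q l & g = wt N l].

Definition secB J b := forall v g, place (fconst X) v -> isgen v g -> local_meet v (b / g ^+ J).

Lemma undefined_A0 v P : place (fconst X) v -> zcenter v 0 P -> ~ (exists Q, dom (it N) P Q) ->
  forall f, zlocal v 0 f -> local_meet v f.
Proof.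
move=> pv cP nd; have [//|hN] := cases pv; case: nd; have [Q cQ] := zcenter_ex sigma N pv.
exists Q; have h1 : incl v N 0 by move=> f /hN; apply.
by have := (incl_dom pv cP cQ).1 h1; rewrite subr0.
Qed.

Lemma defined_AN v P Q : place (fconst X) v -> zcenter v 0 P -> dom (it N) P Q ->
  (forall f, zlocal v N f -> local_meet v f) /\ zcenter v N Q.
Proof.
move=> pv cP d; have cQ : zcenter v N Q by have := zcenter_dom pv cP (d : dom (zpow N) P Q); rewrite add0r.
split=> //; have [h0|//] := cases pv; move=> f hf; apply: h0; move: f hf.
by apply: (proj2 (incl_dom pv cP cQ)); rewrite subr0.
Qed.

Lemma fiber_back P Q : on_var P -> ~ (exists Q, dom (it N) P Q) -> fiber (it N) P Q ->
  dom (zpow (- N%:Z)) Q P.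
Proof.
move=> oP nd [v [pv cP cQ]]; have h0 := undefined_A0 pv (proj2 (zcenter0 sigma v P) cP) nd.
have h1 : incl v 0 N by move=> f /h0; apply.
by have := (incl_dom pv (cQ : zcenter v N Q) (proj2 (zcenter0 sigma v P) cP)).1 h1; rewrite sub0r.
Qed.

Lemma back_fiber P Q : dom (zpow (- N%:Z)) Q P -> fiber (it N) P Q.
Proof.
move=> d; have [oQ _ _] := d; have [w pw cQ] := center_place oQ.
exists (pull (zpow (- N%:Z)) w); split; [exact: pull_place|exact: dom_center cQ d|].
by apply: (proj2 (zcenter_pull sigma w (- N%:Z) N Q)); rewrite addNr.
Qed.

Lemma gens_at Q : on_var Q -> exists l, gen_at Q l.
Proof. by move=> /hL.2 [l h0 hl]; exists l. Qed.

(* The cocycle [sigma^-N g] on the two-element cover cuts out a section of the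
   pullback of [L] with prescribed value at an indeterminacy point. *)
Lemma cocycle_section P0 g : on_var P0 -> ~ (exists Q, dom (it N) P0 Q) -> gcdat P0 (wt N) g ->
  exists be, (forall Q, on_var Q -> ~ fiber (it N) P0 Q -> L Q be) /\
    (forall Q, on_var Q -> fiber (it N) P0 Q -> L Q (be + bpull (zpow (- N%:Z)) g)).
Proof.
move=> oP0 nd hg; pose z := bpull (zpow (- N%:Z)) g; pose FF := fiber (it N) P0.
pose W P' := gcdat P' (wt N) g /\ (P' <> P0 -> exists Q', dom (it N) P' Q').
have nW : nb P0 W.
  by apply: nbS (nbI (gcdat_near sX oP0 hg) (dom_near sX (it N) oP0)) => P' _ [[h1 _] h2].
(* An open set that contains the fibre: the points that [sigma^-N] sends close to [P0]. On it and
   off the fibre [z] is a section of [L], which makes the cochain below regular. *)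
pose V Q := exists2 P', dom (zpow (- N%:Z)) Q P' & nb P' W.
have nV Q : on_var Q -> V Q -> nb Q V by move=> oQ [P' d /nb_nb /(nb_dom d)].
have FV Q : FF Q -> V Q by move=> /(fiber_back oP0 nd) d; exists P0.
have Lmod Q a b : on_var Q -> fin (val Q) a -> L Q b -> L Q (a * b) by move=> *; apply: invertible_mod.
have LD Q a b : on_var Q -> L Q a -> L Q b -> L Q (a + b).
  move=> oQ; have [l [_ hl]] := gens_at oQ; rewrite !hl mulrDl => fa fb.
  exact: (finD (val_lring oQ)).
have LN Q a : on_var Q -> L Q a -> L Q (- a).
  move=> oQ; have [l [_ hl]] := gens_at oQ; rewrite !hl mulNr => fa.
  exact: (finN (val_lring oQ)).
have L0 Q : on_var Q -> L Q 0.
  move=> oQ; have [l [_ hl]] := gens_at oQ; rewrite hl mul0r; exists 0.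
  exact: (hrel0 (val_lring oQ)).
have zL Q : on_var Q -> V Q -> ~ FF Q -> L Q z.
  move=> oQ [P' d nW'] nF; have [_ oP' hd] := d; have [hg' hP'] := nb_mem oP' nW'.
  have [|Q' d'] := hP'; first by move=> e; apply: nF; apply: back_fiber; rewrite -e.
  have eQ : Q' = Q.
    have := dom_zpow d (d' : dom (zpow N) P' Q'); rewrite addNr => d0.
    exact: dom_uniq d0 (dom_id sigma oQ).
  rewrite eQ in d'; have [l [l0 hl]] := gens_at oQ; apply/hl.
  have [r Vr] := gcdat_uniq sX oP' hg' (gcdwt_dom hL d' l0 hl).
  by exists r; have := hd _ _ Vr; rewrite fmorph_div !wtE (zpowK sigma N%:Z).
pose U (i : 'I_2) : point -> Prop := if i == ord0 then (fun Q => ~ (on_var Q /\ FF Q)) else (fun Q => ~ (on_var Q /\ ~ V Q)).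
pose one : 'I_2 := lift ord0 ord0.
have i2 (i : 'I_2) : i = ord0 \/ i = one.
  by case: (unliftP ord0 i) => [j ->|->]; [right; rewrite (ord1 j)|left].
have U0 Q : on_var Q -> U ord0 Q <-> ~ FF Q by move=> oQ; rewrite /U eqxx; tauto.
have U1 Q : on_var Q -> U one Q <-> V Q.
  move=> oQ; rewrite /U /=; split=> [h1|]; last tauto.
  by apply: contrapT => nV1; apply: h1.
have cov : open_cover U.
  split=> [i|i|Q oQ].
  - case: (i2 i) => ->; rewrite /U ?eqxx /=; last exact: nb_zopen_compl nV.
    by apply: zclosed_ext (fiber_closed (it N) oP0) => P; split=> [h1 h2|/contrapT].
  - case: (i2 i) => ->; last first.
      have [Q F1 _] := zariski_main oP0 (gX sX oP0) nd [::]; have [v [_ _ [oQ _]]] := F1.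
      by exists Q => //; apply/U1 => //; apply: FV.
    have [_ _ _ [x [_ [[Vx _ _] _ x0 _]]]] := gX sX oP0.
    have [P' [oP' hd _]] := zeros_inf oP0 (gX sX oP0) Vx x0 (dom_near sX (it N) oP0) [:: P0].
    rewrite inE => /eqP ne; have [Q d] := hd ne; have [_ oQ _] := d.
    exists Q => //; apply/U0 => // /(fiber_back oP0 nd) d'; apply: ne.
    have := dom_zpow (d : dom (zpow N) P' Q) d'; rewrite subrr => d0.
    by have <- := dom_uniq (dom_id sigma oP') d0.
  - by have [F1|nF] := EM (FF Q); [exists one; apply/U1 => //; apply: FV|exists ord0; apply/U0].
pose E (i : 'I_2) : K := if i == ord0 then 0 else z.
pose c (a : {ffun 'I_2 -> 'I_2}) : K := E (a one) - E (a ord0).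
have LU Q : on_var Q -> forall i j, U i Q -> U j Q -> L Q (E i - E j).
  move=> oQ i j; case: (i2 i) => ->; case: (i2 j) => ->; rewrite /E /= ?subrr ?sub0r ?subr0.
  - by move=> _ _; apply: L0.
  - by move=> /(U0 _ oQ) u0 /(U1 _ oQ) u1; apply: LN => //; apply: zL.
  - by move=> /(U1 _ oQ) u1 /(U0 _ oQ) u0; apply: zL.
  - by move=> _ _; apply: L0.
have hc : cochain (twist L sigma 1) U c.
  by move=> a Q oQ hU; apply/(twist1 sigma iL _ oQ); apply: LU.
have cob (a : {ffun 'I_3 -> 'I_2}) : coboundary c a = 0.
  rewrite /coboundary !big_ord_recl big_ord0 /c !ffunE /=.
  rewrite (_ : lift (lift ord0 ord0) ord0 = ord0 :> 'I_3); last exact: val_inj.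
  rewrite (_ : lift (lift ord0 ord0) one = lift ord0 one :> 'I_3); last exact: val_inj.
  rewrite (_ : lift (lift ord0 (lift ord0 ord0)) ord0 = ord0 :> 'I_3); last exact: val_inj.
  rewrite (_ : lift (lift ord0 (lift ord0 ord0)) one = lift ord0 ord0 :> 'I_3); last exact: val_inj.
  rewrite /bump /= !expr0 !expr1 ?expr2 /one; ring.
have [m' [V' [r [b [cov' ref hb hcb]]]]] := H1 cov hc cob.
pose bj j := b [ffun=> j].
have hbj j j' : E (r j') - E (r j) = bj j' - bj j.
  have := hcb [ffun i => if i == ord0 then j else j'].
  rewrite /c !ffunE /= /coboundary !big_ord_recl big_ord0 /= expr0 mul1r expr1 mulN1r addr0.
  rewrite /bj => ->; congr (b _ - b _); apply/ffunP => i; rewrite !ffunE (ord1 i) //=.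
have [_ _ cv] := cov'; have [j0 _] := cv P0 oP0.
(* The difference [bj j - E (r j)] does not depend on [j], so this one function corrects both
   members of the cover. *)
pose be := bj j0 - E (r j0).
have ebj j : bj j = be + E (r j).
  by have := hbj j0 j; rewrite /be => e; rewrite -addrA [- _ + _]addrC e addrC subrK.
have Lbj j Q : on_var Q -> V' j Q -> L Q (be + E (r j)).
  by move=> oQ hV; rewrite -ebj; apply/(twist1 sigma iL _ oQ); apply: hb => // i; rewrite ffunE.
have main i Q : on_var Q -> U i Q -> L Q (be + E i).
  move=> oQ Ui; have [j hj] := cv Q oQ; have := LD Q _ _ oQ (Lbj j Q oQ hj) (LU Q oQ i (r j) Ui (ref j Q oQ hj)).
  by rewrite -addrA [E (r j) + _]addrC subrK.
exists be; split=> Q oQ F1.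
  by have := main ord0 Q oQ (proj2 (U0 Q oQ) F1); rewrite /E eqxx addr0.
by have := main one Q oQ (proj2 (U1 Q oQ) (FV Q F1)); rewrite /E.
Qed.

(** Off the fibre over [P0] the function [be] is a section of [L], so its pullback vanishes at the
    other indeterminacy points by [vanN]. On the fibre [be + bpull (zpow (- N%:Z)) g] is a section,
    so [bpull (it N) be + g] vanishes at [P0] relative to [g]; this explains the sign of [s] and its
    value 1. *)
Lemma separating_section P0 g : on_var P0 -> ~ (exists Q, dom (it N) P0 Q) -> gcdat P0 (wt N) g ->
  exists s, [/\ secB 1 s, val P0 (s / g) 1 &
    forall P g', on_var P -> P <> P0 -> ~ (exists Q, dom (it N) P Q) -> gcdat P (wt N) g' ->
      val P (s / g') 0].
Proof.
move=> oP0 nd hg; have [be [be1 be2]] := cocycle_section oP0 nd hg.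
pose s := - bpull (it N) be; have g0 := hg.1.
have key v P g' : place (fconst X) v -> center v P -> P <> P0 -> gcdat P (wt N) g' ->
    exists c l, fin v (bpull (it N) c) /\
      s / g' = - bpull (it N) c * (wt N l / g').
  move=> pv cP ne [g'0 _]; have [Q cQ] := zcenter_ex sigma N pv; have [oQ hQ] := cQ.
  have nF : ~ fiber (it N) P0 Q.
    move=> /(fiber_back oP0 nd) d; apply: ne.
    by have := zcenter_dom pv cQ d; rewrite subrr => c0; exact: (zcenter_uniq pv (proj2 (zcenter0 sigma v P) cP) c0).
  have [l [l0 hl]] := gens_at oQ; have [a Va] := (hl be).1 (be1 Q oQ nF).
  exists (be / h l), l; split=> //; first by exists a; apply: hQ.
  by rewrite fmorph_div !wtE /s; field; rewrite g'0 fmorph_eq0 l0.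
have off P g' : on_var P -> P <> P0 -> gcdat P (wt N) g' -> fin (val P) (s / g').
  move=> oP ne hg'; apply: fin_places (gX sX oP) _ => // v pv cP.
  have [c [l [fc ->]]] := key v P g' pv cP ne hg'; have V := place_lring pv.
  apply: (finM V); first exact: (finN V).
  by have [_ [fw _]] := hg'; have [a Va] := fw l; exists a; apply: cP.2.
have at0 v : place (fconst X) v -> center v P0 -> v (s / g) 1.
  move=> pv cP; have V := place_lring pv; have [Q cQ] := zcenter_ex sigma N pv; have [oQ hQ] := cQ.
  have F1 : fiber (it N) P0 Q by exists v.
  have [l [l0 hl]] := gens_at oQ; have [a Va] := (hl _).1 (be2 Q oQ F1).
  have := hrelM V (hQ _ _ Va) (cP.2 _ _ (vanN l oP0 nd hg)); rewrite mulr0 /pull /=.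
  rewrite fmorph_div rmorphD /= (zpowVK sigma N%:Z).
  have -> : (bpull (it N) be + g) / bpull (it N) (h l) * (wt N l / g) = 1 - s / g.
    by rewrite !wtE /s; field; rewrite g0 fmorph_eq0 l0.
  move=> h1; have := hrelB V (hrel1 V) h1; rewrite subr0 opprB addrC subrK //.
have v0 : val P0 (s / g) 1.
  have [r Vr] : fin (val P0) (s / g).
    by apply: fin_places (gX sX oP0) _ => // v pv cP; exists 1; apply: at0.
  have [v pv cP] := center_place oP0.
  by rewrite -(hrel_fun (place_hrel pv) (cP.2 _ _ Vr) (at0 v pv cP)).
exists s; split=> //.
- move=> v g' pv [P cP [[ndP hg']|[Q [l [dQ [l0 hl] ->]]]]]; rewrite expr1.
    apply: (undefined_A0 pv cP ndP); exists P => //; rewrite oppr0 /=; have [oP _] := cP.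
    have [e|ne] := EM (P = P0); last exact: off.
    rewrite e in hg'; rewrite e; have -> : s / g' = s / g * (g / g') by rewrite mulrA divfK.
    apply: (finM (val_lring oP0)); first by exists 1.
    exact: (gcdat_uniq sX oP0 hg hg').
  have [hB cQ] := defined_AN pv cP dQ.
  have [oQ _] := cQ; have [F1|nF] := EM (fiber (it N) P0 Q).
    have d := fiber_back oP0 nd F1; have c0 := zcenter_dom pv cQ d; rewrite subrr in c0.
    by case: nd; exists Q; rewrite -(zcenter_uniq pv cP c0).
  apply: hB; apply/(zlocalP _ pv cQ).
  have -> : s / wt N l = bpull (zpow N) (- (be / h l)) by rewrite rmorphN fmorph_div /s mulNr.
  by rewrite zpowK; apply: (finN (val_lring oQ)); apply/hl; apply: be1.
- move=> P g' oP ne ndP hg'; have [r Vr] := off P g' oP ne hg'.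
  have [v pv cP] := center_place oP; have V := place_lring pv.
  have [c [l [[a fc] e]]] := key v P g' pv cP ne hg'.
  have := hrelM V (hrelN V fc) (cP.2 _ _ (vanN l oP ndP hg')); rewrite mulr0 -e => h0.
  by rewrite -(hrel_fun V (cP.2 _ _ Vr) h0).
Qed.

End Sections.

(** * The contracted surface *)

Section PrimeChains.
Variables (k : closedFieldType) (K : fieldType) (V : K -> k -> Prop).
Hypothesis gV : good V.

Definition oprime p := [/\ oideal V p, ~ p 1 & forall a b, fin V a -> fin V b -> p (a * b) -> p a \/ p b].

(** Some parameter lies outside such a prime, and a prime is saturated at every element outside
    it. *)
Lemma prime_principal p z : oprime p -> V z 0 -> ~ p z ->
  exists2 f, p f & forall w, p w -> exists2 a, fin V a & w = a * f.
Proof.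
move=> [ip _ pp] Vz pz; have [hV nV _ [x [y [pxy _ _ _]]]] := gV.
have sat t : fin V t -> ~ p t -> forall c, fin V c -> p (t * c) -> p c.
  by move=> ft nt c fc /pp [].
have [Vx Vy dec] := pxy; have fx := max_fin Vx; have fy := max_fin Vy.
have [px|nx] := EM (p x); last exact: (saturated_principal hV nV pxy ip (sat x fx nx)).
have [py|ny] := EM (p y); last exact: (saturated_principal hV nV (paramsC pxy) ip (sat y fy ny)).
case: pz; have [a [b [fa fb ->]]] := dec z Vz.
by apply: (oiD ip); apply: (oiM ip).
Qed.

(** Both primes are principal, so the generator of the smaller is [b = c * d] with [d] the generator
    of the larger. Primality puts [c] or [d] in the smaller prime; the first would make [d] a
    unit. *)
Lemma prime_chain p q z a : oprime p -> oprime q -> V z 0 -> ~ q z -> (forall f, p f -> q f) ->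
  p a -> a != 0 -> forall f, q f -> p f.
Proof.
move=> hp hq Vz qz pq pa a0; have [hV _ _ _] := gV.
have [b pb gb] := prime_principal hp Vz (fun h => qz (pq _ h)).
have [d qd gd] := prime_principal hq Vz qz.
have [ip _ pp] := hp; have [iq q1 _] := hq.
have b0 : b != 0 by have [e _ e1] := gb a pa; apply: contra_neq a0 => h; rewrite e1 h mulr0.
have [c fc eb] := gd b (pq _ pb).
have [|pc|pd] := pp c d fc (oi_fin iq qd); first by rewrite -eb.
- have [e fe ec] := gb c pc; case: q1.
  have -> : 1 = e * d by apply: (mulfI b0); rewrite mulr1 {1}eb ec; ring.
  exact: (oiM iq).
- by move=> f /gd [e fe ->]; apply: (oiM ip).
Qed.
End PrimeChains.

Section GoodSurface.
Variables (k : closedFieldType) (Z : projVar k).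
Hypothesis gZ : forall P : ppoint k (pdim Z), on_var P -> good (val P).
Local Notation K := (ffield Z).
Local Notation point := (ppoint k (pdim Z)).
Implicit Types (P z : point) (C : point -> Prop).

(* The prime of the local ring at z that defines C. *)
Definition stalk_ideal C z f := exists d F G, [/\ F \is d.-homog, G \is d.-homog,
  G.@[pcoord z] != 0, f = gval F / gval G :> K & forall P, C P -> F.@[pcoord P] = 0].

Definition through z C := [/\ irreducible_closed C, psub C (@on_var k Z) & C z].

Lemma stalk_ideal_form z C d F G : through z C -> F \is d.-homog -> G \is d.-homog ->
  G.@[pcoord z] != 0 -> stalk_ideal C z (gval F / gval G) -> forall P, C P -> F.@[pcoord P] = 0.
Proof.
move=> [iC sC Cz] hF hG Gz [d' [F' [G' [hF' hG' Gz' e hC]]]].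
have oz := sC z Cz; have g0 := gval_neq0 oz hG Gz; have g0' := gval_neq0 oz hG' Gz'.
have e0 : gval (F * G' - F' * G) = 0 :> K.
  move/eqP: e; rewrite eqr_div // => /eqP e.
  by rewrite /gval rmorphB !rmorphM /= -/(gval _) -/(gval _); rewrite -/(gval F) -/(gval G') -/(gval F') -/(gval G) e subrr.
have hh : F * G' - F' * G \is (d + d').-homog.
  by rewrite rpredB // ?(dhomogM hF hG') // addnC (dhomogM hF' hG).
have van P : C P -> (F * G').@[pcoord P] = 0.
  move=> CP; have := sC P CP _ _ hh e0; by rewrite mevalB [(F' * G).@[_]]mevalM (hC P CP) mul0r subr0.
have [_ _ irr] := iC.
have [P CP|h|h] := irr _ _ (form_zclosed hF) (form_zclosed hG').
- by have /eqP := van P CP; rewrite mevalM mulf_eq0 => /orP [/eqP|/eqP]; [left|right].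
- exact: h.
- by have := h z Cz => /eqP; rewrite (negPf Gz').
Qed.

Lemma stalk_ideal_prime z C : through z C -> oprime (val z) (stalk_ideal C z).
Proof.
move=> tC; have [_ sC Cz] := tC; have oz := sC z Cz; split.
- split.
  + move=> f [d [F [G [hF hG Gz -> _]]]]; exists (F.@[pcoord z] / G.@[pcoord z]).
    exact: (form_val oz hF hG Gz).
  + exists 0%N, 0, 1; split; rewrite ?rpred0 ?dhomog1 ?meval1 ?oner_neq0 //.
      by rewrite /gval rmorph0 mul0r.
    by move=> P _; rewrite meval0.
  + move=> a b [d [F [G [hF hG Gz -> hC]]]] [d' [F' [G' [hF' hG' Gz' -> hC']]]].
    have g0 := gval_neq0 oz hG Gz; have g0' := gval_neq0 oz hG' Gz'.
    exists (d + d')%N, (F * G' + F' * G), (G * G'); split.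
    * by rewrite rpredD // ?(dhomogM hF hG') // addnC (dhomogM hF' hG).
    * exact: dhomogM.
    * by rewrite mevalM mulf_neq0.
    * by rewrite addf_div // /gval rmorphD !rmorphM.
    * by move=> P CP; rewrite mevalD !mevalM hC // hC' // !mul0r addr0.
  + move=> a b /fin_regular [d' [F' [G' [hF' hG' Gz' ->]]]] [d [F [G [hF hG Gz -> hC]]]].
    exists (d' + d)%N, (F' * F), (G' * G); split; rewrite ?mevalM ?mulf_neq0 //.
    * exact: dhomogM.
    * exact: dhomogM.
    * by rewrite mulf_div /gval !rmorphM.
    * by move=> P CP; rewrite mevalM hC // mulr0.
- have -> : 1 = gval 1 / gval 1 :> K by rewrite /gval rmorph1 divr1.
  move=> h; have := stalk_ideal_form tC (dhomog1 _ _) (dhomog1 _ _) _ h Cz.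
  by rewrite meval1 oner_neq0 => /(_ isT) /eqP; rewrite oner_eq0.
- move=> a b /fin_regular [d [F [G [hF hG Gz ea]]]] /fin_regular [d' [F' [G' [hF' hG' Gz' eb]]]].
  have -> : a * b = gval (F * F') / gval (G * G') by rewrite ea eb mulf_div /gval !rmorphM.
  have Gzz : (G * G').@[pcoord z] != 0 by rewrite mevalM mulf_neq0.
  move=> /(stalk_ideal_form tC (dhomogM hF hF') (dhomogM hG hG') Gzz) h.
  have [[_ _ irr] _ _] := tC.
  have [P CP|h1|h1] := irr _ _ (form_zclosed hF) (form_zclosed hF').
  + by have /eqP := h P CP; rewrite mevalM mulf_eq0 => /orP [/eqP|/eqP]; [left|right].
  + by left; exists d, F, G.
  + by right; exists d', F', G'.
Qed.

Lemma stalk_ideal_sub z C C' f : psub C C' -> stalk_ideal C' z f -> stalk_ideal C z f.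
Proof. by move=> s [d [F [G [hF hG Gz e h]]]]; exists d, F, G; split=> // P /s /h. Qed.

Lemma stalk_ideal_lt z C C' : through z C -> through z C' -> ~ psub C' C ->
  exists2 f, stalk_ideal C z f & ~ stalk_ideal C' z f.
Proof.
move=> tC tC' ns; have [[cC _ _] _ _] := tC.
have [P CP' nCP] : exists2 P, C' P & ~ C P.
  by apply: contrapT => h; apply: ns => P CP'; apply: contrapT => n; apply: h; exists P.
have [d [F [hF FP hC]]] := zclosed_form cC nCP; have [j zj] := normalized_coord z.
have hX : ('X_j ^+ d : {mpoly k[(pdim Z).+1]}) \is d.-homog.
  by rewrite -[X in X.-homog]mul1n dhomogMn // coordX_homog.
have Xz : ('X_j ^+ d).@[pcoord z] != 0 by rewrite rmorphXn /= mevalXU zj expr1n oner_neq0.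
exists (gval F / gval ('X_j ^+ d)); first by exists d, F, ('X_j ^+ d).
by move=> /(stalk_ideal_form tC' hF hX Xz) /(_ P CP') /eqP; rewrite (negPf FP).
Qed.

Lemma stalk_ideal_max z C f : C z -> on_var z -> stalk_ideal C z f -> val z f 0.
Proof.
by move=> Cz oz [d [F [G [hF hG Gz -> /(_ z Cz) Fz]]]]; have := form_val oz hF hG Gz; rewrite Fz mul0r.
Qed.

Lemma no_chain3 : ~ has_chain (@on_var k Z) 3.
Proof.
move=> [C [h1 h2]]; have [[_ [z C0z] _] _] := h1 0%N isT.
have sub i : (i <= 3)%N -> C i z.
  elim: i => [//|i IH] hi; have [s _] := h2 i hi; apply: s; apply: IH; exact: ltnW.
have t i : (i <= 3)%N -> through z (C i) by move=> hi; have [a b] := h1 i hi; split=> //; apply: sub.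
have oz : on_var z by have [_ s _] := t 0%N isT; apply: s.
have [f f1 f2] := stalk_ideal_lt (t 2%N isT) (t 3%N isT) (h2 2%N isT).2.
have [q q1 q2] := stalk_ideal_lt (t 1%N isT) (t 2%N isT) (h2 1%N isT).2.
have [r r1 r2] := stalk_ideal_lt (t 0%N isT) (t 1%N isT) (h2 0%N isT).2.
apply: q2; have [ip3 _ _] := stalk_ideal_prime (t 3%N isT).
apply: (prime_chain (gZ oz) (stalk_ideal_prime (t 2%N isT)) (stalk_ideal_prime (t 1%N isT))
  (stalk_ideal_max C0z oz r1) r2 _ f1 _ q1).
  by move=> w; apply: stalk_ideal_sub; exact: (h2 1%N isT).1.
by apply: contraPneq f2 => ->; apply: contrapT => h; apply: h => h; apply: h; apply: (oi0 ip3).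
Qed.

(** The middle member is an irreducible set of zeros of a parameter, infinite by [zeros_inf]. *)
Lemma chain2 P : on_var P -> has_chain (@on_var k Z) 2.
Proof.
move=> oP; have g := gZ oP; have [_ _ _ [x [_ [[Vx _ _] _ x0 _]]]] := g.
have [d [F [G [hF hG GP FP ex]]]] := Vx.
have U : nb P (fun P' => G.@[pcoord P'] != 0) by exists d, G; split.
have F0 : gval F != 0 by apply: contra_neq x0; rewrite ex => ->; rewrite mul0r.
have cl : zclosed (fun P' => on_var P' /\ F.@[pcoord P'] = 0).
  exact: zclosedI (zclosed_on_var Z) (form_zclosed hF).
have hi : inf (fun P' => True /\ (on_var P' /\ F.@[pcoord P'] = 0)).
  apply: infS (zeros_inf oP g Vx x0 U) => P' [oP' GP' vP']; split=> //; split=> //.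
  have := form_val oP' hF hG GP'; rewrite -ex => v1.
  have /eqP := hrel_fun (val_lring oP') v1 vP'.
  by rewrite mulf_eq0 invr_eq0 (negPf GP') orbF => /eqP.
have [C [iC sC iiC _]] := inf_irreducible cl hi.
have [Q [_ CQ] _] := iiC [::].
exists (fun i => match i with 0 => (fun P' => P' = Q) | 1 => C | _ => @on_var k Z end).
split=> [[|[|[|i]]]|[|[|i]]] //= _.
- by split; [exact: irreducible1|move=> _ ->; exact: (sC Q CQ).1].
- by split=> // P' /sC [].
- by split=> //; exact: on_var_irreducible oP.
- split; first by move=> _ ->.
  by move=> h; have [Q' [_ CQ']] := iiC [:: Q]; rewrite (h Q' CQ') inE eqxx.
- split; first by move=> P' /sC [].
  move=> h; have [P' [oP' _ FP']] := form_nonzero oP hF F0 (nbT P (fun P' => id) : nb P (fun P' => on_var P')).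
  by have [_ e] := sC P' (h P' oP'); rewrite e eqxx in FP'.
Qed.

Lemma good_surface P : on_var P -> surface Z.
Proof.
move=> oP; split; first by split; [exact: chain2 oP|exact: no_chain3].
move=> Q oQ; have [hV _ _ [x [y [[Vx Vy dec] _ _ _]]]] := gZ oQ.
exists (fun i => if i == ord0 then x else y); split.
  by move=> i; case: ifP => _; apply/val_vanishes.
move=> w /val_vanishes /dec [a [b [fa fb ->]]].
exists (fun i => if i == ord0 then a else b); split.
  by move=> i; case: ifP => _; apply/fin_regular.
by rewrite !big_ord_recl big_ord0 /= addr0.
Qed.
End GoodSurface.

(** * A projective model built from local rings and coordinates *)

Lemma place_exists (k : closedFieldType) (K : fieldType) (io : {rmorphism k -> K}) : exists v, place io v.
Proof.
have hH : hrel (fun (a : K) (c : k) => a = io c).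
  split=> [|a a' b b' -> ->|a a' b b' -> ->|c /esym /eqP]; rewrite ?rmorph1 ?rmorphB ?rmorphM //.
  by rewrite fmorph_eq0 => /eqP.
by have [|v pv _] := place_ext (io := io) hH; [move=> c|exists v].
Qed.

Section Model.
Variables (k : closedFieldType) (K : fieldType) (io : {rmorphism k -> K}).
Variable meet_val : (K -> k -> Prop) -> K -> k -> Prop.
Hypothesis gB : forall v, place io v -> good (meet_val v).
Hypothesis cB : forall v, place io v -> hconst io (meet_val v).
Hypothesis leB : forall v, place io v -> hle (meet_val v) v.
Variables (w : nat) (W : {ffun 'I_w.+1 -> K}).

(** In the chart where coordinate [i0] is inverted, the ring attached to [v] is the localization of
    the algebra of coordinate ratios at the center of [v]. *)
Definition presents v i0 := [/\ W i0 != 0, forall i, fin (meet_val v) (W i / W i0) &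
  forall f, fin (meet_val v) f -> exists a b c, [/\ inalg io (fun i => W i / W i0) a,
    inalg io (fun i => W i / W i0) b, c != 0, v b c & f = a / b]].
Hypothesis hW : forall v, place io v -> exists i0, presents v i0.

Lemma coords_neq0 : exists i, W i != 0.
Proof. by have [v /hW [i [Wi _ _]]] := place_exists io; exists i. Qed.

Lemma coords_gen f : exists d (F G : {mpoly k[w.+1]}),
  [/\ F \is d.-homog, G \is d.-homog, mmap io W G != 0 & f = mmap io W F / mmap io W G].
Proof.
have [v pv] := place_exists io; have [i0 [W0 _ gen]] := hW pv.
have [hV _ fr _] := gB pv; have [d d0 [fd fdf]] := fr f.
have [a [b [c [ia ib c0 vb ed]]]] := gen _ fd; have [a' [b' [c' [ia' ib' c0' vb' edf]]]] := gen _ fdf.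
have ne x e : v x e -> e != 0 -> x != 0.
  by move=> vx; apply: contra_neq => x0; rewrite x0 in vx; apply: (hrel0P (place_hrel pv) vx).
have b0 := ne _ _ vb c0; have b0' := ne _ _ vb' c0'.
have a0 : a != 0 by apply: contra_neq d0 => a0; rewrite ed a0 mul0r.
have ef : f = (a' * b) / (b' * a).
  by apply: (mulfI d0); rewrite edf ed; field; rewrite a0 b0 b0'.
have [F eF] := inalgM ia' ib; have [G eG] := inalgM ib' ia.
pose D := (msize F + msize G)%N.
have sF : (msize F <= D.+1)%N by rewrite /D; lia.
have sG : (msize G <= D.+1)%N by rewrite /D; lia.
exists D, (homogenize D i0 F), (homogenize D i0 G); split.
- exact: homogenize_homog.
- exact: homogenize_homog.
- by rewrite mmap_homogenize // -eG mulf_neq0 ?expf_neq0 ?mulf_neq0.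
- by rewrite !mmap_homogenize // -eG -eF ef -[RHS]mulf_div mulfV ?expf_neq0 // mul1r.
Qed.

Definition model := @ProjVar k K io w W coords_neq0 coords_gen.

(** Ratios to any coordinate that is nonzero at [z] lie in the ring attached to [v], which gives one
    inclusion; for the other, the presentation writes its elements as fractions whose denominators
    do not vanish at [z]. *)
Lemma model_val v (z : ppoint k w) f c : place io v -> @center k model v z ->
  @val k model z f c <-> meet_val v f c.
Proof.
move=> pv cz; have [oz hz] := cz; have [i0 [W0 fW gen]] := hW pv; have [hV _ _ _] := gB pv.
have hv := place_hrel pv; have [j zj] := normalized_coord z.
have j0 : W j != 0 := chart_neq0 (X := model) oz zj.
have zj0 : pcoord z j != 0 by rewrite zj oner_neq0.
have vj i : v (W i / W j) (pcoord z i).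
  by have := hz _ _ (@coord_val k model z j i oz zj0); rewrite zj divr1.
have [e Be] := fW j; have ve := leB pv Be.
have e1 : e * pcoord z i0 = 1.
  have := hrelM hv ve (vj i0); rewrite mulrA divfK // divff // => h.
  exact: (hrel_fun hv h (hrel1 hv)).
have e0 : e != 0 by apply: contra_eq_neq e1 => ->; rewrite mul0r eq_sym oner_neq0.
have z0 : pcoord z i0 != 0 by apply: contra_eq_neq e1 => ->; rewrite mulr0 eq_sym oner_neq0.
have Bj i : meet_val v (W i / W j) (pcoord z i).
  have [r Br] := fW i; have := hrelM hV Br (lr_inv hV Be e0).
  have -> : W i / W i0 * (W j / W i0)^-1 = W i / W j by field; rewrite j0 W0.
  by move=> B1; have := hrel_fun hv (leB pv B1) (vj i) => <-.
split.
- move=> /(val_chart (X := model) _ _ oz zj) [F [G [Gz eF ->]]].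
  have hB H : meet_val v (mmap io (fun i => W i / W j) H) H.@[pcoord z].
    exact: (hrel_mmap H hV (cB pv) Bj).
  have := hrelM hV (hB F) (lr_inv hV (hB G) Gz).
  by rewrite eF -mulrA divff // mulr1.
- move=> Bf; have vf := leB pv Bf.
  have [|a [b [b' [ia ib b0 vb ef]]]] := gen f; first by exists c.
  have hZ := @val_lring k model z oz.
  have fin_alg x : inalg io (fun i => W i / W i0) x -> fin (@val k model z) x.
    move=> [F ->]; apply: (mmap_ind (T := fin (@val k model z))).
    + by move=> r; exists r; apply: (@val_const k model z).
    + by move=> i; eexists; apply: (@coord_val k model z i0 i oz z0).
    + by move=> *; apply: (finD hZ).
    + by move=> *; apply: (finM hZ).
  have [r Vb] := fin_alg _ ib.
  have er : r = b' := hrel_fun hv (hz _ _ Vb) vb.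
  have [q Va] := fin_alg _ ia; rewrite er in Vb.
  have Vf := hrelM hZ Va (lr_inv hZ Vb b0); rewrite -ef in Vf.
  by rewrite (hrel_fun hv vf (hz _ _ Vf)).
Qed.

Lemma model_surface : surface model.
Proof.
have [v pv] := place_exists io; have [z [oz _]] := @center_ex k model v pv.
apply: (@good_surface k model _ z oz) => P oP; have [u pu cP] := @center_place k model P oP.
suff -> : @val k model P = meet_val u by apply: gB.
by apply: funext => f; apply: funext => c; apply: propext; apply: model_val.
Qed.

Lemma model_dom (s : birat model model) :
  (forall v f c, place io v -> meet_val (pull s v) f c -> meet_val v (bpull s f) c) -> everywhere_defined s.
Proof.
move=> hs P oP; have [v pv cP] := @center_place k model P oP.
have pv' : place io (pull s v) := pull_place s pv.
have [Q cQ] := @center_ex k model _ pv'; exists Q; apply/maps_to_dom; have [oQ _] := cQ.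
split=> // f c /(model_val _ _ pv' cQ) /(hs _ _ _ pv) h; exact/(model_val _ _ pv cP).
Qed.
End Model.

Lemma good_transfer (k : closedFieldType) (K : fieldType) (V : K -> k -> Prop) (a b : {rmorphism K -> K}) :
  cancel a b -> cancel b a -> good V -> good (fun f c => V (a f) c).
Proof.
move=> ab ba [hV nV fV [x [y [[Vx Vy dec] dp x0 y0]]]].
have fb f : fin V f -> fin (fun f c => V (a f) c) (b f) by move=> [c Vc]; exists c; rewrite ba.
split.
- split; first split.
  + by rewrite rmorph1; apply: (hrel1 hV).
  + by move=> u u' c c' h h'; rewrite rmorphB; apply: (hrelB hV).
  + by move=> u u' c c' h h'; rewrite rmorphM; apply: (hrelM hV).
  + by move=> c; rewrite rmorph0 => /(hrel0P hV).
  + by move=> u c h c0; rewrite fmorphV; apply: (lr_inv hV).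
- move=> I iI; have iI' : oideal V (fun z => I (b z)).
    split.
    + by move=> z /(oi_fin iI) [c]; rewrite ba; exists c.
    + by rewrite rmorph0; apply: (oi0 iI).
    + by move=> u w h h'; rewrite rmorphD; apply: (oiD iI).
    + by move=> u w h h'; rewrite rmorphM; apply: (oiM iI) => //; apply: fb.
  have [s [hs gs]] := nV _ iI'; exists [seq b z | z <- s]; split.
    by move=> z /mapP [u /hs h ->].
  move=> z Iz; have : cspan (fin V) s (a z) by apply: gs; rewrite ab.
  rewrite -{2}[z]ab; elim: s (a z) {hs gs} => [|u s IH] w /=; first by move=> ->; rewrite rmorph0.
  by move=> [c [fc /IH h]]; exists (b c); rewrite -rmorphM -rmorphB; split=> //; apply: fb.
- move=> f; have [d d0 [fd fdf]] := fV (a f); exists (b d); first by rewrite fmorph_eq0.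
  by split; [exact: fb|have := fb _ fdf; rewrite rmorphM ab].
- exists (b x), (b y); split; rewrite ?fmorph_eq0 //.
  + split; rewrite ?ba // => f /dec [u [w [fu fw e]]]; exists (b u), (b w); split; try exact: fb.
    by rewrite -[f]ab e rmorphD !rmorphM.
  + move=> w n [c1 h1] [c2 h2]; apply: (dp (a w) n).
      by exists c1; move: h1; rewrite rmorphM rmorphXn ba.
    by exists c2; move: h2; rewrite rmorphM rmorphXn ba.
Qed.

Lemma scale_swap (F : fieldType) (r x' A C r' : F) : r' != 0 ->
  r * (x' / A * C) = r * C / A / r' * (r' * x').
Proof. by move=> r0; rewrite [RHS]mulrA -[_ / r' * r']mulrA mulVf // mulr1; ring. Qed.

Section Contraction.
Variables (k : closedFieldType) (X : projVar k) (sigma : birat X X) (L : subsheaf X).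
Local Notation K := (ffield X).
Local Notation io := (fconst X).
Local Notation point := (ppoint k (pdim X)).
Local Notation it := (birat_iter sigma).
Local Notation zpow := (zpow sigma).
Local Notation zcenter := (zcenter sigma).
Local Notation zlocal := (zlocal sigma).
Local Notation local_meet := (local_meet sigma).
Hypotheses (sX : surface X) (iL : invertible L) (st : stable sigma).
Variables (m : nat) (h : 'I_m -> K).
Hypothesis hL : gens L h.
Local Notation wt := (wt sigma h).
Variables (e : nat) (Y : projVar k) (f0 : birat X Y) (h0 : K).
Hypotheses (jf : isomorphism f0) (h00 : h0 != 0).
Hypothesis hf : forall P Q, maps_to f0 P Q ->
  forall s, tensor_pow L e P s <-> pull_stalk f0 (@serre_twist k Y) P Q (s / h0).
Local Notation va := (va f0 h0).
Variable N : nat.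
Hypothesis cases : forall v, place io v ->
  (forall f, zlocal v 0 f -> local_meet v f) \/ (forall f, zlocal v N f -> local_meet v f).
Hypothesis vanN : forall P g l, on_var P -> ~ (exists Q, dom (it N) P Q) -> gcdat P (wt N) g ->
  val P (wt N l / g) 0.
Hypothesis H1 : cech_vanishes_succ (twist L sigma 1) 0.
Local Notation isgen := (isgen sigma L h N).
Local Notation gen_at := (gen_at L h).
Implicit Types (v w : K -> k -> Prop) (P Q R : point) (f g : K).

(** The residue map on the intersection of the local rings along the orbit of [v]. *)
Definition meet_val v f c := local_meet v f /\ v f c.

Lemma meet_val_at v n P f c : place io v -> zcenter v n P -> (forall f, zlocal v n f -> local_meet v f) ->
  meet_val v f c <-> val P (bpull (zpow (- n)) f) c.
Proof.
move=> pv cP hB; have [oP hP] := cP; split.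
  move=> [/(_ n) /(zlocalP _ pv cP) [c' Vc'] vc]; have := hP _ _ Vc'; rewrite /pull zpowVK => vc'.
  by rewrite (hrel_fun (place_hrel pv) vc vc').
move=> Vc; split; first by apply: hB; apply/(zlocalP _ pv cP); exists c.
by have := hP _ _ Vc; rewrite /pull zpowVK.
Qed.

Lemma meet_val_undefined v P f c : place io v -> zcenter v 0 P -> ~ (exists Q, dom (it N) P Q) ->
  meet_val v f c <-> val P f c.
Proof.
move=> pv cP nd; have := meet_val_at f c pv cP (undefined_A0 cases pv cP nd).
by rewrite oppr0.
Qed.

Lemma meet_val_defined v P Q f c : place io v -> zcenter v 0 P -> dom (it N) P Q ->
  meet_val v f c <-> val Q (bpull (zpow (- N%:Z)) f) c.
Proof. by move=> pv cP d; have [hB cQ] := defined_AN cases pv cP d; apply: meet_val_at. Qed.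

Lemma meet_val_model v : place io v -> exists n P, on_var P /\ forall f c, meet_val v f c <-> val P (bpull (zpow n) f) c.
Proof.
move=> pv; have [hB|hB] := cases pv.
  have [P cP] := zcenter_ex sigma 0 pv; exists (- 0), P; split=> [|f c]; first by have [] := cP.
  exact: meet_val_at.
have [P cP] := zcenter_ex sigma N pv; exists (- N%:Z), P; split=> [|f c]; first by have [] := cP.
exact: meet_val_at.
Qed.

Lemma meet_val_eq v n P : (forall f c, meet_val v f c <-> val P (bpull (zpow n) f) c) ->
  meet_val v = (fun f c => val P (bpull (zpow n) f) c).
Proof. by move=> H; apply: funext => f; apply: funext => c; apply: propext. Qed.

Lemma meet_val_good v : place io v -> good (meet_val v).
Proof.
move=> pv; have [n [P [oP /meet_val_eq ->]]] := meet_val_model pv.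
by apply: (good_transfer (zpowK sigma n) (zpowVK sigma n)); apply: gX.
Qed.

Lemma meet_val_const v : place io v -> hconst io (meet_val v).
Proof.
move=> pv; have [n [P [oP /meet_val_eq ->]]] := meet_val_model pv => c.
by rewrite bpull_const; apply: val_const.
Qed.

Lemma meet_val_le v : hle (meet_val v) v.
Proof. by move=> f c []. Qed.

Lemma fin_meet_val v f : place io v -> fin (meet_val v) f <-> local_meet v f.
Proof.
move=> pv; split=> [[c []] //|Bf].
have [P cP] := zcenter_ex sigma 0 pv; have [oP hP] := cP.
have [Q cQ fQ] := Bf 0; rewrite (zcenter_uniq pv cQ cP) oppr0 in fQ.
by have [c Vc] := fQ; exists c; split=> //; apply: hP.
Qed.

(** Sections, on the contracted surface, of the [J]-th power of the pullback of [L] by [sigma^N],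
    tested at every place. *)
Definition secs J b := forall v g, place io v -> isgen v g -> fin (meet_val v) (b / g ^+ J).

Lemma isgen_ex v : place io v -> exists g, isgen v g.
Proof.
move=> pv; have [P cP] := zcenter_ex sigma 0 pv; have [oP _] := cP.
have [[Q d]|nd] := EM (exists Q, dom (it N) P Q).
  by have [_ oQ _] := d; have [l gl] := gens_at hL oQ; exists (wt N l), P => //; right; exists Q, l.
by have [g hg] := gcdwt_ex sigma sX hL N oP; exists g, P => //; left.
Qed.

Lemma isgen_neq0 v g : isgen v g -> g != 0.
Proof. by move=> [P _ [[_ []] //|[Q [l [_ [l0 _] ->]]]]]; rewrite fmorph_eq0. Qed.

Lemma secs_wt l : secs 1 (wt N l).
Proof.
move=> v g pv [P cP [[nd [_ [hg _]]]|[Q [l' [d [l0 hl] ->]]]]]; rewrite expr1.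
  by have [c Vc] := hg l; exists c; apply/(meet_val_undefined _ _ pv cP nd).
have [_ oQ _] := d; have [c Vc] := (hl (h l)).1 (hL.1 Q l oQ); exists c.
by apply/(meet_val_defined _ _ pv cP d); rewrite !wtE -fmorph_div (zpowK sigma N%:Z).
Qed.

Lemma secs_va a : secs e (bpull (it N) (va a)).
Proof.
move=> v g pv [P cP [[nd hg]|[Q [l' [d [l0 hl] ->]]]]].
  have [oP _] := cP.
  have [j _] := wt_neq0 sigma hL 0 oP.
  have sv : sec sigma h e 1 (va a).
    have h1 : sec sigma h e 1 (va a * (\prod_(t < 0) wt t.+1 j) ^+ e) := @sec_va _ _ _ _ sX iL _ _ hL _ _ _ _ jf h00 hf 0 (fun=> j) a.
    by move: h1; rewrite big_ord0 expr1n mulr1.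
  have [|c Vc] := sec_pull sX hL st (i := N) (g := fun=> g) sv oP; last first.
    by exists c; apply/(meet_val_undefined _ _ pv cP nd); rewrite big_ord1 in Vc.
  by move=> [|t] // _; rewrite addn0.
have [_ oQ _] := d; have [c Vc] := va_fin jf h00 hf a oQ l0 hl; exists c.
by apply/(meet_val_defined _ _ pv cP d); rewrite !wtE -rmorphXn -fmorph_div (zpowK sigma N%:Z).
Qed.

(** At an indeterminacy point of [sigma^N] all pulled-back generators vanish, so there the section
    supplied by cohomology is needed. *)
Lemma secs1_ex v g : place io v -> isgen v g ->
  exists s c, [/\ secs 1 s, c != 0 & meet_val v (s / g) c].
Proof.
move=> pv [P cP [[nd hg]|[Q [l [d [l0 hl] eg]]]]].
  have [oP _] := cP; have [s [hs Vs _]] := separating_section sX iL hL cases vanN H1 oP nd hg.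
  exists s, 1; split; rewrite ?oner_neq0 //; last by apply/(meet_val_undefined _ _ pv cP nd).
  by move=> w g' pw hg'; apply/fin_meet_val => //; apply: hs.
exists g, 1; split; rewrite ?oner_neq0 //; first by rewrite eg; apply: secs_wt.
have [V _ _ _] := meet_val_good pv; rewrite divff; last by rewrite eg fmorph_eq0.
exact: (hrel1 V).
Qed.

Lemma ratio_value u s g x y j b : place io u -> g != 0 -> u (s / g) y -> y != 0 ->
  u (b / g ^+ j) x -> u (b / s ^+ j) (x / y ^+ j).
Proof.
move=> pu g0 us y0 ub; have V := place_lring pu.
have s0 : s != 0 by have := unit_neq0 V us y0; apply: contra_neq => ->; rewrite mul0r.
have := hrelM V ub (lr_inv V (hrelX V j us) (expf_neq0 j y0)).
by rewrite expr_div_n invf_div mulrA divfK ?expf_neq0.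
Qed.

Lemma va_coords Q q l x : dom f0 Q q -> gen_at Q l -> (forall i, val Q (va i / h l ^+ e) (x i)) ->
  exists2 r, r != 0 & forall i, pcoord q i = r * x i.
Proof.
move=> d [l0 hl] hx; have [oQ _ _] := d; have V := val_lring oQ.
have [j qj] := normalized_coord q; have qj0 : pcoord q j != 0 by rewrite qj oner_neq0.
have [c c0 Vc] := va_unit jf h00 hf d qj0 l0 hl.
have ec : c = x j := hrel_fun V Vc (hx j).
have j0 := va_neq0 h00 d qj0.
exists (x j)^-1 => [|i]; first by rewrite invr_eq0 -ec.
have := hrelM V (hx i) (lr_inv V (hx j) (_ : x j != 0)).
rewrite -ec => /(_ c0); rewrite invf_div mulrA divfK ?expf_neq0 // => h1.
have := hrel_fun V (va_val h00 i d qj0) h1; rewrite qj divr1 => ->.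
by rewrite mulrC ec.
Qed.

(* The sections determine the center on the contracted surface: those of the
   pullback of L tell the two kinds of points apart, the very ample ones separate
   images of sigma^N, and [separating_section] separates indeterminacy points. *)
Lemma secs_separate v w s g c : place io v -> place io w -> isgen v g -> secs 1 s -> c != 0 ->
  meet_val v (s / g) c -> (forall j b d, secs j b -> v (b / s ^+ j) d -> w (b / s ^+ j) d) ->
  forall f, fin (meet_val v) f -> fin w f.
Proof.
move=> pv pw gv hs c0 [_ vs] hw; have [gw hgw] := isgen_ex pw.
have V := place_lring pv; have W := place_lring pw.
have g0 := isgen_neq0 gv; have gw0 := isgen_neq0 hgw.
have s0 : s != 0 by have := unit_neq0 V vs c0; apply: contra_neq => ->; rewrite mul0r.
have [a [_ wa]] := hs w gw pw hgw; rewrite expr1 in wa.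
have a0 : a != 0.
  have [sw [cw [hsw cw0 [_ wsw]]]] := secs1_ex pw hgw.
  have [d [_ vd]] := hsw v g pv gv.
  have := hrelM W (hw 1%N sw _ hsw (ratio_value pv g0 vs c0 vd)) wa.
  rewrite expr1 mulrA divfK // => wc; have := hrel_fun W wsw wc.
  by move=> e1; apply: contra_neq cw0 => a0; rewrite e1 a0 mulr0.
(* After normalization by the values [c] and [a] of [s], every section takes the same value at both
   places; each case below uses a section that contradicts this. *)
have T j b x y : secs j b -> v (b / g ^+ j) x -> w (b / gw ^+ j) y -> x / c ^+ j = y / a ^+ j.
  move=> hb vb wb; apply: (hrel_fun W _ (ratio_value pw gw0 wa a0 wb)).
  by apply: hw => //; apply: ratio_value vs c0 vb.
have T1 b x y : secs 1 b -> v (b / g) x -> w (b / gw) y -> (x == 0) = (y == 0).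
  move=> hb vb wb; have := T 1%N b x y hb; rewrite !expr1 => /(_ vb wb) e1.
  by apply/eqP/eqP => e2; move/eqP: e1; rewrite e2 mul0r => /eqP;
     [move/esym/eqP|move/eqP]; rewrite mulf_eq0 invr_eq0 ?(negPf a0) ?(negPf c0) orbF => /eqP.
have vg : v (g / g) 1 by rewrite divff //; apply: (hrel1 V).
have wg : w (gw / gw) 1 by rewrite divff //; apply: (hrel1 W).
have [P cP hP] := gv; have [P' cP' hP'] := hgw.
have [oP leP] := cP; have [oP' leP'] := cP'.
case: hP hP' => [[nd hg]|[Q [l [d gl eg]]]] [[nd' hg']|[Q' [l' [d' gl' eg']]]].
- have [eP f [r /(meet_val_undefined _ _ pv cP nd) Vf]|ne] := EM (P' = P).
    by exists r; apply: (@meet_val_le w f r); apply/(meet_val_undefined _ _ pw cP' nd'); rewrite eP.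
  have [s1 [hs1 Vs1 van1]] := separating_section sX iL hL cases vanN H1 oP nd hg.
  have hs1' : secs 1 s1 by move=> u g1 pu hg1; apply/fin_meet_val => //; apply: hs1.
  have := T1 _ _ _ hs1' (leP _ _ Vs1 : v _ _) (leP' _ _ (van1 _ _ oP' ne nd' hg') : w _ _).
  by rewrite oner_eq0 eqxx.
- have vz : v (gw / g) 0 by rewrite eg'; apply: leP; apply: vanN.
  have := T1 gw _ _ _ vz wg; rewrite eqxx oner_eq0 eg' => /(_ (secs_wt l')) //.
- have wz : w (g / gw) 0 by rewrite eg; apply: leP'; apply: vanN.
  have := T1 g _ _ _ vg wz; rewrite eqxx oner_eq0 eg => /(_ (secs_wt l)) //.
- have [_ cQ] := defined_AN cases pv cP d; have [oQ leQ] := cQ.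
  have [_ cQ'] := defined_AN cases pw cP' d'; have [oQ' leQ'] := cQ'.
  have [q /maps_to_dom dq] := jf.1 Q oQ; have [q' /maps_to_dom dq'] := jf.1 Q' oQ'.
  have /choice [x hx] i : exists x, val Q (va i / h l ^+ e) x by have [l0 hl] := gl; exact: (va_fin jf h00 hf i oQ l0 hl).
  have /choice [x' hx'] i : exists x, val Q' (va i / h l' ^+ e) x by have [l0 hl] := gl'; exact: (va_fin jf h00 hf i oQ' l0 hl).
  have [r r0 er] := va_coords dq gl hx; have [r' r0' er'] := va_coords dq' gl' hx'.
  have ex i : x i / c ^+ e = x' i / a ^+ e.
    apply: (T e (bpull (it N) (va i))); first exact: secs_va.
      by have := leQ _ _ (hx i); rewrite /pull /= fmorph_div rmorphXn eg.
    by have := leQ' _ _ (hx' i); rewrite /pull /= fmorph_div rmorphXn eg'.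
  have eq : q = q'.
    apply: (@point_prop _ _ q q' (r * c ^+ e / a ^+ e / r')) => i; rewrite er er'.
    have -> : x i = x' i / a ^+ e * c ^+ e by rewrite -ex divfK ?expf_neq0.
    exact: scale_swap.
  have eQ : Q = Q' by rewrite -eq in dq'; apply: (va_inj jf dq dq').
  move=> f [z /(meet_val_defined _ _ pv cP d) Vf]; exists z; apply: (@meet_val_le w f z).
  by apply/(meet_val_defined _ _ pw cP' d'); rewrite -eQ.
Qed.

End Contraction.

(** * Charts given by sections *)

Lemma mulr_interchange3 (R : comNzRingType) (x y z t u : R) : x * y * (z * t * u) = x * z * (y * t) * u.
Proof. by ring. Qed.

Section Presentation.
Variables (k : closedFieldType) (K : fieldType) (io : {rmorphism k -> K}).
Variables (meet_val : (K -> k -> Prop) -> K -> k -> Prop) (isgen : (K -> k -> Prop) -> K -> Prop).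
Hypothesis gB : forall v, place io v -> good (meet_val v).
Hypothesis cB : forall v, place io v -> hconst io (meet_val v).
Hypothesis leB : forall v, place io v -> hle (meet_val v) v.
Hypothesis gen0 : forall v g, isgen v g -> g != 0.

Definition gsec J b := forall v g, place io v -> isgen v g -> fin (meet_val v) (b / g ^+ J).

Hypothesis sec1 : forall v g, place io v -> isgen v g ->
  exists s c, [/\ gsec 1 s, c != 0 & meet_val v (s / g) c].
Hypothesis separate : forall v w s g c, place io v -> place io w -> isgen v g -> gsec 1 s -> c != 0 ->
  meet_val v (s / g) c -> (forall j b d, gsec j b -> v (b / s ^+ j) d -> w (b / s ^+ j) d) ->
  forall f, fin (meet_val v) f -> fin w f.

Lemma gsecM i j a b : gsec i a -> gsec j b -> gsec (i + j) (a * b).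
Proof.
move=> ha hb v g pv hg; have [V _ _ _] := gB pv.
by rewrite exprD -mulf_div; apply: (finM V); [exact: ha|exact: hb].
Qed.

Lemma gsecB i a b : gsec i a -> gsec i b -> gsec i (a - b).
Proof.
move=> ha hb v g pv hg; have [V _ _ _] := gB pv.
by rewrite mulrBl; apply: (finB V); [exact: ha|exact: hb].
Qed.

Lemma gsec0 i : gsec i 0.
Proof. by move=> v g pv hg; have [V _ _ _] := gB pv; rewrite mul0r; apply: (fin0 V). Qed.

Lemma gsec_const c : gsec 0 (io c).
Proof. by move=> v g pv hg; rewrite expr0 divr1; exists c; apply: cB. Qed.

Lemma gsecX i n a : gsec i a -> gsec (i * n) (a ^+ n).
Proof.
move=> ha; elim: n => [|n IH]; first by rewrite muln0 expr0 -(rmorph1 io); apply: gsec_const.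
by rewrite mulnS exprS; apply: gsecM.
Qed.

Lemma gsec_common_denom (p : {poly K}) s : s != 0 -> gsec 1 s ->
  (forall i, exists j b, gsec j b /\ p`_i = b / s ^+ j) ->
  exists J b, [/\ (0 < J)%N, forall i, gsec J (b i) & forall i, p`_i = b i / s ^+ J].
Proof.
move=> s0 hs hp.
have /choice [jb hjb] i : exists jb : nat * K, gsec jb.1 jb.2 /\ p`_i = jb.2 / s ^+ jb.1.
  by have [j [b hb]] := hp i; exists (j, b).
pose J := (\sum_(i < size p) (jb i).1).+1.
exists J, (fun i => if (i < size p)%N then (jb i).2 * s ^+ (J - (jb i).1) else 0).
have le i : (i < size p)%N -> ((jb i).1 <= J)%N.
  by move=> hi; rewrite /J (bigD1 (Ordinal hi)) //=; lia.
split=> // i; case: ifP => hi.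
- have [h1 _] := hjb i; rewrite -{1}(subnKC (le i hi)); apply: gsecM => //.
  by rewrite -[X in gsec X]mul1n; apply: gsecX.
- exact: gsec0.
- have [_ ->] := hjb i; rewrite -{2}(subnKC (le i hi)) exprD invfM mulrACA divff ?expf_neq0 //.
  by rewrite mulr1.
- by rewrite mul0r nth_default // leqNgt hi.
Qed.

Lemma integral_step (b0 bi g f : K) i : b0 != 0 -> g != 0 -> f != 0 ->
  bi / g * (b0 / g) ^+ i * (f * b0 / g)^-1 ^+ i.+1 = bi / b0 * f^-1 ^+ i.+1.
Proof.
move=> b00 g0 f0.
have -> : (f * b0 / g)^-1 = g / b0 * f^-1 by rewrite invf_div invfM; ring.
have e1 : (b0 / g) ^+ i * (g / b0) ^+ i = 1 by rewrite -exprMn mulrA divfK // divff // expr1n.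
rewrite [(g / b0 * _) ^+ _]exprMn [(g / b0) ^+ i.+1]exprS.
rewrite (mulr_interchange3 (bi / g) ((b0 / g) ^+ i) (g / b0) ((g / b0) ^+ i) (f^-1 ^+ i.+1)) e1 mulr1.
by rewrite mulrA divfK.
Qed.

(* The sections over powers of s form a ring whose places dominating v are finite
   on the local ring, which is thus integral over it up to a unit denominator;
   normality makes the numerators sections. *)
Lemma gsec_quotient v g f : place io v -> isgen v g -> fin (meet_val v) f ->
  exists j s c, [/\ (0 < j)%N, gsec j s, gsec j (f * s), c != 0 & meet_val v (s / g ^+ j) c].
Proof.
move=> pv hg ff; have [s [c [hs c0 Bs]]] := sec1 pv hg.
have V := place_lring pv; have vs := leB pv Bs; have g0 := gen0 hg.
have s0 : s != 0 by have := unit_neq0 V vs c0; apply: contra_neq => ->; rewrite mul0r.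
pose r a d := exists j b, [/\ gsec j b, a = b / s ^+ j & v a d].
have hr : hrel r.
  split.
  - exists 0%N, 1; split; last exact: (hrel1 V); last by rewrite expr0 divr1.
    by rewrite -(rmorph1 io); apply: gsec_const.
  - move=> a a' d d' [j [b [hb ea va]]] [j' [b' [hb' ea' va']]].
    exists (j + j')%N, (b * s ^+ j' - b' * s ^+ j); split; last exact: (hrelB V).
      apply: gsecB; last rewrite addnC; apply: gsecM => //.
        by rewrite -[X in gsec X]mul1n; apply: gsecX.
      by rewrite -[X in gsec X]mul1n; apply: gsecX.
    rewrite ea ea' exprD; have sj : s ^+ j != 0 by rewrite expf_neq0.
    by have sj' : s ^+ j' != 0 by [rewrite expf_neq0]; rewrite -mulNr addf_div // mulNr.
  - move=> a a' d d' [j [b [hb ea va]]] [j' [b' [hb' ea' va']]].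
    exists (j + j')%N, (b * b'); split; [exact: gsecM| |exact: (hrelM V)].
    by rewrite ea ea' exprD mulf_div.
  - by move=> d [j [b [_ _ /(hrel0P V)]]].
have cr : hconst io r.
  move=> d; exists 0%N, (io d); rewrite expr0 divr1; split=> //; first exact: gsec_const.
  exact: (place_const pv).
have fr w : place io w -> hle r w -> fin w f.
  move=> pw lw; apply: (separate pv pw hg hs c0 Bs) ff => j b d hb vb.
  by apply: lw; exists j, b.
have [->|[p [q [hp pf q0]]]] := place_integral hr cr fr.
  by exists 1%N, s, c; rewrite mul0r expr1; split=> //; apply: gsec0.
have [J [b [J0 hb eb]]] : exists J b, [/\ (0 < J)%N, forall i, gsec J (b i) & forall i, p`_i = b i / s ^+ J].
  by apply: gsec_common_denom => // i; have [j [b [hb eb _]]] := hp i; exists j, b.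
have sJ : s ^+ J != 0 by rewrite expf_neq0.
have [_ [_ [_ _ vp0]]] := hp 0%N; rewrite eb in vp0.
have b00 : b 0%N != 0 by have := unit_neq0 V vp0 q0; apply: contra_neq => ->; rewrite mul0r.
have [y By] := hb 0%N v g pv hg.
have ey : y = q`_0 * c ^+ J.
  apply: (hrel_fun V (leB pv By)).
  have := hrelM V vp0 (hrelX V J vs); rewrite expr_div_n mulrA divfK //.
exists J, (b 0%N), y; split=> //; last by rewrite ey mulf_neq0 ?expf_neq0.
have [-> |f0] := eqVneq f 0; first by rewrite mul0r; apply: gsec0.
move=> w gw pw hgw; have gw0 := gen0 hgw; have gJ : gw ^+ J != 0 by rewrite expf_neq0.
have [hW nW fW [x1 [y1 [pxy dp _ _]]]] := gB pw.
apply: (normal hW nW fW pxy dp); right.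
(* The relation on [f^-1], rescaled by powers of the section [b 0%N], becomes a relation on the
   inverse of [f * b 0%N / gw ^+ J] with constant coefficient 1 and all coefficients in the ring
   attached to [w]. *)
pose cf i := if i is i'.+1 then b i / gw ^+ J * (b 0%N / gw ^+ J) ^+ i' else 1.
have /choice [d hd] i : exists d, meet_val w (cf i) d.
  case: i => [|i] /=; first by exists 1; apply: (hrel1 hW).
  by apply: (finM hW); [|apply: (finX hW)]; apply: hb.
have sp : (0 < size p)%N.
  rewrite lt0n size_poly_eq0; apply: contra_neq b00 => p0.
  by move/eqP: (eb 0%N); rewrite p0 coef0 eq_sym mulf_eq0 invr_eq0 (negPf sJ) orbF => /eqP.
exists (\poly_(i < size p) cf i), (\poly_(i < size p) d i); split.
- by move=> i; rewrite !coef_poly; case: ifP => _; [apply: hd|apply: (hrel0 hW)].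
- rewrite horner_poly.
  suff -> : \sum_(i < size p) cf i * (f * b 0%N / gw ^+ J)^-1 ^+ i = s ^+ J / b 0%N * p.[f^-1].
    by rewrite pf mulr0.
  rewrite horner_coef mulr_sumr; apply: eq_bigr => -[[|i] hi] _ /=; rewrite eb.
    by rewrite !expr0 !mulr1 mulrA divfK // divff.
  rewrite integral_step // [RHS]mulrA; congr (_ * _); field; rewrite b00 sJ //.
- rewrite coef_poly sp; have -> : d 0%N = 1 := hrel_fun hW (hd 0%N) (hrel1 hW).
  exact: oner_neq0.
Qed.

Variable n : nat.

(** [D] consists of a degree [D.1.1], a denominator [D.1.2] and numerators [D.2], all sections in
    that degree. *)
Definition wf_chart (D : nat * K * {ffun 'I_n -> K}) :=
  [/\ (0 < D.1.1)%N, gsec D.1.1 D.1.2 & forall i, gsec D.1.1 (D.2 i)].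

Definition ok_chart v (D : nat * K * {ffun 'I_n -> K}) :=
  (exists g c, [/\ isgen v g, c != 0 & meet_val v (D.1.2 / g ^+ D.1.1) c]) /\
  forall f, fin (meet_val v) f -> exists a b c, [/\ inalg io (fun i => D.2 i / D.1.2) a,
    inalg io (fun i => D.2 i / D.1.2) b, c != 0, v b c & f = a / b].

(** The degrees of the charts are raised to the common degree [J], by powers of each denominator,
    which leaves the coordinate ratios of the chart unchanged. The sections of all charts together
    are the homogeneous coordinates. *)
Lemma charts_present (l : seq (nat * K * {ffun 'I_n -> K})) :
  (forall D, D \in l -> wf_chart D) ->
  (forall v, place io v -> exists2 D, D \in l & ok_chart v D) ->
  exists w (W : {ffun 'I_w.+1 -> K}), forall v, place io v -> exists i0, presents io meet_val W v i0.
Proof.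
move=> wf cov; pose J := (\prod_(D <- l) D.1.1)%N.
have dv D : D \in l -> exists2 q, (0 < q)%N & J = (D.1.1 * q)%N.
  move=> Dl; have J0 : (0 < J)%N by rewrite /J big_seq prodn_cond_gt0 // => D' /wf [].
  have : (D.1.1 %| J)%N by rewrite /J (big_rem D) //= dvdn_mulr.
  move=> /dvdnP [q eJ]; exists q; last by rewrite mulnC.
  by move: J0; rewrite eJ muln_gt0 => /andP [].
pose row (D : nat * K * {ffun 'I_n -> K}) := let q := (J %/ D.1.1)%N in
  D.1.2 ^+ q :: [seq D.2 i * D.1.2 ^+ q.-1 | i : 'I_n].
pose M := flatten [seq row D | D <- l].
have hM b : b \in M -> gsec J b.
  move=> /flattenP [_ /mapP [D Dl ->]]; have [D0 ht hu] := wf D Dl.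
  have [q q0 eJ] := dv D Dl; rewrite /row eJ mulKn // inE => /orP [/eqP ->|/mapP [i _ ->]].
    exact: gsecX.
  by rewrite -(prednK q0) /= mulnS; apply: gsecM => //; apply: gsecX.
(* The index type is nonempty by form; past the end of [M] the coordinate is the default 0, again a
   section. *)
exists (size M).-1, [ffun i : 'I_(size M).-1.+1 => M`_i] => v pv.
have [D Dl [[g [c [hg c0 Bt]]] gen]] := cov v pv; have [D0 ht hu] := wf D Dl.
have [q q0 eJ] := dv D Dl; have [V _ _ _] := gB pv; have g0 := gen0 hg.
have idx b : b \in row D -> exists i : 'I_(size M).-1.+1, M`_i = b.
  move=> hb; have bM : b \in M by apply/flattenP; exists (row D) => //; apply: map_f.
  have hi : (index b M < (size M).-1.+1)%N by rewrite prednK ?index_mem //; case: (M) bM.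
  by exists (Ordinal hi); rewrite /= nth_index.
have [i0 e0] : exists i : 'I_(size M).-1.+1, M`_i = D.1.2 ^+ q.
  by apply: idx; rewrite /row eJ mulKn // mem_head.
have t0 : D.1.2 != 0 by have := unit_neq0 V Bt c0; apply: contra_neq => ->; rewrite mul0r.
have u0 : meet_val v (D.1.2 ^+ q / g ^+ J) (c ^+ q).
  by have := hrelX V q Bt; rewrite expr_div_n -exprM -eJ.
have inW i : inalg io (fun i => [ffun i : 'I_(size M).-1.+1 => M`_i] i / [ffun i : 'I_(size M).-1.+1 => M`_i] i0) (D.2 i / D.1.2).
  have [j ej] : exists j : 'I_(size M).-1.+1, M`_j = D.2 i * D.1.2 ^+ q.-1.
    by apply: idx; rewrite /row eJ mulKn // inE; apply/orP; right; apply: map_f; rewrite mem_enum.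
  have -> : D.2 i / D.1.2 = [ffun i : 'I_(size M).-1.+1 => M`_i] j / [ffun i : 'I_(size M).-1.+1 => M`_i] i0.
    rewrite !ffunE ej e0 -{2}(prednK q0) exprS invfM mulrACA.
    by rewrite divff ?expf_neq0 // mulr1.
  exact: inalg_gen.
have inP x : inalg io (fun i => D.2 i / D.1.2) x ->
    inalg io (fun i => [ffun i : 'I_(size M).-1.+1 => M`_i] i / [ffun i : 'I_(size M).-1.+1 => M`_i] i0) x.
  by move=> [F ->]; apply: inalg_mmap.
exists i0; split.
- by rewrite ffunE e0 expf_neq0.
- move=> i; rewrite !ffunE e0.
  have [x Bx] : fin (meet_val v) (M`_i / g ^+ J).
    have [hi|hi] := ltnP i (size M); first by apply: hM => //; apply: mem_nth.
    by rewrite nth_default // mul0r; apply: (fin0 V).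
  exists (x / c ^+ q); have := hrelM V Bx (lr_inv V u0 (expf_neq0 q c0)).
  by rewrite invf_div mulrA divfK ?expf_neq0.
- by move=> f /gen [a [b [c' [ia ib c0' vb ef]]]]; exists a, b, c'; split=> //; apply: inP.
Qed.
End Presentation.

Lemma list_choice (T U : eqType) (s : seq T) (R : T -> U -> Prop) :
  (forall x, x \in s -> exists u, R x u) ->
  exists l : seq U, (forall u, u \in l -> exists2 x, x \in s & R x u) /\
    forall x, x \in s -> exists2 u, u \in l & R x u.
Proof.
elim: s => [|x s IH] hs; first by exists [::].
have [|l [l1 l2]] := IH; first by move=> y ys; apply: hs; rewrite inE ys orbT.
have [u Ru] := hs x (mem_head _ _); exists (u :: l); split.
- move=> u'; rewrite inE => /orP [/eqP ->|/l1 [y ys Ry]]; first by exists x; rewrite ?mem_head.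
  by exists y; rewrite // inE ys orbT.
- move=> y; rewrite inE => /orP [/eqP ->|/l2 [u' hu Ru']]; first by exists u; rewrite ?mem_head.
  by exists u'; rewrite // inE hu orbT.
Qed.

Lemma chart_frac (k : closedFieldType) (X : projVar k) (P : ppoint k (pdim X)) j f :
  on_var P -> pcoord P j != 0 -> fin (val P) f -> exists F G c, [/\ c != 0,
    val P (mmap (fconst X) (@chart k X j) G) c &
    f = mmap (fconst X) (@chart k X j) F / mmap (fconst X) (@chart k X j) G].
Proof.
move=> oP Pj /fin_regular [d [F [G [hF hG GP ->]]]].
have hX : ('X_j ^+ d : {mpoly k[(pdim X).+1]}) \is d.-homog.
  by rewrite -[X in X.-homog]mul1n dhomogMn // coordX_homog.
have Xj : ('X_j : {mpoly k[(pdim X).+1]}).@[pcoord P] != 0 by rewrite mevalXU.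
have y0 : gpoint X j != 0 by rewrite -gvalX; apply: (gval_neq0 oP (coordX_homog k j)).
have XP : ('X_j ^+ d).@[pcoord P] != 0 by rewrite rmorphXn expf_neq0.
have eX : gval ('X_j ^+ d) = gpoint X j ^+ d by rewrite /gval rmorphXn /= -/(gval _) gvalX.
exists F, G, (G.@[pcoord P] / ('X_j ^+ d).@[pcoord P]); split.
- by rewrite mulf_neq0 ?invr_eq0.
- have := form_val oP hG hX XP.
  by rewrite eX (gval_chart y0 hG) mulrAC divff ?expf_neq0 // mul1r.
- by rewrite (gval_chart y0 hF) (gval_chart y0 hG) -mulf_div divff ?expf_neq0 // mul1r.
Qed.

Section Charts.
Variables (k : closedFieldType) (X : projVar k) (sigma : birat X X) (L : subsheaf X).
Local Notation K := (ffield X).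
Local Notation io := (fconst X).
Local Notation point := (ppoint k (pdim X)).
Local Notation it := (birat_iter sigma).
Local Notation zpow := (zpow sigma).
Local Notation zcenter := (zcenter sigma).
Local Notation zlocal := (zlocal sigma).
Local Notation local_meet := (local_meet sigma).
Local Notation meet_val := (meet_val sigma).
Hypotheses (sX : surface X) (iL : invertible L) (st : stable sigma).
Variables (m : nat) (h : 'I_m -> K).
Hypothesis hL : gens L h.
Local Notation wt := (wt sigma h).
Variables (e : nat) (Y : projVar k) (f0 : birat X Y) (h0 : K).
Hypotheses (jf : isomorphism f0) (h00 : h0 != 0).
Hypothesis hf : forall P Q, maps_to f0 P Q ->
  forall s, tensor_pow L e P s <-> pull_stalk f0 (@serre_twist k Y) P Q (s / h0).
Variable N : nat.
Hypothesis cases : forall v, place io v ->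
  (forall f, zlocal v 0 f -> local_meet v f) \/ (forall f, zlocal v N f -> local_meet v f).
Hypothesis vanN : forall P g l, on_var P -> ~ (exists Q, dom (it N) P Q) -> gcdat P (wt N) g ->
  val P (wt N l / g) 0.
Hypothesis H1 : cech_vanishes_succ (twist L sigma 1) 0.
Local Notation isgen := (isgen sigma L h N).
Local Notation gen_at := (gen_at L h).
Local Notation gsec := (gsec io meet_val isgen).
Local Notation wf_chart := (@wf_chart k K io meet_val isgen (pdim X).+1).
Local Notation ok_chart := (@ok_chart k K io meet_val isgen (pdim X).+1).
Implicit Types (v w : K -> k -> Prop) (P Q R : point) (f g : K).

Let gB v (pv : place io v) := meet_val_good sX cases pv.
Let cB v (pv : place io v) := meet_val_const cases pv.
Let leB v (pv : place io v) := @meet_val_le k X sigma v.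
Let gen0 v g (hg : isgen v g) := isgen_neq0 hg.
Let sec1 v g (pv : place io v) (hg : isgen v g) := secs1_ex sX iL hL cases vanN H1 pv hg.
Let separate v w s g c := @secs_separate _ _ _ _ sX iL st _ _ hL _ _ _ _ jf h00 hf N cases vanN H1 v w s g c.

Definition shifted_chart (n : int) j (t : K) : {ffun 'I_(pdim X).+1 -> K} :=
  [ffun i => bpull (zpow (- n)) (@chart k X j i) * t].

Lemma ok_shifted v n P j J t g c : place io v -> on_var P ->
  (forall f d, meet_val v f d <-> val P (bpull (zpow n) f) d) -> pcoord P j != 0 -> isgen v g ->
  c != 0 -> meet_val v (t / g ^+ J) c -> ok_chart v (J, t, shifted_chart n j t).
Proof.
move=> pv oP mod Pj hg c0 Bt; split; first by exists g, c.
have [V _ _ _] := gB pv.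
have t0 : t != 0 by have := unit_neq0 V Bt c0; apply: contra_neq => ->; rewrite mul0r.
move=> f [d /mod Vf]; have [|F [G [r [r0 Vr ef]]]] := chart_frac oP Pj (f := bpull (zpow n) f); first by exists d.
pose x i := shifted_chart n j t i / t.
have ex H : bpull (zpow (- n)) (mmap io (@chart k X j) H) = mmap io x H.
  rewrite rmorph_mmap; apply: eq_mmap => i /=; first exact: bpull_const.
  by rewrite /x ffunE mulfK.
exists (mmap io x F), (mmap io x G), r; split=> //.
- by exists F.
- by exists G.
- by apply: (leB pv); apply/mod; rewrite -ex zpowVK.
- by rewrite -!ex -fmorph_div -ef zpowK.
Qed.

(** Each affine coordinate at [P] is a quotient of sections whose denominator is nonzero at the
    center, by [gsec_quotient]. The product of these denominators serves all coordinates. *)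
Lemma shifted_chart_ex v n P g : place io v -> on_var P ->
  (forall f d, meet_val v f d <-> val P (bpull (zpow n) f) d) -> isgen v g ->
  exists j J t c, [/\ pcoord P j != 0, wf_chart (J, t, shifted_chart n j t), c != 0 &
    meet_val v (t / g ^+ J) c].
Proof.
move=> pv oP mod hg; have [j Pj1] := normalized_coord P.
have Pj : pcoord P j != 0 by rewrite Pj1 oner_neq0.
pose x i := bpull (zpow (- n)) (@chart k X j i).
have fx i : fin (meet_val v) (x i).
  by exists (pcoord P i / pcoord P j); apply/mod; rewrite zpowVK; apply: coord_val.
have /choice [D hD] i : exists D : nat * K, (0 < D.1)%N /\ [/\ gsec D.1 D.2, gsec D.1 (x i * D.2) &
    exists2 c, c != 0 & meet_val v (D.2 / g ^+ D.1) c].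
  have [J [s [c [J0 hs hxs c0 Bs]]]] := gsec_quotient gB cB leB gen0 sec1 separate pv hg (fx i).
  by exists (J, s); split=> //; split=> //; exists c.
pose J := (\sum_i (D i).1)%N; pose t := \prod_i (D i).2.
have ht (A : pred 'I_(pdim X).+1) : gsec (\sum_(i | A i) (D i).1)%N (\prod_(i | A i) (D i).2).
  apply: (big_ind2 (fun J t => gsec J t)).
  - by rewrite -(rmorph1 io); apply: (gsec_const cB).
  - by move=> *; apply: (gsecM gB).
  - by move=> i _; have [_ []] := hD i.
have [V _ _ _] := gB pv.
have [c c0 Bt] : exists2 c, c != 0 & meet_val v (t / g ^+ J) c.
  apply: (big_ind2 (fun J t => exists2 c, c != 0 & meet_val v (t / g ^+ J) c)).
  - by exists 1; rewrite ?oner_neq0 // expr0 divr1; apply: (hrel1 V).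
  - move=> J1 t1 J2 t2 [c1 c10 B1] [c2 c20 B2]; exists (c1 * c2); first exact: mulf_neq0.
    by rewrite exprD -mulf_div; apply: (hrelM V).
  - by move=> i _; have [_ []] := hD i.
exists j, J, t, c; split=> //; split=> /=.
- by have [D0 _] := hD j; rewrite /J (bigD1 j) //= ltn_addr.
- exact: (ht xpredT).
- move=> i; rewrite ffunE -/(x i) /J /t (bigD1 i) // [\prod_i' _](bigD1 i) //= mulrA.
  by apply: (gsecM gB); [have [_ []] := hD i|exact: (ht (fun i' => i' != i))].
Qed.

Lemma gen_near Q l : on_var Q -> gen_at Q l -> nb Q (fun Q' => gen_at Q' l).
Proof.
move=> oQ [l0 hl]; have [g g0 [V [oV VQ hV]]] := iL oQ.
have hg Q' : on_var Q' -> V Q' -> forall s, L Q' s <-> fin (val Q') (s / g).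
  by move=> oQ' VQ' s; split=> [/(hV Q' oQ' VQ')/fin_regular|/fin_regular/(hV Q' oQ' VQ')].
have f1 : fin (val Q) (h l / g) by apply/(hg Q oQ VQ); apply: hL.1.
have f2 : fin (val Q) (g / h l).
  by apply/hl; apply/(hg Q oQ VQ); rewrite divff //; apply: (fin1 (val_lring oQ)).
apply: nbS (nbI (nb_zopen oV VQ) (nbI (nb_fin f1) (nb_fin f2))) => Q' oQ' [VQ' [f1' f2']].
split=> // s; rewrite (hg Q' oQ' VQ'); have W := val_lring oQ'; split=> fs.
- by have -> : s / h l = s / g * (g / h l) by [rewrite mulrA divfK]; apply: (finM W).
- by have -> : s / g = s / h l * (h l / g) by [rewrite mulrA divfK]; apply: (finM W).
Qed.

(** One chart is taken for each of the finitely many points where [sigma^N] is undefined. The other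
    charts depend only on the image under [sigma^N] and work on open sets of it, of which finitely
    many suffice by the basis theorem. *)
Lemma finite_charts : exists l : seq (nat * K * {ffun 'I_(pdim X).+1 -> K}),
  (forall D, D \in l -> wf_chart D) /\
  forall v, place io v -> exists2 D, D \in l & ok_chart v D.
Proof.
have [ps hps] := fund_finite sX (it N).
pose R1 P D := wf_chart D /\ (on_var P -> ~ (exists Q, dom (it N) P Q) ->
  forall v, place io v -> zcenter v 0 P -> ok_chart v D).
have [|l1 [l1w l1c]] := @list_choice _ (nat * K * {ffun 'I_(pdim X).+1 -> K})%type ps R1.
  move=> P _; have [[oP nd]|n] := EM (on_var P /\ ~ (exists Q, dom (it N) P Q)); last first.
    (* A dummy chart for entries of [ps] that are not points of indeterminacy. *)
    exists (1%N, 0, [ffun=> 0]); split=> [|oP nd]; last by case: n.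
    by split=> //= [|i]; rewrite ?ffunE; apply: (gsec0 gB).
  have [v pv cP] := center_place oP; have [g hg] := gcdwt_ex sigma sX hL N oP.
  have mod u : place io u -> zcenter u 0 P -> forall f d, meet_val u f d <-> val P (bpull (zpow 0) f) d.
    by move=> pu cu f d; apply: (meet_val_undefined cases f d pu cu nd).
  have gen u : zcenter u 0 P -> isgen u g by move=> cu; exists P => //; left.
  have cP' := proj2 (zcenter0 sigma v P) cP.
  have [j [J [t [c [Pj wf c0 Bt]]]]] := shifted_chart_ex pv oP (mod v pv cP') (gen v cP').
  exists (J, t, shifted_chart 0 j t); split=> // _ _ u pu cu.
  apply: (ok_shifted pu oP (mod u pu cu) Pj (gen u cu) c0).
  by apply/(mod u pu cu); apply/(mod v pv cP').
pose good_chart (G : {mpoly k[(pdim X).+1]}) D := wf_chart D /\ forall v P Q, place io v ->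
  zcenter v 0 P -> dom (it N) P Q -> G.@[pcoord Q] != 0 -> ok_chart v D.
pose T G := exists D, good_chart G D.
have [s [sT hs]] := forms_noeth T.
have [|l2 [l2w l2c]] := @list_choice _ (nat * K * {ffun 'I_(pdim X).+1 -> K})%type s good_chart.
  by move=> G /sT.
exists (l1 ++ l2); split.
  by move=> D; rewrite mem_cat => /orP [/l1w [P _ []]|/l2w [G _ []]].
move=> v pv; have [P cP] := zcenter_ex sigma 0 pv; have [oP _] := cP.
have [[Q d]|nd] := EM (exists Q, dom (it N) P Q); last first.
  have [D Dl [_ okD]] := l1c P (hps P oP nd).
  by exists D; [rewrite mem_cat Dl|apply: okD].
have [_ oQ _] := d; have [l gl] := gens_at hL oQ.
have mod u P' Q' : place io u -> zcenter u 0 P' -> dom (it N) P' Q' ->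
    forall f c, meet_val u f c <-> val Q' (bpull (zpow (- N%:Z)) f) c.
  by move=> pu cu du f c; apply: (meet_val_defined cases f c pu cu du).
have gen u P' Q' : zcenter u 0 P' -> dom (it N) P' Q' -> gen_at Q' l -> isgen u (wt N l).
  by move=> cu du gl'; exists P' => //; right; exists Q', l.
have [j [J [t [c [Qj wf c0 Bt]]]]] := shifted_chart_ex pv oQ (mod v P Q pv cP d) (gen v P Q cP d gl).
have ut : vunit Q (bpull (zpow (- N%:Z)) (t / wt N l ^+ J)) by exists c => //; apply/(mod v P Q pv cP d).
have nj : nb Q (fun Q' => pcoord Q' j != 0).
  by exists 1%N, 'X_j; split; [exact: coordX_homog|rewrite mevalXU|move=> Q' _; rewrite mevalXU].
have [dG [G [hG GQ near]]] := nbI nj (nbI (gen_near oQ gl) (nb_unit oQ ut)).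
have TG : T G.
  exists (J, t, shifted_chart (- N%:Z) j t); split=> // u P' Q' pu cu du GQ'.
  have [_ oQ' _] := du; have [Qj' [gl' [c' c0' Bt']]] := near Q' oQ' GQ'.
  apply: (ok_shifted pu oQ' (mod u P' Q' pu cu du) Qj' (gen u P' Q' cu du gl') c0').
  exact/(mod u P' Q' pu cu du).
have [G' G's G'Q] : exists2 G', G' \in s & G'.@[pcoord Q] != 0.
  apply: contrapT => n; move/eqP: GQ; apply.
  apply: (ispan_eval (hs G TG)) => F Fs; apply: contrapT => nF; apply: n; exists F => //; exact/eqP.
have [D Dl [_ okD]] := l2c G' G's; exists D; first by rewrite mem_cat Dl orbT.
exact: (okD v P Q pv cP d G'Q).
Qed.

(** [Z] has the function field of [X] and [f] is the identity on it, so the conjugate of [sigma] is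
    [sigma] on functions. An intersection over all integer times is unchanged by a shift of 1 or -1,
    so [sigma] and its inverse are everywhere defined on [Z]. *)
Lemma positive_geometric : (1 <= N)%N -> geometric sigma.
Proof.
move=> N1; have [l [lw lc]] := finite_charts.
have [w [W hW]] := charts_present gB cB gen0 lw lc.
pose Z : projVar k := model gB hW.
pose f : birat Z X := @Birat k Z X idfun idfun (fun=> erefl) (fun=> erefl) (fun=> erefl).
exists Z, f; split; first exact: (model_surface gB cB leB hW).
split; apply: (@model_dom _ _ _ _ gB cB leB _ _ hW) => v a c pv [hB va]; split=> //.
- exact: (proj1 (local_meet_zt sigma N1 1 a pv) hB).
- exact: (proj1 (local_meet_zt sigma N1 (-1) a pv) hB).
Qed.
End Charts.

Theorem theorem4p5 (k : closedFieldType) (X : projVar k) (sigma : birat X X)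
    (L : subsheaf X) :
  surface X -> stable sigma -> ~ geometric sigma ->
  invertible L -> sigma_positive sigma L ->
  ~ finitely_generated sigma (twisted_section_ring sigma L).
Proof.
move=> sX st ng iL [[e _ [Y [f0 [h0 [jf h00 hf]]]]] gg hH] fg; apply: ng.
have [m [h hL]] := gens_ex iL (gg 1%N isT).
have vanish := sec_vanish sX iL st hL jf h00 hf.
have [N0 orb] := fundamental_orbit sX st hL vanish gg fg.
(* A positive window is required later, and enlarging [N0] preserves the orbit condition. *)
pose N := maxn N0 1; have N1 : (1 <= N)%N by rewrite leq_maxr.
have FO P : on_var P -> ~ (exists Q, dom sigma P Q) -> forall j, (N <= j)%N ->
    exists Q, dom (birat_iter sigma j) P Q /\ exists Q', dom sigma Q Q'.
  move=> oP nd j hj; have [d [q [dN _ dq _ hq]]] := orb P oP nd.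
  (* After [d] steps the orbit is at [q], where all further iterates are defined; the remaining
     [j - d] steps start there. *)
  have [Q' dQ' hQ'] := hq (j - d)%N; exists Q'; split=> //.
  have := dom_it dq dQ'; rewrite subnKC //.
  by apply: leq_trans dN (leq_trans (leq_maxl _ _) hj).
have cases v := @local_meet_cases k X sigma sX st N N1 FO v.
have vanN P g l : on_var P -> ~ (exists Q, dom (birat_iter sigma N) P Q) ->
    gcdat P (wt sigma h N) g -> val P (wt sigma h N l / g) 0.
  move=> oP nd hg; have hl : sec sigma h 1 1 (h l).
    move=> Q g' oQ hg'; rewrite big_ord1 expr1; have [_ [fg' _]] := hg' 0%N isT.
    exact: (fg' l).
  have := vanish N 0%N P (h l) (fun=> g) oP nd _ hl; rewrite big_ord1; apply.
  by move=> [|t] // _; rewrite addn0.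
exact: (positive_geometric sX iL st hL jf h00 hf cases vanN (hH 0%N 1%N isT) N1).
Qed.
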